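(* Let $(u,p)\in (H^1(B_{R_0}))^{n+1}$ be a nontrivial solution, i.e. $(u,p)\ne(0,0)$, of the Stokes system $$\Delta u+A(x)\cdot\nabla u+\nabla p=0,\qquad \operatorname{div}u=0$$ in $B_{R_0}$, and let $U(x)=\left[|x|^4|\nabla p(x)|^2+|x|^2|p(x)|^2+|u(x)|^2\right]^{1/2}$. Then there exist positive constants $K$ and $m$, depending on $n$ and $(u,p)$, such that $$\int_{|x|<R}|U|^2\,dx\ge K R^m$$ for all $R>0$ sufficiently small.
   Context: $n\ge 2$, and $\Omega\subset\mathbb{R}^n$ is a connected open set containing $0$. $B_r$ denotes the open ball of radius $r>0$ centered at the origin, and $0<R_0\le 1$ is such that $B_{R_0}\subset\Omega$. $A:\Omega\to\mathbb{R}^n$ is a measurable vector field satisfying $|A(x)|\le C_0\,|\log|x||^{-3}|x|^{-1}$ for all $x\in\Omega$, where $C_0>0$ is a constant fixed throughout (so dependence of constants on $C_0$ is not tracked). The unknowns are $u=(u_1,\dots,u_n)$ (vector valued) and $p$ (scalar), and $A\cdot\nabla u=(A\cdot\nabla u_1,\dots,A\cdot\nabla u_n)$. Solutions are understood in the weak (distributional) sense. *)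

(* Defs.v *)
From HB Require Import structures.
From mathcomp Require Import all_boot all_order all_algebra.
From mathcomp Require Import all_classical all_reals all_analysis.
From mathcomp Require Import measurable_realfun.

Set Implicit Arguments.
Unset Strict Implicit.
Unset Printing Implicit Defensive.

Import Order.TTheory GRing.Theory Num.Theory.
Import numFieldNormedType.Exports.

Local Open Scope classical_set_scope.
Local Open Scope ring_scope.

(* R^n is 'rV[R]_n, with the library's topology and the sigma-algebra generated
   by the coordinates, which is the Borel one. *)
Definition measure_rV_display : measure_display -> measure_display.
Proof. exact. Qed.

Section measurable_rV.
Context {R : realType}.
Variable n : nat.

Let coord : 'I_n -> 'rV[R]_n -> measurableTypeR R := fun i x => x 0 i.

Let rV_set0 : g_sigma_preimage coord set0.
Proof. exact: sigma_algebra0. Qed.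

Let rV_setC A : g_sigma_preimage coord A -> g_sigma_preimage coord (~` A).
Proof. exact: sigma_algebraC. Qed.

Let rV_bigcup (F : _^nat) : (forall i, g_sigma_preimage coord (F i)) ->
  g_sigma_preimage coord (\bigcup_i (F i)).
Proof. exact: sigma_algebra_bigcup. Qed.

HB.instance Definition _ := @isMeasurable.Build
  (measure_rV_display default_measure_display) 'rV[R]_n
  (g_sigma_preimage coord) rV_set0 rV_setC rV_bigcup.

End measurable_rV.

Lemma measurable_rV_coord (R : realType) n (i : 'I_n) :
  measurable_fun [set: 'rV[R]_n] (fun x => x 0 i : measurableTypeR R).
Proof.
move=> _ Y mY; rewrite setTI; apply: sub_sigma_algebra => /=.
rewrite -bigcup_seq/=; exists i => /=; first by rewrite mem_index_enum.
by exists Y => //; rewrite setTI.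
Qed.

Lemma measurable_fun_rVP (R : realType) d (T : measurableType d) n
    (f : T -> 'rV[R]_n) :
  measurable_fun [set: T] f <->
  forall i, measurable_fun [set: T] (fun t => f t 0 i : measurableTypeR R).
Proof.
split=> [mf i|mf].
  exact: (measurableT_comp (@measurable_rV_coord R n i) mf).
apply: (@iffRL _ (g_sigma_preimage
    (fun i t => f t 0 i : measurableTypeR R) `<=` measurable)).
  rewrite (_ : (fun i t => _) =
    (fun i => (fun x : 'rV[R]_n => x 0 i : measurableTypeR R) \o f))//.
  rewrite g_sigma_preimage_comp; split=> [mf' A [/= C preC <-]|prefS].
    exact: mf'.
  by move=> _ A mA; apply: prefS; exists A.
apply: smallest_sub; first exact: sigma_algebra_measurable.
by rewrite -bigcup_seq; apply: bigcup_sub => i _ A [B mB <-]; exact: mf.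
Qed.

(* Lebesgue measure on R^n: the n-fold product measure, built by adjoining one
   coordinate at a time; lebesgue_rV_box below characterizes it. *)
Definition rV_cons (R : realType) n (z : measurableTypeR R * 'rV[R]_n) :
  'rV[R]_n.+1 := \row_i (if unlift ord0 i is Some j then z.2 0 j else z.1).

Lemma rV_cons0 (R : realType) n (z : measurableTypeR R * 'rV[R]_n) :
  rV_cons z 0 ord0 = z.1.
Proof. by rewrite mxE unlift_none. Qed.

Lemma rV_consS (R : realType) n (z : measurableTypeR R * 'rV[R]_n) i :
  rV_cons z 0 (lift ord0 i) = z.2 0 i.
Proof. by rewrite mxE liftK. Qed.

Lemma measurable_rV_cons (R : realType) n :
  measurable_fun setT (@rV_cons R n).
Proof.
apply/measurable_fun_rVP => i; have [j ->|->] := unliftP ord0 i.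
- under [X in measurable_fun _ X]eq_fun do rewrite rV_consS.
  exact: (measurableT_comp (@measurable_rV_coord R n j) measurable_snd).
- under [X in measurable_fun _ X]eq_fun do rewrite rV_cons0.
  exact: measurable_fst.
Qed.

Section lebesgue_rV_step.
Context {R : realType}.
Variables (n : nat) (mu : {sigma_finite_measure set 'rV[R]_n -> \bar R}).
Local Open Scope ereal_scope.

Local Notation prod := (@lebesgue_measure R \x mu).

Definition lebesgue_rV_step : set 'rV[R]_n.+1 -> \bar R :=
  pushforward prod (@rV_cons R n).

Let step0 : lebesgue_rV_step set0 = 0.
Proof. by rewrite /lebesgue_rV_step /pushforward preimage_set0 measure0. Qed.

Let step_ge0 A : 0 <= lebesgue_rV_step A.
Proof. by rewrite /lebesgue_rV_step /pushforward measure_ge0. Qed.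

Let step_sigma_additive : semi_sigma_additive lebesgue_rV_step.
Proof.
move=> F mF tF mUF; rewrite /lebesgue_rV_step /pushforward preimage_bigcup.
apply: measure_semi_sigma_additive.
- by move=> i; rewrite -[X in measurable X]setTI; exact: measurable_rV_cons.
- apply/trivIsetP => /= i j _ _ ij; rewrite -preimage_setI.
  by move/trivIsetP : tF => /(_ _ _ _ _ ij) ->//; rewrite preimage_set0.
- rewrite -preimage_bigcup -[X in measurable X]setTI.
  exact: measurable_rV_cons.
Qed.

HB.instance Definition _ := isMeasure.Build _ _ _ lebesgue_rV_step
  step0 step_ge0 step_sigma_additive.

Let hd (x : 'rV[R]_n.+1) : measurableTypeR R := x 0%R ord0.
Let tl (x : 'rV[R]_n.+1) : 'rV[R]_n := (\row_j x 0 (lift ord0 j))%R.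

Let measurable_uncons : measurable_fun setT (fun x => (hd x, tl x)).
Proof.
apply/measurable_fun_pairP; split; first exact: measurable_rV_coord.
apply/measurable_fun_rVP => i.
rewrite (_ : (fun t => _) = (fun x : 'rV[R]_n.+1 => x 0%R (lift ord0 i))).
  exact: measurable_rV_coord.
by apply/funext => x; rewrite /tl/= mxE.
Qed.

Let rV_consK z : (hd (rV_cons z), tl (rV_cons z)) = z.
Proof.
case: z => a v; congr pair; first exact: rV_cons0.
by apply/rowP => j; rewrite mxE rV_consS.
Qed.

Let step_sigma_finite : sigma_finite setT lebesgue_rV_step.
Proof.
have [F FT Foo] : sigma_finite setT prod.
  have /sigma_finiteP[F [TF ndF Foo]] := sigma_finiteT (@lebesgue_measure R).
  have /sigma_finiteP[G [TG ndG Goo]] := sigma_finiteT mu.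
  exists (fun k => F k `*` G k).
    rewrite -setXTT TF TG predeqE => -[x y]; split; last first.
      by move=> [k _ []/= ? ?]; split; exists k.
    move=> [/= [k _ Fkx] [l _ Gly]]; exists (maxn k l) => //; split.
    - by move: x Fkx; exact/subsetPset/ndF/leq_maxl.
    - by move: y Gly; exact/subsetPset/ndG/leq_maxr.
  move=> k; have [? ?] := Foo k; have [? ?] := Goo k.
  split; first exact: measurableX.
  by rewrite product_measure1E// lte_mul_pinfty// ge0_fin_numE.
exists (fun k => (fun x => (hd x, tl x)) @^-1` F k).
  by rewrite -preimage_bigcup -FT preimage_setT.
move=> k; have [mF Fk] := Foo k; split.
  by rewrite -[X in measurable X]setTI; exact: measurable_uncons.
rewrite /lebesgue_rV_step /pushforward -comp_preimage.
by rewrite (_ : _ \o _ = id)//; apply/funext => z; exact: rV_consK.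
Qed.

HB.instance Definition _ := Measure_isSigmaFinite.Build _ _ _ lebesgue_rV_step
  step_sigma_finite.

End lebesgue_rV_step.

Fixpoint lebesgue_rV (R : realType) (n : nat) :
    {sigma_finite_measure set 'rV[R]_n -> \bar R} :=
  if n is m.+1 then lebesgue_rV_step (lebesgue_rV R m) else \d_ (0 : 'rV[R]_0).

Lemma lebesgue_rV_box (R : realType) n (A : 'I_n -> set (measurableTypeR R)) :
  (forall i, measurable (A i)) ->
  lebesgue_rV R n [set x | forall i, A i (x 0 i)] =
  (\prod_(i < n) lebesgue_measure (A i))%E.
Proof.
elim: n A => [|n IH] A mA.
  rewrite big_ord0 /= diracE.
  by rewrite (_ : _ \in _) ?inE//= => -[].
rewrite big_ord_recl -IH// /= /lebesgue_rV_step /pushforward.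
rewrite -product_measure1E//.
  congr (_ _); apply/seteqP; split => -[a v]/= Av.
    split; first by have := Av ord0; rewrite rV_cons0.
    by move=> i; have := Av (lift ord0 i); rewrite rV_consS.
  move=> i; case: (unliftP ord0 i) => [j ->|->].
    by rewrite rV_consS; exact: Av.2.
  by rewrite rV_cons0; exact: Av.1.
rewrite (_ : (fun x : 'rV_n => _) = \bigcap_(i in [set: 'I_n])
  ((fun x : 'rV[R]_n => x 0 i : measurableTypeR R) @^-1` A (lift ord0 i))).
  apply: fin_bigcap_measurable => [|i _]; first exact: finite_finset.
  by rewrite -[X in measurable X]setTI; exact: measurable_rV_coord.
by apply/seteqP; split => x/= Ax i => [_|]; exact: Ax.
Qed.

Section function_spaces.
Context {R : realType} {n : nat}.
Implicit Types (D : set 'rV[R]_n) (f g phi : 'rV[R]_n -> R).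

Local Notation mu := (lebesgue_rV R n).

(* The library's norm on 'rV[R]_n is the sup norm. *)
Definition enorm (x : 'rV[R]_n) : R := Num.sqrt (\sum_(i < n) x 0 i ^+ 2).

Definition eball (r : R) : set 'rV[R]_n := [set x | enorm x < r].

(* Measurability on D for the Lebesgue (completed Borel) sigma-algebra. *)
Definition lmeasurable_fun d (T : measurableType d) D (f : 'rV[R]_n -> T) :=
  forall Y, measurable Y -> completed_algebra_gen mu (D `&` f @^-1` Y).

Definition in_L2 D f :=
  lmeasurable_fun D (f : 'rV[R]_n -> measurableTypeR R) /\
  (\int[mu]_(x in D) ((f x) ^+ 2)%:E < +oo)%E.

Definition partial (i : 'I_n) f : 'rV[R]_n -> R := 'D_(delta_mx 0 i) f.

Definition laplacian f : 'rV[R]_n -> R :=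
  fun x => \sum_(i < n) partial i (partial i f) x.

(* C^oo: all iterated partial derivatives, in any order, are differentiable. *)
Definition smooth f :=
  forall (s : seq 'I_n) x, differentiable (foldr partial f s) x.

Definition test_function D phi :=
  let supp := closure [set x | phi x != 0] in
  [/\ smooth phi, compact supp & supp `<=` D].

Definition is_weak_partial D (i : 'I_n) f g :=
  forall phi, test_function D phi ->
  \int[mu]_(x in D) (f x * partial i phi x) = - \int[mu]_(x in D) (g x * phi x).

Definition in_H1 D f :=
  in_L2 D f /\
  forall i, exists g, in_L2 D g /\ is_weak_partial D i f g.

(* A representative of the weak derivative, which for f in H^1(D) exists and is
   unique up to null sets; it is 0 if there is none in L^2(D). *)
Definition weak_partial D (i : 'I_n) f : 'rV[R]_n -> R :=
  xget (cst 0) [set g | in_L2 D g /\ is_weak_partial D i f g].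

Definition weak_grad D f (x : 'rV[R]_n) : 'rV[R]_n :=
  \row_i weak_partial D i f x.

(* Delta u + A . grad u + grad p = 0 and div u = 0 in D, tested against phi in
   C_c^oo(D); u and p are meant to be in H^1(D). *)
Definition stokes_solution D (A u : 'rV[R]_n -> 'rV[R]_n) (p : 'rV[R]_n -> R) :=
  (forall (i : 'I_n) phi, test_function D phi ->
    \int[mu]_(x in D) (u x 0 i * laplacian phi x
      + (\sum_(j < n) A x 0 j * weak_grad D (fun y => u y 0 i) x 0 j) * phi x
      - p x * partial i phi x) = 0) /\
  (forall phi, test_function D phi ->
    \int[mu]_(x in D) (\sum_(i < n) u x 0 i * partial i phi x) = 0).

Definition stokes_U D (u : 'rV[R]_n -> 'rV[R]_n) (p : 'rV[R]_n -> R)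
    (x : 'rV[R]_n) : R :=
  Num.sqrt (enorm x ^+ 4 * enorm (weak_grad D p x) ^+ 2
    + enorm x ^+ 2 * p x ^+ 2 + enorm (u x) ^+ 2).

End function_spaces.

(* Main.v *)
Require Import Defs.
From mathcomp Require Import all_boot all_order all_algebra.
From mathcomp Require Import all_classical all_reals all_analysis.
From mathcomp Require Import measurable_realfun ring lra.

(* Write t = ln |x| and w_ij = d_i u_j - d_j u_i. The Stokes system is equivalent
   to two first-order elliptic systems, div u = 0 with curl u = w, and
   sum_i d_i w_ij + d_j p = - (A . grad u)_j. For both, conjugating with a radial
   weight splits the operator into an antisymmetric radial part and a symmetric
   tangential part, and integrating the cross term by parts gives a Carleman
   inequality for every weight that is convex in t; no spherical harmonics are
   needed. The gradient of u in the drift term is controlled by a weighted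
   Caccioppoli inequality. With the weight |t| exp(c / t), whose second derivative
   is at least a large multiple of |t|^-3 times its slope, the drift, which is of
   size |t|^-3 / |x|, is absorbed for all large values of the parameter beta.

   If the conclusion failed, then for every m there would be arbitrarily small r
   with int_(B_r) |U|^2 < r^m. For fixed beta and m large enough this removes the
   boundary terms of the inner cut-off; letting beta tend to infinity then shows
   that u and p vanish on every annulus contained in B_R0, so almost everywhere.
   The inequalities are proved for mollifications of u and p, which satisfy the
   equations away from the origin, and pass to the limit in L^2. *)

(** The delicate point is the power of beta. Each Carleman inequality gains one factor [be * aa], so
    passing from the drift to the vorticity and then to the velocity gains [be ^+ 2 * aa ^+ 2]. The
    Caccioppoli inequality, which pays for grad u, costs the square of the logarithmic derivative of
    the weight, that is [be ^+ 2 * t ^- 6 * bb ^+ 2] once the drift bound is inserted. The powers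
    agree, so a large [be] cannot decide: the ratio of the second to the first derivative of the
    weight must exceed a fixed multiple [Lam] of |t|^-3, and this is what the parameter [c]
    provides. At the same time the weight may grow at most linearly in |t|, or its exponential would
    beat every power of R in the inner boundary terms. The function |t| exp(c / t) meets both
    demands.

    Since A is only measurable, the curl of the equation cannot be taken. Keeping p and w together
    as unknowns of one first-order system leaves the drift undifferentiated. *)

Set Implicit Arguments.
Unset Strict Implicit.
Unset Printing Implicit Defensive.

Import Order.TTheory GRing.Theory Num.Theory.
Import numFieldNormedType.Exports.

Local Open Scope classical_set_scope.
Local Open Scope ring_scope.

(** * Integration and differentiation on R^n *)

Section translation.
Context {R : realType}.
Local Notation mu1 := (@lebesgue_measure R).

(** The image of Lebesgue measure under a translation agrees with it on half-open intervals, hence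
    on all Borel sets. *)
Lemma ge0_integral_shift1 (c : R) (f : measurableTypeR R -> \bar R) :
  measurable_fun setT f -> (forall x, 0 <= f x)%E ->
  (\int[mu1]_x f (x + c)%R = \int[mu1]_x f x)%E.
Proof.
move=> mf f0.
have mshift : measurable_fun setT (fun x : measurableTypeR R => x + c : measurableTypeR R).
  exact: measurable_funD.
rewrite -[LHS](@ge0_integral_pushforward _ _ _ _ _ _ mshift mu1 setT f)//.
apply: eq_measure_integral => //= A mA _; apply/esym/lebesgue_measure_unique => //=.
move=> _ [[a b]] _ <-; rewrite /pushforward.
rewrite (_ : _ @^-1` _ = `]a - c, b - c]%classic).
  rewrite !lebesgue_measure_itv/= !lte_fin ltrBlDr subrK.
  by case: ifP => // _; rewrite -!EFinB; congr EFin; lra.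
by apply/seteqP; split => x; rewrite /= !in_itv/= ltrBlDr lerBrDr.
Qed.

Lemma measurable_rV_add n (v : 'rV[R]_n) : measurable_fun setT (fun x : 'rV[R]_n => x + v).
Proof.
apply/measurable_fun_rVP => i.
under eq_fun do rewrite mxE.
by apply: measurable_funD => //; exact: measurable_rV_coord.
Qed.

Lemma rV_consD n (a : R) (x : 'rV[R]_n) (v : 'rV[R]_n.+1) :
  rV_cons (a, x) + v = rV_cons (a + v 0 ord0, x + \row_j v 0 (lift ord0 j)).
Proof.
apply/rowP => i; rewrite mxE; have [j ->|->] := unliftP ord0 i.
  by rewrite !rV_consS !mxE.
by rewrite !rV_cons0.
Qed.

Lemma ge0_integral_rV_cons n (f : 'rV[R]_n.+1 -> \bar R) :
  measurable_fun setT f -> (forall x, 0 <= f x)%E ->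
  (\int[lebesgue_rV R n.+1]_x f x =
   \int[mu1]_a \int[lebesgue_rV R n]_x f (rV_cons (a, x)))%E.
Proof.
move=> mf f0.
rewrite [LHS](@ge0_integral_pushforward _ _ _ _ _ _ (@measurable_rV_cons R n)
  (mu1 \x lebesgue_rV R n)%E setT f)//.
rewrite preimage_setT fubini_tonelli1//; last by move=> z; exact: f0.
by apply: measurableT_comp => //; exact: measurable_rV_cons.
Qed.

Lemma measurable_rV_cons2 n (a : R) :
  measurable_fun setT (fun x : 'rV[R]_n => rV_cons (a, x)).
Proof. exact: (measurableT_comp (@measurable_rV_cons R n) (measurable_pair1 _)). Qed.

(** By Tonelli, the tail of the vector is shifted inside and the first coordinate outside. *)
Lemma ge0_integral_shift n (v : 'rV[R]_n) (f : 'rV[R]_n -> \bar R) :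
  measurable_fun setT f -> (forall x, 0 <= f x)%E ->
  (\int[lebesgue_rV R n]_x f (x + v)%R = \int[lebesgue_rV R n]_x f x)%E.
Proof.
elim: n v f => [|n IH] v f mf f0.
  by apply: eq_integral => x _; congr f; apply/rowP => -[].
have mfv : measurable_fun setT (fun x : 'rV[R]_n.+1 => f (x + v)).
  exact: (measurableT_comp mf (measurable_rV_add v)).
rewrite (ge0_integral_rV_cons mf f0) (ge0_integral_rV_cons mfv)//.
pose g a := (\int[lebesgue_rV R n]_x f (rV_cons (a, x)))%E.
have mg : measurable_fun setT (g : measurableTypeR R -> \bar R).
  apply: (@measurable_fun_fubini_tonelli_F _ _ _ _ _ _ (fun z => f (rV_cons z))) => //.
  by apply: measurableT_comp => //; exact: measurable_rV_cons.
rewrite -(ge0_integral_shift1 (v 0 ord0) mg); last by move=> a; exact: integral_ge0.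
apply: eq_integral => a _.
under eq_integral do rewrite rV_consD.
rewrite (IH _ (fun x => f (rV_cons (a + v 0 ord0, x))))//.
by apply: measurableT_comp => //; exact: measurable_rV_cons2.
Qed.

End translation.
Section is_derive_pointwise.
Context {R : realType}.

(** Reduces directional derivatives to one real variable, so that the chain rule and the mean value
    theorem apply without Frechet differentiability. *)
Lemma is_derive_line (V : normedModType R) (f : V -> R) (x v : V) (a : R) :
  is_derive x v f a <-> is_derive (0 : R) 1 (fun s : R => f (x + s *: v)) a.
Proof.
have E : (fun h : R => h^-1 *: ((f \o shift x) (h *: v) - f x)) =
   (fun h : R => h^-1 *: (((fun s : R => f (x + s *: v)) \o shift 0) (h *: (1 : R)) -
      f (x + 0 *: v))).
  by apply/funext => h; rewrite /= scaler1 addr0 scale0r addr0 (addrC x).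
by split=> -[df Df]; constructor; move: df Df;
  rewrite /derivable /derive ?E// -E.
Qed.

Lemma is_derive_line_at (V : normedModType R) (f : V -> R) (x v : V) (s a : R) :
  is_derive (x + s *: v) v f a -> is_derive s 1 (fun s : R => f (x + s *: v)) a.
Proof.
move=> /is_derive_line h; apply/is_derive_line.
rewrite (_ : (fun _ => _) = (fun s0 : R => f (x + s *: v + s0 *: v)))//.
by apply/funext => r; rewrite scaler1 scalerDl addrA.
Qed.

Lemma is_derive_add (V : normedModType R) (f g : V -> R) (x v : V) (a b : R) :
  is_derive x v f a -> is_derive x v g b -> is_derive x v (fun y => f y + g y) (a + b).
Proof. by move=> fa gb; exact: (is_deriveD fa gb). Qed.

Lemma is_derive_opp (V : normedModType R) (f : V -> R) (x v : V) (a : R) :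
  is_derive x v f a -> is_derive x v (fun y => - f y) (- a).
Proof. by move=> fa; exact: (is_deriveN fa). Qed.

Lemma is_derive_mul (V : normedModType R) (f g : V -> R) (x v : V) (a b : R) :
  is_derive x v f a -> is_derive x v g b ->
  is_derive x v (fun y => f y * g y) (a * g x + f x * b).
Proof.
move=> fa gb; have := is_deriveM fa gb.
by rewrite addrC /GRing.scale/= [g x * a]mulrC.
Qed.

Lemma is_derive_comp1 (V : normedModType R) (k : R -> R) (f : V -> R) (x v : V) (a b : R) :
  is_derive x v f a -> is_derive (f x) 1 k b ->
  is_derive x v (fun y => k (f y)) (b * a).
Proof.
move=> /is_derive_line fa kb; apply/is_derive_line.
have kb' : is_derive ((fun s : R => f (x + s *: v)) 0) 1 k b.
  by rewrite /= scale0r addr0.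
exact: (is_derive1_comp kb' fa).
Qed.

Lemma is_derive_bigsum (V : normedModType R) (I : Type) (r : seq I)
    (f : I -> V -> R) (x v : V) (a : I -> R) :
  (forall i, is_derive x v (f i) (a i)) ->
  is_derive x v (fun y => \sum_(i <- r) f i y) (\sum_(i <- r) a i).
Proof.
move=> fa; elim: r => [|i r IH].
  rewrite big_nil (_ : (fun _ => _) = cst 0)//.
    exact: is_derive_cst.
  by apply/funext => y; rewrite big_nil.
rewrite big_cons (_ : (fun _ => _) = (fun y => f i y + \sum_(j <- r) f j y)).
  exact: is_derive_add.
by apply/funext => y; rewrite big_cons.
Qed.

(** The mean value theorem along a line. It supplies the domination of difference quotients in
    [Int_partial0]. *)
Lemma is_derive_lipschitz (V : normedModType R) (f df : V -> R) (v : V) (C : R) :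
  (forall x, is_derive x v f (df x)) -> (forall x, `|df x| <= C) ->
  forall x s, `|f (x + s *: v) - f x| <= C * `|s|.
Proof.
move=> fdf dfC.
suff H : forall x (s : R), 0 <= s -> `|f (x + s *: v) - f x| <= C * `|s|.
  move=> x s; have [/H//|s0] := leP 0 s.
  have := H (x + s *: v) (- s); rewrite oppr_ge0 (ltW s0) => /(_ isT).
  by rewrite -addrA -scalerDl subrr scale0r addr0 distrC normrN.
move=> x s s0; pose g (r : R) := f (x + r *: v).
have gd (r : R) : is_derive r (1 : R) g (df (x + r *: v)) by exact: is_derive_line_at.
have cg : {within `[0, s], continuous g}.
  by apply: derivable_within_continuous => r _; exact: ex_derive.
have [c _] := @MVT_segment R g (fun r => df (x + r *: v)) 0 s s0 (fun r _ => gd r) cg.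
by rewrite /g scale0r addr0 subr0 => ->; rewrite normrM ler_wpM2r.
Qed.

End is_derive_pointwise.

(** * Integrals over the unit cube *)

Section bounded_measurable.
Context {R : realType} {n : nat}.
Local Notation mu := (lebesgue_rV R n).
Implicit Types (f g h : 'rV[R]_n -> R).

Definition cube (M : R) : set 'rV[R]_n := [set x | forall i, `|x 0 i| <= M].

Lemma cubeE M : cube M = [set x | forall i, `[-M, M]%classic (x 0 i)].
Proof.
by apply/seteqP; split => x /= h i; have := h i; rewrite /= in_itv/= ler_norml.
Qed.

Lemma measurable_cube M : measurable (cube M).
Proof.
have -> : cube M = \bigcap_(i in [set: 'I_n])
  ((fun x : 'rV[R]_n => x 0 i : measurableTypeR R) @^-1` `[-M, M]%classic).
  by apply/seteqP; split => x /= h i => [_|]; have := h i;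
    rewrite /= in_itv/= ler_norml => // /(_ Logic.I).
apply: fin_bigcap_measurable => [|i _]; first exact: finite_finset.
by rewrite -[X in measurable X]setTI; exact: measurable_rV_coord.
Qed.

Lemma cube_lty M : (mu (cube M) < +oo)%E.
Proof.
rewrite cubeE (@lebesgue_rV_box R n (fun=> `[-M, M]%classic))//.
have [c ->] : exists c : R, lebesgue_measure (`[-M, M]%classic : set R) = c%:E.
  rewrite lebesgue_measure_itv/=; case: ifP => // _; last by exists 0.
  by eexists; rewrite -EFinB.
by rewrite prodEFin ltey.
Qed.

Definition sq (x : 'rV[R]_n) : R := \sum_(i < n) x 0 i ^+ 2.

Lemma sq_ge0 (x : 'rV[R]_n) : 0 <= sq x.
Proof. by apply: sumr_ge0 => i _; exact: sqr_ge0. Qed.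

Lemma coord_sq (x : 'rV[R]_n) i : x 0 i ^+ 2 <= sq x.
Proof.
rewrite /sq (bigD1 i)//= lerDl; apply: sumr_ge0 => j _; exact: sqr_ge0.
Qed.

Lemma enorm_sq (x : 'rV[R]_n) : enorm x ^+ 2 = sq x.
Proof. by rewrite sqr_sqrtr// sq_ge0. Qed.

Lemma measurable_coord i : measurable_fun setT (fun x : 'rV[R]_n => x 0 i).
Proof. exact: measurable_rV_coord. Qed.

Lemma measurable_sq : measurable_fun setT sq.
Proof.
apply: measurable_sum => i; apply: measurable_funX; exact: measurable_coord.
Qed.

(* Bounded on the unit cube, over which all integrals below are taken: it has
   finite measure and contains the supports of the radial weights. *)
Definition bmfun f := measurable_fun setT f /\
  exists C : R, forall x, cube 1 x -> `|f x| <= C.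

Lemma bmfun_cst c : bmfun (fun=> c).
Proof. by split; [exact: measurable_cst|exists `|c|]. Qed.

Lemma bmfun_coord i : bmfun (fun x => x 0 i).
Proof. by split; [exact: measurable_coord|exists 1 => x; apply]. Qed.

Lemma bmfunD f g : bmfun f -> bmfun g -> bmfun (fun x => f x + g x).
Proof.
move=> [mf [C fC]] [mg [D gD]]; split; first exact: measurable_funD.
by exists (C + D) => x cx; rewrite (le_trans (ler_normD _ _))// lerD ?fC ?gD.
Qed.

Lemma bmfunM f g : bmfun f -> bmfun g -> bmfun (fun x => f x * g x).
Proof.
move=> [mf [C fC]] [mg [D gD]]; split; first exact: measurable_funM.
by exists (C * D) => x cx; rewrite normrM ler_pM ?fC ?gD.
Qed.

Lemma bmfunN f : bmfun f -> bmfun (fun x => - f x).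
Proof.
move=> [mf [C fC]]; split; first exact: measurable_funN.
by exists C => x cx; rewrite normrN fC.
Qed.

Lemma bmfunX f k : bmfun f -> bmfun (fun x => f x ^+ k).
Proof.
move=> bf; elim: k => [|k IH].
  rewrite (_ : (fun _ => _) = (fun=> 1)); first exact: bmfun_cst.
  by apply/funext => x; rewrite expr0.
rewrite (_ : (fun _ => _) = (fun x => f x * f x ^+ k)); first exact: bmfunM.
by apply/funext => x; rewrite exprS.
Qed.

Lemma bmfun_sum (I : Type) (s : seq I) (f : I -> 'rV[R]_n -> R) :
  (forall i, bmfun (f i)) -> bmfun (fun x => \sum_(i <- s) f i x).
Proof.
move=> bf; elim: s => [|i s IH].
  rewrite (_ : (fun _ => _) = (fun=> 0)); first exact: bmfun_cst.
  by apply/funext => x; rewrite big_nil.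
rewrite (_ : (fun _ => _) = (fun x => f i x + \sum_(j <- s) f j x)).
  exact: bmfunD.
by apply/funext => x; rewrite big_cons.
Qed.

Local Notation Q := (cube 1).
Definition L1 f := mu.-integrable Q (EFin \o f).
Definition Int f : R := \int[mu]_(x in Q) f x.

Lemma bm_L1 f : bmfun f -> L1 f.
Proof.
move=> [mf [C fC]]; apply: measurable_bounded_integrable.
- exact: measurable_cube.
- exact: cube_lty.
- exact: measurable_funTS.
- exists C; split; first exact: num_real.
  by move=> D CD x cx /=; rewrite (le_trans (fC x cx))// ltW.
Qed.

Lemma L1_measurable f : L1 f -> measurable_fun Q f.
Proof. by move=> /integrableP[/measurable_EFinP]. Qed.

Lemma L1D f g : L1 f -> L1 g -> L1 (fun x => f x + g x).
Proof. by move=> Lf Lg; exact: (integrableD (measurable_cube 1) Lf Lg). Qed.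

Lemma L1Z c f : L1 f -> L1 (fun x => c * f x).
Proof. by move=> Lf; exact: (integrableZl (measurable_cube 1) c Lf). Qed.

Lemma L1N f : L1 f -> L1 (fun x => - f x).
Proof.
by move=> /(L1Z (-1)); congr L1; apply/funext => x; rewrite mulN1r.
Qed.

Lemma L1_sum (I : Type) (s : seq I) (f : I -> 'rV[R]_n -> R) :
  (forall i, L1 (f i)) -> L1 (fun x => \sum_(i <- s) f i x).
Proof.
move=> bf; elim: s => [|i s IH].
  rewrite (_ : (fun _ => _) = (fun=> 0)); first exact/bm_L1/bmfun_cst.
  by apply/funext => x; rewrite big_nil.
rewrite (_ : (fun _ => _) = (fun x => f i x + \sum_(j <- s) f j x)).
  exact: L1D.
by apply/funext => x; rewrite big_cons.
Qed.

Lemma L1_bmM f g : bmfun f -> L1 g -> L1 (fun x => f x * g x).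
Proof.
move=> [mf [C fC]] Lg; have mg := L1_measurable Lg.
apply: (@le_integrable _ _ _ mu Q (measurable_cube 1) _ (EFin \o (fun x => C * g x))).
- apply/measurable_EFinP/measurable_funM => //; exact: measurable_funTS.
- move=> x cx /=; rewrite lee_fin !normrM ler_wpM2r//.
  by rewrite (le_trans (fC x cx))// ler_norm.
- exact: L1Z.
Qed.

Lemma IntD f g : L1 f -> L1 g -> Int (fun x => f x + g x) = Int f + Int g.
Proof. by move=> ? ?; apply: RintegralD => //; exact: measurable_cube. Qed.

Lemma IntZ c f : L1 f -> Int (fun x => c * f x) = c * Int f.
Proof. by move=> ?; apply: RintegralZl => //; exact: measurable_cube. Qed.

Lemma IntN f : L1 f -> Int (fun x => - f x) = - Int f.
Proof.
move=> Lf; rewrite -[RHS]mulN1r -IntZ//; congr Int.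
by apply/funext => x; rewrite mulN1r.
Qed.

Lemma Int0 : Int (fun=> 0) = 0.
Proof. by rewrite /Int Rintegral_cst ?mul0r//; exact: measurable_cube. Qed.

Lemma Int_sum (I : Type) (s : seq I) (f : I -> 'rV[R]_n -> R) :
  (forall i, L1 (f i)) ->
  Int (fun x => \sum_(i <- s) f i x) = \sum_(i <- s) Int (f i).
Proof.
move=> bf; elim: s => [|i s IH].
  rewrite big_nil -[RHS]Int0; congr Int.
  by apply/funext => x; rewrite big_nil.
rewrite big_cons -IH -IntD//; last exact: L1_sum.
by congr Int; apply/funext => x; rewrite big_cons.
Qed.

Lemma Int_ge0 f : (forall x, Q x -> 0 <= f x) -> 0 <= Int f.
Proof. by move=> f0; apply: Rintegral_ge0. Qed.

Lemma le_Int f g : L1 f -> L1 g -> (forall x, Q x -> f x <= g x) -> Int f <= Int g.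
Proof. by move=> ? ? fg; apply: le_Rintegral => //; exact: measurable_cube. Qed.

Lemma eq_Int f g : (forall x, Q x -> f x = g x) -> Int f = Int g.
Proof. by move=> fg; apply: eq_Rintegral => x; rewrite inE => /fg. Qed.

End bounded_measurable.

(** * Integration by parts from translation invariance *)

Section integration_by_parts.
Context {R : realType} {n : nat}.
Local Notation mu := (lebesgue_rV R n).
Implicit Types (f g h : 'rV[R]_n -> R).

Lemma integral_shift (v : 'rV[R]_n) (f : 'rV[R]_n -> \bar R) :
  measurable_fun setT f ->
  (\int[mu]_x f (x + v)%R = \int[mu]_x f x)%E.
Proof.
move=> mf; rewrite integralE [RHS]integralE.
congr (_ - _)%E.
  rewrite -(@ge0_integral_shift R n v (f^\+)%E) //; last exact: measurable_funepos.
  by apply: eq_integral => x _; rewrite !funeposE.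
rewrite -(@ge0_integral_shift R n v (f^\-)%E) //; last exact: measurable_funeneg.
by apply: eq_integral => x _; rewrite !funenegE.
Qed.

Lemma integrable_supp M C h : measurable_fun setT h -> (forall x, `|h x| <= C) ->
  (forall x, ~ cube M x -> h x = 0) -> mu.-integrable setT (EFin \o h).
Proof.
move=> mh hC h0.
have mc := @measurable_cube R n M.
have : mu.-integrable (cube M) (EFin \o h).
  apply: measurable_bounded_integrable => //.
  - exact: cube_lty.
  - exact: measurable_funTS.
  - exists C; split; first exact: num_real.
    by move=> D CD x _ /=; rewrite (le_trans (hC x))// ltW.
rewrite integrable_mkcond//; congr (_.-integrable _ _).
apply/funext => x; rewrite /patch; case: ifPn => //.
by move=> /negP xM; rewrite /= h0// => xM'; apply: xM; rewrite inE.
Qed.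

Lemma IntE h : (forall x, ~ cube 1 x -> h x = 0) -> Int h = \int[mu]_x h x.
Proof.
move=> h0; rewrite /Int Rintegral_mkcond; apply: eq_Rintegral => x _.
rewrite /patch; case: ifPn => //.
by move=> /negP xM; rewrite /= h0// => xM'; apply: xM; rewrite inE.
Qed.

(** Translation invariance makes the integral of every difference quotient of h zero, and dominated
    convergence passes to the derivative. No continuity of h' and no iterated integral enters. *)
Lemma Int_partial0 (b : 'I_n) h h' : bmfun h -> bmfun h' ->
  (forall x, is_derive x (delta_mx 0 b : 'rV[R]_n) h (h' x)) ->
  (forall x, ~ cube 1 x -> h x = 0) -> (forall x, ~ cube 1 x -> h' x = 0) ->
  Int h' = 0.
Proof.
move=> bh bh' hh' h0 h'0; rewrite IntE// /Rintegral.
set e := (delta_mx 0 b : 'rV[R]_n).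
have bound f : bmfun f -> (forall x, ~ cube 1 x -> f x = 0) ->
    exists C : R, 0 <= C /\ forall x, `|f x| <= C.
  move=> [_ [C fC]] f0; have C0 : 0 <= C.
    by rewrite (le_trans _ (fC 0 _))// => i; rewrite mxE normr0.
  exists C; split => // x; have [/fC//|/f0 ->] := pselect (cube 1 x).
  by rewrite normr0.
have [C [C0 h'C]] := bound _ bh' h'0.
have [D [D0 hD]] := bound _ bh h0.
(* Increments of at most 1 keep all difference quotients supported in [cube 2]. *)
pose t k : R := k.+1%:R^-1.
have t0 k : 0 < t k by rewrite invr_gt0.
pose q k (x : 'rV[R]_n) := (t k)^-1 * (h (x + t k *: e) - h x).
have mh : measurable_fun setT h by case: bh.
have mhs (s : R) : measurable_fun setT (fun x : 'rV[R]_n => h (x + s *: e)).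
  exact: (measurableT_comp mh (measurable_rV_add _)).
have mq k : measurable_fun setT (q k).
  by apply: measurable_funM => //; apply: measurable_funB.
have q_cvg x : q ^~ x @ \oo --> h' x.
  have [dh <-] := hh' x.
  have : t @ \oo --> (0 : R) by exact: cvg_harmonic.
  move=> tc; have /cvg_ex[l hl] := dh; have E := hl.
  move/(cvg_lim (@Rhausdorff R)) : hl; rewrite -/('D_e h x) => ->.
  move/cvgr_dnbhsP : E => /(_ t (conj (fun k => lt0r_neq0 (t0 k)) tc)).
  apply: cvg_trans; apply: near_eq_cvg; apply: nearW => k /=.
  by rewrite /q /= (addrC x).
have c12 k x : cube 1 (x + t k *: e) -> cube 2 x.
  move=> c1 i; have := c1 i; rewrite !mxE eqxx/= => xi.
  have te : `|t k * (i == b)%:R| <= 1.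
    case: (i == b); last by rewrite mulr0 normr0.
    by rewrite mulr1 gtr0_norm// /t invf_le1 ?ler1n.
  rewrite -[x 0 i](addrK (t k * (i == b)%:R)) (le_trans (ler_normB _ _))//.
  by rewrite (le_trans (lerD xi te)).
have q_le k x : `|q k x| <= C * \1_(cube 2) x.
  rewrite /indic; case: (boolP (x \in cube 2)) => [_|/negP xc].
    rewrite mulr1 /q normrM gtr0_norm ?invr_gt0//.
    rewrite ler_pdivrMl// mulrC -[X in _ * X]gtr0_norm//.
    exact: (is_derive_lipschitz hh').
  have c2 : ~ cube 2 x by move=> xc'; apply: xc; rewrite inE.
  rewrite mulr0 /q !h0 ?subrr ?mulr0 ?normr0// => c1; apply: c2; last first.
    exact: c12 c1.
  by move=> i; rewrite (le_trans (c1 i))// ler1n.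
have iq k : (\int[mu]_x (q k x)%:E = 0)%E.
  have ih : mu.-integrable setT (EFin \o h) by exact: (integrable_supp mh hD h0).
  have ihs : mu.-integrable setT (EFin \o (fun x : 'rV[R]_n => h (x + t k *: e))).
    apply: (@integrable_supp 2 D) => // x xc.
    by apply: h0 => c1; apply: xc; exact: c12 c1.
  under eq_integral do rewrite /q EFinM.
  rewrite integralZl//; last exact: (integrableB _ ihs ih).
  rewrite [X in (_ * X)%E](_ : _ = 0)%E ?mule0//.
  under eq_integral do rewrite EFinB.
  rewrite (integralB _ ihs ih)//=.
  rewrite (@integral_shift (t k *: e) (EFin \o h)); last exact/measurable_EFinP.
  rewrite subee//; exact: integrable_fin_num.
have ig : mu.-integrable setT (fun x => (C * \1_(cube 2) x)%:E).
  apply: (@integrable_supp 2 C) => [|x|x xc]; last first.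
  - by rewrite indicE memNset ?mulr0.
  - rewrite indicE; case: (_ \in _); rewrite ?mulr1 ?mulr0 ?normr0//.
    by rewrite ger0_norm.
  - apply: measurable_funM => //.
    by apply: measurable_indic; exact: measurable_cube.
have mq' k : measurable_fun setT (fun x => (q k x)%:E) by exact/measurable_EFinP.
have mh' : measurable_fun setT (fun x => (h' x)%:E) by apply/measurable_EFinP; case: bh'.
have qc' : {ae mu, forall x, setT x -> (fun k => (q k x)%:E) @ \oo --> (h' x)%:E}.
  by apply: aeW => x _; apply: cvg_EFin; [exact: nearW|exact: q_cvg].
have qle' : {ae mu, forall x k, setT x -> (`|(q k x)%:E| <= (C * \1_(cube 2) x)%:E)%E}.
  by apply: aeW => x k _; rewrite lee_fin; exact: q_le.
have [_ _ +] := dominated_convergence measurableT mq' mh' qc' ig qle'.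
under eq_fun do rewrite iq.
by move=> /cvg_lim; rewrite lim_cst// => /(_ _) <-.
Qed.

End integration_by_parts.

(** * Radial weights and first-order vector fields *)

Section weights.
Context {R : realType}.
Implicit Types (k g : R -> R).

(* Weights are functions of t = ln |x|, supported in an annulus away from the
   origin and from the unit sphere. *)
Definition weight0 k := continuous k /\
  exists t0 t1, t1 < 0 /\ forall t, ~ (t0 < t < t1) -> k t = 0.

Definition weight1 k k' :=
  [/\ weight0 k, weight0 k' & forall t : R, is_derive t (1 : R) k (k' t)].

Lemma weight0_ge0 k (t : R) : weight0 k -> 0 <= t -> k t = 0.
Proof.
by move=> [_ [t0 [t1 [t10 k0]]]] t_ge0; apply: k0 => /andP[_]; lra.
Qed.

Lemma weight0_bounded k : weight0 k -> exists C, 0 <= C /\ forall t, `|k t| <= C.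
Proof.
move=> [ck [t0 [t1 [t10 k0]]]].
have : compact (k @` `[t0, t1]).
  by apply: continuous_compact; [exact: continuous_subspaceT|exact: segment_compact].
move=> /compact_bounded[N [_ N1x]].
exists (`|N| + 1); split; first by rewrite addr_ge0.
move=> t; have [tt|tt] := boolP (t0 < t < t1).
  apply: N1x; first by rewrite ltr_pwDr// ler_norm.
  by exists t => //=; rewrite in_itv/=; move/andP : tt => [? ?]; rewrite !ltW.
by rewrite k0 ?normr0 ?addr_ge0//; exact/negP.
Qed.

Lemma weight0_near0 k (t : R) : weight0 k -> 0 <= t -> \forall s \near t, k s = 0.
Proof.
move=> [_ [t0 [t1 [t10 k0]]]] t_ge0.
have : t1 < t by lra.
move=> /lt_nbhsr.
by apply: filterS => s ts; apply: k0 => /andP[_]; lra.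
Qed.

(** The factor g, typically a negative power of t, may be singular at 0: k vanishes in a
    neighbourhood of every t >= 0, so the product is continuous there. *)
Lemma weight0M k g : weight0 k -> (forall t : R, t < 0 -> {for t, continuous g}) ->
  weight0 (fun t => k t * g t).
Proof.
move=> wk cg; split.
  move=> t; have [t0|t0] := ltP t 0.
    by apply: cvgM; [exact: wk.1|exact: cg].
  have /= kg0 : \forall s \near t, cst 0 s = k s * g s.
    have := weight0_near0 wk t0.
    by apply: filterS => s ->; rewrite mul0r.
  rewrite /continuous_at (weight0_ge0 wk t0) mul0r.
  by apply: (cvg_trans (near_eq_cvg kg0)); exact: cvg_cst.
case: wk => _ [t0 [t1 [t10 k0]]]; exists t0, t1; split => // t /k0 ->.
by rewrite mul0r.
Qed.

Lemma weight0D k g : weight0 k -> weight0 g -> weight0 (fun t => k t + g t).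
Proof.
move=> [ck [t0 [t1 [t10 k0]]]] [cg [s0 [s1 [s10 g0]]]]; split.
  by move=> t; apply: cvgD; [exact: ck|exact: cg].
exists (Num.min t0 s0), (Num.max t1 s1); split; first by rewrite gt_max t10.
move=> t tt; rewrite k0 ?g0 ?addr0// => /andP[h1 h2]; apply: tt.
  by rewrite gt_min lt_max h1 h2 !orbT.
by rewrite gt_min lt_max h1 h2.
Qed.

Lemma weight0Z c k : weight0 k -> weight0 (fun t => c * k t).
Proof.
move=> [ck [t0 [t1 [t10 k0]]]]; split.
  by move=> t; apply: cvgM; [exact: cvg_cst|exact: ck].
by exists t0, t1; split => // t /k0 ->; rewrite mulr0.
Qed.

Lemma weight1M k k' g g' : weight1 k k' ->
  (forall t : R, t < 0 -> is_derive t (1 : R) g (g' t)) ->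
  (forall t : R, t < 0 -> {for t, continuous g'}) ->
  weight1 (fun t => k t * g t) (fun t => k' t * g t + k t * g' t).
Proof.
move=> [wk wk' kk'] gg' cg'.
have cg (t : R) : t < 0 -> {for t, continuous g}.
  move=> /gg' [dg _]; apply: differentiable_continuous; exact/derivable1_diffP.
split; first exact: weight0M.
  by apply: weight0D; apply: weight0M.
move=> t; have [t0|t0] := ltP t 0.
  exact: (is_derive_mul (kk' t) (gg' t t0)).
rewrite (weight0_ge0 wk t0) (weight0_ge0 wk' t0) !mul0r addr0.
apply: (near_eq_is_derive _ (is_derive_cst (0 : R) t (1 : R))).
have := weight0_near0 wk t0.
by apply: filterS => s ->; rewrite mul0r.
Qed.

Lemma weight1_mul k k' g g' : weight1 k k' -> weight1 g g' ->
  weight1 (fun t => k t * g t) (fun t => k' t * g t + k t * g' t).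
Proof.
move=> wk [wg wg' gg']; apply: weight1M => // t _; exact: wg'.1.
Qed.

End weights.

Section radial.
Context {R : realType} {n : nat}.
Implicit Types (f g h : 'rV[R]_n -> R) (k : R -> R).

(** ln |x|. At the origin it takes the default value 0, where every weight vanishes, so composites
    with weights need no separate convention there. *)
Definition logr (x : 'rV[R]_n) : R := ln (sq x) / 2.

Lemma sq0P (x : 'rV[R]_n) : sq x = 0 -> x = 0.
Proof.
move=> x0; apply/rowP => i; rewrite mxE; apply/eqP; rewrite -sqrf_eq0 eq_le.
by rewrite sqr_ge0 andbT -x0 coord_sq.
Qed.

Lemma sq_gt0 (x : 'rV[R]_n) : x != 0 -> 0 < sq x.
Proof.
move=> x0; rewrite lt_neqAle sq_ge0 andbT eq_sym; apply: contra x0 => /eqP.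
by move=> /sq0P ->.
Qed.

Lemma logr0 : logr 0 = 0.
Proof.
rewrite /logr /sq big1 ?ln0 ?mul0r// => i _.
by rewrite mxE expr0n.
Qed.

Lemma expR_logr (x : 'rV[R]_n) : x != 0 -> expR (2 * logr x) = sq x.
Proof.
by move=> /sq_gt0 x0; rewrite /logr mulrC divfK// lnK.
Qed.

Lemma logr_lt (x : 'rV[R]_n) t : x != 0 -> (logr x < t) = (sq x < expR (2 * t)).
Proof. by move=> x0; rewrite -expR_logr// ltr_expR ltr_pM2l. Qed.

Lemma measurable_logr : measurable_fun setT logr.
Proof.
apply: measurable_funM => //.
by apply: measurableT_comp; [exact: measurable_ln|exact: measurable_sq].
Qed.

Lemma weight_measurable k : weight0 k -> measurable_fun setT (fun x => k (logr x)).
Proof.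
move=> [ck _]; apply: measurableT_comp; last exact: measurable_logr.
exact: continuous_measurable_fun.
Qed.

Lemma weight_bm k : weight0 k -> bmfun (fun x => k (logr x)).
Proof.
move=> wk; split; first exact: weight_measurable.
by have [C [_ kC]] := weight0_bounded wk; exists C.
Qed.

Lemma weight_supp k x : weight0 k -> ~ cube 1 x -> k (logr x) = 0.
Proof.
move=> wk xc; apply: weight0_ge0 => //; rewrite leNgt; apply/negP => t0; apply: xc => i.
have x0 : x != 0 by apply: contraTneq t0 => ->; rewrite logr0 ltxx.
move: t0; rewrite logr_lt// mulr0 expR0 => sq1.
rewrite -(ler_pXn2r (n:=2))// ?nnegrE// expr1n -normrX ger0_norm ?sqr_ge0//.
by rewrite (le_trans (coord_sq _ _))// ltW.
Qed.

Lemma is_derive_coord (x : 'rV[R]_n) (a b : 'I_n) :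
  is_derive x (delta_mx 0 b : 'rV[R]_n) (fun y : 'rV[R]_n => y 0 a) (a == b)%:R.
Proof.
apply/is_derive_line.
rewrite (_ : (fun s => _) = (fun s : R => x 0 a + s * (a == b)%:R)).
  have := is_derive_add (is_derive_cst (x 0 a) (0 : R) (1 : R))
    (is_derive_mul (is_derive_id (0 : R) (1 : R)) (is_derive_cst ((a == b)%:R : R) (0 : R) (1 : R))).
  by rewrite add0r mul1r mulr0 addr0.
by apply/funext => s; rewrite !mxE.
Qed.

Lemma is_derive_sq (x : 'rV[R]_n) (b : 'I_n) :
  is_derive x (delta_mx 0 b : 'rV[R]_n) (@sq R n) (2 * x 0 b).
Proof.
have := @is_derive_bigsum _ _ _ (index_enum 'I_n) (fun i (y : 'rV[R]_n) => y 0 i * y 0 i) x _ _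
  (fun i => is_derive_mul (is_derive_coord x i b) (is_derive_coord x i b)).
rewrite (bigD1 b)//= eqxx mul1r mulr1 big1 ?addr0 => [|i /negPf ib].
  by rewrite -mulr2n mulr_natl.
by rewrite ib mul0r mulr0 addr0.
Qed.

(* expR (- 2 * logr x) is 1 / |x|^2; at x = 0, where logr is the junk value 0,
   both sides vanish. *)
Lemma is_derive_weight k k' (x : 'rV[R]_n) (b : 'I_n) : weight1 k k' ->
  is_derive x (delta_mx 0 b : 'rV[R]_n) (fun y => k (logr y))
    (k' (logr x) * expR (- 2 * logr x) * x 0 b).
Proof.
move=> [wk wk' kk']; have [->|x0] := eqVneq x 0.
  rewrite mxE mulr0; apply/is_derive_line.
  apply: (near_eq_is_derive _ (is_derive_cst (0 : R) (0 : R) (1 : R))).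
  have [_ [t0 [t1 [t10 k0]]]] := wk.
  (* On the axis [logr] is ln |s|, so this puts s below the support of k and the weight is locally
     zero. *)
  have nb : \forall s \near (0 : R), `|s| <= expR t0.
    exists (expR t0) => [/=|s]; first exact: expR_gt0.
    by rewrite /= sub0r normrN => /ltW.
  near=> s; apply/esym; have [->|s0] := eqVneq s 0.
    by rewrite scale0r addr0 logr0; apply: k0 => /andP[_]; lra.
  have sq_e : sq (0 + s *: (delta_mx 0 b : 'rV[R]_n)) = s ^+ 2.
    rewrite /sq (bigD1 b)//= !mxE !eqxx add0r mulr1 big1 ?addr0// => i /negPf ib.
    by rewrite !mxE ib /= mulr0 add0r expr0n.
  apply: k0 => /andP[]; rewrite ltNge => /negP + _; apply.
  rewrite /logr sq_e -(real_normK (num_real s)) lnXn ?normr_gt0//.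
  rewrite -(mulr_natr (ln _)) mulfK// -ler_expR lnK ?posrE ?normr_gt0//.
  by near: s.
rewrite mulNr expRN expR_logr//.
have dl : is_derive (sq x) 1 (@ln R) (sq x)^-1 by apply: is_derive1_ln; exact: sq_gt0.
have dlog : is_derive x (delta_mx 0 b : 'rV[R]_n) logr ((sq x)^-1 * x 0 b).
  have := is_derive_mul (is_derive_comp1 (is_derive_sq x b) dl)
    (is_derive_cst (2^-1 : R) x (delta_mx 0 b : 'rV[R]_n)).
  rewrite mulr0 addr0 [X in is_derive _ _ _ X](_ : _ = (sq x)^-1 * x 0 b)//.
  by rewrite /cst -mulrA [2 * _]mulrC mulfK.
by rewrite -mulrA; apply: is_derive_comp1 => //; exact: kk'.
Unshelve. all: by end_near. Qed.

Implicit Types (df dg : 'I_n -> 'rV[R]_n -> R) (ddf ddg : 'I_n -> 'I_n -> 'rV[R]_n -> R).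

(** The partial derivatives are carried as explicit data, bounded on the cube, so that all products
    in the integral identities are integrable without further hypotheses. *)
Definition C1fun f (df : 'I_n -> 'rV[R]_n -> R) :=
  [/\ bmfun f, forall i, bmfun (df i) &
    forall i x, is_derive x (delta_mx 0 i : 'rV[R]_n) f (df i x)].

Lemma C1funM f df g dg : C1fun f df -> C1fun g dg ->
  C1fun (fun x => f x * g x) (fun i x => df i x * g x + f x * dg i x).
Proof.
move=> [bf bdf Hf] [bg bdg Hg]; split; first exact: bmfunM.
  by move=> i; apply: bmfunD; apply: bmfunM.
by move=> i x; exact: (is_derive_mul (Hf i x) (Hg i x)).
Qed.

Lemma C1funD f df g dg : C1fun f df -> C1fun g dg ->
  C1fun (fun x => f x + g x) (fun i x => df i x + dg i x).
Proof.
move=> [bf bdf Hf] [bg bdg Hg]; split; first exact: bmfunD.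
  by move=> i; apply: bmfunD.
by move=> i x; exact: (is_derive_add (Hf i x) (Hg i x)).
Qed.

Lemma C1funN f df : C1fun f df -> C1fun (fun x => - f x) (fun i x => - df i x).
Proof.
move=> [bf bdf Hf]; split; first exact: bmfunN.
  by move=> i; apply: bmfunN.
by move=> i x; exact: (is_derive_opp (Hf i x)).
Qed.

Lemma C1fun_sum (I : Type) (s : seq I) (f : I -> 'rV[R]_n -> R)
    (df : I -> 'I_n -> 'rV[R]_n -> R) : (forall j, C1fun (f j) (df j)) ->
  C1fun (fun x => \sum_(j <- s) f j x) (fun i x => \sum_(j <- s) df j i x).
Proof.
move=> Cf; split; first by apply: bmfun_sum => j; case: (Cf j).
  by move=> i; apply: bmfun_sum => j; case: (Cf j).
by move=> i x; apply: is_derive_bigsum => j; case: (Cf j).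
Qed.

Lemma C1fun_coord a : C1fun (fun x => x 0 a) (fun i _ => (a == i)%:R).
Proof.
split; first exact: bmfun_coord.
  by move=> i; exact: bmfun_cst.
by move=> i x; exact: is_derive_coord.
Qed.

Lemma Int_by_parts (b : 'I_n) M M' f df : bmfun M -> bmfun M' ->
  (forall x, is_derive x (delta_mx 0 b : 'rV[R]_n) M (M' x)) ->
  (forall x, ~ cube 1 x -> M x = 0) -> (forall x, ~ cube 1 x -> M' x = 0) ->
  C1fun f df ->
  Int (fun x => M x * df b x) = - Int (fun x => M' x * f x).
Proof.
move=> bM bM' dM M0 M'0 [bf bdf Hf].
have L1a : L1 (fun x => M x * df b x) by exact/bm_L1/bmfunM.
have L1b : L1 (fun x => M' x * f x) by exact/bm_L1/bmfunM.
apply/eqP; rewrite -subr_eq0 opprK addrC -IntD//; apply/eqP.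
apply: (@Int_partial0 R n b (fun x => M x * f x)).
- exact: bmfunM.
- by apply: bmfunD; apply: bmfunM.
- by move=> x; exact: (is_derive_mul (dM x) (Hf b x)).
- by move=> x /M0 ->; rewrite mul0r.
- by move=> x xc; rewrite M0// M'0// !mul0r addr0.
Qed.

Lemma continuous_expZ (c t : R) : {for t, continuous (fun s : R => expR (c * s))}.
Proof.
apply: continuous_comp; last exact: continuous_expR.
by apply: cvgM; [exact: cvg_cst|exact: cvg_id].
Qed.

Lemma weight0_expM k c : weight0 k -> weight0 (fun t => k t * expR (c * t)).
Proof. by move=> wk; apply: weight0M => // t _; exact: continuous_expZ. Qed.

Lemma Int_weight_partial k k' b f df : weight1 k k' -> C1fun f df ->
  Int (fun x => k (logr x) * df b x) =
  - Int (fun x => k' (logr x) * expR (- 2 * logr x) * x 0 b * f x).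
Proof.
move=> wk Cf; have [w w' _] := wk; have we := weight0_expM (-2) w'.
apply: (@Int_by_parts b (fun x => k (logr x))
  (fun x => k' (logr x) * expR (- 2 * logr x) * x 0 b)) => //.
- exact: weight_bm.
- by apply: bmfunM; [exact: (weight_bm we)|exact: bmfun_coord].
- by move=> x; exact: is_derive_weight.
- by move=> x xc; exact: weight_supp.
- by move=> x xc; rewrite (weight_supp we xc) mul0r.
Qed.

Lemma Int_weight_xpartial k k' a b f df : weight1 k k' -> C1fun f df ->
  Int (fun x => k (logr x) * (x 0 a * df b x)) =
  - Int (fun x => (k (logr x) * (a == b)%:R +
      k' (logr x) * expR (- 2 * logr x) * (x 0 a * x 0 b)) * f x).
Proof.
move=> wk Cf; have [w w' _] := wk; have we := weight0_expM (-2) w'.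
pose M' (x : 'rV[R]_n) := k (logr x) * (a == b)%:R +
      k' (logr x) * expR (- 2 * logr x) * (x 0 a * x 0 b).
transitivity (Int (fun x => k (logr x) * x 0 a * df b x)).
  by apply: eq_Int => x _; rewrite mulrA.
apply: (@Int_by_parts b (fun x => k (logr x) * x 0 a) M' f df) => //.
- by apply: bmfunM; [exact: weight_bm|exact: bmfun_coord].
- apply: bmfunD; apply: bmfunM.
  + exact: weight_bm.
  + exact: bmfun_cst.
  + exact: (weight_bm we).
  + by apply: bmfunM; exact: bmfun_coord.
- move=> x; have := is_derive_mul (is_derive_weight x b wk) (is_derive_coord x a b).
  by rewrite addrC -!mulrA [x 0 b * x 0 a]mulrC /M' -!mulrA.
- by move=> x xc; rewrite (weight_supp w xc) mul0r.
- by move=> x xc; rewrite /M' (weight_supp w xc) (weight_supp we xc) !mul0r addr0.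
Qed.

(* N is the Euler field x . grad, T a b the rotation field x_a d_b - x_b d_a. *)
Definition Nop (df : 'I_n -> 'rV[R]_n -> R) (x : 'rV[R]_n) := \sum_(a < n) x 0 a * df a x.
Definition Top a b (df : 'I_n -> 'rV[R]_n -> R) (x : 'rV[R]_n) :=
  x 0 a * df b x - x 0 b * df a x.

Lemma bm_Nop df : (forall i, bmfun (df i)) -> bmfun (Nop df).
Proof.
by move=> bdf; apply: bmfun_sum => a; apply: bmfunM => //; exact: bmfun_coord.
Qed.

Lemma bm_Top a b df : (forall i, bmfun (df i)) -> bmfun (Top a b df).
Proof.
move=> bdf; apply: bmfunD; [|apply: bmfunN]; apply: bmfunM => //; exact: bmfun_coord.
Qed.

(** The divergence of the field k(ln |x|) x is n k + k'. *)
Lemma Int_Nop k k' f df : weight1 k k' -> C1fun f df ->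
  Int (fun x => k (logr x) * Nop df x) =
  - Int (fun x => (n%:R * k (logr x) + k' (logr x)) * f x).
Proof.
move=> wk Cf; have [w w' _] := wk; have we := weight0_expM (-2) w'.
have [bf bdf _] := Cf.
transitivity (\sum_(a < n) Int (fun x => k (logr x) * (x 0 a * df a x))).
  rewrite -Int_sum; first by apply: eq_Int => x _; rewrite mulr_sumr.
  move=> a; apply/bm_L1/bmfunM; first exact: weight_bm.
  by apply: bmfunM => //; exact: bmfun_coord.
under eq_bigr do rewrite (Int_weight_xpartial _ _ wk Cf).
rewrite sumrN -Int_sum; last first.
  move=> a; apply/bm_L1/bmfunM => //; apply: bmfunD; apply: bmfunM.
  + exact: weight_bm.
  + exact: bmfun_cst.
  + exact: (weight_bm we).
  + by apply: bmfunM; exact: bmfun_coord.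
congr (- _); apply: eq_Int => x _; rewrite -mulr_suml; congr (_ * _).
under eq_bigr do rewrite eqxx mulr1.
rewrite big_split/= sumr_const card_ord -mulr_sumr mulr_natl; congr (_ + _).
have [->|x0] := eqVneq x 0.
  by rewrite logr0 (weight0_ge0 w')// !mul0r.
rewrite (_ : \sum_(i < n) _ = sq x); last by apply: eq_bigr => i _; rewrite expr2.
by rewrite -mulrA -expR_logr// -expRD mulNr addNr expR0 mulr1.
Qed.

(** A rotation field is divergence free and annihilates radial weights. *)
Lemma Int_Top k k' a b f df : weight1 k k' -> C1fun f df ->
  Int (fun x => k (logr x) * Top a b df x) = 0.
Proof.
move=> wk Cf; have [w w' _] := wk; have we := weight0_expM (-2) w'.
have [bf bdf _] := Cf.
have bkx c d : bmfun (fun x => k (logr x) * (x 0 c * df d x)).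
  apply: bmfunM; first exact: weight_bm.
  by apply: bmfunM => //; exact: bmfun_coord.
transitivity (Int (fun x => k (logr x) * (x 0 a * df b x)) -
    Int (fun x => k (logr x) * (x 0 b * df a x))).
  rewrite -IntN -?IntD//; try exact/bm_L1; last exact/bm_L1/bmfunN.
  by apply: eq_Int => x _; rewrite /Top mulrBr.
rewrite !(Int_weight_xpartial _ _ wk Cf) eq_sym.
apply/eqP; rewrite subr_eq0; apply/eqP; congr (- _); apply: eq_Int => x _.
by rewrite [x 0 b * _]mulrC.
Qed.

Definition C2fun f (df : 'I_n -> 'rV[R]_n -> R)
    (ddf : 'I_n -> 'I_n -> 'rV[R]_n -> R) :=
  [/\ C1fun f df, forall i, C1fun (df i) (ddf i) & forall i j x, ddf i j x = ddf j i x].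

Lemma C1fun_Top a b g dg ddg : C2fun g dg ddg ->
  C1fun (Top a b dg) (fun i x => ((a == i)%:R * dg b x + x 0 a * ddg b i x) -
    ((b == i)%:R * dg a x + x 0 b * ddg a i x)).
Proof.
move=> [_ Cdg _]; apply: C1funD; first exact: C1funM (C1fun_coord a) (Cdg b).
apply: C1funN; exact: C1funM (C1fun_coord b) (Cdg a).
Qed.

Lemma C1fun_Nop g dg ddg : C2fun g dg ddg ->
  C1fun (Nop dg) (fun i x => \sum_(a < n) ((a == i)%:R * dg a x + x 0 a * ddg a i x)).
Proof.
move=> [_ Cdg _]; apply: C1fun_sum => a; exact: C1funM (C1fun_coord a) (Cdg a).
Qed.

(** The Euler field commutes with rotations. On the left is N applied to T g, on the right T applied
    to N g, both spelled out through second derivatives; the symmetry of the Hessian makes them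
    equal. *)
Lemma Nop_Top a b g dg ddg : C2fun g dg ddg ->
  Nop (fun i x => ((a == i)%:R * dg b x + x 0 a * ddg b i x) -
    ((b == i)%:R * dg a x + x 0 b * ddg a i x)) =1
  Top a b (fun i x => \sum_(c < n) ((c == i)%:R * dg c x + x 0 c * ddg c i x)).
Proof.
move=> [_ _ gC] x; rewrite /Nop /Top.
have delta c d (F : 'I_n -> R) : \sum_(i < n) F i * ((c == i)%:R * dg d x) = F c * dg d x.
  rewrite (bigD1 c)//= eqxx mul1r big1 ?addr0// => i /negPf ic.
  by rewrite eq_sym ic mul0r mulr0.
have delta' d : \sum_(c < n) (c == d)%:R * dg c x = dg d x.
  rewrite (bigD1 d)//= eqxx mul1r big1 ?addr0// => i /negPf ->.
  by rewrite mul0r.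
have hess d e : \sum_(i < n) x 0 i * (x 0 d * ddg e i x) = x 0 d * \sum_(i < n) x 0 i * ddg i e x.
  by rewrite mulr_sumr; apply: eq_bigr => i _; rewrite mulrCA gC.
under eq_bigr do rewrite mulrBr !mulrDr.
rewrite big_split/= sumrN !big_split/= !delta !delta' !hess.
by rewrite !mulrDr.
Qed.

(** Since N and T commute, the bracket is N(f T g) - T(f N g); the second term integrates to zero
    and the first produces the divergence of the weighted Euler field. *)
Lemma Int_Nop_Top k k' a b f df ddf g dg ddg : weight1 k k' ->
  C2fun f df ddf -> C2fun g dg ddg ->
  Int (fun x => k (logr x) * (Nop df x * Top a b dg x - Top a b df x * Nop dg x)) =
  - Int (fun x => (n%:R * k (logr x) + k' (logr x)) * (f x * Top a b dg x)).
Proof.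
move=> wk Cf Cg; have [w w' _] := wk.
have [Cdf _ _] := Cf.
have CT := C1funM Cdf (C1fun_Top a b Cg).
have CN := C1funM Cdf (C1fun_Nop Cg).
rewrite -(Int_Nop wk CT) -[RHS]subr0 -[X in _ - X](Int_Top a b wk CN).
have [_ bCT _] := CT; have [_ bCN _] := CN.
rewrite -IntN -?IntD; last first.
- by apply/bm_L1/bmfunM; [exact: weight_bm|exact: bm_Top].
- by apply/bm_L1/bmfunN/bmfunM; [exact: weight_bm|exact: bm_Top].
- by apply/bm_L1/bmfunM; [exact: weight_bm|exact: bm_Nop].
apply: eq_Int => x _; rewrite -mulrBr; congr (_ * _).
have := Nop_Top a b Cg x; rewrite /Nop /Top => E.
under [X in _ = X - _]eq_bigr do rewrite mulrDr.
rewrite big_split/=.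
under [X in _ = _ + X - _]eq_bigr do rewrite mulrCA.
rewrite -mulr_sumr E.
under [X in _ = X + _ - _]eq_bigr do rewrite mulrA.
rewrite -mulr_suml; ring.
Qed.

End radial.

(** * Carleman and Caccioppoli inequalities for smooth functions *)

Section carleman.
Context {R : realType} {n : nat}.
Implicit Types (f g h : 'rV[R]_n -> R) (k : R -> R).
Implicit Types (df dg : 'I_n -> 'rV[R]_n -> R) (ddf ddg : 'I_n -> 'I_n -> 'rV[R]_n -> R).

Lemma is_derive_continuous (g dg : R -> R) (t : R) :
  is_derive t (1 : R) g (dg t) -> {for t, continuous g}.
Proof.
by move=> [Dg _]; apply: differentiable_continuous; exact/derivable1_diffP.
Qed.

Lemma bm_weightM k f : weight0 k -> bmfun f -> bmfun (fun x => k (logr x) * f x).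
Proof. by move=> wk bf; apply: bmfunM => //; exact: weight_bm. Qed.

Definition ip (I : finType) (m : I -> R) (V W : I -> 'rV[R]_n -> R) x :=
  \sum_i m i * (V i x * W i x).

Lemma bm_ip (I : finType) (m : I -> R) (V W : I -> 'rV[R]_n -> R) :
  (forall i, bmfun (V i)) -> (forall i, bmfun (W i)) -> bmfun (ip m V W).
Proof.
move=> bV bW; apply: bmfun_sum => i; apply: bmfunM; first exact: bmfun_cst.
exact: bmfunM.
Qed.

(* The conjugated operator is a difference of an antisymmetric part a (radial)
   and a symmetric part b (tangential), and |a - b|^2 >= - 4 a b. *)
Lemma carleman (I : finType) (m : I -> R) (V NV GV Q : I -> 'rV[R]_n -> R)
    (chi dchi E Psi dPsi : R -> R) :
  (forall i, 0 <= m i) ->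
  (forall i, bmfun (V i)) -> (forall i, bmfun (NV i)) -> (forall i, bmfun (GV i)) ->
  (forall k k', weight1 k k' ->
    2 * Int (fun x => k (logr x) * ip m NV GV x) =
    - Int (fun x => (n%:R * k (logr x) + k' (logr x)) * ip m V GV x)) ->
  (forall k k', weight1 k k' ->
    2 * Int (fun x => k (logr x) * ip m NV V x) =
    - Int (fun x => (n%:R * k (logr x) + k' (logr x)) * ip m V V x)) ->
  weight1 chi dchi ->
  (forall t : R, t < 0 -> 0 <= E t) ->
  (forall t : R, t < 0 -> is_derive t (1 : R) E ((2 * Psi t - n%:R) * E t)) ->
  (forall t : R, t < 0 -> is_derive t (1 : R) Psi (dPsi t)) ->
  (forall t : R, t < 0 -> {for t, continuous dPsi}) ->
  (forall i x, Q i x = NV i x - GV i x) ->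
  Int (fun x => chi (logr x) * chi (logr x) * (E (logr x) * dPsi (logr x)) * ip m V V x) <=
  Int (fun x => chi (logr x) * chi (logr x) * E (logr x) * ip m Q Q x) +
  Int (fun x => dchi (logr x) * dchi (logr x) * E (logr x) * ip m V V x).
Proof.
move=> m0 bV bN bG H1 H2 wc E0 dE dP cP QE.
have cE (t : R) : t < 0 -> {for t, continuous E}.
  by move=> /dE/(@is_derive_continuous E (fun t => (2 * Psi t - n%:R) * E t)).
have cPsi (t : R) : t < 0 -> {for t, continuous Psi}.
  by move=> /dP/(@is_derive_continuous Psi dPsi).
have cEd (t : R) : t < 0 -> {for t, continuous (fun t => (2 * Psi t - n%:R) * E t)}.
  move=> t0; apply: cvgM; last exact: cE.
  apply: cvgB; last exact: cvg_cst.
  by apply: cvgM; [exact: cvg_cst|exact: cPsi].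
have w1 := weight1M (weight1_mul wc wc) dE cEd.
have w2 := weight1M w1 dP cP.
have bQ i : bmfun (Q i).
  rewrite (_ : Q i = (fun x => NV i x - GV i x)); last exact/funext/QE.
  by apply: bmfunD => //; exact: bmfunN.
have [wc0 wdc0 _] := wc.
have wE : weight0 (fun t => chi t * chi t * E t) by case: w1.
have wEd : weight0 (fun t => chi t * chi t * (E t * dPsi t)).
  have [w _ _] := weight1_mul wc wc.
  by apply: weight0M => // t t0; apply: cvgM; [exact: cE|exact: cP].
have wdE : weight0 (fun t => dchi t * dchi t * E t).
  by apply: weight0M => //; apply: weight0M => // t _; exact: wdc0.1.
have i1 := bm_L1 (bm_weightM wEd (bm_ip m bV bV)).
have i2 := bm_L1 (bm_weightM wE (bm_ip m bQ bQ)).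
have i3 := bm_L1 (bm_weightM wdE (bm_ip m bV bV)).
have [k1 k1' _] := w1.
have [k2 k2' _] := w2.
have i4 := bm_L1 (bm_weightM k1 (bm_ip m bN bG)).
have i5 := bm_L1 (bm_weightM (weight0D (weight0Z n%:R k1) k1') (bm_ip m bV bG)).
have i6 := bm_L1 (bm_weightM k2 (bm_ip m bN bV)).
have i7 := bm_L1 (bm_weightM (weight0D (weight0Z n%:R k2) k2') (bm_ip m bV bV)).
have := H1 _ _ w1; have := H2 _ _ w2.
set F1 := (X in Int X <= _); set F2 := (X in _ <= Int X + _); set F3 := (X in _ <= _ + Int X).
set F6 := (X in 2 * Int X = _ -> _); set F7 := (X in _ = - Int X -> _) => E67.
set F4 := (X in 2 * Int X = _ -> _); set F5 := (X in _ = - Int X -> _) => E45.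
have : 0 <= Int (fun x => F2 x + F3 x + (-1) * F1 x + (2 * F4 x + F5 x) + (2 * F6 x + F7 x)).
  apply: Int_ge0 => x _; rewrite /F1 /F2 /F3 /F4 /F5 /F6 /F7.
  have [t0|t0] := ltP (logr x) 0; last first.
    by rewrite (weight0_ge0 wc0 t0) (weight0_ge0 wdc0 t0) !(mul0r, mulr0, addr0).
  have Et := E0 _ t0.
  set c := chi _; set c' := dchi _; set e := E _ in Et *; set p := Psi _; set p' := dPsi _.
  rewrite /ip !mulr_sumr -!big_split/=; apply: sumr_ge0 => i _.
  rewrite QE; set v := V i x; set N := NV i x; set G := GV i x.
  (* Put a = c N + (c' + p c) v and b = c (G + p v), so that a - b = c (N - G) + c' v. The sum of
     the squares of c (N - G) and c' v is half the sum of the squares of their difference and of a -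
     b, and (a - b)^2 = (a + b)^2 - 4 a b. The two integrations by parts evaluate the integral of a
     b; the remaining squares are on the right. *)
  suff -> : c * c * e * (m i * ((N - G) * (N - G))) + c' * c' * e * (m i * (v * v)) +
    -1 * (c * c * (e * p') * (m i * (v * v))) +
   (2 * (c * c * e * (m i * (N * G))) +
   (n%:R * (c * c * e) + ((c' * c + c * c') * e + c * c * ((2 * p - n%:R) * e))) *
   (m i * (v * G))) +
   (2 * (c * c * e * p * (m i * (N * v))) +
   (n%:R * (c * c * e * p) +
    (((c' * c + c * c') * e + c * c * ((2 * p - n%:R) * e)) * p + c * c * e * p')) *
   (m i * (v * v))) =
   m i * (e * (2^-1 * (c * (N - G) - c' * v) ^+ 2 +
      2^-1 * (c * (N + G) + (c' + 2 * p * c) * v) ^+ 2)).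
    by rewrite !mulr_ge0// addr_ge0// mulr_ge0// sqr_ge0.
  by field.
rewrite !IntD ?IntZ //; try by repeat first [assumption | apply: L1D | apply: L1Z].
by move: E67 E45; lra.
Qed.

Lemma lagrange_identity (a b : 'I_n -> R) :
  \sum_i \sum_j (a i * b j - a j * b i) ^+ 2 =
  2 * ((\sum_i a i ^+ 2) * (\sum_i b i ^+ 2)) - 2 * (\sum_i a i * b i) ^+ 2.
Proof.
have E i j : (a i * b j - a j * b i) ^+ 2 =
    a i ^+ 2 * b j ^+ 2 + b i ^+ 2 * a j ^+ 2 + (- 2 * (a i * b i)) * (a j * b j).
  by ring.
under eq_bigr do under eq_bigr do rewrite E.
under eq_bigr do rewrite !big_split/= -!mulr_sumr.
rewrite !big_split/= -!mulr_suml -mulr_sumr; ring.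
Qed.

Lemma cauchy_schwarz_sum (a b : 'I_n -> R) :
  (\sum_i a i * b i) ^+ 2 <= (\sum_i a i ^+ 2) * (\sum_i b i ^+ 2).
Proof.
have := lagrange_identity a b.
have : 0 <= \sum_i \sum_j (a i * b j - a j * b i) ^+ 2.
  by apply: sumr_ge0 => i _; apply: sumr_ge0 => j _; exact: sqr_ge0.
lra.
Qed.

Lemma Int_weight_norm (I : finType) (m : I -> R) (V : I -> 'rV[R]_n -> R)
    (dV : I -> 'I_n -> 'rV[R]_n -> R) k k' :
  (forall i, C1fun (V i) (dV i)) -> weight1 k k' ->
  2 * Int (fun x => k (logr x) * ip m (fun i => Nop (dV i)) V x) =
  - Int (fun x => (n%:R * k (logr x) + k' (logr x)) * ip m V V x).
Proof.
move=> CV wk; have [w w' _] := wk.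
have bV i : bmfun (V i) by case: (CV i).
have bN i : bmfun (Nop (dV i)) by apply: bm_Nop; case: (CV i).
have wn := weight0D (weight0Z n%:R w) w'.
rewrite -IntZ; last exact/bm_L1/bm_weightM/bm_ip.
transitivity (\sum_i m i * Int (fun x => k (logr x) *
    Nop (fun a x => dV i a x * V i x + V i x * dV i a x) x)).
  have bc i : bmfun (Nop (fun a x => dV i a x * V i x + V i x * dV i a x)).
    apply: bm_Nop => a; have [bv bdv _] := CV i.
    by apply: bmfunD; apply: bmfunM.
  have iL i := bm_L1 (bm_weightM w (bc i)).
  under eq_bigr do rewrite -(IntZ _ (iL _)).
  rewrite -Int_sum; last by move=> i; apply/L1Z/bm_L1/bm_weightM.
  apply: eq_Int => x _; rewrite /ip !mulr_sumr; apply: eq_bigr => i _.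
  have -> : Nop (fun a x => dV i a x * V i x + V i x * dV i a x) x =
      2 * (Nop (dV i) x * V i x).
    by rewrite /Nop mulr_suml mulr_sumr; apply: eq_bigr => a _; ring.
  by ring.
under eq_bigr do rewrite (Int_Nop wk (C1funM (CV _) (CV _))) mulrN.
rewrite sumrN; congr (- _).
have iL i := bm_L1 (bm_weightM wn (bmfunM (bV i) (bV i))).
under eq_bigr do rewrite -(IntZ _ (iL _)).
rewrite -Int_sum; last by move=> i; apply/L1Z/bm_L1/(bm_weightM wn)/bmfunM.
apply: eq_Int => x _; rewrite /ip mulr_sumr; apply: eq_bigr => i _; ring.
Qed.

Lemma Int_Nop_Top_sum (J : finType) (a b : J -> 'I_n)
    (f g : J -> 'rV[R]_n -> R) (df dg : J -> 'I_n -> 'rV[R]_n -> R)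
    (ddf ddg : J -> 'I_n -> 'I_n -> 'rV[R]_n -> R) k k' :
  (forall j, C2fun (f j) (df j) (ddf j)) -> (forall j, C2fun (g j) (dg j) (ddg j)) ->
  weight1 k k' ->
  Int (fun x => k (logr x) * \sum_j (Nop (df j) x * Top (a j) (b j) (dg j) x -
       Top (a j) (b j) (df j) x * Nop (dg j) x)) =
  - Int (fun x => (n%:R * k (logr x) + k' (logr x)) *
       \sum_j f j x * Top (a j) (b j) (dg j) x).
Proof.
move=> Cf Cg wk; have [w w' _] := wk.
have wn := weight0D (weight0Z n%:R w) w'.
have bf j : bmfun (f j) by have [[]] := Cf j.
have bdf j i : bmfun (df j i) by have [[]] := Cf j.
have bdg j i : bmfun (dg j i) by have [[]] := Cg j.
transitivity (\sum_j Int (fun x => k (logr x) * (Nop (df j) x * Top (a j) (b j) (dg j) x -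
       Top (a j) (b j) (df j) x * Nop (dg j) x))).
  rewrite -Int_sum; first by apply: eq_Int => x _; rewrite mulr_sumr.
  move=> j; apply/bm_L1/bm_weightM => //; apply: bmfunD; last apply: bmfunN.
    by apply: bmfunM; [exact: bm_Nop|exact: bm_Top].
  by apply: bmfunM; [exact: bm_Top|exact: bm_Nop].
under eq_bigr do rewrite (Int_Nop_Top _ _ wk (Cf _) (Cg _)).
rewrite sumrN; congr (- _); rewrite -Int_sum.
  by apply: eq_Int => x _; rewrite mulr_sumr.
by move=> j; apply/bm_L1/(bm_weightM wn)/bmfunM => //; exact: bm_Top.
Qed.

(** * The div-curl system for the velocity *)

Section velocity.
Variables (u : 'I_n -> 'rV[R]_n -> R) (du : 'I_n -> 'I_n -> 'rV[R]_n -> R)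
  (ddu : 'I_n -> 'I_n -> 'I_n -> 'rV[R]_n -> R).
Hypothesis Cu : forall j, C2fun (u j) (du j) (ddu j).

Let GV j x := \sum_i Top i j (du i) x.

Let bu j : bmfun (u j). Proof. by have [[]] := Cu j. Qed.
Let bdu j i : bmfun (du j i). Proof. by have [[]] := Cu j. Qed.
Let bG j : bmfun (GV j).
Proof. by apply: bmfun_sum => i; exact: bm_Top. Qed.

Lemma TopC a b df x : Top b a df x = - Top a b df x :> R.
Proof. by rewrite /Top opprB. Qed.

(** The rotation fields form an antisymmetric matrix of antisymmetric operators, so the tangential
    operator [GV] is symmetric; it also commutes with N. In the double sum every pair of indices
    contributes twice, whence the factor 2. *)
Let velocity_sym k k' : weight1 k k' ->
  2 * Int (fun x => k (logr x) * ip (fun=> 1) (fun j => Nop (du j)) GV x) =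
  - Int (fun x => (n%:R * k (logr x) + k' (logr x)) * ip (fun=> 1) u GV x).
Proof.
move=> wk; have [w w' _] := wk.
rewrite -IntZ; last by apply/bm_L1/bm_weightM/bm_ip => // i; exact: bm_Nop.
have := Int_Nop_Top_sum (fun q : 'I_n * 'I_n => q.2) (fun q => q.1)
  (fun q => Cu q.1) (fun q => Cu q.2) wk.
set l := Int _; set r := Int _ => lr.
have -> : Int (fun x => (n%:R * k (logr x) + k' (logr x)) * ip (fun=> 1) u GV x) = r.
  apply: eq_Int => x _; congr (_ * _).
  rewrite -(pair_bigA _ (fun j i => u j x * Top i j (du i) x))/=.
  by apply: eq_bigr => j _; rewrite mul1r mulr_sumr.
rewrite -lr; apply: eq_Int => x _; rewrite mulrCA; congr (_ * _).
rewrite -(pair_bigA _ (fun j i => Nop (du j) x * Top i j (du i) x -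
  Top i j (du j) x * Nop (du i) x))/=.
under [RHS]eq_bigr do rewrite big_split/=.
rewrite big_split/= [X in _ = _ + X]exchange_big/= /ip mulr_natl mulr2n.
congr (_ + _); apply: eq_bigr => j _; rewrite mul1r mulr_sumr.
  by [].
by apply: eq_bigr => i _; rewrite (TopC i j) mulNr opprK mulrC.
Qed.

(** The combination [Q] of curl and divergence is exactly the radial derivative minus the tangential
    operator. Where the divergence vanishes, Cauchy-Schwarz bounds its square by |x|^2 times the
    square of the curl. *)
Lemma carleman_velocity (chi dchi E Psi dPsi : R -> R) :
  weight1 chi dchi ->
  (forall t : R, t < 0 -> 0 <= E t) ->
  (forall t : R, t < 0 -> is_derive t (1 : R) E ((2 * Psi t - n%:R) * E t)) ->
  (forall t : R, t < 0 -> is_derive t (1 : R) Psi (dPsi t)) ->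
  (forall t : R, t < 0 -> {for t, continuous dPsi}) ->
  (forall x, chi (logr x) != 0 -> \sum_i du i i x = 0) ->
  Int (fun x => chi (logr x) * chi (logr x) * (E (logr x) * dPsi (logr x)) *
    \sum_j u j x ^+ 2) <=
  Int (fun x => chi (logr x) * chi (logr x) * E (logr x) *
    (sq x * \sum_i \sum_j (du j i x - du i j x) ^+ 2)) +
  Int (fun x => dchi (logr x) * dchi (logr x) * E (logr x) * \sum_j u j x ^+ 2).
Proof.
move=> wc E0 dE dP cP div0.
pose Q j (x : 'rV[R]_n) := \sum_i x 0 i * (du j i x - du i j x) + x 0 j * \sum_i du i i x.
have QE j x : Q j x = Nop (du j) x - GV j x.
  rewrite /Q /Nop /GV /Top mulr_sumr -big_split/= -sumrB.
  by apply: eq_bigr => i _; ring.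
have ipE V (x : 'rV[R]_n) : ip (fun=> 1) V V x = \sum_j V j x ^+ 2.
  by apply: eq_bigr => j _; rewrite mul1r expr2.
have bQ j : bmfun (Q j).
  apply: bmfunD.
    apply: bmfun_sum => i; apply: bmfunM; first exact: bmfun_coord.
    by apply: bmfunD => //; exact: bmfunN.
  by apply: bmfunM; [exact: bmfun_coord|exact: bmfun_sum].
have cE (t : R) : t < 0 -> {for t, continuous E}.
  by move=> /dE/(@is_derive_continuous E (fun t => (2 * Psi t - n%:R) * E t)).
have [wc0 wdc _] := wc.
have wE : weight0 (fun t => chi t * chi t * E t).
  by apply: weight0M => //; apply: weight0M => // t _; exact: wc0.1.
have bsq : bmfun (@sq R n).
  by apply: bmfun_sum => i; apply: bmfunX; exact: bmfun_coord.
have := @carleman _ (fun=> 1) u (fun j => Nop (du j)) GV Q chi dchi E Psi dPsi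
  (fun=> ler01) bu (fun j => bm_Nop (bdu j)) bG velocity_sym
  (fun k k' => Int_weight_norm _ (fun j => let: And3 C _ _ := Cu j in C))
  wc E0 dE dP cP QE.
have -> : ip (fun=> 1) u u = (fun x => \sum_j u j x ^+ 2) by apply/funext.
move=> /le_trans; apply; rewrite lerD2r; apply: le_Int.
- by apply/bm_L1/(bm_weightM wE)/bm_ip.
- apply/bm_L1/(bm_weightM wE)/bmfunM => //; apply: bmfun_sum => i.
  apply: bmfun_sum => j; apply: bmfunX; apply: bmfunD => //; exact: bmfunN.
move=> x _; have [t0|t0] := ltP (logr x) 0; last first.
  by rewrite (weight0_ge0 wc0 t0) !mul0r.
have [->|c0] := eqVneq (chi (logr x)) 0; first by rewrite !mul0r.
apply: ler_wpM2l; first by rewrite mulr_ge0 ?E0// -expr2 sqr_ge0.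
rewrite ipE [X in _ <= _ * X]exchange_big/= mulr_sumr; apply: ler_sum => j _.
by rewrite /Q div0// mulr0 addr0; exact: cauchy_schwarz_sum.
Qed.

End velocity.

(** Both halves of the antisymmetrized inner sum pair equally with an antisymmetric M. *)
Lemma antisym_contract (M P : 'I_n -> 'I_n -> R) (W : 'I_n -> 'I_n -> 'I_n -> 'I_n -> R) :
  (forall i j, M j i = - M i j) ->
  \sum_i \sum_j M i j * (- P i j + \sum_k (W k i k j - W k j k i)) =
  - (\sum_i \sum_j M i j * P i j) + 2 * \sum_i \sum_j \sum_k M i j * W k i k j.
Proof.
move=> MA.
have E : \sum_i \sum_j M i j * (\sum_k W k j k i) =
    - \sum_i \sum_j \sum_k M i j * W k i k j.
  rewrite exchange_big/= -sumrN; apply: eq_bigr => i _.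
  rewrite -sumrN; apply: eq_bigr => j _.
  by rewrite MA mulNr mulr_sumr.
under eq_bigr do under eq_bigr do rewrite sumrB mulrDr mulrBr mulrN.
under eq_bigr do rewrite big_split/= sumrB sumrN.
rewrite big_split/= sumrB sumrN E opprK; congr (_ + _).
rewrite mulr_natl mulr2n; congr (_ + _); apply: eq_bigr => i _.
by apply: eq_bigr => j _; rewrite mulr_sumr.
Qed.

Lemma Int_lin3 f g h : L1 f -> L1 g -> L1 h ->
  Int f - Int g + 2 * Int h = Int (fun x => f x - g x + 2 * h x).
Proof.
move=> Lf Lg Lh; rewrite IntD ?IntD ?IntN ?IntZ//; first exact: L1N.
  by apply: L1D => //; exact: L1N.
exact: L1Z.
Qed.

(** * The Hodge-Dirac system for pressure and vorticity *)

Section pressure_vorticity.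
Variables (p : 'rV[R]_n -> R) (dp : 'I_n -> 'rV[R]_n -> R)
  (ddp : 'I_n -> 'I_n -> 'rV[R]_n -> R).
Variables (w : 'I_n -> 'I_n -> 'rV[R]_n -> R)
  (dw : 'I_n -> 'I_n -> 'I_n -> 'rV[R]_n -> R)
  (ddw : 'I_n -> 'I_n -> 'I_n -> 'I_n -> 'rV[R]_n -> R).
Hypothesis Cp : C2fun p dp ddp.
Hypothesis Cw : forall i j, C2fun (w i j) (dw i j) (ddw i j).
Hypothesis wA : forall i j x, w j i x = - w i j x.
Hypothesis dwA : forall i j a x, dw j i a x = - dw i j a x.
Hypothesis w_closed : forall (i j k : 'I_n) x, dw i j k x + dw j k i x + dw k i j x = 0.

Local Notation I := ('I_1 + 'I_n * 'I_n)%type.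
(** The unknown is the 0-form p together with the 2-form w. The double sum counts every component of
    w twice, so p receives weight 2; only then is the tangential operator symmetric. *)
Let m (al : I) : R := if al is inl _ then 2 else 1.
Let pw (f0 : 'rV[R]_n -> R) (f : 'I_n -> 'I_n -> 'rV[R]_n -> R) (al : I) :=
  match al with inl _ => f0 | inr q => f q.1 q.2 end.

Let ip_pw v0 v z0 z (x : 'rV[R]_n) : ip m (pw v0 v) (pw z0 z) x =
  2 * (v0 x * z0 x) + \sum_i \sum_j v i j x * z i j x.
Proof.
rewrite /ip big_sumType/= big_ord1 pair_bigA/=; congr (_ + _).
by apply: eq_bigr => q _; rewrite mul1r.
Qed.

Let G0 (x : 'rV[R]_n) := 2^-1 * \sum_i \sum_j Top i j (dw i j) x.
Let G i j (x : 'rV[R]_n) := - Top i j dp x + \sum_k (Top k i (dw k j) x - Top k j (dw k i) x).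

Let bp : bmfun p. Proof. by have [[]] := Cp. Qed.
Let bdp i : bmfun (dp i). Proof. by have [[]] := Cp. Qed.
Let bw i j : bmfun (w i j). Proof. by have [[]] := Cw i j. Qed.
Let bdw i j a : bmfun (dw i j a). Proof. by have [[]] := Cw i j. Qed.

Let bG0 : bmfun G0.
Proof.
apply: bmfunM; first exact: bmfun_cst.
by apply: bmfun_sum => i; apply: bmfun_sum => j; exact: bm_Top.
Qed.

Let bG i j : bmfun (G i j).
Proof.
apply: bmfunD; first by apply: bmfunN; exact: bm_Top.
apply: bmfun_sum => k; apply: bmfunD; last apply: bmfunN; exact: bm_Top.
Qed.

Let bpw v0 v : bmfun v0 -> (forall i j, bmfun (v i j)) -> forall al, bmfun (pw v0 v al).
Proof. by move=> b0 b [?|[i j]] /=. Qed.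

(** The pairing splits into p against w, w against p, and w against w. The first two enter with
    opposite signs, the third twice, and each is an instance of [Int_Nop_Top_sum]. *)
Let pw_sym k k' : weight1 k k' ->
  2 * Int (fun x => k (logr x) * ip m (pw (Nop dp) (fun i j => Nop (dw i j))) (pw G0 G) x) =
  - Int (fun x => (n%:R * k (logr x) + k' (logr x)) * ip m (pw p w) (pw G0 G) x).
Proof.
move=> wk; have [wk0 wk0' _] := wk.
have wn := weight0D (weight0Z n%:R wk0) wk0'.
have := Int_Nop_Top_sum (fun q : 'I_n * 'I_n => q.1) (fun q => q.2)
  (fun q => Cp) (fun q => Cw q.1 q.2) wk.
have := Int_Nop_Top_sum (fun q : 'I_n * 'I_n => q.1) (fun q => q.2)
  (fun q => Cw q.1 q.2) (fun q => Cp) wk.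
have := Int_Nop_Top_sum (fun q : 'I_n * 'I_n * 'I_n => q.2) (fun q => q.1.1)
  (fun q => Cw q.1.1 q.1.2) (fun q => Cw q.2 q.1.2) wk.
set l3 := (fun x => k (logr x) * _); set r3 := (fun x => (_ + _) * _) => E3.
set l2 := (fun x => k (logr x) * _); set r2 := (fun x => (_ + _) * _) => E2.
set l1 := (fun x => k (logr x) * _); set r1 := (fun x => (_ + _) * _) => E1.
have b3 q : bmfun (fun x => Nop (dw q.1.1 q.1.2) x * Top q.2 q.1.1 (dw q.2 q.1.2) x -
    Top q.2 q.1.1 (dw q.1.1 q.1.2) x * Nop (dw q.2 q.1.2) x).
  by apply: bmfunD; last apply: bmfunN; apply: bmfunM; try exact: bm_Nop; exact: bm_Top.
have b2 q : bmfun (fun x => Nop (dw q.1 q.2) x * Top q.1 q.2 dp x -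
    Top q.1 q.2 (dw q.1 q.2) x * Nop dp x).
  by apply: bmfunD; last apply: bmfunN; apply: bmfunM; try exact: bm_Nop; exact: bm_Top.
have b1 q : bmfun (fun x => Nop dp x * Top q.1 q.2 (dw q.1 q.2) x -
    Top q.1 q.2 dp x * Nop (dw q.1 q.2) x).
  by apply: bmfunD; last apply: bmfunN; apply: bmfunM; try exact: bm_Nop; exact: bm_Top.
have c3 q : bmfun (fun x => w q.1.1 q.1.2 x * Top q.2 q.1.1 (dw q.2 q.1.2) x).
  by apply: bmfunM => //; exact: bm_Top.
have c2 q : bmfun (fun x => w q.1 q.2 x * Top q.1 q.2 dp x).
  by apply: bmfunM => //; exact: bm_Top.
have c1 q : bmfun (fun x => p x * Top q.1 q.2 (dw q.1 q.2) x).
  by apply: bmfunM => //; exact: bm_Top.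
have L3 : L1 l3 := bm_L1 (bm_weightM wk0 (bmfun_sum _ b3)).
have L2 : L1 l2 := bm_L1 (bm_weightM wk0 (bmfun_sum _ b2)).
have Ll1 : L1 l1 := bm_L1 (bm_weightM wk0 (bmfun_sum _ b1)).
have M3 : L1 r3 := bm_L1 (bm_weightM wn (bmfun_sum _ c3)).
have M2 : L1 r2 := bm_L1 (bm_weightM wn (bmfun_sum _ c2)).
have M1 : L1 r1 := bm_L1 (bm_weightM wn (bmfun_sum _ c1)).
have -> : Int (fun x => (n%:R * k (logr x) + k' (logr x)) * ip m (pw p w) (pw G0 G) x) =
    Int r1 - Int r2 + 2 * Int r3.
  rewrite Int_lin3//.
  apply: eq_Int => x _; rewrite ip_pw /G.
  rewrite (@antisym_contract (fun i j => w i j x) (fun i j => Top i j dp x)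
    (fun a b c d => Top a b (dw c d) x) (fun i j => wA i j x)).
  rewrite /r1 /r2 /r3 /G0 -mulr_sumr.
  rewrite -(pair_bigA _ (fun i j => Top i j (dw i j) x))/=.
  rewrite -(pair_bigA _ (fun i j => w i j x * Top i j dp x))/=.
  rewrite -(pair_bigA _ (fun (q : 'I_n * 'I_n) r => w q.1 q.2 x * Top r q.1 (dw r q.2) x))/=.
  rewrite -(pair_bigA _ (fun i j => \sum_r w i j x * Top r i (dw r j) x))/=.
  by field.
have -> : 2 * Int (fun x => k (logr x) * ip m (pw (Nop dp) (fun i j => Nop (dw i j))) (pw G0 G) x) =
    Int l1 - Int l2 + 2 * Int l3; last by rewrite E1 E2 E3; ring.
rewrite -IntZ; last first.
  by apply/bm_L1/bm_weightM/bm_ip => // i; apply: bpw => // *; exact: bm_Nop.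
rewrite Int_lin3//.
apply: eq_Int => x _; rewrite ip_pw /G.
have NA i j : Nop (dw j i) x = - Nop (dw i j) x.
  by rewrite /Nop -sumrN; apply: eq_bigr => a _; rewrite dwA mulrN.
rewrite (@antisym_contract (fun i j => Nop (dw i j) x) (fun i j => Top i j dp x)
    (fun a b c d => Top a b (dw c d) x) NA).
rewrite /l1 /l2 /l3 /G0.
rewrite -(pair_bigA _ (fun i j => Nop dp x * Top i j (dw i j) x - Top i j dp x * Nop (dw i j) x))/=.
rewrite -(pair_bigA _ (fun i j => Nop (dw i j) x * Top i j dp x - Top i j (dw i j) x * Nop dp x))/=.
rewrite -(pair_bigA _ (fun (q : 'I_n * 'I_n) r => Nop (dw q.1 q.2) x * Top r q.1 (dw r q.2) x -
  Top r q.1 (dw q.1 q.2) x * Nop (dw r q.2) x))/=.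
rewrite -(pair_bigA _ (fun i j => \sum_r (Nop (dw i j) x * Top r i (dw r j) x -
  Top r i (dw i j) x * Nop (dw r j) x)))/=.
have -> : \sum_i \sum_j (Nop dp x * Top i j (dw i j) x - Top i j dp x * Nop (dw i j) x) =
    Nop dp x * (\sum_i \sum_j Top i j (dw i j) x) - \sum_i \sum_j Nop (dw i j) x * Top i j dp x.
  rewrite mulr_sumr -sumrB; apply: eq_bigr => i _; rewrite mulr_sumr -sumrB.
  by apply: eq_bigr => j _; rewrite [Top i j dp x * _]mulrC.
have -> : \sum_i \sum_j (Nop (dw i j) x * Top i j dp x - Top i j (dw i j) x * Nop dp x) =
    \sum_i \sum_j Nop (dw i j) x * Top i j dp x - Nop dp x * (\sum_i \sum_j Top i j (dw i j) x).
  rewrite mulr_sumr -sumrB; apply: eq_bigr => i _; rewrite mulr_sumr -sumrB.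
  by apply: eq_bigr => j _; rewrite [Nop dp x * _]mulrC.
have -> : \sum_i \sum_j \sum_r (Nop (dw i j) x * Top r i (dw r j) x -
      Top r i (dw i j) x * Nop (dw r j) x) =
    2 * \sum_i \sum_j \sum_r Nop (dw i j) x * Top r i (dw r j) x.
  under eq_bigr do under eq_bigr do rewrite sumrB.
  under eq_bigr do rewrite sumrB.
  rewrite sumrB mulr_natl mulr2n; congr (_ + _).
  under eq_bigr do rewrite exchange_big/=.
  rewrite exchange_big/= -sumrN; apply: eq_bigr => i _; rewrite exchange_big/=.
  rewrite -sumrN; apply: eq_bigr => j _; rewrite -sumrN; apply: eq_bigr => r _.
  by rewrite (TopC r i) mulNr opprK mulrC.
by field.
Qed.

Let F j (x : 'rV[R]_n) := \sum_i dw i j i x + dp j x.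

Lemma carleman_pressure (chi dchi E Psi dPsi : R -> R) :
  weight1 chi dchi ->
  (forall t : R, t < 0 -> 0 <= E t) ->
  (forall t : R, t < 0 -> is_derive t (1 : R) E ((2 * Psi t - n%:R) * E t)) ->
  (forall t : R, t < 0 -> is_derive t (1 : R) Psi (dPsi t)) ->
  (forall t : R, t < 0 -> {for t, continuous dPsi}) ->
  Int (fun x => chi (logr x) * chi (logr x) * (E (logr x) * dPsi (logr x)) *
    (2 * p x ^+ 2 + \sum_i \sum_j w i j x ^+ 2)) <=
  Int (fun x => chi (logr x) * chi (logr x) * E (logr x) *
    (2 * (sq x * \sum_j F j x ^+ 2))) +
  Int (fun x => dchi (logr x) * dchi (logr x) * E (logr x) *
    (2 * p x ^+ 2 + \sum_i \sum_j w i j x ^+ 2)).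
Proof.
move=> wc E0 dE dP cP.
pose Q0 (x : 'rV[R]_n) := \sum_j x 0 j * F j x.
pose Q i j (x : 'rV[R]_n) := x 0 i * F j x - x 0 j * F i x.
have QE al x : pw Q0 Q al x = pw (Nop dp) (fun i j => Nop (dw i j)) al x - pw G0 G al x.
  case: al => [a|[i j]] /=.
    rewrite /Q0 /F /G0 /Nop.
    have -> : \sum_i \sum_j Top i j (dw i j) x =
        - (2 * \sum_j x 0 j * \sum_i dw i j i x).
      rewrite (_ : \sum_i _ = \sum_i \sum_j x 0 i * dw i j j x -
        \sum_i \sum_j x 0 j * dw i j i x); last first.
        by rewrite -sumrB; apply: eq_bigr => i _; rewrite -sumrB.
      rewrite [X in _ - X]exchange_big/= mulr_natl mulr2n opprD; congr (_ + _).
        rewrite -sumrN; apply: eq_bigr => i _; rewrite mulr_sumr -sumrN.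
        by apply: eq_bigr => j _; rewrite dwA mulrN.
      by congr (- _); apply: eq_bigr => i _; rewrite mulr_sumr.
    under eq_bigr do rewrite mulrDr.
    by rewrite big_split/=; field.
  rewrite /Q /F /G /Nop /Top.
  have -> : \sum_k (x 0 k * dw k j i x - x 0 i * dw k j k x -
      (x 0 k * dw k i j x - x 0 j * dw k i k x)) =
      \sum_k x 0 k * dw i j k x - x 0 i * \sum_k dw k j k x + x 0 j * \sum_k dw k i k x.
    rewrite !mulr_sumr -sumrB -big_split/=; apply: eq_bigr => k _.
    (* Closedness converts the two rotated derivatives of w into the Euler derivative of w i j. *)
    have := w_closed i j k x; rewrite (dwA k j).
    move=> /eqP; rewrite addrAC subr_eq0 => /eqP <-; ring.
  ring.
have bsq : bmfun (@sq R n).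
  by apply: bmfun_sum => i; apply: bmfunX; exact: bmfun_coord.
have := @carleman _ m (pw p w) (pw (Nop dp) (fun i j => Nop (dw i j))) (pw G0 G)
  (pw Q0 Q) chi dchi E Psi dPsi _ _ _ _ pw_sym _ wc E0 dE dP cP QE.
have -> : ip m (pw p w) (pw p w) = (fun x => 2 * p x ^+ 2 + \sum_i \sum_j w i j x ^+ 2).
  by apply/funext => x; rewrite ip_pw.
have -> : ip m (pw Q0 Q) (pw Q0 Q) = (fun x => 2 * (sq x * \sum_j F j x ^+ 2)).
  apply/funext => x; rewrite ip_pw /Q.
  under eq_bigr do under eq_bigr do rewrite -expr2.
  rewrite (lagrange_identity (fun i => x 0 i) (fun j => F j x)) /Q0 /sq; ring.
apply.
- by case=> [a|q]; rewrite /m.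
- exact: bpw.
- by apply: bpw => [|i j]; exact: bm_Nop.
- exact: bpw.
- move=> k k' wk.
  pose dV (al : I) := match al with inl _ => dp | inr q => dw q.1 q.2 end.
  have -> : pw (Nop dp) (fun i j => Nop (dw i j)) = (fun al => Nop (dV al)).
    by apply/funext => -[].
  have CdV al : C1fun (pw p w al) (dV al).
    by case: al => [a|q] /=; [case: Cp|case: (Cw q.1 q.2)].
  have := Int_weight_norm m CdV wk.
  have -> : ip m (pw p w) (pw p w) = (fun x => 2 * p x ^+ 2 + \sum_i \sum_j w i j x ^+ 2).
    by apply/funext => x; rewrite ip_pw.
  by [].
Qed.

End pressure_vorticity.

End carleman.

(** * Caccioppoli inequality for the Stokes system *)

Section caccioppoli.
Context {R : realType} {n : nat}.
Implicit Types (f g h : 'rV[R]_n -> R) (k : R -> R).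

Lemma sqr_sum_lin (a b : 'I_n -> R) (c d : R) :
  \sum_i (c * a i + d * b i) ^+ 2 =
  c ^+ 2 * (\sum_i a i ^+ 2) + 2 * (c * d) * (\sum_i a i * b i) +
  d ^+ 2 * (\sum_i b i ^+ 2).
Proof. by rewrite !mulr_sumr -!big_split/=; apply: eq_bigr => i _; ring. Qed.

Variables (u : 'I_n -> 'rV[R]_n -> R) (du : 'I_n -> 'I_n -> 'rV[R]_n -> R)
  (ddu : 'I_n -> 'I_n -> 'I_n -> 'rV[R]_n -> R).
Variables (p : 'rV[R]_n -> R) (dp : 'I_n -> 'rV[R]_n -> R).
Variable F : 'I_n -> 'rV[R]_n -> R.
Hypothesis Cu : forall j, C2fun (u j) (du j) (ddu j).
Hypothesis Cp : C1fun p dp.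
Hypothesis bF : forall i, bmfun (F i).

(** The equation is tested with eta^2 u; since div u = 0, the pressure survives only against the
    derivative of the cut-off. The drift is split by Young's inequality with a free radial weight
    [gam], chosen later so that the part with F can be absorbed on the left. *)
Lemma caccioppoli (eta deta gam : R -> R) :
  weight1 eta deta ->
  (forall t : R, t < 0 -> {for t, continuous gam}) ->
  (forall t : R, t < 0 -> 0 < gam t) ->
  (forall x, eta (logr x) != 0 -> \sum_i du i i x = 0) ->
  (forall i x, eta (logr x) != 0 -> \sum_a ddu i a a x + F i x + dp i x = 0) ->
  2^-1 * Int (fun x => eta (logr x) * eta (logr x) * \sum_i \sum_a du i a x ^+ 2) <=
  3 * Int (fun x => deta (logr x) * deta (logr x) * expR (- 2 * logr x) *
        \sum_i u i x ^+ 2) +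
  Int (fun x => eta (logr x) * eta (logr x) * p x ^+ 2) +
  2^-1 * Int (fun x => eta (logr x) * eta (logr x) * gam (logr x) * \sum_i F i x ^+ 2) +
  2^-1 * Int (fun x => eta (logr x) * eta (logr x) * (gam (logr x))^-1 *
        \sum_i u i x ^+ 2).
Proof.
move=> we cg g0 div0 eqn.
have [we0 wde0 _] := we.
have bu j : bmfun (u j) by have [[]] := Cu j.
have bdu j i : bmfun (du j i) by have [[]] := Cu j.
have bddu j i a : bmfun (ddu j i a) by have [_ /(_ i)[]] := Cu j.
have bp : bmfun p by case: Cp.
have bdp i : bmfun (dp i) by case: Cp.
have wk := weight1_mul we we; have [wk0 wk1 _] := wk.
have wk1e := weight0_expM (-2) wk1.
have wdd : weight0 (fun t => deta t * deta t).
  by apply: weight0M => // t _; exact: wde0.1.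
have wdde := weight0_expM (-2) wdd.
have wkg : weight0 (fun t => eta t * eta t * gam t) by apply: weight0M.
have wkgv : weight0 (fun t => eta t * eta t * (gam t)^-1).
  apply: weight0M => // t t0; apply: cvgV; last exact: cg.
  by rewrite gt_eqF// g0.
have b1 : bmfun (fun x => \sum_i \sum_a du i a x ^+ 2).
  by apply: bmfun_sum => i; apply: bmfun_sum => a; exact: bmfunX.
have b2 : bmfun (fun x => \sum_i u i x ^+ 2).
  by apply: bmfun_sum => i; exact: bmfunX.
have b3 : bmfun (fun x => \sum_i F i x ^+ 2).
  by apply: bmfun_sum => i; exact: bmfunX.
have b4 : bmfun (fun x => \sum_i \sum_a (du i a x * du i a x + u i x * ddu i a a x)).
  by apply: bmfun_sum => i; apply: bmfun_sum => a; apply: bmfunD; exact: bmfunM.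
have b5 : bmfun (fun x => \sum_i \sum_a x 0 a * (u i x * du i a x)).
  apply: bmfun_sum => i; apply: bmfun_sum => a; apply: bmfunM; first exact: bmfun_coord.
  exact: bmfunM.
have b6 : bmfun (fun x => \sum_i (dp i x * u i x + p x * du i i x)).
  by apply: bmfun_sum => i; apply: bmfunD; exact: bmfunM.
have b7 : bmfun (fun x => \sum_i x 0 i * (p x * u i x)).
  apply: bmfun_sum => i; apply: bmfunM; first exact: bmfun_coord.
  exact: bmfunM.
have I1 : Int (fun x => eta (logr x) * eta (logr x) *
      (\sum_i \sum_a (du i a x * du i a x + u i x * ddu i a a x))) +
    Int (fun x => (deta (logr x) * eta (logr x) + eta (logr x) * deta (logr x)) *
      expR (- 2 * logr x) * \sum_i \sum_a x 0 a * (u i x * du i a x)) = 0.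
  rewrite -IntD; [|exact/bm_L1/(bm_weightM wk0)|exact/bm_L1/(bm_weightM wk1e)].
  pose S q x := eta (logr x) * eta (logr x) *
      (du q.1 q.2 x * du q.1 q.2 x + u q.1 x * ddu q.1 q.2 q.2 x) +
    (deta (logr x) * eta (logr x) + eta (logr x) * deta (logr x)) *
      expR (- 2 * logr x) * (x 0 q.2 * (u q.1 x * du q.1 q.2 x)).
  have iS1 (q : 'I_n * 'I_n) : L1 (fun x => eta (logr x) * eta (logr x) *
      (du q.1 q.2 x * du q.1 q.2 x + u q.1 x * ddu q.1 q.2 q.2 x)).
    by apply/bm_L1/(bm_weightM wk0); apply: bmfunD; exact: bmfunM.
  have iS2 (q : 'I_n * 'I_n) : L1 (fun x => (deta (logr x) * eta (logr x) + eta (logr x) * deta (logr x)) *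
      expR (- 2 * logr x) * (x 0 q.2 * (u q.1 x * du q.1 q.2 x))).
    apply/bm_L1/(bm_weightM wk1e); apply: bmfunM; first exact: bmfun_coord.
    exact: bmfunM.
  transitivity (\sum_q Int (S q)).
    rewrite -Int_sum => [|q]; last exact: L1D.
    apply: eq_Int => x _; rewrite /S.
    rewrite -(pair_bigA _ (fun i a => eta (logr x) * eta (logr x) *
      (du i a x * du i a x + u i x * ddu i a a x) +
    (deta (logr x) * eta (logr x) + eta (logr x) * deta (logr x)) *
      expR (- 2 * logr x) * (x 0 a * (u i x * du i a x))))/=.
    rewrite !mulr_sumr -big_split/=; apply: eq_bigr => i _.
    by rewrite !mulr_sumr -big_split/=.
  apply: big1 => q _; rewrite /S IntD//.
  have [C1u C1du _] := Cu q.1.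
  have := Int_weight_partial q.2 wk (C1funM C1u (C1du q.2)).
  move=> ->; apply/eqP; rewrite addrC subr_eq0; apply/eqP; apply: eq_Int => x _.
  by rewrite !mulrA.
have I2 : Int (fun x => eta (logr x) * eta (logr x) *
      (\sum_i (dp i x * u i x + p x * du i i x))) +
    Int (fun x => (deta (logr x) * eta (logr x) + eta (logr x) * deta (logr x)) *
      expR (- 2 * logr x) * \sum_i x 0 i * (p x * u i x)) = 0.
  rewrite -IntD; [|exact/bm_L1/(bm_weightM wk0)|exact/bm_L1/(bm_weightM wk1e)].
  pose S i x := eta (logr x) * eta (logr x) * (dp i x * u i x + p x * du i i x) +
    (deta (logr x) * eta (logr x) + eta (logr x) * deta (logr x)) *
      expR (- 2 * logr x) * (x 0 i * (p x * u i x)).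
  have iS1 i : L1 (fun x => eta (logr x) * eta (logr x) * (dp i x * u i x + p x * du i i x)).
    by apply/bm_L1/(bm_weightM wk0); apply: bmfunD; exact: bmfunM.
  have iS2 i : L1 (fun x => (deta (logr x) * eta (logr x) + eta (logr x) * deta (logr x)) *
      expR (- 2 * logr x) * (x 0 i * (p x * u i x))).
    apply/bm_L1/(bm_weightM wk1e); apply: bmfunM; first exact: bmfun_coord.
    exact: bmfunM.
  transitivity (\sum_q Int (S q)).
    rewrite -Int_sum => [|q]; last exact: L1D.
    by apply: eq_Int => x _; rewrite /S !mulr_sumr -big_split/=.
  apply: big1 => i _; rewrite /S IntD//.
  have [C1u _ _] := Cu i.
  have := Int_weight_partial i wk (C1funM Cp C1u).
  move=> ->; apply/eqP; rewrite addrC subr_eq0; apply/eqP; apply: eq_Int => x _.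
  by rewrite !mulrA.
move: I1 I2.
set f1 := (X in Int X + _ = _ -> _); set f2 := (X in _ + Int X = _ -> _) => I1.
set f3 := (X in Int X + _ = _ -> _); set f4 := (X in _ + Int X = _ -> _) => I2.
set f5 := (X in _ * Int X <= _); set f6 := (X in _ <= 3 * Int X + _ + _ + _).
set f7 := (X in _ <= _ + Int X + _ + _).
set f8 := (X in _ <= _ + 2^-1 * Int X + _).
set f9 := (X in _ <= _ + 2^-1 * Int X).
have L_1 : L1 f1 := bm_L1 (bm_weightM wk0 b4).
have L_2 : L1 f2 := bm_L1 (bm_weightM wk1e b5).
have L_3 : L1 f3 := bm_L1 (bm_weightM wk0 b6).
have L_4 : L1 f4 := bm_L1 (bm_weightM wk1e b7).
have L_5 : L1 f5 := bm_L1 (bm_weightM wk0 b1).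
have L_6 : L1 f6 := bm_L1 (bm_weightM wdde b2).
have L_7 : L1 f7 := bm_L1 (bm_weightM wk0 (bmfunX 2 bp)).
have L_8 : L1 f8 := bm_L1 (bm_weightM wkg b3).
have L_9 : L1 f9 := bm_L1 (bm_weightM wkgv b2).
have : 0 <= Int (fun x => 3 * f6 x + f7 x + 2^-1 * f8 x + 2^-1 * f9 x + (- 2^-1) * f5 x +
    (f1 x + f2 x) + (f3 x + f4 x)).
  apply: Int_ge0 => x _.
  rewrite /f1 /f2 /f3 /f4 /f5 /f6 /f7 /f8 /f9.
  have [t0|t0] := ltP (logr x) 0; last first.
    by rewrite (weight0_ge0 we0 t0) (weight0_ge0 wde0 t0) !(mul0r, mulr0, addr0).
  have x0 : x != 0 by apply: contraTneq t0 => ->; rewrite logr0 ltxx.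
  have [e0|e0] := eqVneq (eta (logr x)) 0.
    rewrite e0 !(mul0r, mulr0, addr0) mulr_ge0// mulr_ge0//.
      by rewrite mulr_ge0 ?expR_ge0// -expr2 sqr_ge0.
    by apply: sumr_ge0 => i _; exact: sqr_ge0.
  set e := eta _ in e0 *; set d := deta _; set y := gam _.
  have y0 : 0 < y by exact: g0.
  set q := expR _; have q0 : 0 < q by exact: expR_gt0.
  have qs : q * sq x = 1 by rewrite -expR_logr// -expRD mulNr addNr expR0.
  set D2 := \sum_i \sum_a du i a x ^+ 2; set U2 := \sum_i u i x ^+ 2.
  set F2 := \sum_i F i x ^+ 2.
  pose UX := \sum_i Nop (du i) x * u i x; pose X2 := \sum_i Nop (du i) x ^+ 2.
  pose UF := \sum_i F i x * u i x; pose UP := \sum_i u i x * dp i x.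
  pose xu := \sum_i x 0 i * u i x.
  have -> : \sum_i \sum_a (du i a x * du i a x + u i x * ddu i a a x) = D2 - UF - UP.
    rewrite /D2 /UF /UP -!sumrB; apply: eq_bigr => i _.
    rewrite big_split/= -mulr_sumr.
    have /eqP := eqn i x e0; rewrite -addrA addrC addr_eq0 eq_sym => /eqP E.
    rewrite -[X in u i x * X]opprK E.
    by rewrite (_ : \sum_a _ = \sum_a du i a x ^+ 2) ?mulrN ?mulrDr; [ring|].
  have -> : \sum_i \sum_a x 0 a * (u i x * du i a x) = UX.
    apply: eq_bigr => i _; rewrite /Nop mulr_suml; apply: eq_bigr => a _; ring.
  have -> : \sum_i (dp i x * u i x + p x * du i i x) = UP.
    rewrite big_split/= -mulr_sumr div0// mulr0 addr0.
    by apply: eq_bigr => i _; rewrite mulrC.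
  have -> : \sum_i x 0 i * (p x * u i x) = p x * xu.
    by rewrite mulr_sumr; apply: eq_bigr => i _; rewrite mulrCA.
  (* Mixed terms are completed to squares: [S1] for the gradient, [S2] for the pressure, [S3] for
     the drift; [S4] and [S5] are Cauchy-Schwarz. The constant 3 is 2 from half of [S1] plus 1 from
     [S2]. *)
  have S1 : 0 <= q * (e ^+ 2 * X2 + 2 * (e * (2 * d)) * UX + (2 * d) ^+ 2 * U2).
    rewrite mulr_ge0 ?(ltW q0)// -sqr_sum_lin.
    by apply: sumr_ge0 => i _; exact: sqr_ge0.
  have S2 : 0 <= (e * p x + d * q * xu) ^+ 2 by exact: sqr_ge0.
  have S3 : 0 <= e ^+ 2 * (y * F2 - 2 * UF + y^-1 * U2).
    rewrite mulr_ge0 ?sqr_ge0//.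
    have -> : y * F2 - 2 * UF + y^-1 * U2 = y^-1 * (y ^+ 2 * F2 + 2 * (y * -1) * UF + (-1) ^+ 2 * U2).
      by field; rewrite gt_eqF.
    rewrite mulr_ge0 ?invr_ge0 ?(ltW y0)// -sqr_sum_lin.
    by apply: sumr_ge0 => i _; exact: sqr_ge0.
  have XD : X2 <= sq x * D2.
    rewrite /X2 /D2 mulr_sumr; apply: ler_sum => i _; exact: cauchy_schwarz_sum.
  have S4 : 0 <= e ^+ 2 * (D2 - q * X2).
    rewrite mulr_ge0 ?sqr_ge0// subr_ge0.
    by rewrite -[leRHS]mul1r -qs -mulrA ler_wpM2l ?(ltW q0).
  have S5 : 0 <= d ^+ 2 * (q * U2 - q ^+ 2 * xu ^+ 2).
    rewrite mulr_ge0 ?sqr_ge0// subr_ge0 expr2 -mulrA ler_wpM2l ?(ltW q0)//.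
    rewrite -[leRHS]mul1r -qs -mulrA ler_wpM2l ?(ltW q0)//.
    exact: cauchy_schwarz_sum.
  lra.
rewrite !IntD ?IntZ //; try by repeat first [assumption | apply: L1D | apply: L1Z].
by move: I1 I2; lra.
Qed.

End caccioppoli.

(** * Mollification *)

Section bump.
Context {R : realType}.
Implicit Types (P : {poly R}) (k : nat) (t s : R).

(* The family of functions P(t) (1 - t^2)^-k exp(-1/(1 - t^2)), extended by 0
   outside ]-1, 1[, is closed under differentiation. *)
Definition bumpf k P t : R :=
  if t ^+ 2 < 1 then P.[t] * (1 - t ^+ 2)^-1 ^+ k * expR (- (1 - t ^+ 2)^-1)
  else 0.

Definition dbump k P : {poly R} :=
  P^`() * (1 - 'X ^+ 2) ^+ 2 + (2 * k%:R) *: 'X * P * (1 - 'X ^+ 2) - 2 *: 'X * P.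

Lemma is_derive_exp (V : normedModType R) (f : V -> R) (x v : V) (a : R) k :
  is_derive x v f a -> is_derive x v (fun y => f y ^+ k) (k%:R * f x ^+ k.-1 * a).
Proof.
move=> fa; elim: k => [|k IH].
  rewrite !mul0r (_ : (fun _ => _) = cst 1); first exact: is_derive_cst.
  by apply/funext => y; rewrite expr0.
rewrite (_ : (fun _ => _) = (fun y => f y * f y ^+ k)); last first.
  by apply/funext => y; rewrite exprS.
have := is_derive_mul fa IH.
rewrite (_ : a * _ + _ = k.+1%:R * f x ^+ k * a)//.
case: k {IH} => [|k]; first by rewrite !mul0r mulr0 addr0 expr0; ring.
by rewrite /= exprS -[in RHS]natr1; ring.
Qed.

(** A function that vanishes to second order at t has derivative 0 there. This covers the points
    where two formulas are glued together. *)
Lemma is_derive_quad (f g : R -> R) (t : R) : f t = 0 -> {for t, continuous g} ->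
  (forall s, `|f s| <= g s * (s - t) ^+ 2) -> is_derive t (1 : R) f 0.
Proof.
move=> ft0 cg fg.
have H : (fun h : R => h^-1 *: ((f \o shift t) (h *: (1 : R)) - f t)) @ 0^' --> (0 : R).
  apply: norm_cvg0.
  apply: (@squeeze_cvgr _ _ _ _ (cst 0) (fun h : R => g (h + t) * `|h|)).
  - near=> h; rewrite normr_ge0/= ft0 subr0 scaler1 /GRing.scale/= normrM.
    have h0 : h != 0 by near: h; exact: nbhs_dnbhs_neq.
    rewrite normfV ler_pdivrMl ?normr_gt0//.
    rewrite (le_trans (fg _))// addrK -(real_normK (num_real h)) expr2 mulrCA.
    by [].
  - exact: cvg_cst.
  - have : (fun h : R => g (h + t) * `|h|) @ nbhs (0 : R) --> g (0 + t) * `|(0 : R)|.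
      apply: cvgM; last by apply: cvg_norm; exact: cvg_id.
      apply: (@cvg_comp _ _ _ (fun h : R => h + t) g).
        by apply: cvgD; [exact: cvg_id|exact: cvg_cst].
      by rewrite add0r; exact: cg.
    rewrite normr0 mulr0 => H; apply: cvg_trans H; apply: cvg_app; exact: nbhs_dnbhs.
constructor; first by apply/cvg_ex; exists 0.
by rewrite /derive; apply/cvg_lim.
Unshelve. all: by end_near. Qed.

(** With q = 1 - t^2, a single term of the exponential series gives exp(-1/q) <= (k + 2)! q^(k + 2),
    which beats q^-k and leaves q^2. *)
Lemma bumpf_le k P : exists C : R, 0 <= C /\
  forall t, `|bumpf k P t| <= C * (1 - t ^+ 2) ^+ 2.
Proof.
have [M [M0 PM]] : exists M : R, 0 <= M /\ forall t, t ^+ 2 < 1 -> `|P.[t]| <= M.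
  have : compact (horner P @` `[(-1 : R), 1]).
    apply: continuous_compact; last exact: segment_compact.
    exact/continuous_subspaceT/continuous_horner.
  move=> /compact_bounded[N [_ N1x]]; exists (`|N| + 1); split; first by rewrite addr_ge0.
  move=> t t1; apply: N1x; first by rewrite ltr_pwDr// ler_norm.
  exists t => //=; rewrite in_itv/= -ler_norml -(ler_pXn2r (n:=2)) ?nnegrE//.
  by rewrite expr1n real_normK ?num_real// ltW.
exists (M * (k.+2)`!%:R); split; first by rewrite mulr_ge0.
move=> t; rewrite /bumpf; case: ifPn => [t1|_]; last first.
  by rewrite normr0 mulr_ge0 ?sqr_ge0 ?mulr_ge0.
set q := 1 - t ^+ 2; have q0 : 0 < q by rewrite subr_gt0.
rewrite !normrM -!mulrA ler_pM ?PM// ?mulr_ge0//.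
rewrite normrX ger0_norm ?invr_ge0 ?(ltW q0)// ger0_norm ?expR_ge0// expRN.
have := @expR_ge1Dxn R q^-1 k.+1; rewrite invr_ge0 (ltW q0) => /(_ isT) H.
have {}H : (q ^- k.+2) / (k.+2)`!%:R <= expR q^-1.
  by rewrite (le_trans _ H)// -exprVn lerDr.
have F0 : 0 < (k.+2)`!%:R :> R by rewrite ltr0n fact_gt0.
rewrite ler_pdivrMr ?expR_gt0//.
rewrite (le_trans _ (ler_wpM2l _ H))// ?mulr_ge0 ?sqr_ge0 ?(ltW F0)//.
rewrite exprVn le_eqVlt; apply/orP; left; apply/eqP.
have -> : q ^+ k.+2 = q ^+ k * q ^+ 2 by rewrite -exprD addn2.
by field; rewrite expf_neq0 gt_eqF//= gt_eqF.
all: exact: ltW.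
Qed.

Lemma horner_dbump k P t : (dbump k P).[t] =
  P^`().[t] * (1 - t ^+ 2) ^+ 2 + 2 * k%:R * t * P.[t] * (1 - t ^+ 2) - 2 * t * P.[t].
Proof.
by rewrite /dbump !(hornerD, hornerN, hornerM, hornerZ, hornerX, horner_exp, hornerXn, hornerC).
Qed.

Lemma is_derive_bumpf k P t :
  is_derive t (1 : R) (bumpf k P) (bumpf k.+2 (dbump k P) t).
Proof.
have [t1|t1|t1] := ltgtP (t ^+ 2) 1.
- have q0 : 0 < 1 - t ^+ 2 by rewrite subr_gt0.
  have near1 : \forall s \near t, P.[s] * (1 - s ^+ 2)^-1 ^+ k * expR (- (1 - s ^+ 2)^-1) =
      bumpf k P s.
    have : (fun s => s ^+ 2) @ t --> t ^+ 2 by apply: exprn_continuous.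
    move=> /(cvgr_lt _) /(_ _ t1); apply: filterS => s s1.
    by rewrite /bumpf s1.
  apply: (near_eq_is_derive near1).
  have dq : is_derive t (1 : R) (fun s => (1 - s ^+ 2)^-1)
      (- (1 - t ^+ 2) ^- 2 * (- (2 * t))).
    have d2 : is_derive t (1 : R) (fun s => 1 - s ^+ 2) (- (2 * t)).
      have := is_derive_add (is_derive_cst (1 : R) t (1 : R))
        (is_derive_opp (is_derive_exp 2 (is_derive_id t (1 : R)))).
      by rewrite add0r mulr1.
    exact: (@is_deriveV R (fun s => 1 - s ^+ 2) t _ 1 (lt0r_neq0 q0) d2).
  have dqk : is_derive t (1 : R) (fun s => (1 - s ^+ 2)^-1 ^+ k)
      (k%:R * (1 - t ^+ 2)^-1 ^+ k.-1 * (- (1 - t ^+ 2) ^- 2 * (- (2 * t)))).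
    exact: (is_derive_exp k dq).
  have de : is_derive t (1 : R) (fun s => expR (- (1 - s ^+ 2)^-1))
      (expR (- (1 - t ^+ 2)^-1) * - (- (1 - t ^+ 2) ^- 2 * (- (2 * t)))).
    exact: (is_derive_comp1 (is_derive_opp dq) (is_derive_expR _)).
  have := is_derive_mul (is_derive_mul (is_derive_poly P t) dqk) de.
  rewrite /bumpf t1 => H; apply: (is_derive_eq H).
  rewrite horner_dbump; move: q0; set q := 1 - _ => q0.
  case: k {near1 dqk H} => [|k].
    by rewrite !exprS !expr0; field; rewrite gt_eqF.
  rewrite succnK (exprS q^-1 k) (exprS q^-1 k.+2) (exprS q^-1 k.+1) (exprS q^-1 k).
  set A := q^-1 ^+ k.
  by field; rewrite gt_eqF.
- have near1 : \forall s \near t, cst 0 s = bumpf k P s.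
    have : (fun s => s ^+ 2) @ t --> t ^+ 2 by apply: exprn_continuous.
    move=> /(cvgr_gt _) /(_ _ t1); apply: filterS => s s1.
    by rewrite /bumpf ltNge (ltW s1).
  rewrite /bumpf ltNge (ltW t1)/=.
  exact: (near_eq_is_derive near1 (is_derive_cst _ _ _)).
- have [C [C0 fC]] := bumpf_le k P.
  rewrite [X in is_derive _ _ _ X](_ : _ = 0); last by rewrite /bumpf t1 ltxx.
  apply: (@is_derive_quad _ (fun s => C * (s + t) ^+ 2)).
  - by rewrite /bumpf t1 ltxx.
  - apply: cvgM; first exact: cvg_cst.
    apply: (@cvg_comp _ _ _ (fun s => s + t) (fun s => s ^+ 2)).
      by apply: cvgD; [exact: cvg_id|exact: cvg_cst].
    exact: exprn_continuous.
  - move=> s; rewrite (le_trans (fC s))// le_eqVlt; apply/orP; left; apply/eqP.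
    by rewrite -t1; ring.
Qed.

(** The exponent k and the polynomial P that describe the j-th derivative of exp(-1/(1 - t^2)). *)
Fixpoint bump_state j : nat * {poly R} :=
  if j is j'.+1 then ((bump_state j').1.+2, dbump (bump_state j').1 (bump_state j').2)
  else (0%N, 1).

Definition zeta j := bumpf (bump_state j).1 (bump_state j).2.

Lemma is_derive_zeta j t : is_derive t (1 : R) (zeta j) (zeta j.+1 t).
Proof. exact: is_derive_bumpf. Qed.

Lemma zeta_out j t : 1 <= `|t| -> zeta j t = 0.
Proof.
move=> t1; rewrite /zeta /bumpf ifN// -leNgt -(real_normK (num_real t)).
by rewrite -(expr1n _ 2) ler_pXn2r ?nnegrE.
Qed.

Lemma zeta_bounded j : exists C : R, 0 <= C /\ forall t, `|zeta j t| <= C.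
Proof.
have [C [C0 fC]] := bumpf_le (bump_state j).1 (bump_state j).2.
exists C; split => // t; have [t1|t1] := ltP (t ^+ 2) 1; last first.
  by rewrite /zeta /bumpf ltNge t1 normr0.
rewrite (le_trans (fC t))// ler_piMr// expr_le1// ?subr_ge0 ?(ltW t1)//.
by rewrite gerBl sqr_ge0.
Qed.

Lemma zeta_continuous j : continuous (zeta j).
Proof.
move=> t; apply: differentiable_continuous; apply/derivable1_diffP.
by case: (is_derive_zeta j t).
Qed.

Lemma zeta0E t : zeta 0 t = if t ^+ 2 < 1 then expR (- (1 - t ^+ 2)^-1) else 0.
Proof. by rewrite /zeta /bumpf /= hornerC expr0 !mul1r. Qed.

Lemma zeta0_ge0 t : 0 <= zeta 0 t.
Proof. by rewrite zeta0E; case: ifP => // _; exact: expR_ge0. Qed.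

Lemma zeta0N t : zeta 0 (- t) = zeta 0 t.
Proof. by rewrite !zeta0E sqrrN. Qed.

End bump.

(** * Product kernels and their derivatives *)

Section kernel.
Context {R : realType} {n : nat}.
Implicit Types (kap : 'I_n -> nat) (x y : 'rV[R]_n) (eps : R) (b : 'I_n).

Definition incr kap b : 'I_n -> nat := fun i => (kap i + (i == b))%N.

Lemma incrC kap a b : incr (incr kap a) b = incr (incr kap b) a.
Proof. by apply/funext => i; rewrite /incr addnAC. Qed.

(** A product of one-dimensional bumps instead of a radial bump: partial derivatives of every order
    have the same form, with the multi-index [kap] raised and a power of [eps^-1] in front. The
    normalization is left to [mass]. *)
Definition zker kap eps x y : R := \prod_i zeta (kap i) ((y 0 i - x 0 i) / eps).

Lemma zker_out kap eps x y i : 0 < eps -> eps <= `|y 0 i - x 0 i| -> zker kap eps x y = 0.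
Proof.
move=> e0 xy; rewrite /zker (bigD1 i)//= zeta_out ?mul0r//.
by rewrite normrM normfV (gtr0_norm e0) ler_pdivlMr// mul1r.
Qed.

Lemma is_derive_zker1 (j : nat) eps c y i b :
  is_derive y (delta_mx 0 b : 'rV[R]_n) (fun y : 'rV[R]_n => zeta j ((y 0 i - c) / eps))
   (zeta j.+1 ((y 0 i - c) / eps) * (eps^-1 * (i == b)%:R)).
Proof.
have H : is_derive y (delta_mx 0 b : 'rV[R]_n) (fun y : 'rV[R]_n => (y 0 i - c) / eps)
    (eps^-1 * (i == b)%:R).
  have := is_derive_mul (is_derive_add (is_derive_coord y i b)
    (is_derive_cst (- c) y (delta_mx 0 b : 'rV[R]_n)))
    (is_derive_cst (eps^-1) y (delta_mx 0 b : 'rV[R]_n)).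
  by rewrite addr0 mulr0 addr0 mulrC.
exact: (is_derive_comp1 H (is_derive_zeta j _)).
Qed.

Lemma is_derive_zker kap eps x y b :
  is_derive y (delta_mx 0 b : 'rV[R]_n) (zker kap eps x) (eps^-1 * zker (incr kap b) eps x y).
Proof.
have H : is_derive y (delta_mx 0 b : 'rV[R]_n)
    (fun y => \prod_(i | i != b) zeta (kap i) ((y 0 i - x 0 i) / eps)) 0.
  apply/is_derive_line.
  rewrite (_ : (fun s => _) = cst (\prod_(i | i != b) zeta (kap i) ((y 0 i - x 0 i) / eps))).
    exact: is_derive_cst.
  apply/funext => s; apply: eq_bigr => i ib.
  by rewrite !mxE eqxx/= (negPf ib) mulr0 addr0.
have := is_derive_mul (is_derive_zker1 (kap b) eps (x 0 b) y b b) H.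
rewrite (_ : (fun y => _) = zker kap eps x); last first.
  by apply/funext => z; rewrite /zker [RHS](bigD1 b).
rewrite [X in is_derive _ _ _ X -> _](_ : _ = eps^-1 * zker (incr kap b) eps x y)//.
rewrite mulr0 addr0 eqxx mulr1 /zker [in RHS](bigD1 b)//= /incr eqxx addn1.
rewrite mulrAC mulrC; congr (_ * (_ * _)); apply: eq_bigr => i /negPf ib.
by rewrite ib addn0.
Qed.

Lemma is_derive_zker_center kap eps x y b :
  is_derive x (delta_mx 0 b : 'rV[R]_n) (fun x => zker kap eps x y)
    (- eps^-1 * zker (incr kap b) eps x y).
Proof.
apply/is_derive_line.
have := is_derive_zker kap eps x y b => /is_derive_line H.
rewrite (_ : (fun s => _) = (fun s => zker kap eps x (y + (- s) *: delta_mx 0 b))); last first.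
  apply/funext => s; apply: eq_bigr => i _; rewrite !mxE.
  by congr (zeta _ (_ / _)); ring.
have HN : is_derive (0 : R) (1 : R) (fun s : R => - s) (- 1) by exact: is_derive_opp.
have H0 : is_derive (- 0 : R) 1 (fun s : R => zker kap eps x (y + s *: delta_mx 0 b))
  (eps^-1 * zker (incr kap b) eps x y) by rewrite oppr0.
have := is_derive_comp1 HN H0.
by rewrite mulrN1 -mulNr.
Qed.

Lemma differentiable_zker kap eps x y : differentiable (zker kap eps x) y.
Proof.
have H (s : seq 'I_n) : differentiable
    (fun y : 'rV[R]_n => \prod_(i <- s) zeta (kap i) ((y 0 i - x 0 i) / eps)) y.
  elim: s => [|i s IH].
    rewrite (_ : (fun _ => _) = cst 1); first exact: differentiable_cst.
    by apply/funext => z; rewrite big_nil.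
  rewrite (_ : (fun _ => _) = (fun y : 'rV[R]_n => zeta (kap i) ((y 0 i - x 0 i) / eps)) *
     (fun y : 'rV[R]_n => \prod_(i <- s) zeta (kap i) ((y 0 i - x 0 i) / eps))); last first.
    by apply/funext => z; rewrite big_cons.
  apply: differentiableM => //.
  apply: (@differentiable_comp _ _ _ _ (fun y : 'rV[R]_n => (y 0 i - x 0 i) / eps) (zeta (kap i))).
    rewrite (_ : (fun _ => _) = ((fun y : 'rV[R]_n => y 0 i) - cst (x 0 i)) * cst (eps^-1))//.
    apply: differentiableM; last exact: differentiable_cst.
    by apply: differentiableB; [exact: differentiable_coord|exact: differentiable_cst].
  by apply/derivable1_diffP; case: (is_derive_zeta (kap i) ((y 0 i - x 0 i) / eps)).
exact: H.
Qed.

Lemma smooth_zker kap eps x : smooth (zker kap eps x).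
Proof.
move=> s; suff [c [kap' ->]] : exists c kap', foldr partial (zker kap eps x) s =
    (fun y => c * zker kap' eps x y).
  move=> y; rewrite (_ : (fun _ => _) = cst c * zker kap' eps x)//.
  by apply: differentiableM; [exact: differentiable_cst|exact: differentiable_zker].
elim: s => [|b s [c [kap' IH]]] /=.
  by exists 1, kap; apply/funext => y; rewrite mul1r.
exists (c * eps^-1), (incr kap' b); rewrite IH; apply/funext => y; rewrite /partial.
have := is_derive_mul (is_derive_cst c y (delta_mx 0 b : 'rV[R]_n))
  (is_derive_zker kap' eps x y b).
by rewrite mul0r add0r mulrA => H; rewrite derive_val.
Qed.

Lemma partial_zker kap eps x b : partial b (zker kap eps x) =
  (fun y => eps^-1 * zker (incr kap b) eps x y).
Proof.
apply/funext => y; rewrite /partial.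
by have H := is_derive_zker kap eps x y b; rewrite derive_val.
Qed.

Lemma partial2_zker kap eps x a b : partial a (partial b (zker kap eps x)) =
  (fun y => eps^-1 * (eps^-1 * zker (incr (incr kap b) a) eps x y)).
Proof.
rewrite partial_zker; apply/funext => y; rewrite /partial.
have := is_derive_mul (is_derive_cst (eps^-1) y (delta_mx 0 a : 'rV[R]_n))
  (is_derive_zker (incr kap b) eps x y a).
by rewrite mul0r add0r => H; rewrite derive_val.
Qed.

Lemma test_function_zker kap eps x (D : set 'rV[R]_n) : 0 < eps ->
  (forall y, (forall i, `|y 0 i - x 0 i| <= eps) -> D y) ->
  test_function D (zker kap eps x).
Proof.
move=> e0 xD.
have supp : closure [set y | zker kap eps x y != 0] `<=`
    [set y : 'rV[R]_n | forall i, `|y 0 i - x 0 i| <= eps].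
  rewrite (_ : [set y : 'rV[R]_n | forall i, `|y 0 i - x 0 i| <= eps] =
    \bigcap_(i in [set: 'I_n]) [set y : 'rV[R]_n | `|y 0 i - x 0 i| <= eps]); last first.
    by apply/seteqP; split => y /= h i => [_|]; exact: h.
  have cl : closed (\bigcap_(i in [set: 'I_n]) [set y : 'rV[R]_n | `|y 0 i - x 0 i| <= eps]).
    apply: closed_bigI => i _.
    apply: (@closed_comp _ _ (fun y : 'rV[R]_n => `|y 0 i - x 0 i|) [set r | r <= eps]).
      move=> y _; apply: (@continuous_comp _ _ _ (fun y : 'rV[R]_n => y 0 i)
        (fun r : R => `|r - x 0 i|)); first exact: coord_continuous.
      by apply: cvg_norm; apply: cvgB; [exact: cvg_id|exact: cvg_cst].
    exact: closed_le.
  rewrite [X in _ `<=` X]((closure_id _).1 cl); apply: closure_subset => y /=.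
  move=> h i _ /=; rewrite leNgt; apply/negP => /ltW yx.
  by move: h; rewrite (zker_out kap e0 yx) eqxx.
split; first exact: smooth_zker.
- apply: (subclosed_compact (@closed_closure _ _) _ supp).
  have := @rV_compact R n (fun i => `[x 0 i - eps, x 0 i + eps]%classic)
    (fun i => @segment_compact _ _ _).
  congr compact; apply/seteqP; split => y /= h i; have := h i; rewrite /= in_itv/= ler_distl//.
- by move=> y /supp; exact: xD.
Qed.

End kernel.

(** * Convolution with a kernel *)

Section mollifier.
Context {R : realType} {n : nat}.
Local Notation mu := (lebesgue_rV R n).
Implicit Types (f g h : 'rV[R]_n -> R) (kap : 'I_n -> nat) (x y : 'rV[R]_n) (eps : R).

Lemma is_derive_param (F F' : R -> 'rV[R]_n -> R) (G : 'rV[R]_n -> R) :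
  (forall s, L1 (F s)) -> (forall s y, is_derive s (1 : R) (F ^~ y) (F' s y)) ->
  (forall y, 0 <= G y) -> L1 G -> (forall s y, `|F' s y| <= G y) ->
  is_derive (0 : R) (1 : R) (fun s => Int (F s)) (Int (F' 0)).
Proof.
move=> LF dF G0 LG FG.
have I0 : `](-1 : R), 1[%classic 0 by rewrite /= in_itv/= ltrN10 ltr01.
have dE s y : partial1of2 F s y = F' s y.
  by rewrite partial1of2E; have H := dF s y; rewrite derive_val.
have H1 := @derivable_under_integral R _ _ mu F _ (measurable_cube 1) 0 (-1) 1 I0
  (fun s _ => LF s) (fun s y _ _ => let: DeriveDef d _ := dF s y in d) G G0 LG.
have H2 := @differentiation_under_integral R _ _ mu F _ (measurable_cube 1) 0 (-1) 1 I0
  (fun s _ => LF s) (fun s y _ _ => let: DeriveDef d _ := dF s y in d) G G0 LG.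
constructor; first by apply: H1 => s y _ _; rewrite dE.
rewrite -derive1E H2; last by move=> s y _ _; rewrite dE.
by apply: eq_Int => y _; rewrite dE.
Qed.

Lemma measurable_zker2 kap eps :
  measurable_fun setT (fun z : 'rV[R]_n * 'rV[R]_n => zker kap eps z.1 z.2).
Proof.
have H (s : seq 'I_n) : measurable_fun setT
    (fun z : 'rV[R]_n * 'rV[R]_n => \prod_(i <- s) zeta (kap i) ((z.2 0 i - z.1 0 i) / eps)).
  elim: s => [|i s IH].
    under eq_fun do rewrite big_nil; exact: measurable_cst.
  under eq_fun do rewrite big_cons.
  apply: measurable_funM => //.
  apply: (measurableT_comp (continuous_measurable_fun (@zeta_continuous R (kap i)))).
  apply: measurable_funM => //; apply: measurable_funB.
    exact: (measurableT_comp (@measurable_rV_coord R n i) measurable_snd).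
  exact: (measurableT_comp (@measurable_rV_coord R n i) measurable_fst).
exact: H.
Qed.

Lemma measurable_zker kap eps x : measurable_fun setT (zker kap eps x).
Proof. exact: (measurableT_comp (measurable_zker2 kap eps) (measurable_pair1 x)). Qed.

Lemma zker_bounded kap : exists C : R, 0 <= C /\
  forall eps x y, `|zker kap eps x y| <= C.
Proof.
have /choice[C HC] : forall i, exists C : R, 0 <= C /\ forall t, `|zeta (kap i) t| <= C.
  by move=> i; exact: zeta_bounded.
exists (\prod_i C i); split; first by apply: prodr_ge0 => i _; case: (HC i).
move=> eps x y; rewrite /zker normr_prod; apply: ler_prod => i _.
by rewrite normr_ge0; case: (HC i) => _ ->.
Qed.

Lemma bm_zker kap eps x : bmfun (zker kap eps x).
Proof.
split; first exact: measurable_zker.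
by have [C [_ HC]] := zker_bounded kap; exists C => y _.
Qed.

Lemma L1_norm f : L1 f -> L1 (fun x => `|f x|).
Proof. by move=> Lf; apply: integrable_norm => //; exact: measurable_cube. Qed.

Lemma L1_mulC f g : L1 (fun x => g x * f x) -> L1 (fun x => f x * g x).
Proof. by congr L1; apply/funext => x; rewrite mulrC. Qed.

Definition conv kap eps f x : R := Int (fun y => f y * zker kap eps x y).

Lemma L1_conv kap eps f x : L1 f -> L1 (fun y => f y * zker kap eps x y).
Proof. by move=> Lf; apply: L1_mulC; apply: L1_bmM => //; exact: bm_zker. Qed.

(** The derivative falls on the kernel, so f only has to be integrable. *)
Lemma is_derive_conv kap eps f x b : L1 f ->
  is_derive x (delta_mx 0 b : 'rV[R]_n) (conv kap eps f)
    (- eps^-1 * conv (incr kap b) eps f x).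
Proof.
move=> Lf; apply/is_derive_line; rewrite -IntZ; last exact: L1_conv.
have [C [C0 HC]] := zker_bounded (incr kap b).
pose F' (s : R) (y : 'rV[R]_n) := - eps^-1 * (f y * zker (incr kap b) eps (x + s *: delta_mx 0 b) y).
have -> : Int (fun y => - eps^-1 * (f y * zker (incr kap b) eps x y)) = Int (F' 0).
  by apply: eq_Int => y _; rewrite /F' scale0r addr0.
apply: (@is_derive_param (fun s y => f y * zker kap eps (x + s *: delta_mx 0 b) y) F'
  (fun y => `|eps^-1| * C * `|f y|)).
- by move=> s; exact: L1_conv.
- move=> s y; rewrite /F' mulrCA.
  have H := is_derive_zker_center kap eps (x + s *: (delta_mx 0 b : 'rV[R]_n)) y b.
  have := is_derive_mul (is_derive_cst (f y) s (1 : R))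
    (@is_derive_line_at _ _ (fun x => zker kap eps x y) x _ s _ H).
  by rewrite mul0r add0r.
- by move=> y; rewrite !mulr_ge0.
- exact/L1Z/L1_norm.
- move=> s y; rewrite /F' !normrM normrN -mulrA ler_wpM2l// mulrC ler_wpM2r//.
Qed.

Lemma conv_bounded kap eps f : L1 f -> exists C : R, forall x, `|conv kap eps f x| <= C.
Proof.
move=> Lf; have [C [C0 HC]] := zker_bounded kap.
exists (C * Int (fun y => `|f y|)) => x; rewrite /conv.
rewrite (le_trans (le_normr_Rintegral (measurable_cube 1) (L1_conv kap eps x Lf)))//.
rewrite -IntZ; last exact: L1_norm.
apply: le_Int => [||y _]; first exact/L1_norm/L1_conv.
  exact/L1Z/L1_norm.
by rewrite normrM mulrC ler_wpM2r.
Qed.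

Lemma measurable_integral_param (D : set 'rV[R]_n) (g : 'rV[R]_n * 'rV[R]_n -> \bar R) :
  measurable D -> measurable_fun setT g -> (forall z, 0 <= g z)%E ->
  measurable_fun setT (fun x => \int[mu]_(y in D) g (x, y))%E.
Proof.
move=> mD mg g0.
have mQ : measurable ([set: 'rV[R]_n] `*` D) by exact: measurableX.
have mr : measurable_fun setT (g \_ ([set: 'rV[R]_n] `*` D)).
  by apply/(measurable_restrictT _ mQ); exact: measurable_funTS.
have := @measurable_fun_fubini_tonelli_F _ _ _ _ _ mu _ mr (erestrict_ge0 (fun z _ => g0 z)).
congr measurable_fun; apply/funext => x; rewrite /fubini_F [RHS]integral_mkcond.
apply: eq_integral => y _; rewrite /patch.
by rewrite in_setX in_setT.
Qed.

Lemma measurable_Int_param (h : 'rV[R]_n * 'rV[R]_n -> R) : measurable_fun setT h ->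
  measurable_fun setT (fun x => Int (fun y => h (x, y))).
Proof.
move=> mh; rewrite /Int /Rintegral.
apply: (measurableT_comp (fine_measurable measurableT)).
under eq_fun do rewrite integralE.
have mhE : measurable_fun setT (fun z => (h z)%:E) by exact/measurable_EFinP.
apply: emeasurable_funB.
- have := measurable_integral_param (measurable_cube 1) (measurable_funepos mhE)
    (fun z => funepos_ge0 _ z).
  congr measurable_fun; apply/funext => x; apply: eq_integral => y _.
  by rewrite !funeposE.
- have := measurable_integral_param (measurable_cube 1) (measurable_funeneg mhE)
    (fun z => funeneg_ge0 _ z).
  congr measurable_fun; apply/funext => x; apply: eq_integral => y _.
  by rewrite !funenegE.
Qed.

Lemma measurable_conv kap eps f : measurable_fun setT f ->
  measurable_fun setT (conv kap eps f).
Proof.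
move=> mf; apply: (@measurable_Int_param (fun z => f z.2 * zker kap eps z.1 z.2)).
apply: measurable_funM; last exact: measurable_zker2.
exact: measurableT_comp.
Qed.

Lemma bm_conv kap eps f : measurable_fun setT f -> L1 f -> bmfun (conv kap eps f).
Proof.
move=> mf Lf; split; first exact: measurable_conv.
by have [C HC] := conv_bounded kap eps Lf; exists C => x _.
Qed.

End mollifier.

Section mass.
Context {R : realType} {n : nat}.
Local Notation mu := (lebesgue_rV R n).
Implicit Types (f g h : 'rV[R]_n -> R) (x y : 'rV[R]_n) (eps : R).

Lemma EFin_Int f : L1 f -> ((Int f)%:E = \int[mu]_(x in cube 1) (f x)%:E)%E.
Proof.
move=> Lf; rewrite /Int /Rintegral fineK//.
by apply: integrable_fin_num => //; exact: measurable_cube.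
Qed.

Definition kap0 : 'I_n -> nat := fun=> 0%N.
Local Notation ker := (zker kap0).

Lemma ker_ge0 eps x y : 0 <= ker eps x y.
Proof. by apply: prodr_ge0 => i _; exact: zeta0_ge0. Qed.

Lemma kerC eps x y : ker eps x y = ker eps y x.
Proof.
by apply: eq_bigr => i _; rewrite -zeta0N -mulNr opprB.
Qed.

Lemma ker_shift eps x y : ker eps x y = ker eps 0 (y - x).
Proof. by apply: eq_bigr => i _; rewrite !mxE subr0. Qed.

Definition mass eps : R := \int[mu]_y ker eps 0 y.

Lemma integrable_ker eps : 0 < eps -> mu.-integrable setT (EFin \o ker eps 0).
Proof.
move=> e0; have [C [C0 HC]] := @zker_bounded R n kap0.
apply: (@integrable_supp R n eps C) => [||y yc]; first exact: measurable_zker.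
  exact: HC.
have [i yi] : exists i, ~ `|y 0 i| <= eps by exact/existsNP.
apply: (@zker_out R n kap0 eps 0 y i e0); rewrite mxE subr0 ltW// ltNge.
exact/negP.
Qed.

Lemma massE eps x : 0 < eps -> (\int[mu]_y (ker eps x y)%:E = (mass eps)%:E)%E.
Proof.
move=> e0; rewrite /mass /Rintegral fineK; last first.
  exact: (integrable_fin_num _ (integrable_ker e0)).
have mk : measurable_fun setT (fun y => (ker eps 0 y)%:E).
  by apply/measurable_EFinP; exact: measurable_zker.
rewrite -(@ge0_integral_shift R n (- x) _ mk).
  by apply: eq_integral => y _; rewrite ker_shift.
by move=> y; rewrite lee_fin; exact: ker_ge0.
Qed.

Lemma mass_gt0 eps : 0 < eps -> 0 < mass eps.
Proof.
move=> e0; rewrite -lte_fin -(massE 0 e0).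
(* On the cube of half-side eps / 2 each factor is at least exp(-1/(1 - 1/4)) = exp(-4/3). *)
pose c : R := \prod_(i < n) expR (- (4 / 3)).
have c0 : 0 < c by apply: prodr_gt0 => i _; exact: expR_gt0.
have h0 : 0 < eps / 2 by rewrite divr_gt0.
have mc0 : (0 < mu (cube (eps / 2)))%E.
  rewrite cubeE (@lebesgue_rV_box R n (fun=> `[- (eps / 2), eps / 2]%classic))//.
  have -> : lebesgue_measure (`[- (eps / 2), eps / 2]%classic : set R) = eps%:E.
    rewrite lebesgue_measure_itv/= lte_fin gtrN// -EFinB; congr EFin; lra.
  by rewrite prodEFin lte_fin; exact: prodr_gt0.
apply: (@lt_le_trans _ _ (\int[mu]_(y in cube (eps / 2)) c%:E)%E).
  rewrite integral_cst; last exact: measurable_cube.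
  by rewrite mule_gt0.
apply: (@le_trans _ _ (\int[mu]_(y in cube (eps / 2)) (ker eps 0 y)%:E)%E).
  apply: ge0_le_integral.
  - exact: measurable_cube.
  - by move=> y _; rewrite lee_fin ltW.
  - exact: measurable_cst.
  - by apply/measurable_EFinP/measurable_funTS; exact: measurable_zker.
  - move=> y yc; rewrite lee_fin /c /zker; apply: ler_prod => i _.
    rewrite expR_ge0/= mxE subr0 /kap0 zeta0E.
    have yi : (y 0 i / eps) ^+ 2 <= 4^-1.
      rewrite -(real_normK (num_real _)) normrM normfV (gtr0_norm e0).
      have : `|y 0 i| / eps <= 2^-1 by rewrite ler_pdivrMr// mulrC; exact: yc.
      move=> yi; rewrite (_ : 4^-1 = 2^-1 ^+ 2 :> R); last by field.
      by rewrite ler_pXn2r// ?nnegrE ?divr_ge0 ?(ltW e0).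
    have y1 : (y 0 i / eps) ^+ 2 < 1 by lra.
    rewrite y1 ler_expR lerN2 -[leRHS]invrK invf_div lef_pV2 ?posrE; lra.
apply: ge0_subset_integral => //.
- exact: measurable_cube.
- by apply/measurable_EFinP; exact: measurable_zker.
- by move=> y _; rewrite lee_fin; exact: ker_ge0.
Qed.

(** Only an inequality, because near the boundary of the unit cube part of the kernel lies
    outside. *)
Lemma Int_ker_le eps x : 0 < eps -> Int (ker eps x) <= mass eps.
Proof.
move=> e0; rewrite -lee_fin EFin_Int; last exact/bm_L1/bm_zker.
rewrite -(massE x e0); apply: ge0_subset_integral => //.
- exact: measurable_cube.
- by apply/measurable_EFinP; exact: measurable_zker.
- by move=> y _; rewrite lee_fin; exact: ker_ge0.
Qed.

(** Tonelli on the product of two cubes; the kernel is symmetric in its two points, so the integral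
    over the centre is again at most the mass. *)
Lemma Int_conv_le eps f : 0 < eps -> measurable_fun setT f -> L1 f -> (forall y, 0 <= f y) ->
  Int (conv kap0 eps f) <= mass eps * Int f.
Proof.
move=> e0 mf Lf f0.
have mQ := @measurable_cube R n 1.
have mfk : measurable_fun setT (fun z : 'rV[R]_n * 'rV[R]_n => (f z.2 * ker eps z.1 z.2)%:E).
  apply/measurable_EFinP/measurable_funM; last exact: measurable_zker2.
  exact: measurableT_comp.
have mQQ : measurable (@cube R n 1 `*` @cube R n 1) by exact: measurableX.
pose H := (fun z : 'rV[R]_n * 'rV[R]_n => (f z.2 * ker eps z.1 z.2)%:E) \_ (cube 1 `*` cube 1).
have mH : measurable_fun setT H.
  by apply/(measurable_restrictT _ mQQ); exact: measurable_funTS.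
have H0 z : (0 <= H z)%E.
  by apply: erestrict_ge0 => t _; rewrite lee_fin mulr_ge0// ker_ge0.
have Hxy x y : H (x, y) = (((fun y => (f y * ker eps x y)%:E) \_ (cube 1)) y *
    (\1_(cube 1) x)%:E)%E.
  rewrite /H /patch in_setX indicE /=; case: (x \in _); rewrite /= ?mule1//.
  by case: (y \in _); rewrite mule0.
have Lc := @bm_L1 _ _ _ (bm_conv kap0 eps mf Lf).
rewrite -lee_fin EFinM !EFin_Int//.
apply: (@le_trans _ _ (\int[mu]_x \int[mu]_y H (x, y))%E).
  rewrite [leLHS]integral_mkcond; apply: ge0_le_integral => //.
  - by move=> z _; apply: erestrict_ge0 => x _; rewrite lee_fin; apply: Int_ge0 => y _; rewrite mulr_ge0// ker_ge0.
  - apply/(measurable_restrictT _ mQ); apply: measurable_funTS.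
    by apply/measurable_EFinP; exact: measurable_conv.
  - exact: (measurable_fun_fubini_tonelli_F H).
  - move=> x _; rewrite patchE; case: ifPn => xQ; last exact: integral_ge0.
    rewrite /conv EFin_Int; last exact: L1_conv.
    rewrite [leLHS]integral_mkcond; apply: ge0_le_integral => //.
    + by move=> y _; apply: erestrict_ge0 => z _; rewrite lee_fin mulr_ge0// ker_ge0.
    + apply/(measurable_restrictT _ mQ); apply: measurable_funTS.
      by apply/measurable_EFinP/measurable_funM => //; exact: measurable_zker.
    + exact: (measurableT_comp mH (measurable_pair1 x)).
    + by move=> y _; rewrite Hxy indicE xQ mule1.
rewrite (fubini_tonelli H)//.
rewrite -ge0_integralZl//; last 3 first.
- by apply/measurable_EFinP/measurable_funTS.
- by move=> y _; rewrite lee_fin.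
- by rewrite lee_fin ltW// mass_gt0.
rewrite [leRHS]integral_mkcond; apply: ge0_le_integral => //.
- by move=> y _; exact: integral_ge0.
- exact: (measurable_fun_fubini_tonelli_G H).
- apply/(measurable_restrictT _ mQ); apply: measurable_funTS.
  by apply: measurable_funeM; exact/measurable_EFinP.
move=> y _; rewrite patchE; case: ifPn => yQ; last first.
  rewrite le_eqVlt; apply/orP; left; apply/eqP; apply: integral0_eq => x _.
  by rewrite Hxy patchE (negbTE yQ) mul0e.
rewrite -(massE y e0) muleC -ge0_integralZl//; last 3 first.
- by apply/measurable_EFinP; exact: measurable_zker.
- by move=> x _; rewrite lee_fin ker_ge0.
- by rewrite lee_fin.
apply: ge0_le_integral => //.
- exact: (measurableT_comp mH (measurable_pair2 y)).
- by apply/measurable_EFinP/measurable_funM => //; exact: measurable_zker.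
- move=> x _; rewrite Hxy patchE yQ -EFinM lee_fin kerC indicE -[leRHS]mulr1.
  by rewrite ler_wpM2l ?mulr_ge0 ?ker_ge0//; case: (_ \in _).
Qed.

End mass.

(** * Stability of mollification in L^2 *)

Section L2_convergence.
Context {R : realType} {n : nat}.
Local Notation mu := (lebesgue_rV R n).
Implicit Types (f g h : 'rV[R]_n -> R) (x y : 'rV[R]_n) (eps : R).
Local Notation ker := (zker (@kap0 n)).
Local Notation mass := (@mass R n).

Definition L2 f := measurable_fun setT f /\ L1 (fun x => f x ^+ 2).

Lemma le_L1 f g : measurable_fun setT f -> (forall x, cube 1 x -> `|f x| <= g x) ->
  L1 g -> L1 f.
Proof.
move=> mf fg Lg; apply: (le_integrable (measurable_cube 1) _ _ Lg).
  by apply/measurable_EFinP; exact: measurable_funTS.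
move=> x xQ /=; rewrite lee_fin (le_trans (fg x xQ))// ler_norm//.
Qed.

Lemma L2_L1 f : L2 f -> L1 f.
Proof.
move=> [mf Lf]; apply: (@le_L1 f (fun x => 1 + f x ^+ 2)) => // [x _|].
  rewrite -(real_normK (num_real (f x))).
  have := sqr_ge0 (`|f x| - 2^-1); rewrite sqrrB; nra.
apply: L1D => //; exact/bm_L1/bmfun_cst.
Qed.

Lemma L2M f g : L2 f -> L2 g -> L1 (fun x => f x * g x).
Proof.
move=> [mf Lf] [mg Lg].
apply: (@le_L1 _ (fun x => f x ^+ 2 + g x ^+ 2)); first exact: measurable_funM.
- move=> x _; rewrite normrM -(real_normK (num_real (f x))) -(real_normK (num_real (g x))).
  by have := sqr_ge0 (`|f x| - `|g x|); rewrite sqrrB; have := normr_ge0 (f x); have := normr_ge0 (g x); nra.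
- exact: L1D.
Qed.

Lemma L2D f g : L2 f -> L2 g -> L2 (fun x => f x + g x).
Proof.
move=> Lf Lg; have Lfg := L2M Lf Lg; case: Lf Lg => [mf Lf] [mg Lg].
split; first exact: measurable_funD.
have : L1 (fun x => f x ^+ 2 + 2 * (f x * g x) + g x ^+ 2).
  by apply: L1D => //; apply: L1D => //; exact: L1Z.
by congr L1; apply/funext => x; ring.
Qed.

Lemma L2Z c f : L2 f -> L2 (fun x => c * f x).
Proof.
move=> [mf Lf]; split; first exact: measurable_funM.
have : L1 (fun x => c ^+ 2 * f x ^+ 2) by exact: L1Z.
by congr L1; apply/funext => x; rewrite exprMn.
Qed.

Lemma L2B f g : L2 f -> L2 g -> L2 (fun x => f x - g x).
Proof.
move=> Lf Lg; have := L2D Lf (L2Z (-1) Lg).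
by congr L2; apply/funext => x; rewrite mulN1r.
Qed.

Lemma bm_L2 f : bmfun f -> L2 f.
Proof.
by move=> bf; split; [case: bf|exact/bm_L1/bmfunX].
Qed.

Definition moll eps f x : R := (mass eps)^-1 * conv (@kap0 n) eps f x.

Lemma bm_moll eps f : L2 f -> bmfun (moll eps f).
Proof.
move=> Lf; apply: bmfunM; first exact: bmfun_cst.
by apply: bm_conv; [case: Lf|exact: L2_L1].
Qed.

Lemma mollD eps f g : L1 f -> L1 g ->
  moll eps (fun x => f x + g x) =1 (fun x => moll eps f x + moll eps g x).
Proof.
move=> Lf Lg x; rewrite /moll /conv -mulrDr -IntD; try exact: L1_conv.
by congr (_ * _); apply: eq_Int => y _; rewrite mulrDl.
Qed.

Lemma mollZ eps c f : L1 f -> moll eps (fun x => c * f x) =1 (fun x => c * moll eps f x).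
Proof.
move=> Lf x; rewrite /moll /conv mulrCA -(IntZ c); last exact: L1_conv.
by congr (_ * _); apply: eq_Int => y _; rewrite mulrA.
Qed.

Lemma mollB eps f g : L1 f -> L1 g ->
  moll eps (fun x => f x - g x) =1 (fun x => moll eps f x - moll eps g x).
Proof.
move=> Lf Lg x; rewrite /moll /conv -mulrBr -IntN -?IntD; try exact: L1_conv.
  by congr (_ * _); apply: eq_Int => y _; rewrite mulrBl.
by apply: L1N; exact: L1_conv.
Qed.

(* Jensen, from 0 <= int (f(y) - a)^2 ker(x, y) dy with a the mollified value. *)
Lemma moll_sqr_le eps f x : 0 < eps -> L2 f ->
  moll eps f x ^+ 2 <= (mass eps)^-1 * conv (@kap0 n) eps (fun y => f y ^+ 2) x.
Proof.
move=> e0 Lf; have L1f := L2_L1 Lf; have [mf Lf2] := Lf.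
set a := moll eps f x; have m0 := @mass_gt0 R n eps e0.
have aE : Int (fun y => f y * ker eps x y) = mass eps * a.
  by rewrite /a /moll mulrA divff ?mul1r// gt_eqF.
have : 0 <= Int (fun y => (f y ^+ 2 * ker eps x y) + (- (2 * a)) * (f y * ker eps x y) +
    a ^+ 2 * ker eps x y).
  apply: Int_ge0 => y _.
  rewrite (_ : _ + _ = (f y - a) ^+ 2 * ker eps x y); last by ring.
  by rewrite mulr_ge0 ?sqr_ge0 ?ker_ge0.
have i1 : L1 (fun y => f y ^+ 2 * ker eps x y) by exact: L1_conv.
have i2 : L1 (fun y => f y * ker eps x y) by exact: L1_conv.
have i3 : L1 (ker eps x) by exact/bm_L1/bm_zker.
rewrite IntD ?IntD ?IntZ//; last 3 first.
- exact: L1Z.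
- by apply: L1D => //; exact: L1Z.
- exact: L1Z.
rewrite aE /conv; set J := Int _ => H.
have := Int_ker_le x e0 => K.
rewrite ler_pdivlMl//; have : a ^+ 2 * Int (ker eps x) <= a ^+ 2 * mass eps.
  by rewrite ler_wpM2l ?sqr_ge0.
move: H; lra.
Qed.

Lemma Int_moll_sqr_le eps f : 0 < eps -> L2 f ->
  Int (fun x => moll eps f x ^+ 2) <= Int (fun x => f x ^+ 2).
Proof.
move=> e0 Lf; have [mf Lf2] := Lf; have m0 := @mass_gt0 R n eps e0.
have mf2 : measurable_fun setT (fun x => f x ^+ 2) by exact: measurable_funX.
have Lc : L1 (conv (@kap0 n) eps (fun y => f y ^+ 2)) by exact/bm_L1/bm_conv.
apply: (@le_trans _ _ (Int (fun x => (mass eps)^-1 * conv (@kap0 n) eps (fun y => f y ^+ 2) x))).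
  apply: le_Int => [||x _]; [|exact: L1Z|exact: moll_sqr_le].
  exact/bm_L1/bmfunX/bm_moll.
rewrite IntZ// ler_pdivrMl//; apply: Int_conv_le => // y; exact: sqr_ge0.
Qed.

Definition epsk (k : nat) : R := k.+1%:R^-1.

Lemma epsk_gt0 k : 0 < epsk k. Proof. by rewrite invr_gt0. Qed.

Definition err f k := Int (fun x => (moll (epsk k) f x - f x) ^+ 2).
Definition approximable f := L2 f /\ err f @ \oo --> (0 : R).

Lemma err_ge0 f k : 0 <= err f k.
Proof. by apply: Int_ge0 => x _; exact: sqr_ge0. Qed.

Lemma L2_moll eps f : L2 f -> L2 (moll eps f).
Proof. by move=> Lf; apply: bm_L2; exact: bm_moll. Qed.

Lemma L2_sqr f : L2 f -> L1 (fun x => f x ^+ 2). Proof. by case. Qed.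

(** The error is split into three terms. Mollification contracts L^2, so two of them are bounded by
    the distance of f and g, whence 6 = 3 + 3. *)
Lemma err_le f g k : L2 f -> L2 g ->
  err f k <= 3 * err g k + 6 * Int (fun x => (f x - g x) ^+ 2).
Proof.
move=> Lf Lg; have Lfg := L2B Lf Lg.
have H := Int_moll_sqr_le (epsk_gt0 k) Lfg.
have i1 := L2_sqr (L2B (L2_moll (epsk k) Lf) Lf).
have i2 := L2_sqr (L2B (L2_moll (epsk k) Lg) Lg).
have i3 := L2_sqr Lfg.
have i4 := L2_sqr (L2_moll (epsk k) Lfg).
have : err f k <= Int (fun x => 3 * (moll (epsk k) g x - g x) ^+ 2 +
    3 * moll (epsk k) (fun x => f x - g x) x ^+ 2 + 3 * (f x - g x) ^+ 2).
  apply: le_Int => //; first by apply: L1D; [apply: L1D|]; exact: L1Z.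
  move=> x _; rewrite mollB; [|exact: L2_L1|exact: L2_L1].
  set a := moll _ f x; set b := moll _ g x.
  have := sqr_ge0 (b - g x - (a - b)); have := sqr_ge0 (b - g x + (f x - g x)).
  have := sqr_ge0 (a - b + (f x - g x)); lra.
rewrite IntD ?IntD ?IntZ//; try exact: L1Z; last by apply: L1D; exact: L1Z.
by rewrite -/(err g k); move: H; lra.
Qed.

Lemma err_add f g k : L2 f -> L2 g ->
  err (fun x => f x + g x) k <= 2 * err f k + 2 * err g k.
Proof.
move=> Lf Lg; have Lfg := L2D Lf Lg.
have i1 := L2_sqr (L2B (L2_moll (epsk k) Lf) Lf).
have i2 := L2_sqr (L2B (L2_moll (epsk k) Lg) Lg).
have i3 := L2_sqr (L2B (L2_moll (epsk k) Lfg) Lfg).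
rewrite /err -!IntZ// -IntD; try exact: L1Z.
apply: le_Int => //; first by apply: L1D; exact: L1Z.
move=> x _; rewrite mollD; [|exact: L2_L1|exact: L2_L1].
set a := moll _ f x; set b := moll _ g x.
by have := sqr_ge0 ((a - f x) - (b - g x)); lra.
Qed.

Lemma approximableD f g : approximable f -> approximable g ->
  approximable (fun x => f x + g x).
Proof.
move=> [Lf cf] [Lg cg]; split; first exact: L2D.
apply: (@squeeze_cvgr _ _ _ _ (cst 0) (fun k => 2 * err f k + 2 * err g k)).
- by apply: nearW => k; rewrite err_ge0/=; exact: err_add.
- exact: cvg_cst.
- rewrite -[X in _ --> X](_ : 2 * 0 + 2 * 0 = 0 :> R); last by rewrite mulr0 addr0.
  by apply: cvgD; apply: cvgM => //; exact: cvg_cst.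
Qed.

Lemma approximableZ c f : approximable f -> approximable (fun x => c * f x).
Proof.
move=> [Lf cf]; split; first exact: L2Z.
have -> : err (fun x => c * f x) = (fun k => c ^+ 2 * err f k).
  apply/funext => k; rewrite /err -IntZ; last exact: (L2_sqr (L2B (L2_moll (epsk k) Lf) Lf)).
  by apply: eq_Int => x _; rewrite mollZ -?mulrBr ?exprMn//; exact: L2_L1.
rewrite -[X in _ --> X](_ : c ^+ 2 * 0 = 0 :> R); last by rewrite mulr0.
by apply: cvgM => //; exact: cvg_cst.
Qed.

Lemma approximable0 : approximable (fun=> 0).
Proof.
have L0 : L2 (fun=> 0 : R) by exact/bm_L2/bmfun_cst.
split => //; rewrite (_ : err _ = cst 0); first exact: cvg_cst.
apply/funext => k; rewrite /err -[RHS](@Int0 R n); apply: eq_Int => x _.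
rewrite /moll /conv (_ : (fun _ => _) = fun=> 0) ?Int0 ?mulr0 ?subr0 ?expr0n//.
by apply/funext => y; rewrite mul0r.
Qed.

Lemma approximable_sum (I : Type) (s : seq I) (f : I -> 'rV[R]_n -> R) :
  (forall i, approximable (f i)) -> approximable (fun x => \sum_(i <- s) f i x).
Proof.
move=> af; elim: s => [|i s IH].
  rewrite (_ : (fun _ => _) = (fun=> 0)); first exact: approximable0.
  by apply/funext => x; rewrite big_nil.
rewrite (_ : (fun _ => _) = (fun x => f i x + \sum_(j <- s) f j x)).
  exact: approximableD.
by apply/funext => x; rewrite big_cons.
Qed.

Lemma approximable_lim f (g : nat -> 'rV[R]_n -> R) : L2 f ->
  (forall m, approximable (g m)) ->
  (fun m => Int (fun x => (f x - g m x) ^+ 2)) @ \oo --> (0 : R) -> approximable f.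
Proof.
move=> Lf ag cg; split => //; apply/cvgr0Pnorm_lt => e e0.
have e12 : 0 < e / 12 by rewrite divr_gt0.
have [m _ /(_ m (leqnn m)) Hm] := (cvgr0Pnorm_lt _).1 cg _ e12.
have [Lg cge] := ag m.
have e6 : 0 < e / 6 by rewrite divr_gt0.
have cgn : \forall k \near \oo, `|err (g m) k| < e / 6.
  exact: ((cvgr0Pnorm_lt _).1 cge _ e6).
near=> k; have Hk : `|err (g m) k| < e / 6 by near: k.
rewrite ger0_norm ?err_ge0// in Hk; rewrite ger0_norm ?err_ge0//.
have := err_le k Lf Lg; rewrite ger0_norm in Hm; last by apply: Int_ge0 => x _; exact: sqr_ge0.
lra.
Unshelve. all: by end_near. Qed.

End L2_convergence.

(** * Convergence of mollifications for all L^2 functions *)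

Section density.
Context {R : realType} {n : nat}.
Local Notation mu := (lebesgue_rV R n).
Implicit Types (f g h : 'rV[R]_n -> R) (x y : 'rV[R]_n) (eps : R).
Local Notation ker := (zker (@kap0 n)).
Local Notation mass := (@mass R n).

Lemma Int_dominated (F : nat -> 'rV[R]_n -> R) f g :
  (forall k, measurable_fun setT (F k)) -> measurable_fun setT f ->
  {ae mu, forall x, cube 1 x -> F ^~ x @ \oo --> f x} ->
  L1 g -> (forall k x, cube 1 x -> `|F k x| <= g x) ->
  (fun k => Int (F k)) @ \oo --> Int f.
Proof.
move=> mF mf Ff Lg Fg.
have mF' k : measurable_fun (cube 1) (fun x => (F k x)%:E).
  by apply/measurable_EFinP; exact: measurable_funTS.
have mf' : measurable_fun (cube 1) (fun x => (f x)%:E).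
  by apply/measurable_EFinP; exact: measurable_funTS.
have Ff' : {ae mu, forall x, cube 1 x -> (fun k => (F k x)%:E) @ \oo --> (f x)%:E}.
  apply: filterS Ff => x H /H; apply: cvg_EFin; exact: nearW.
have Fg' : {ae mu, forall x k, cube 1 x -> (`|(F k x)%:E| <= (EFin \o g) x)%E}.
  by apply: aeW => x k xQ; rewrite /= lee_fin; exact: Fg.
have [If _ H] := dominated_convergence (measurable_cube 1) mF' mf' Ff' Lg Fg'.
apply: fine_cvg; rewrite fineK//.
by apply: integrable_fin_num => //; exact: measurable_cube.
Qed.

(** Coordinate hyperplanes are null sets. This disposes of the faces of boxes here and of the origin
    later on. *)
Lemma ae_coord_neq (c : 'I_n -> R) : {ae mu, forall x, forall i, x 0 i != c i}.
Proof.
have H (m : nat) : {ae mu, forall x, forall i : 'I_n, val i = m -> x 0 i != c i}.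
  have [nm|mn] := leqP n m.
    by apply: aeW => x i im; have := ltn_ord i; rewrite im ltnNge nm.
  pose i := Ordinal mn.
  exists [set x : 'rV[R]_n | x 0 i = c i]; split.
  - rewrite (_ : [set x | _] = (fun x : 'rV[R]_n => x 0 i) @^-1` [set c i])//.
    by rewrite -[X in measurable X]setTI; exact: measurable_rV_coord.
  - pose A j : set (measurableTypeR R) := if j == i then [set c i] else setT.
    have -> : [set x : 'rV[R]_n | x 0 i = c i] = [set x | forall j, A j (x 0 j)].
      apply/seteqP; split => x /= h; last by have := h i; rewrite /A eqxx.
      by move=> j; rewrite /A; case: eqP => // ->.
    rewrite lebesgue_rV_box; last by move=> j; rewrite /A; case: eqP.
    rewrite (bigD1 i)//= {1}/A eqxx (_ : lebesgue_measure _ = 0)%E ?mul0e//.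
    exact: lebesgue_measure_set1.
  - move=> x /= /existsNP[j /not_implyP[jm]] /negP; rewrite negbK => /eqP xj.
    by have <- : j = i by exact/val_inj.
have := ae_foralln H; apply: filterS => x h i; exact: (h (val i) i).
Qed.

(** Half-open boxes are stable under intersection and generate the Borel sets, as the Dynkin
    argument below requires. *)
Definition box (a b : 'I_n -> R) : set 'rV[R]_n :=
  [set x | forall i, a i < x 0 i <= b i].

Lemma measurable_box a b : measurable (box a b).
Proof.
have -> : box a b = \bigcap_(i in [set: 'I_n])
  ((fun x : 'rV[R]_n => x 0 i : measurableTypeR R) @^-1` `]a i, b i]%classic).
  by apply/seteqP; split => x /= h i => [_|]; have := h i;
    rewrite /= in_itv/= => // /(_ Logic.I).
apply: fin_bigcap_measurable => [|i _]; first exact: finite_finset.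
by rewrite -[X in measurable X]setTI; exact: measurable_rV_coord.
Qed.

Lemma bm_indic (A : set 'rV[R]_n) : measurable A -> bmfun (\1_A : 'rV[R]_n -> R).
Proof.
move=> mA; split; first exact: measurable_indic.
by exists 1 => x _; rewrite indicE; case: (_ \in _); rewrite ?normr1 ?normr0.
Qed.

Lemma between_stable (a b s t : R) : s != a -> s != b ->
  `|t - s| < `|s - a| -> `|t - s| < `|s - b| -> (a < t <= b) = (a < s <= b).
Proof.
have h1 := ler_norm (t - s); have h2 := ler_norm (s - t); rewrite distrC in h2.
have E (c : R) : s < c -> `|s - c| = c - s by move=> sc; rewrite ltr0_norm ?opprB ?subr_lt0.
have F (c : R) : c < s -> `|s - c| = s - c by move=> sc; rewrite gtr0_norm ?subr_gt0.
rewrite !neq_lt => /orP[] sa /orP[] sb; rewrite ?(E _ sa) ?(E _ sb) ?(F _ sa) ?(F _ sb) => h3 h4;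
  by apply/idP/idP => /andP[h5 h6]; apply/andP; split; lra.
Qed.

(** Off the hyperplanes of its faces, the mollified indicator eventually equals the indicator, and
    both lie between 0 and 1; dominated convergence does the rest. *)
Lemma approximable_box (a b : 'I_n -> R) : (forall i, -1 <= a i) -> (forall i, b i <= 1) ->
  approximable (\1_(box a b) : 'rV[R]_n -> R).
Proof.
move=> a1 b1; have mB := measurable_box a b; have bB := bm_indic mB.
have LB := bm_L2 bB; split => //.
have m01 k x : 0 <= moll (epsk k) (\1_(box a b) : 'rV[R]_n -> R) x <= 1.
  have m0 := @mass_gt0 R n _ (epsk_gt0 k); apply/andP; split.
    rewrite mulr_ge0 ?invr_ge0 ?(ltW m0)//; apply: Int_ge0 => y _.
    by rewrite mulr_ge0 ?ker_ge0.
  rewrite /moll ler_pdivrMl// mulr1.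
  apply: le_trans (Int_ker_le x (@epsk_gt0 R k)).
  apply: le_Int => [||y _]; first exact/L1_conv/L2_L1.
    exact/bm_L1/bm_zker.
  by rewrite ler_piMl ?ker_ge0// indicE; case: (_ \in _).
rewrite -[X in _ --> X](@Int0 R n).
apply: (@Int_dominated _ _ (fun=> 1)).
- move=> k; apply: measurable_funX; apply: measurable_funB; last by case: bB.
  by have [] := bm_moll (epsk k) LB.
- exact: measurable_cst.
- have := ae_coord_neq b; have := ae_coord_neq a; apply: filterS2 => x xa xb _.
  (* The distance from x to the nearest face hyperplane, capped at 1. Moving each coordinate by less
     than this does not change membership in the box. *)
  pose d := \big[Order.min/(1 : R)]_i Order.min `|x 0 i - a i| `|x 0 i - b i|.
  have d0 : 0 < d.
    apply: (big_ind (fun r : R => 0 < r)) => // [u v u0 v0|i _]; first by rewrite lt_min u0.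
    by rewrite lt_min !normr_gt0 !subr_eq0 xa xb.
  have dB y : (forall i, `|y 0 i - x 0 i| < d) ->
      \1_(box a b) y = \1_(box a b) x :> R.
    move=> yx; rewrite !indicE; congr (nat_of_bool _)%:R.
    suff H i : (a i < y 0 i <= b i) = (a i < x 0 i <= b i).
      apply/idP/idP; rewrite !inE => h i; first by rewrite -H.
      by rewrite H.
    have : `|y 0 i - x 0 i| < Order.min `|x 0 i - a i| `|x 0 i - b i|.
      by apply: (lt_le_trans (yx i)); exact: bigmin_le_cond.
    by rewrite lt_min => /andP[h1 h2]; exact: between_stable.
  have : \forall k \near \oo, cst 0 k = (moll (epsk k) (\1_(box a b) : 'rV[R]_n -> R) x - \1_(box a b) x) ^+ 2.
    have : @epsk R @ \oo --> (0 : R) by exact: cvg_harmonic.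
    move=> /cvgr0_norm_lt /(_ _ d0); apply: filterS => k.
    rewrite gtr0_norm ?epsk_gt0// => kd.
    suff -> : moll (epsk k) (\1_(box a b) : 'rV[R]_n -> R) x = \1_(box a b) x.
      by rewrite subrr expr0n.
    have kx y : \1_(box a b) y * ker (epsk k) x y = \1_(box a b) x * ker (epsk k) x y.
      have [h|/existsNP[i]] := pselect (forall i, `|y 0 i - x 0 i| < epsk k).
        by rewrite dB// => i; rewrite (lt_trans (h i)).
      move=> /negP; rewrite -leNgt => h.
      by rewrite (zker_out _ (epsk_gt0 k) h) !mulr0.
    have m0 := @mass_gt0 R n _ (epsk_gt0 k).
    rewrite /moll /conv (_ : Int _ = \1_(box a b) x * Int (ker (epsk k) x)); last first.
      rewrite -IntZ; last exact/bm_L1/bm_zker.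
      by apply: eq_Int => y _; exact: kx.
    have [xB|xB] := pselect (box a b x); last by rewrite indicE memNset// mul0r mulr0.
    move: kx; rewrite indicE mem_set// mul1r => kx.
    (* For x in the box the kernel is carried by the box, hence by the unit cube, so the integral
       over the cube is the full mass. *)
    rewrite (_ : Int (ker (epsk k) x) = mass (epsk k)) ?mulVf ?gt_eqF//.
    rewrite IntE; first by rewrite /Rintegral massE ?epsk_gt0.
    move=> y yQ; have := kx y; rewrite mul1r => <-.
    rewrite indicE memNset ?mul0r// => yB; apply: yQ => i.
    have /andP[h1 h2] := yB i; have := a1 i; have := b1 i.
    rewrite ler_norml; lra.
  by move=> h; apply: (cvg_trans (near_eq_cvg h)); exact: cvg_cst.
- exact/bm_L1/bmfun_cst.
- move=> k x _; have /andP[h1 h2] := m01 k x.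
  rewrite ger0_norm ?sqr_ge0// -(real_normK (num_real _)) expr_le1//.
  rewrite ler_norml indicE; case: (_ \in _) => /=; lra.
Qed.

Local Notation Q := (box (fun=> -1) (fun=> 1)).

Let boxes := [set box ab.1 ab.2 | ab in [set: ('I_n -> R) * ('I_n -> R)]].

Lemma setI_closed_boxes : setI_closed boxes.
Proof.
move=> _ _ [[a b] _ <-] [[c d] _ <-] /=.
exists (fun i => Num.max (a i) (c i), fun i => Num.min (b i) (d i)) => //=.
apply/seteqP; split => x /= h.
  by split => i; have := h i; rewrite gt_max le_min => /andP[/andP[h1 h2] /andP[h3 h4]]; rewrite ?h1 ?h2 ?h3 ?h4.
by move=> i; have /andP[h1 h2] := h.1 i; have /andP[h3 h4] := h.2 i;
  rewrite gt_max le_min h1 h2 h3.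
Qed.

Lemma measurable_boxes : @measurable _ 'rV[R]_n = <<s boxes >>.
Proof.
apply/seteqP; split; last first.
  apply: smallest_sub; first exact: sigma_algebra_measurable.
  by move=> _ [[a b] _ <-]; exact: measurable_box.
apply: smallest_sub; first exact: smallest_sigma_algebra.
rewrite -bigcup_seq; apply: bigcup_sub => i _ _ [Y mY <-]; rewrite setTI.
move: Y mY; apply: (@smallest_sub _ _ _
  [set Y : set R | <<s boxes >> ((fun x : 'rV[R]_n => x 0 i) @^-1` Y)]) => [|_ [[a b] _ <-]] /=.
  split => [|Y|Y] /=; first by rewrite preimage_set0; exact: sigma_algebra0.
    by rewrite setTD preimage_setC; exact: sigma_algebraC.
  by move=> mY; rewrite preimage_bigcup; exact: sigma_algebra_bigcup.
rewrite (_ : _ @^-1` _ = \bigcup_(k in [set: nat]) box (fun j => if j == i then a else - k%:R)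
    (fun j => if j == i then b else k%:R)).
  apply: sigma_algebra_bigcup => k; apply: sub_sigma_algebra.
  by exists ((fun j => if j == i then a else - k%:R), (fun j => if j == i then b else k%:R)).
apply/seteqP; split => x /=; last first.
  by move=> [k _ /(_ i)]; rewrite eqxx in_itv.
rewrite in_itv /= => xab.
have [k Hk] : exists k : nat, \sum_j `|x 0 j| < k%:R.
  by exists (Num.bound (\sum_j `|x 0 j|)); apply: archi_boundP; exact: sumr_ge0.
exists k => // j; case: eqP => [->//|_].
have : `|x 0 j| < k%:R.
  by apply: le_lt_trans Hk; rewrite (bigD1 j)//= lerDl sumr_ge0.
by rewrite ltr_norml => /andP[-> /ltW].
Qed.

(** Dynkin's theorem: the sets with this property contain the boxes and are stable under complements
    and countable disjoint unions. *)
Lemma approximable_indic E : measurable E -> approximable (\1_(E `&` Q) : 'rV[R]_n -> R).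
Proof.
have mQ := measurable_box (fun=> -1) (fun=> 1).
rewrite measurable_boxes => mE; move: E mE.
apply: (dynkin_induction measurable_boxes setI_closed_boxes).
- by rewrite setTI; exact: approximable_box.
- move=> _ [[a b] _ <-] /=.
  have -> : box a b `&` Q = box (fun i => Num.max (a i) (-1)) (fun i => Num.min (b i) 1).
    apply/seteqP; split => x /= h.
      by move=> i; have /andP[h1 h2] := h.1 i; have /andP[h3 h4] := h.2 i;
        rewrite gt_max le_min h1 h2 h3.
    by split => i; have := h i; rewrite gt_max le_min => /andP[/andP[h1 h2] /andP[h3 h4]]; rewrite ?h1 ?h2 ?h3 ?h4.
  by apply: approximable_box => i; rewrite ?le_max ?ge_min lexx orbT.
- move=> S mS aS.
  have := approximableD (approximable_box (fun i => lexx (-1)) (fun i => lexx 1))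
    (approximableZ (-1) aS).
  congr approximable; apply/funext => x; rewrite !indicE !in_setI in_setC.
  by case: (x \in S); case: (x \in _) => /=; ring.
- move=> F mF tF aF.
  have mU : measurable ((\bigcup_k F k) `&` Q).
    by apply: measurableI => //; exact: bigcup_measurable.
  apply: (@approximable_lim _ _ _ (fun m x => \sum_(k < m) \1_(F k `&` Q) x)).
  + exact/bm_L2/bm_indic.
  + by move=> m; apply: approximable_sum => k; exact: aF.
  have sE m x : \sum_(k < m) \1_(F k `&` Q) x = \1_((\bigcup_(k < m) F k) `&` Q) x :> R.
    rewrite -(big_mkord xpredT (fun k => \1_(F k `&` Q) x)) [RHS]indicE in_setI.
    have [xQ|xQ] := boolP (x \in Q); last first.
      rewrite andbF big1// => i _; rewrite indicE in_setI (negbTE xQ) andbF//.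
    rewrite andbT; have [xF|xF] := boolP (x \in \bigcup_(k < m) F k).
      move: (xF); rewrite inE => -[k /= km xk].
      rewrite (bigD1_seq k) ?mem_index_iota ?iota_uniq//= indicE in_setI xQ (mem_set xk)/=.
      rewrite big1 ?addr0// => j jk; rewrite indicE in_setI xQ andbT memNset// => xj.
      move/trivIsetP : tF => /(_ j k Logic.I Logic.I jk) /seteqP[+ _] => /(_ x); exact.
    rewrite big_nat_cond big1// => k /andP[/andP[_ km] _].
    rewrite indicE in_setI xQ andbT memNset// => xk.
    by move/negP : xF; apply; rewrite inE; exists k.
  rewrite -[X in _ --> X](@Int0 R n).
  apply: (@Int_dominated _ _ (fun=> 1)).
  + move=> m; apply: measurable_funX; apply: measurable_funB; first exact: measurable_indic.
    rewrite (_ : (fun _ => _) = \1_((\bigcup_(k < m) F k) `&` Q)); last exact/funext/sE.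
    by apply/measurable_indic/measurableI => //; exact: bigcup_measurable.
  + exact: measurable_cst.
  + apply: aeW => x _.
    have H : \forall m \near \oo, cst 0 m =
        (\1_((\bigcup_k F k) `&` Q) x - \sum_(k < m) \1_(F k `&` Q) x) ^+ 2 :> R.
      have [[k _ xk]|xU] := pselect ((\bigcup_k F k) x).
        exists k.+1 => // m /= km; rewrite sE !indicE !in_setI.
        have -> : x \in \bigcup_k F k by rewrite inE; exists k.
        have -> : x \in \bigcup_(k < m) F k by rewrite inE; exists k.
        by rewrite subrr expr0n.
      apply: nearW => m; rewrite sE !indicE !in_setI.
      have -> : (x \in \bigcup_k F k) = false by apply: memNset.
      have -> : (x \in \bigcup_(k < m) F k) = false.
        by apply: memNset => -[k _ xk]; apply: xU; exists k.
      by rewrite subrr expr0n.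
    by apply: (cvg_trans (near_eq_cvg H)); exact: cvg_cst.
  + exact/bm_L1/bmfun_cst.
  + move=> m x _; rewrite sE !indicE ger0_norm ?sqr_ge0//.
    by case: (_ \in _); case: (_ \in _) => /=; rewrite ?subrr ?subr0 ?sub0r ?sqrrN ?expr1n ?expr0n.
Qed.

Import HBSimple HBNNSimple.

(** Simple functions increase to f and converge in L^2 by domination. They vanish with f outside Q,
    so only level sets inside Q matter. *)
Lemma approximable_ge0 f : L2 f -> (forall x, 0 <= f x) -> (forall x, ~ Q x -> f x = 0) ->
  approximable f.
Proof.
move=> Lf f0 fQ; have [mf Lf2] := Lf.
have mf' : measurable_fun setT (EFin \o f) by exact/measurable_EFinP.
pose g := nnsfun_approx measurableT mf'.
have gf x : (fun m => g m x) @ \oo --> f x.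
  have H : (EFin \o (fun m => g m x)) @ \oo --> (f x)%:E.
    by apply: (cvg_nnsfun_approx measurableT mf') => // y _; rewrite lee_fin.
  by move/fine_cvgP : H => [].
have gle m x : g m x <= f x.
  rewrite -(cvg_lim _ (gf x))//; apply: nondecreasing_cvgn_le; last by apply/cvg_ex; exists (f x).
  move=> a b ab; exact/lefP/(nd_nnsfun_approx measurableT mf' ab).
have g0 m x : 0 <= g m x by [].
apply: (@approximable_lim _ _ _ (fun m => g m)) => // [m|].
  have -> : (g m : 'rV[R]_n -> R) = fun x => \sum_(y <- finmap.enum_fset (fset_set (range (g m))))
      y * \1_(g m @^-1` [set y] `&` Q) x.
    apply/funext => x; rewrite fimfunE fsbig_finite//=; apply: eq_bigr => y _.
    rewrite !indicE in_setI; have [xQ|xQ] := pselect (Q x); first by rewrite (mem_set xQ) andbT.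
    rewrite (memNset xQ) andbF; have [xy|xy] := pselect (g m x = y); last first.
      by rewrite memNset.
    by rewrite -xy (_ : g m x = 0) ?mul0r//; apply/eqP; rewrite eq_le g0 andbT -(fQ x xQ).
  apply: approximable_sum => y; apply: approximableZ; apply: approximable_indic.
  exact: measurable_funPTI.
rewrite -[X in _ --> X](@Int0 R n).
apply: (@Int_dominated _ _ (fun x => f x ^+ 2)) => //.
- by move=> k; apply: measurable_funX; exact: measurable_funB.
- apply: aeW => x _; rewrite -[X in _ --> X](_ : (f x - f x) ^+ 2 = 0); last by rewrite subrr expr0n.
  have H : (fun m => f x - g m x) @ \oo --> f x - f x by apply: cvgB => //; exact: cvg_cst.
  by rewrite expr2; under eq_fun do rewrite expr2; exact: cvgM.
- move=> k x _; rewrite ger0_norm ?sqr_ge0// ler_pXn2r ?nnegrE ?subr_ge0//.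
  by rewrite lerBlDr lerDl.
Qed.

Lemma approximable_L2 f : L2 f -> (forall x, ~ Q x -> f x = 0) -> approximable f.
Proof.
move=> [mf Lf] fQ.
have H (h : 'rV[R]_n -> R) : measurable_fun setT h -> (forall x, 0 <= h x) ->
    (forall x, h x <= `|f x|) -> approximable h.
  move=> mh h0 hf; apply: approximable_ge0 => //.
    split => //; apply: (le_L1 _ _ Lf); first exact: measurable_funX.
    move=> x _; rewrite ger0_norm ?sqr_ge0// -(real_normK (num_real (f x))).
    by rewrite ler_pXn2r ?nnegrE.
  by move=> x xQ; apply/eqP; rewrite eq_le h0 andbT (le_trans (hf x))// fQ// normr0.
have hp : approximable (fun x => Num.max (f x) 0).
  apply: H => // [|x|x]; first by apply: measurable_maxr => //; exact: measurable_cst.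
  - by rewrite le_max lexx orbT.
  - by rewrite ge_max ler_norm normr_ge0.
have hn : approximable (fun x => Num.max (- f x) 0).
  apply: H => // [|x|x].
  - by apply: measurable_maxr; [exact: measurableT_comp|exact: measurable_cst].
  - by rewrite le_max lexx orbT.
  - by rewrite ge_max -normrN ler_norm normr_ge0.
have := approximableD hp (approximableZ (-1) hn).
congr approximable; apply/funext => x.
by have [h|h] := leP (f x) 0; have [h'|h'] := leP (- f x) 0; lra.
Qed.

Lemma cvg_Int_moll_sqr f xi : L2 f -> (forall x, ~ Q x -> f x = 0) -> bmfun xi ->
  (fun k => Int (fun x => xi x * moll (epsk k) f x ^+ 2)) @ \oo --> Int (fun x => xi x * f x ^+ 2).
Proof.
move=> Lf fQ bxi; have [_ ae] := approximable_L2 Lf fQ.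
have [mxi [C Cxi]] := bxi; set S := Int (fun x => f x ^+ 2).
have S0 : 0 <= S by apply: Int_ge0 => x _; exact: sqr_ge0.
pose C' : R := `|C| + 1; have C0 : 0 < C' by rewrite ltr_wpDl.
apply/cvgrPdistC_lt => e e0.
have CS0 : 0 <= C' * S by rewrite mulr_ge0// ltW.
have CS : 0 < C' * S + 1 by rewrite ltr_wpDl.
(* The difference of squares is at most (1 + 1/d) (m - f)^2 + d f^2. The number d is chosen first so
   that the second term costs less than e / 2; the mollification error then takes care of the
   first. *)
have [d d0 dS] : exists2 d : R, 0 < d & C' * (d * S) < e / 2.
  have D0 : 0 < 2 * (C' * S + 1) by rewrite mulr_gt0.
  have d0 := divr_gt0 e0 D0; exists (e / (2 * (C' * S + 1))) => //.
  have := divfK (lt0r_neq0 D0) e; move: d0; set d : R := e / (_ * _) => d0 dE.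
  by rewrite mulrCA -dE; move: d0; lra.
pose B : R := C' * (1 + d^-1); have B0 : 0 < B by rewrite mulr_gt0// addr_gt0// invr_gt0.
have e2 : 0 < e / 2 / B by rewrite !divr_gt0.
have cgn : \forall k \near \oo, `|err f k| < e / 2 / B.
  exact: ((cvgr0Pnorm_lt _).1 ae _ e2).
near=> k; have Hk : `|err f k| < e / 2 / B by near: k.
rewrite ger0_norm ?err_ge0// ltr_pdivlMr// in Hk.
have Lm := L2_moll (epsk k) Lf; set m := moll _ f.
have i1 := L2_sqr (L2B Lm Lf); have i2 := L2_sqr Lf; have i3 := L2_sqr Lm.
have j1 : L1 (fun x => xi x * m x ^+ 2) by exact: L1_bmM.
have j2 : L1 (fun x => xi x * f x ^+ 2) by exact: L1_bmM.
have P x : cube 1 x -> `|xi x * m x ^+ 2 - xi x * f x ^+ 2| <=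
    B * (m x - f x) ^+ 2 + C' * d * f x ^+ 2.
  move=> xQ; rewrite -mulrBr normrM.
  apply: (@le_trans _ _ (C' * `|m x ^+ 2 - f x ^+ 2|)).
    rewrite ler_wpM2r// (le_trans (Cxi x xQ))// /C' (le_trans (ler_norm _))// lerDl//.
  rewrite /B -!mulrA -mulrDr ler_pM2l//.
  have -> : m x ^+ 2 - f x ^+ 2 = (m x - f x) ^+ 2 + 2 * (m x - f x) * f x by ring.
  have V : d^-1 * (m x - f x) ^+ 2 + d * f x ^+ 2 >= `|2 * (m x - f x) * f x|.
    have dd : d^-1 * d = 1 by rewrite mulVf// gt_eqF.
    rewrite ler_norml; apply/andP; split; rewrite -subr_ge0.
      rewrite (_ : _ - _ = d^-1 * ((m x - f x) + d * f x) ^+ 2 +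
        (1 - d^-1 * d) * (2 * (m x - f x) * f x + d * f x ^+ 2)); last by ring.
      by rewrite dd subrr mul0r addr0 mulr_ge0 ?sqr_ge0// ltW// invr_gt0.
    rewrite (_ : _ - _ = d^-1 * ((m x - f x) - d * f x) ^+ 2 +
      (1 - d^-1 * d) * (- (2 * (m x - f x) * f x) + d * f x ^+ 2)); last by ring.
    by rewrite dd subrr mul0r addr0 mulr_ge0 ?sqr_ge0// ltW// invr_gt0.
  apply: (le_trans (ler_normD _ _)).
  by rewrite (ger0_norm (sqr_ge0 _)); move: V; lra.
have le1 : Int (fun x => B * (m x - f x) ^+ 2 + C' * d * f x ^+ 2) < e.
  rewrite IntD ?IntZ//; try exact: L1Z.
  by rewrite -/S -/(err f k) mulrC -mulrA; move: Hk dS; lra.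
rewrite -IntN// -IntD//; last exact: L1N.
have LR : L1 (fun x => B * (m x - f x) ^+ 2 + C' * d * f x ^+ 2).
  by apply: L1D; exact: L1Z.
have LD : L1 (fun x => xi x * m x ^+ 2 - xi x * f x ^+ 2) by apply: L1D => //; exact: L1N.
rewrite ltr_norml; apply/andP; split.
  rewrite ltrNl -IntN//; apply: le_lt_trans le1; apply: le_Int => //; first exact: L1N.
  by move=> x xQ; have := P x xQ; rewrite ler_norml lerNl => /andP[].
apply: le_lt_trans le1; apply: le_Int => // x xQ.
by have := P x xQ; rewrite ler_norml => /andP[].
Unshelve. all: by end_near. Qed.

End density.

(** * Passage to the limit *)

Section mollified_derivatives.
Context {R : realType} {n : nat}.
Implicit Types (f g h : 'rV[R]_n -> R) (x y : 'rV[R]_n) (eps c : R) (kap : 'I_n -> nat).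

Definition mollk kap eps f x : R := (mass (n := n) eps)^-1 * conv kap eps f x.

Lemma bm_mollk kap eps f : L2 f -> bmfun (mollk kap eps f).
Proof.
move=> Lf; apply: bmfunM; first exact: bmfun_cst.
by apply: bm_conv; [case: Lf|exact: L2_L1].
Qed.

Lemma C1fun_mollk c kap eps f : L2 f ->
  C1fun (fun x => c * mollk kap eps f x) (fun b x => c * - eps^-1 * mollk (incr kap b) eps f x).
Proof.
move=> Lf; have Hb d k : bmfun (fun x => d * mollk k eps f x).
  by apply: bmfunM; [exact: bmfun_cst|exact: bm_mollk].
split=> // b x.
have := is_derive_mul (is_derive_cst (c * (mass (n := n) eps)^-1) x (delta_mx 0 b : 'rV[R]_n))
  (is_derive_conv kap eps x b (L2_L1 Lf)).
rewrite mul0r add0r (_ : _ * (_ * _) = c * - eps^-1 * mollk (incr kap b) eps f x).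
  by congr is_derive; apply/funext => y; rewrite /= /mollk mulrA.
by rewrite /cst /mollk; ring.
Qed.

(** Derivatives of the mollification; each sign comes from differentiating the kernel in its centre
    and not in its argument. *)
Definition D1 eps f (i : 'I_n) x : R := - eps^-1 * mollk (incr (@kap0 n) i) eps f x.
Definition D2 eps f (i j : 'I_n) x : R :=
  - eps^-1 * - eps^-1 * mollk (incr (incr (@kap0 n) i) j) eps f x.

Lemma C2fun_moll eps f : L2 f -> C2fun (moll eps f) (D1 eps f) (D2 eps f).
Proof.
move=> Lf; split.
- have := C1fun_mollk 1 (@kap0 n) eps Lf.
  congr C1fun; first by apply/funext => x; rewrite mul1r.
  by apply/funext => i; apply/funext => x; rewrite mul1r.
- by move=> i; exact: C1fun_mollk.
- by move=> i j x; rewrite /D2 incrC.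
Qed.

Lemma C2funB f df ddf g dg ddg : C2fun f df ddf -> C2fun g dg ddg ->
  C2fun (fun x => f x - g x) (fun i x => df i x - dg i x) (fun i j x => ddf i j x - ddg i j x).
Proof.
move=> [Cf Cdf sf] [Cg Cdg sg]; split.
- exact: (C1funD Cf (C1funN Cg)).
- by move=> i; exact: (C1funD (Cdf i) (C1funN (Cdg i))).
- by move=> i j x; rewrite sf sg.
Qed.

Definition D3 eps f (i j k : 'I_n) x : R := - eps^-1 * - eps^-1 * - eps^-1 *
  mollk (incr (incr (incr (@kap0 n) i) j) k) eps f x.

Lemma C2fun_D1 eps f i : L2 f -> C2fun (D1 eps f i) (D2 eps f i) (D3 eps f i).
Proof.
move=> Lf; split; [exact: C1fun_mollk|by move=> j; exact: C1fun_mollk|].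
by move=> j k x; rewrite /D3 incrC.
Qed.

End mollified_derivatives.

Section weak_limits.
Context {R : realType} {n : nat}.
Implicit Types (f g h xi : 'rV[R]_n -> R) (x y : 'rV[R]_n) (eps c : R).
Implicit Types (q r : nat -> 'rV[R]_n -> R) (Q P : 'rV[R]_n -> R).

(** Weak convergence against bounded multipliers. It is applied to sums of squares of mollified
    functions, so that an inequality between weighted integrals passes to the limit whatever the
    weights are. *)
Definition wlim q Q := [/\ forall k, bmfun (q k), L1 Q & forall xi, bmfun xi ->
  (fun k => Int (fun x => xi x * q k x)) @ \oo --> Int (fun x => xi x * Q x)].

Lemma wlimD q r Q P : wlim q Q -> wlim r P ->
  wlim (fun k x => q k x + r k x) (fun x => Q x + P x).
Proof.
move=> [bq LQ cq] [br LP cr]; split; [by move=> k; exact: bmfunD|exact: L1D|].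
move=> xi bxi.
rewrite (_ : (fun k => _) = (fun k => Int (fun x => xi x * q k x) + Int (fun x => xi x * r k x))).
  have -> : Int (fun x => xi x * (Q x + P x)) = Int (fun x => xi x * Q x) + Int (fun x => xi x * P x).
    by rewrite -IntD; try exact: L1_bmM; apply: eq_Int => x _; rewrite mulrDr.
  by apply: cvgD; [exact: cq|exact: cr].
apply/funext => k; rewrite -IntD; try exact/bm_L1/bmfunM.
by apply: eq_Int => x _; rewrite mulrDr.
Qed.

Lemma wlimZ c q Q : wlim q Q -> wlim (fun k x => c * q k x) (fun x => c * Q x).
Proof.
move=> [bq LQ cq]; split => [k||xi bxi]; [exact/bmfunM/bq/bmfun_cst|exact: L1Z|].
have -> : (fun k => Int (fun x => xi x * (c * q k x))) = (fun k => Int (fun x => c * xi x * q k x)).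
  by apply/funext => k; apply: eq_Int => x _; ring.
have -> : Int (fun x => xi x * (c * Q x)) = Int (fun x => c * xi x * Q x).
  by apply: eq_Int => x _; ring.
exact: (cq (fun x => c * xi x) (bmfunM (bmfun_cst c) bxi)).
Qed.

Lemma wlim_sum (I : Type) (s : seq I) (q : I -> nat -> 'rV[R]_n -> R) (Q : I -> 'rV[R]_n -> R) :
  (forall i, wlim (q i) (Q i)) ->
  wlim (fun k x => \sum_(i <- s) q i k x) (fun x => \sum_(i <- s) Q i x).
Proof.
move=> cq; elim: s => [|i s IH].
  rewrite (_ : (fun _ => _) = (fun _ _ => 0)); last by apply/funext => k; apply/funext => x; rewrite big_nil.
  rewrite (_ : (fun x => \sum_(i <- [::]) Q i x) = (fun=> 0)); last by apply/funext => x; rewrite big_nil.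
  split; [by move=> k; exact: bmfun_cst|exact/bm_L1/bmfun_cst|move=> xi _].
  exact: cvg_cst.
have := wlimD (cq i) IH; congr wlim; last by apply/funext => x; rewrite big_cons.
by apply/funext => k; apply/funext => x; rewrite big_cons.
Qed.

Local Notation Qbox := (box (fun=> -1) (fun=> 1)).

Lemma wlim_moll f : L2 f -> (forall x, ~ Qbox x -> f x = 0) ->
  wlim (fun k x => moll (epsk k) f x ^+ 2) (fun x => f x ^+ 2).
Proof.
move=> Lf fQ; split; [by move=> k; exact/bmfunX/bm_moll|by case: Lf|].
by move=> xi; exact: cvg_Int_moll_sqr.
Qed.

Lemma wlim_le (q1 q2 q3 q4 : nat -> 'rV[R]_n -> R) (Q1 Q2 Q3 Q4 xi1 xi2 xi3 xi4 : 'rV[R]_n -> R) :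
  wlim q1 Q1 -> wlim q2 Q2 -> wlim q3 Q3 -> wlim q4 Q4 ->
  bmfun xi1 -> bmfun xi2 -> bmfun xi3 -> bmfun xi4 ->
  (\forall k \near \oo, Int (fun x => xi1 x * q1 k x) <= Int (fun x => xi2 x * q2 k x) +
    Int (fun x => xi3 x * q3 k x) + Int (fun x => xi4 x * q4 k x)) ->
  Int (fun x => xi1 x * Q1 x) <= Int (fun x => xi2 x * Q2 x) +
    Int (fun x => xi3 x * Q3 x) + Int (fun x => xi4 x * Q4 x).
Proof.
move=> [_ _ c1] [_ _ c2] [_ _ c3] [_ _ c4] b1 b2 b3 b4.
apply: ler_cvg_to; first exact: c1.
by apply: cvgD; [apply: cvgD; [exact: c2|exact: c3]|exact: c4].
Qed.

End weak_limits.

(** * Annuli and cells inside them *)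

Section annulus.
Context {R : realType} {n : nat}.
Implicit Types (x y : 'rV[R]_n) (t s eps : R).

Definition annulus t0 t1 : set 'rV[R]_n := [set x | t0 < logr x < t1].

Definition cell_in t0 t1 eps x :=
  forall y, (forall i, `|y 0 i - x 0 i| <= eps) -> annulus t0 t1 y.

Lemma annulus_sq t0 t1 x : t1 <= 0 -> annulus t0 t1 x <->
  expR (2 * t0) < sq x < expR (2 * t1).
Proof.
move=> t1_le0; have [->|x0] := eqVneq x 0.
  rewrite /annulus /= logr0; split => /andP[h1 h2]; first lra.
  have := expR_gt0 (2 * t0); have : sq (0 : 'rV[R]_n) = 0.
    by rewrite /sq big1// => i _; rewrite mxE expr0n.
  move=> h3 h4; rewrite h3 in h1; lra.
by rewrite /annulus /= -expR_logr// !ltr_expR !ltr_pM2l.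
Qed.

Lemma sq_near x y eps : cube 1 x -> 0 < eps -> eps <= 1 -> (forall i, `|y 0 i - x 0 i| <= eps) ->
  `|sq y - sq x| <= n%:R * 3 * eps.
Proof.
move=> xQ e0 e1 xy; rewrite /sq -sumrB (le_trans (ler_norm_sum _ _ _))//.
rewrite -mulrA mulr_natl -[X in _ *+ X](card_ord n) -sumr_const; apply: ler_sum => i _.
have -> : y 0 i ^+ 2 - x 0 i ^+ 2 = (y 0 i - x 0 i) * ((y 0 i - x 0 i) + 2 * x 0 i) by ring.
rewrite normrM mulrC; apply: ler_pM => //.
rewrite (le_trans (ler_normD _ _))// normrM ger0_norm//.
by have := xy i; have := xQ i; lra.
Qed.

Lemma annulus_nbhs t0 s0 s1 t1 : t0 < s0 -> s1 < t1 -> t1 < 0 ->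
  \forall k \near \oo, forall x y, annulus s0 s1 x ->
    (forall i, `|y 0 i - x 0 i| <= epsk (R := R) k) -> annulus t0 t1 y.
Proof.
move=> ts0 st1 t10; have s10 : s1 <= 0 by lra.
(* The gap between the annuli measured in |x|^2, a quantity that changes by at most 3 n eps within a
   cell. *)
pose d : R := Num.min (expR (2 * s0) - expR (2 * t0)) (expR (2 * t1) - expR (2 * s1)).
have d0 : 0 < d by rewrite lt_min !subr_gt0 !ltr_expR !ltr_pM2l// ts0.
have N0 : 0 < n%:R * 3 + 1 :> R by rewrite ltr_wpDl.
have e0 : 0 < d / (n%:R * 3 + 1) by rewrite divr_gt0.
have ck : @epsk R @ \oo --> (0 : R) by exact: cvg_harmonic.
have H : \forall k \near \oo, `|@epsk R k| < d / (n%:R * 3 + 1) by exact: ((cvgr0Pnorm_lt _).1 ck _ e0).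
apply: filterS H => k; rewrite gtr0_norm ?epsk_gt0// ltr_pdivlMr// => kd x y xA xy.
have k1 : epsk k <= 1 :> R by rewrite invf_le1 ?ler1n.
have xA' := (annulus_sq s0 x s10).1 xA.
have xQ : cube 1 x.
  move=> i; rewrite -(@ler_pXn2r _ 2)// ?nnegrE// expr1n real_normK ?num_real//.
  apply: (le_trans (coord_sq _ _)); case/andP : xA' => _ /ltW h; apply: (le_trans h).
  by rewrite -[leRHS]expR0 ler_expR; lra.
have := sq_near xQ (@epsk_gt0 R k) k1 xy; rewrite ler_norml => /andP[h1 h2].
apply/annulus_sq; first exact: ltW.
have de : n%:R * 3 * epsk k < d by have := @epsk_gt0 R k; move: kd; lra.
move: de; rewrite lt_min => /andP[d1 d2]; case/andP : xA' => h3 h4.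
by apply/andP; split; lra.
Qed.

End annulus.

(** * The inequalities for weak solutions on an annulus *)

Section limits.
Context {R : realType} {n : nat}.
Implicit Types (x y : 'rV[R]_n) (phi : 'rV[R]_n -> R).
Local Notation Qbox := (box (fun=> -1) (fun=> 1)).

Variables (u F : 'I_n -> 'rV[R]_n -> R) (G : 'I_n -> 'I_n -> 'rV[R]_n -> R) (p : 'rV[R]_n -> R).
Hypotheses (Lu : forall i, L2 (u i)) (LG : forall i j, L2 (G i j)) (Lp : L2 p)
  (LF : forall i, L2 (F i)).
Hypotheses (u0 : forall i x, ~ Qbox x -> u i x = 0) (G0 : forall i j x, ~ Qbox x -> G i j x = 0)
  (p0 : forall x, ~ Qbox x -> p x = 0) (F0 : forall i x, ~ Qbox x -> F i x = 0).
Variables t0 t1 : R.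
Hypothesis t1_lt0 : t1 < 0.
Local Notation inside := (cell_in t0 t1).
Hypothesis weak_gradient : forall i j kap (eps : R) x, 0 < eps -> inside eps x ->
  Int (fun y => u i y * (eps^-1 * zker (incr kap j) eps x y)) =
  - Int (fun y => G i j y * zker kap eps x y).
Hypothesis weak_divergence : forall kap (eps : R) x, 0 < eps -> inside eps x ->
  Int (fun y => \sum_i u i y * (eps^-1 * zker (incr kap i) eps x y)) = 0.
Hypothesis weak_equation : forall i kap (eps : R) x, 0 < eps -> inside eps x ->
  Int (fun y => u i y * (\sum_a eps^-1 * (eps^-1 * zker (incr (incr kap a) a) eps x y)) +
    F i y * zker kap eps x y - p y * (eps^-1 * zker (incr kap i) eps x y)) = 0.

Section at_a_point.
Variable (eps : R).
Hypothesis eps_gt0 : 0 < eps.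
Variable x : 'rV[R]_n.
Hypothesis x_in : forall y, (forall i, `|y 0 i - x 0 i| <= eps) -> annulus t0 t1 y.

Let ei := eps^-1.
Let ei0 : ei != 0. Proof. by rewrite invr_eq0 gt_eqF. Qed.

Let Lk (f : 'rV[R]_n -> R) kap : L2 f -> L1 (fun y => f y * zker kap eps x y).
Proof. by move=> Lf; exact/L1_conv/L2_L1. Qed.

(** A kernel centred at x is an admissible test function as soon as its cell lies in the annulus, so
    the weak identity tested with it is the pointwise identity for the mollification at x. *)
Lemma moll_gradient i j : D1 eps (u i) j x = moll eps (G i j) x.
Proof.
have := weak_gradient i j (@kap0 n) eps_gt0 x_in.
rewrite (_ : Int _ = ei * conv (incr (@kap0 n) j) eps (u i) x); last first.
  by rewrite -IntZ; [apply: eq_Int => y _; rewrite mulrCA|exact: Lk].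
rewrite -/(conv _ _ _ _) => H.
by rewrite /D1 /moll /mollk mulNr mulrCA -/ei H mulrN opprK.
Qed.

(** Stated for every multi-index, because the Carleman inequality for the pressure also needs the
    first derivatives of the divergence. *)
Lemma moll_divergence kap : \sum_i mollk (incr kap i) eps (u i) x = 0.
Proof.
have := weak_divergence kap eps_gt0 x_in.
rewrite (@Int_sum R n _ _ (fun i y => u i y * (ei * zker (incr kap i) eps x y))); last first.
  move=> i; have := L1Z ei (Lk (incr kap i) (Lu i)); congr L1.
  by apply/funext => y; rewrite mulrCA.
rewrite (_ : \sum_(i <- _) _ = ei * \sum_i conv (incr kap i) eps (u i) x); last first.
  rewrite mulr_sumr; apply: eq_bigr => i _; rewrite -IntZ; last exact: Lk.
  by apply: eq_Int => y _; rewrite mulrCA.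
move=> /eqP; rewrite mulf_eq0 (negbTE ei0) => /eqP H.
by rewrite /mollk -mulr_sumr H mulr0.
Qed.

Lemma moll_divergence0 : \sum_i D1 eps (u i) i x = 0.
Proof. by rewrite /D1 -mulr_sumr moll_divergence mulr0. Qed.

Lemma moll_divergence1 k : \sum_i D2 eps (u i) i k x = 0.
Proof.
rewrite /D2 -mulr_sumr (_ : \sum_i _ = 0) ?mulr0//.
under eq_bigr do rewrite incrC.
exact: moll_divergence.
Qed.

Lemma moll_equation i :
  \sum_a D2 eps (u i) a a x + moll eps (F i) x + D1 eps p i x = 0.
Proof.
have := weak_equation i (@kap0 n) eps_gt0 x_in.
rewrite (_ : Int _ = Int (fun y => \sum_a ei * (ei * (u i y * zker (incr (incr (@kap0 n) a) a) eps x y)) +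
    (F i y * zker (@kap0 n) eps x y + (- ei) * (p y * zker (incr (@kap0 n) i) eps x y)))); last first.
  apply: eq_Int => y _; rewrite mulr_sumr -addrA; congr (_ + (_ + _)).
    by apply: eq_bigr => a _; rewrite /ei; ring.
  by rewrite /ei; ring.
have L1a a : L1 (fun y => ei * (ei * (u i y * zker (incr (incr (@kap0 n) a) a) eps x y))).
  by do 2 apply: L1Z; exact: Lk.
rewrite IntD; last 2 first.
- exact: L1_sum.
- by apply: L1D; [exact: Lk|apply: L1Z; exact: Lk].
rewrite IntD; [|exact: Lk|by apply: L1Z; exact: Lk].
rewrite IntZ; last exact: Lk.
rewrite Int_sum//.
rewrite (_ : \sum_(a <- _) _ = ei * ei * \sum_a conv (incr (incr (@kap0 n) a) a) eps (u i) x); last first.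
  rewrite mulr_sumr; apply: eq_bigr => a _; rewrite -mulrA -!IntZ//; last exact: Lk.
  by apply: L1Z; exact: Lk.
rewrite -!/(conv _ _ _ _) => H.
rewrite /D2 -mulr_sumr /D1 /mollk -mulr_sumr /moll -/ei.
set a := \sum_(_ | _) _ in H *; set b := conv _ _ (F i) _ in H *; set c := conv _ _ p _ in H *.
transitivity ((mass (n := n) eps)^-1 * (ei * ei * a + (b + (- ei) * c))); first by ring.
by rewrite H mulr0.
Qed.

End at_a_point.

Variables s0 s1 : R.
Hypotheses (ts0 : t0 < s0) (st1 : s1 < t1).

Let near_in : \forall k \near \oo, forall x, annulus s0 s1 x ->
  forall y, (forall i, `|y 0 i - x 0 i| <= epsk (R := R) k) -> annulus t0 t1 y.
Proof.
have := @annulus_nbhs R n t0 s0 s1 t1 ts0 st1 t1_lt0.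
by apply: filterS => k H x xA y; exact: H.
Qed.

Let W x := 2 * p x ^+ 2 + \sum_i \sum_j (G j i x - G i j x) ^+ 2.
Let W' k x := 2 * moll (epsk k) p x ^+ 2 +
  \sum_i \sum_j moll (epsk k) (fun y => G j i y - G i j y) x ^+ 2.

Let wlimW : wlim W' W.
Proof.
apply: wlimD; first exact/wlimZ/wlim_moll.
do 2 apply: wlim_sum => ?; apply: wlim_moll; first exact: L2B.
by move=> x xQ; rewrite !G0// subrr.
Qed.

Let Int0M (f : 'rV[R]_n -> R) : Int (fun x => 0 * f x) = 0.
Proof. by rewrite -[RHS](@Int0 R n); apply: eq_Int => x _; rewrite mul0r. Qed.

Let mulwl (c a b : R) : (c != 0 -> a = b) -> c * a = c * b.
Proof. by have [->|c0 ->//] := eqVneq c 0; rewrite !mul0r. Qed.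

Let bsq : bmfun (@sq R n).
Proof. by apply: bmfun_sum => i; apply: bmfunX; exact: bmfun_coord. Qed.

Section carleman.
Variables chi dchi E Psi dPsi : R -> R.
Hypotheses (wchi : weight1 chi dchi)
  (chi0 : forall t, ~ (s0 < t < s1) -> chi t = 0)
  (dchi0 : forall t, ~ (s0 < t < s1) -> dchi t = 0)
  (E0 : forall t : R, t < 0 -> 0 <= E t)
  (dE : forall t : R, t < 0 -> is_derive t (1 : R) E ((2 * Psi t - n%:R) * E t))
  (dP : forall t : R, t < 0 -> is_derive t (1 : R) Psi (dPsi t))
  (cP : forall t : R, t < 0 -> {for t, continuous dPsi}).

Let cE (t : R) : t < 0 -> {for t, continuous E}.
Proof. by move=> /dE/(@is_derive_continuous R E (fun t => (2 * Psi t - n%:R) * E t)). Qed.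

Let wc : weight0 (fun t => chi t * chi t * E t).
Proof. by case: wchi => w _ _; do 2 apply: weight0M => //; move=> t _; exact: w.1. Qed.
Let wd : weight0 (fun t => dchi t * dchi t * E t).
Proof. by case: wchi => _ w _; do 2 apply: weight0M => //; move=> t _; exact: w.1. Qed.
Let wP : weight0 (fun t => chi t * chi t * (E t * dPsi t)).
Proof.
case: wchi => w _ _; apply: weight0M => [|t t_lt0]; last by apply: cvgM; [exact: cE|exact: cP].
by apply: weight0M => // t _; exact: w.1.
Qed.

Let chi_in x : chi (logr x) != 0 -> annulus s0 s1 x.
Proof. by move=> h; apply: contrapT => xA; move/eqP : h; apply; exact: chi0. Qed.
Let dchi_in x : dchi (logr x) != 0 -> annulus s0 s1 x.
Proof. by move=> h; apply: contrapT => xA; move/eqP : h; apply; exact: dchi0. Qed.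
Let sq_in (a b : R) : a * a * b != 0 -> a != 0.
Proof. by apply: contraNneq => ->; rewrite !mul0r. Qed.

(** For the curl w of the mollified velocity, sum_i d_i w_ij + d_j p is the Laplacian of u_j minus
    d_j div u plus d_j p, which the equation reduces to minus the mollified drift. *)
Lemma limit_pressure :
  Int (fun x => chi (logr x) * chi (logr x) * (E (logr x) * dPsi (logr x)) * W x) <=
  Int (fun x => (chi (logr x) * chi (logr x) * E (logr x) * (2 * sq x)) * \sum_j F j x ^+ 2) +
  Int (fun x => dchi (logr x) * dchi (logr x) * E (logr x) * W x).
Proof.
have bE := weight_bm (n := n) wc.
(* A term with weight 0 brings the inequality to the four-term form of [wlim_le], which is cut to
   the shape of the Caccioppoli inequality. *)
have addZ (a b : R) : a <= b + Int (fun x => 0 * W x) -> a <= b by rewrite Int0M addr0.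
apply: addZ.
have wF : wlim (fun k x => \sum_j moll (epsk k) (F j) x ^+ 2) (fun x => \sum_j F j x ^+ 2).
  by apply: wlim_sum => j; exact: (wlim_moll (LF j) (@F0 j)).
apply: (wlim_le wlimW wF wlimW wlimW).
- exact: (weight_bm wP).
- by apply: bmfunM => //; apply: bmfunM => //; exact: bmfun_cst.
- exact: (weight_bm wd).
- exact: bmfun_cst.
apply: filterS near_in => k Hk; rewrite Int0M addr0.
have e0 := @epsk_gt0 R k; set eps := epsk k in Hk e0 *.
have Cw i j := C2funB (C2fun_D1 eps i (Lu j)) (C2fun_D1 eps j (Lu i)).
have DC f i j x : D2 eps f i j x = D2 eps f j i x by rewrite /D2 incrC.
have := carleman_pressure (C2fun_moll eps Lp) Cw _ _ _ wchi E0 dE dP cP.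
have WE x : annulus s0 s1 x -> 2 * moll eps p x ^+ 2 +
    \sum_i \sum_j (D1 eps (u j) i x - D1 eps (u i) j x) ^+ 2 = W' k x.
  move=> xA; congr (_ + _); apply: eq_bigr => i _; apply: eq_bigr => j _.
  by rewrite !(moll_gradient e0 (Hk x xA)) mollB//; exact: L2_L1.
have -> : Int (fun x => chi (logr x) * chi (logr x) * (E (logr x) * dPsi (logr x)) *
    (2 * moll eps p x ^+ 2 + \sum_i \sum_j (D1 eps (u j) i x - D1 eps (u i) j x) ^+ 2)) =
    Int (fun x => chi (logr x) * chi (logr x) * (E (logr x) * dPsi (logr x)) * W' k x).
  by apply: eq_Int => x _; apply: mulwl => /sq_in/chi_in/WE.
have -> : Int (fun x => dchi (logr x) * dchi (logr x) * E (logr x) *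
    (2 * moll eps p x ^+ 2 + \sum_i \sum_j (D1 eps (u j) i x - D1 eps (u i) j x) ^+ 2)) =
    Int (fun x => dchi (logr x) * dchi (logr x) * E (logr x) * W' k x).
  by apply: eq_Int => x _; apply: mulwl => /sq_in/dchi_in/WE.
set C := Int (fun x => _ * (2 * (sq x * _))); set D := Int (fun x => _ * \sum_j moll _ _ _ ^+ 2).
suff -> : C = D.
  apply.
  - by move=> i j x; rewrite opprB.
  - by move=> i j a x; rewrite opprB.
  - move=> i j a x; rewrite (DC (u i) j a) (DC (u j) a i) (DC (u a) i j); ring.
apply: eq_Int => x _; rewrite -[RHS]mulrA; apply: mulwl => /sq_in/chi_in xA.
rewrite -mulrA; congr (2 * (_ * _)); apply: eq_bigr => j _.
(* The derivative of the mollified divergence: the only term of sum_i d_i w_ij besides the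
   Laplacian. *)
have dv : \sum_i D2 eps (u i) j i x = 0.
  rewrite -[RHS](moll_divergence1 e0 (Hk x xA) j); apply: eq_bigr => i _; exact: DC.
have := moll_equation e0 (Hk x xA) j; rewrite sumrB dv subr0.
set a := \sum_(_ | _) _; set b := moll _ _ _; set c := D1 _ _ _ _ => H.
by rewrite (_ : a + c = - b) ?sqrrN//; move: H; lra.
Qed.

Lemma limit_velocity :
  Int (fun x => chi (logr x) * chi (logr x) * (E (logr x) * dPsi (logr x)) *
    \sum_j u j x ^+ 2) <=
  Int (fun x => (chi (logr x) * chi (logr x) * E (logr x) * sq x) *
    \sum_i \sum_j (G j i x - G i j x) ^+ 2) +
  Int (fun x => dchi (logr x) * dchi (logr x) * E (logr x) * \sum_j u j x ^+ 2).
Proof.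
have bE := weight_bm (n := n) wc.
have addZ (a b : R) : a <= b + Int (fun x => 0 * W x) -> a <= b by rewrite Int0M addr0.
apply: addZ.
have wu : wlim (fun k x => \sum_j moll (epsk k) (u j) x ^+ 2) (fun x => \sum_j u j x ^+ 2).
  by apply: wlim_sum => j; exact: (wlim_moll (Lu j) (@u0 j)).
have wG : wlim (fun k x => \sum_i \sum_j moll (epsk k) (fun y => G j i y - G i j y) x ^+ 2)
    (fun x => \sum_i \sum_j (G j i x - G i j x) ^+ 2).
  do 2 apply: wlim_sum => ?; apply: wlim_moll; first exact: L2B.
  by move=> x xQ; rewrite !G0// subrr.
apply: (wlim_le wu wG wu wlimW).
- exact: (weight_bm wP).
- by apply: bmfunM.
- exact: (weight_bm wd).
- exact: bmfun_cst.
apply: filterS near_in => k Hk; rewrite Int0M addr0.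
have e0 := @epsk_gt0 R k; set eps := epsk k in Hk e0 *.
have div0 x : chi (logr x) != 0 -> \sum_i D1 eps (u i) i x = 0.
  by move=> /chi_in xA; exact: (moll_divergence0 e0 (Hk x xA)).
have := carleman_velocity (fun j => C2fun_moll eps (Lu j)) wchi E0 dE dP cP div0.
rewrite (_ : Int (fun x => _ * (sq x * _)) = Int (fun x => (chi (logr x) * chi (logr x) * E (logr x) * sq x) *
    \sum_i \sum_j moll eps (fun y => G j i y - G i j y) x ^+ 2))//.
apply: eq_Int => x _; rewrite -[RHS]mulrA; apply: mulwl => /sq_in/chi_in xA; congr (_ * _).
apply: eq_bigr => i _; apply: eq_bigr => j _.
by rewrite !(moll_gradient e0 (Hk x xA)) mollB//; exact: L2_L1.
Qed.

End carleman.

Lemma limit_caccioppoli (eta deta gam : R -> R) : weight1 eta deta ->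
  (forall t, ~ (s0 < t < s1) -> eta t = 0) ->
  (forall t : R, t < 0 -> {for t, continuous gam}) -> (forall t : R, t < 0 -> 0 < gam t) ->
  Int (fun x => (2^-1 * (eta (logr x) * eta (logr x))) * \sum_i \sum_a G i a x ^+ 2) <=
  Int (fun x => (3 * (deta (logr x) * deta (logr x) * expR (- 2 * logr x)) +
      2^-1 * (eta (logr x) * eta (logr x) * (gam (logr x))^-1)) * \sum_i u i x ^+ 2) +
  Int (fun x => eta (logr x) * eta (logr x) * p x ^+ 2) +
  Int (fun x => (2^-1 * (eta (logr x) * eta (logr x) * gam (logr x))) * \sum_i F i x ^+ 2).
Proof.
move=> we eta0 cg g0; have [w w' _] := we.
have wu : wlim (fun k x => \sum_j moll (epsk k) (u j) x ^+ 2) (fun x => \sum_j u j x ^+ 2).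
  by apply: wlim_sum => j; exact: (wlim_moll (Lu j) (@u0 j)).
have wF : wlim (fun k x => \sum_j moll (epsk k) (F j) x ^+ 2) (fun x => \sum_j F j x ^+ 2).
  by apply: wlim_sum => j; exact: (wlim_moll (LF j) (@F0 j)).
have wG : wlim (fun k x => \sum_i \sum_j moll (epsk k) (G i j) x ^+ 2)
    (fun x => \sum_i \sum_j G i j x ^+ 2).
  by apply: wlim_sum => i; apply: wlim_sum => j; exact: (wlim_moll (LG i j) (@G0 i j)).
have w2 : weight0 (fun t => eta t * eta t) by apply: weight0M => // t _; exact: w.1.
have wd2 : weight0 (fun t => deta t * deta t) by apply: weight0M => // t _; exact: w'.1.
have b1 : bmfun (fun x : 'rV[R]_n => 3 * (deta (logr x) * deta (logr x) * expR (- 2 * logr x))).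
  exact: (weight_bm (weight0Z 3 (weight0_expM (-2) wd2))).
have b2 : bmfun (fun x : 'rV[R]_n => 2^-1 * (eta (logr x) * eta (logr x) * (gam (logr x))^-1)).
  apply: (weight_bm (weight0Z _ (weight0M w2 (g := fun t => (gam t)^-1) _))) => t t_lt0.
  by apply: cvgV; [rewrite gt_eqF// g0|exact: cg].
have b3 : bmfun (fun x : 'rV[R]_n => 2^-1 * (eta (logr x) * eta (logr x) * gam (logr x))).
  exact: (weight_bm (weight0Z _ (weight0M w2 cg))).
have b4 : bmfun (fun x : 'rV[R]_n => eta (logr x) * eta (logr x)) by exact: (weight_bm w2).
apply: (wlim_le wG wu (wlim_moll Lp p0) wF) => //.
- by apply: bmfunM => //; exact: bmfun_cst.
- exact: bmfunD.
apply: filterS near_in => k Hk.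
have e0 := @epsk_gt0 R k; set eps := epsk k in Hk e0 *.
have eta_in x : eta (logr x) != 0 -> annulus s0 s1 x.
  by move=> h; apply: contrapT => xA; move/eqP : h; apply; exact: eta0.
have sq_in (a : R) : a * a != 0 -> a != 0.
  by apply: contraNneq => ->; rewrite !mul0r.
have div0 x : eta (logr x) != 0 -> \sum_i D1 eps (u i) i x = 0.
  by move=> /eta_in xA; exact: (moll_divergence0 e0 (Hk x xA)).
have eqn i x : eta (logr x) != 0 ->
    \sum_a D2 eps (u i) a a x + moll eps (F i) x + D1 eps p i x = 0.
  by move=> /eta_in xA; exact: (moll_equation e0 (Hk x xA)).
have Cp : C1fun (moll eps p) (D1 eps p) by have [] := C2fun_moll eps Lp.
have bF i : bmfun (moll eps (F i)) by exact: bm_moll.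
have := caccioppoli (fun j => C2fun_moll eps (Lu j)) Cp bF we cg g0 div0 eqn.
have bsu : bmfun (fun x => \sum_i moll eps (u i) x ^+ 2).
  by apply: bmfun_sum => i; exact/bmfunX/bm_moll.
have bsF : bmfun (fun x => \sum_i moll eps (F i) x ^+ 2).
  by apply: bmfun_sum => i; exact/bmfunX/bm_moll.
rewrite (_ : Int (fun x => _ * \sum_i \sum_a D1 _ _ _ _ ^+ 2) =
  Int (fun x => eta (logr x) * eta (logr x) * \sum_i \sum_a moll eps (G i a) x ^+ 2)); last first.
  apply: eq_Int => x _; apply: mulwl => /sq_in/eta_in xA.
  apply: eq_bigr => i _; apply: eq_bigr => j _.
  by rewrite (moll_gradient e0 (Hk x xA)).
set SG := (fun x => \sum_i \sum_a moll eps (G i a) x ^+ 2).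
have bSG : bmfun SG.
  by apply: bmfun_sum => i; apply: bmfun_sum => j; exact/bmfunX/bm_moll.
have lw (c : R) (f g : 'rV[R]_n -> R) : bmfun f -> bmfun g ->
    Int (fun x => (c * f x) * g x) = c * Int (fun x => f x * g x).
  move=> bf bg; rewrite -IntZ; last exact/bm_L1/bmfunM.
  by apply: eq_Int => x _; rewrite mulrA.
have bd := weight_bm (n := n) (weight0_expM (-2) wd2).
have bg : bmfun (fun x : 'rV[R]_n => eta (logr x) * eta (logr x) * gam (logr x)).
  exact: (weight_bm (weight0M w2 cg)).
have bgV : bmfun (fun x : 'rV[R]_n => eta (logr x) * eta (logr x) * (gam (logr x))^-1).
  apply: (weight_bm (weight0M w2 (g := fun t => (gam t)^-1) _)) => t t_lt0.
  by apply: cvgV; [rewrite gt_eqF// g0|exact: cg].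
rewrite (lw _ _ _ b4 bSG) (lw _ _ _ bg bsF).
have -> : Int (fun x => (3 * (deta (logr x) * deta (logr x) * expR (- 2 * logr x)) +
      2^-1 * (eta (logr x) * eta (logr x) * (gam (logr x))^-1)) * \sum_i moll eps (u i) x ^+ 2) =
    3 * Int (fun x => deta (logr x) * deta (logr x) * expR (- 2 * logr x) * \sum_i moll eps (u i) x ^+ 2) +
    2^-1 * Int (fun x => eta (logr x) * eta (logr x) * (gam (logr x))^-1 * \sum_i moll eps (u i) x ^+ 2).
  rewrite -!lw// -IntD; try exact/bm_L1/bmfunM.
  by apply: eq_Int => x _; rewrite mulrDl.
have aux (a b c d e : R) : 2^-1 * a <= 3 * b + c + 2^-1 * d + 2^-1 * e ->
    2^-1 * a <= 3 * b + 2^-1 * e + c + 2^-1 * d by lra.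
exact: aux.
Qed.

End limits.

(** * The weak system *)

(* The integral is defined for all functions, hence monotone without measurability. *)
Section nonmeasurable_integrands.
Import HBSimple HBNNSimple.
Context d (T : measurableType d) (R : realType) (mu : {measure set T -> \bar R}).
Implicit Types (D : set T) (f g h : T -> \bar R).
Local Open Scope ereal_scope.

Lemma le_nonmeasurable_integral D f g : (forall x, D x -> 0 <= f x) ->
  (forall x, D x -> f x <= g x) -> \int[mu]_(x in D) f x <= \int[mu]_(x in D) g x.
Proof.
move=> f0 fg; rewrite !ge0_integralE//; last by move=> x Dx; rewrite (le_trans (f0 x Dx))// fg.
apply: ereal_sup_le; apply: image_subset => h /= hf x; apply: (le_trans (hf x)).
by rewrite /patch; case: ifPn => // /set_mem; exact: fg.
Qed.

(** The left side is a supremum over simple functions below f; each of these is measurable and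
    almost everywhere below g. *)
Lemma ge_nonmeasurable_integral D f g : measurable D -> (forall x, D x -> 0 <= f x) ->
  (forall x, D x -> 0 <= g x) -> measurable_fun D g ->
  {ae mu, forall x, D x -> f x <= g x} -> \int[mu]_(x in D) f x <= \int[mu]_(x in D) g x.
Proof.
move=> mD f0 g0 mg fg; rewrite ge0_integralE//; apply: ub_ereal_sup => _ [h /= hf <-].
rewrite -integralT_nnsfun.
apply: (@le_trans _ _ (\int[mu]_x (g \_ D) x)); last by rewrite -integral_mkcond.
apply: ae_ge0_le_integral => //.
- by move=> x _; rewrite lee_fin; exact: fun_ge0.
- exact/measurable_EFinP/measurable_funP.
- by move=> x _; apply: erestrict_ge0.
- exact/(measurable_restrictT _ mD).
apply: filterS fg => x fgx _; apply: (le_trans (hf x)).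
by rewrite /patch; case: ifPn => // /set_mem; exact: fgx.
Qed.

(** Removing the exceptional null set from the domain leaves the integral of the measurable f
    unchanged and can only lower that of g. *)
Lemma ae_le_nonmeasurable_integral D f g : measurable D -> (forall x, D x -> 0 <= f x) ->
  (forall x, D x -> 0 <= g x) -> measurable_fun D f ->
  {ae mu, forall x, D x -> f x <= g x} -> \int[mu]_(x in D) f x <= \int[mu]_(x in D) g x.
Proof.
move=> mD f0 g0 mf [M [mM M0 sM]].
rewrite (ge0_negligible_integral mM mD mf f0 M0).
apply: (@le_trans _ _ (\int[mu]_(x in D `\` M) g x)).
  apply: le_nonmeasurable_integral => x [Dx xM]; first exact: f0.
  by apply: contrapT => fgx; apply/xM/sM => /(_ Dx).
rewrite setDE integral_mkcondr; apply: le_nonmeasurable_integral => x Dx.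
  by rewrite /patch; case: ifPn => // _; exact: g0.
by rewrite /patch; case: ifPn => // _; exact: g0.
Qed.

Lemma ae_eq_ge0_nonmeasurable_integral D f g : measurable D -> (forall x, D x -> 0 <= f x) ->
  (forall x, D x -> 0 <= g x) -> measurable_fun D g ->
  {ae mu, forall x, D x -> f x = g x} -> \int[mu]_(x in D) f x = \int[mu]_(x in D) g x.
Proof.
move=> mD f0 g0 mg fg; apply/eqP; rewrite eq_le; apply/andP; split.
  by apply: ge_nonmeasurable_integral => //; apply: filterS fg => x H /H ->.
by apply: ae_le_nonmeasurable_integral => //; apply: filterS fg => x H /H ->.
Qed.

Lemma ae_eq_nonmeasurable_integral D f g : measurable D -> measurable_fun D g ->
  {ae mu, forall x, D x -> f x = g x} -> \int[mu]_(x in D) f x = \int[mu]_(x in D) g x.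
Proof.
move=> mD mg fg; rewrite integralE [RHS]integralE; congr (_ - _).
  apply: ae_eq_ge0_nonmeasurable_integral => //; first exact: measurable_funepos.
  by apply: filterS fg => x H /H; rewrite !funeposE => ->.
apply: ae_eq_ge0_nonmeasurable_integral => //; first exact: measurable_funeneg.
by apply: filterS fg => x H /H; rewrite !funenegE => ->.
Qed.

End nonmeasurable_integrands.

(** * Borel representatives *)

Section representatives.
Context {R : realType} {n : nat}.
Local Notation mu := (lebesgue_rV R n).
Implicit Types (D : set 'rV[R]_n) (f g : 'rV[R]_n -> R).

(** Mollification and Tonelli need Borel functions on the whole space, whereas the data are
    measurable for the completed sigma-algebra on D. *)
Definition rep D f g := [/\ measurable_fun setT g, forall x, ~ D x -> g x = 0 &
  {ae mu, forall x, D x -> f x = g x}].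

Lemma completed_subset D X : measurable D -> completed_algebra_gen mu X ->
  completed_algebra_gen mu (D `&` X).
Proof.
move=> mD [A mA [N [M [mM M0 NM]]] <-].
exists (D `&` A); first exact: measurableI.
exists (D `&` N); last by rewrite setIUr.
by exists M; split => // x [_ /NM].
Qed.

(** For each rational r the set where f > r is Borel up to a null set. The countably many null sets
    are collected into one Borel null set, on which the representative is put equal to 0. *)
Lemma lmeasurable_rep D f : measurable D ->
  lmeasurable_fun D (f : 'rV[R]_n -> measurableTypeR R) -> exists g, rep D f g.
Proof.
move=> mD lf.
have /choice[B HB] : forall q : rat, exists B : set 'rV[R]_n * set 'rV[R]_n,
    [/\ measurable B.1, measurable B.2, mu B.2 = 0%E &
      forall x, ~ B.2 x -> (D x /\ ratr q < f x) <-> B.1 x].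
  move=> q; have := lf `]ratr q, +oo[%classic (measurable_itv _).
  move=> [A mA [N [M [mM M0 NM]]] H]; exists (A, M); split => //= x xM.
  have -> : (D x /\ ratr q < f x) = (D `&` f @^-1` `]ratr q, +oo[%classic) x.
    by rewrite /= in_itv/= andbT.
  by rewrite -H; split => [[//|/NM]|Ax]; [|left].
have [e He] : exists e : nat -> option rat, forall q, exists k, e k = Some q.
  by exists unpickle => q; exists (pickle q); exact: pickleK.
pose F k := if e k is Some q then (B q).2 else set0.
have [M [mM M0 FM]] : mu.-negligible (\bigcup_k F k).
  apply: negligible_bigcup => k; rewrite /F; case: (e k) => [q|]; last exact: negligible_set0.
  by have [_ mB B0 _] := HB q; exists (B q).2; split.
have BM q x : ~ M x -> (D x /\ ratr q < f x) <-> (B q).1 x.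
  move=> xM; have [_ _ _] := HB q; apply => xB; apply/xM/FM.
  by have [k ek] := He q; exists k => //; rewrite /F ek.
pose g x := if x \in D `\` M then f x else 0.
exists g; split.
- apply: (measurability _ (RGenOInfty.measurableE R)) => _ [_ [r ->] <-].
  (* The set where g > r is the union of the Borel sets attached to rationals above r, without M.
     The region where g is 0 by convention belongs to it exactly when r < 0. *)
  pose C k := if e k is Some q then (if r < ratr q then (B q).1 `\` M else set0) else set0.
  have mC : measurable (\bigcup_k C k).
    apply: bigcup_measurable => k _; rewrite /C; case: (e k) => // q.
    by case: ifP => // _; apply: measurableD => //; have [] := HB q.
  have mE : measurable (if r < 0 then ~` (D `\` M) else set0).
    by case: ifP => // _; apply: measurableC; exact: measurableD.
  rewrite (_ : _ `&` _ = \bigcup_k C k `|` (if r < 0 then ~` (D `\` M) else set0)).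
    exact: measurableU.
  rewrite setTI; apply/seteqP; split => x /=.
    rewrite in_itv/= andbT /g; case: ifPn => [|xDM r0].
      move=> /set_mem[Dx xM] rf; left.
      have [q] := rat_in_itvoo rf; rewrite in_itv/= => /andP[rq qf].
      have [k ek] := He q; exists k => //; rewrite /C ek rq; split => //.
      by apply/BM.
    by right; rewrite r0 => DMx; move: xDM; rewrite mem_set.
  rewrite in_itv/= andbT => -[[k _]|].
    rewrite /C; case: (e k) => // q; case: ifP => // rq [Bx xM].
    have [Dx qf] := (BM q x xM).2 Bx.
    by rewrite /g mem_set//; exact: lt_trans rq qf.
  by case: ifP => // r0 xDM; rewrite /g memNset.
- by move=> x xD; rewrite /g memNset// => -[].
- exists M; split => // x /= /not_implyP[Dx fgx]; apply: contrapT => xM.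
  by apply: fgx; rewrite /g mem_set.
Qed.

Lemma Int_rep D (h g : 'rV[R]_n -> R) : measurable D -> D `<=` cube 1 ->
  measurable_fun setT g -> (forall x, ~ D x -> g x = 0) ->
  {ae mu, forall x, D x -> h x = g x} -> \int[mu]_(x in D) h x = Int g.
Proof.
move=> mD D1 mg g0 hg; rewrite /Int /Rintegral; congr fine.
rewrite (@ae_eq_nonmeasurable_integral _ _ _ mu D _ (EFin \o g))//.
- rewrite integral_mkcond [RHS]integral_mkcond; apply: eq_integral => x _.
  rewrite /patch; case: ifPn => xD; case: ifPn => // xQ.
    by rewrite mem_set in xQ => //; apply: D1; exact: set_mem.
  by rewrite /= g0// => Dx; rewrite mem_set in xD.
- by apply/measurable_EFinP; exact: measurable_funTS.
- by apply: filterS hg => x H /H /= ->.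
Qed.

Lemma L2_rep D f g : measurable D -> D `<=` cube 1 -> in_L2 D f -> rep D f g -> L2 g.
Proof.
move=> mD D1 [_ fi] [mg g0 fg]; split => //; apply/integrableP; split.
  by apply/measurable_EFinP; apply: measurable_funTS; exact: measurable_funX.
apply: le_lt_trans fi.
rewrite (@ae_eq_nonmeasurable_integral _ _ _ mu D _ (fun x => (g x ^+ 2)%:E))//; last 2 first.
- by apply/measurable_EFinP; apply: measurable_funTS; exact: measurable_funX.
- by apply: filterS fg => x H /H ->.
rewrite le_eqVlt; apply/orP; left; apply/eqP.
rewrite [LHS]integral_mkcond [RHS]integral_mkcond; apply: eq_integral => x _.
rewrite /patch; case: ifPn => xQ; case: ifPn => // xD /=.
- by rewrite ger0_norm ?sqr_ge0.
- by rewrite g0 ?expr0n ?normr0// => Dx; rewrite mem_set in xD.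
- by rewrite mem_set in xQ => //; apply: D1; exact: set_mem.
Qed.

End representatives.

Section balls.
Context {R : realType} {n : nat}.
Implicit Types (x : 'rV[R]_n) (r t : R).

Lemma eballE r : 0 < r -> eball r = [set x : 'rV[R]_n | sq x < r ^+ 2].
Proof.
move=> r0; apply/seteqP; split => x /= h.
  by rewrite -enorm_sq ltr_pXn2r ?nnegrE ?sqrtr_ge0// ltW.
by rewrite /eball/= -(@ltr_pXn2r _ 2)// ?nnegrE ?sqrtr_ge0 ?(ltW r0)// enorm_sq.
Qed.

Lemma measurable_eball r : measurable (eball r : set 'rV[R]_n).
Proof.
have [r0|r0] := ltP 0 r; last first.
  rewrite (_ : eball r = set0)//; apply/seteqP; split => // x /=.
  by rewrite /eball/= => h; have := le_lt_trans (sqrtr_ge0 _) h; rewrite ltNge r0.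
rewrite eballE// (_ : [set x | _] = @sq R n @^-1` `]-oo, r ^+ 2[%classic).
  by rewrite -[X in measurable X]setTI; apply: measurable_sq.
by apply/seteqP; split => x /=; rewrite in_itv.
Qed.

Lemma eball_cube r : r <= 1 -> eball r `<=` @box R n (fun=> -1) (fun=> 1).
Proof.
move=> r1 x xr i; have : enorm x < 1 by exact: lt_le_trans r1.
move=> x1; have : sq x < 1.
  by rewrite -enorm_sq expr_lt1// sqrtr_ge0.
move=> /(le_lt_trans (coord_sq x i)); rewrite -real_normK ?num_real// expr_lt1//.
by rewrite ltr_norml => /andP[-> /ltW].
Qed.

Lemma box_cube : @box R n (fun=> -1) (fun=> 1) `<=` cube 1.
Proof. by move=> x h i; rewrite ler_norml; have /andP[/ltW -> ->] := h i. Qed.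

Lemma enorm_logr x : x != 0 -> enorm x = expR (logr x).
Proof.
move=> x0; apply/eqP; rewrite -(@eqrXn2 _ 2)// ?sqrtr_ge0 ?expR_ge0//.
by rewrite enorm_sq -expR_logr// -expRM_natl.
Qed.

Lemma annulus_neq0 t0 t1 x : t1 <= 0 -> annulus t0 t1 x -> x != 0.
Proof.
by move=> t10 /andP[_ h]; apply: contraTneq h => ->; rewrite logr0 -leNgt.
Qed.

Lemma annulus_eball t0 t1 : t1 <= 0 -> annulus t0 t1 `<=` @eball R n (expR t1).
Proof.
move=> t10 x xA; rewrite /eball/= enorm_logr ?ltr_expR; last exact: annulus_neq0 xA.
by case/andP : xA.
Qed.

Lemma measurable_annulus t0 t1 : measurable (annulus t0 t1 : set 'rV[R]_n).
Proof.
rewrite (_ : annulus t0 t1 = @logr R n @^-1` `]t0, t1[%classic).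
  by rewrite -[X in measurable X]setTI; apply: measurable_logr.
by apply/seteqP; split => x /=; rewrite in_itv.
Qed.

End balls.

Section radial_weights.
Context {R : realType} {n : nat}.
Implicit Types (f g : 'rV[R]_n -> R) (w : R -> R).

Definition J w f := Int (fun x => w (logr x) * f x).

Lemma L1_J w f : weight0 w -> L1 f -> L1 (fun x => w (logr x) * f x).
Proof. by move=> ww Lf; apply: L1_bmM => //; exact: weight_bm. Qed.

Lemma eq_J w1 w2 f : (forall t : R, t < 0 -> w1 t = w2 t) -> (forall t : R, 0 <= t -> w1 t = w2 t) ->
  J w1 f = J w2 f.
Proof.
by move=> h1 h2; apply: eq_Int => x _; have [/h1 ->|/h2 ->] := ltP (logr x) 0.
Qed.

Lemma J_ge0 w f : weight0 w -> (forall t : R, t < 0 -> 0 <= w t) -> (forall x, 0 <= f x) -> 0 <= J w f.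
Proof.
move=> ww w0 f0; apply: Int_ge0 => x _; have [h|h] := ltP (logr x) 0.
  by rewrite mulr_ge0// w0.
by rewrite (weight0_ge0 ww)// mul0r.
Qed.

Lemma le_J w1 w2 f : weight0 w1 -> weight0 w2 -> L1 f -> (forall x, 0 <= f x) ->
  (forall t : R, t < 0 -> w1 t <= w2 t) -> J w1 f <= J w2 f.
Proof.
move=> ww1 ww2 Lf f0 w12; apply: le_Int => [||x _]; try exact: L1_J.
have [h|h] := ltP (logr x) 0; first by rewrite ler_wpM2r// w12.
by rewrite (weight0_ge0 ww1)// (weight0_ge0 ww2)// !mul0r.
Qed.

Lemma J_Z c w f : weight0 w -> L1 f -> J (fun t => c * w t) f = c * J w f.
Proof.
move=> ww Lf; rewrite /J -IntZ; last exact: L1_J.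
by apply: eq_Int => x _; rewrite mulrA.
Qed.

Lemma J_D w1 w2 f : weight0 w1 -> weight0 w2 -> L1 f ->
  J (fun t => w1 t + w2 t) f = J w1 f + J w2 f.
Proof.
move=> ww1 ww2 Lf; rewrite /J -IntD; try exact: L1_J.
by apply: eq_Int => x _; rewrite mulrDl.
Qed.

Lemma le_J_fun w f g : weight0 w -> (forall t : R, t < 0 -> 0 <= w t) -> L1 f -> L1 g ->
  (forall x, f x <= g x) -> J w f <= J w g.
Proof.
move=> ww w0 Lf Lg fg; apply: le_Int => [||x _]; try exact: L1_J.
have [h|h] := ltP (logr x) 0; first by rewrite ler_wpM2l// w0.
by rewrite (weight0_ge0 ww)// !mul0r.
Qed.

Lemma J_lin w c f g : weight0 w -> L1 f -> L1 g ->
  J w (fun x => c * f x + g x) = c * J w f + J w g.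
Proof.
move=> ww Lf Lg; rewrite /J -IntZ; last exact: L1_J.
rewrite -IntD; [|by apply: L1Z; exact: L1_J|exact: L1_J].
by apply: eq_Int => x _; rewrite mulrDr mulrCA.
Qed.

Lemma continuous_exprV k (t : R) : t < 0 -> {for t, continuous (fun s : R => s ^- k)}.
Proof.
move=> t0; apply: cvgV; last exact: exprn_continuous.
by rewrite expf_neq0// lt_eqF.
Qed.

End radial_weights.

(** * The weak Stokes system in the punctured ball *)

Section system.
Context {R : realType} {n : nat}.
Local Notation mu := (lebesgue_rV R n).
Variables (R0 : R) (R0_gt0 : 0 < R0) (R0_le1 : R0 <= 1).
Local Notation D := (eball R0 : set 'rV[R]_n).
Variables (C0 : R) (C0_gt0 : 0 < C0) (A u : 'rV[R]_n -> 'rV[R]_n) (p : 'rV[R]_n -> R).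
Hypothesis A_bound : forall x, D x -> x != 0 -> enorm x != 1 ->
  enorm (A x) <= C0 * `|ln (enorm x)| ^- 3 * (enorm x)^-1.
Hypothesis u_H1 : forall i : 'I_n, in_H1 D (fun x => u x 0 i).
Hypothesis p_H1 : in_H1 D p.
Hypothesis up_solution : stokes_solution D A u p.

Let mD : measurable D := measurable_eball R0.
Let DQ : D `<=` box (fun=> -1) (fun=> 1) := eball_cube R0_le1.
Let D1 : D `<=` cube 1. Proof. by move=> x /DQ /box_cube. Qed.

Let weak_partialP i j : in_L2 D (weak_partial D j (fun x => u x 0 i)) /\
  is_weak_partial D j (fun x => u x 0 i) (weak_partial D j (fun x => u x 0 i)).
Proof.
have [_ /(_ j)[g Hg]] := u_H1 i; rewrite /weak_partial; case: xgetP => [_ _ //|].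
by move=> /(_ g) [].
Qed.

Variables (v B : 'I_n -> 'rV[R]_n -> R) (G : 'I_n -> 'I_n -> 'rV[R]_n -> R) (q : 'rV[R]_n -> R).
Hypotheses (rv : forall i, rep D (fun x => u x 0 i) (v i)) (rq : rep D p q)
  (rG : forall i j, rep D (weak_partial D j (fun x => u x 0 i)) (G i j))
  (rB : forall j, rep D (fun x => A x 0 j) (B j)).

Lemma L2_v i : L2 (v i). Proof. by apply: L2_rep (rv i) => //; case: (u_H1 i). Qed.
Lemma L2_q : L2 q. Proof. by apply: L2_rep rq => //; case: p_H1. Qed.
Lemma L2_G i j : L2 (G i j). Proof. by apply: L2_rep (rG i j) => //; case: (weak_partialP i j). Qed.

Section in_annulus.
Variables t0 t1 : R.
Hypotheses (t1_lt0 : t1 < 0) (t1R : t1 <= ln R0).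

Let annD : annulus t0 t1 `<=` D.
Proof.
move=> x /(annulus_eball (ltW t1_lt0)) h; apply: (lt_le_trans h).
by rewrite -[leRHS]lnK ?posrE// ler_expR.
Qed.

Definition Abound (x : 'rV[R]_n) : R := C0 ^+ 2 * (logr x ^- 6 * expR (- 2 * logr x)).

(* The bound on the drift, which holds almost everywhere in the annulus. *)
Definition good : set 'rV[R]_n := annulus t0 t1 `&`
  [set x | logr x ^+ 6 * \sum_j B j x ^+ 2 <= C0 ^+ 2 * expR (- 2 * logr x)].

Lemma measurable_good : measurable good.
Proof.
apply: measurableI; first exact: measurable_annulus.
have mB j : measurable_fun setT (B j) by have [] := rB j.
pose f (x : 'rV[R]_n) := C0 ^+ 2 * expR (- 2 * logr x) - logr x ^+ 6 * \sum_j B j x ^+ 2.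
have mf : measurable_fun setT f.
  apply: measurable_funB; last first.
    apply: measurable_funM; first by apply: measurable_funX; exact: measurable_logr.
    by apply: measurable_sum => j; exact: measurable_funX.
  apply: measurable_funM => //.
  by apply: measurableT_comp => //; apply: measurable_funM => //; exact: measurable_logr.
rewrite (_ : [set x | _] = f @^-1` `[0, +oo[%classic).
  by rewrite -[X in measurable X]setTI; exact: mf.
by apply/seteqP; split => x /=; rewrite in_itv/= andbT subr_ge0.
Qed.

Lemma goodE x : annulus t0 t1 x -> good x <-> \sum_j B j x ^+ 2 <= Abound x.
Proof.
move=> xA; have l6 : 0 < logr x ^+ 6.
  by rewrite exprn_even_gt0//= lt_eqF//; case/andP : xA => _ h; exact: lt_trans t1_lt0.
rewrite /Abound mulrCA (ler_pdivlMl _ _ l6) /good /=.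
by split => [[]|].
Qed.

(** Cut off outside [good], so that the bound [drift_sq] holds everywhere, while almost everywhere
    in the annulus it is still A . grad u. *)
Definition drift i (x : 'rV[R]_n) : R := \1_good x * \sum_j B j x * G i j x.

Lemma drift_ae : {ae mu, forall x, annulus t0 t1 x ->
  forall i, drift i x = \sum_j A x 0 j * weak_partial D j (fun y => u y 0 i) x}.
Proof.
have H (P : 'I_n -> 'rV[R]_n -> Prop) : (forall j, {ae mu, forall x, P j x}) ->
    {ae mu, forall x, forall j, P j x}.
  move=> HP; have : {ae mu, forall x, forall m : nat, forall j : 'I_n, val j = m -> P j x}.
    apply: ae_foralln => m; have [nm|mn] := leqP n m.
      by apply: aeW => x j jm; have := ltn_ord j; rewrite jm ltnNge nm.
    by apply: filterS (HP (Ordinal mn)) => x Px j jm; rewrite (_ : j = Ordinal mn)//; exact/val_inj.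
  by apply: filterS => x h j; exact: (h (val j)).
have HB := H (fun j x => D x -> A x 0 j = B j x) (fun j => let: And3 _ _ h := rB j in h).
have HG := H (fun i x => forall j, D x -> weak_partial D j (fun y => u y 0 i) x = G i j x)
  (fun i => H (fun j x => D x -> weak_partial D j (fun y => u y 0 i) x = G i j x)
    (fun j => let: And3 _ _ h := rG i j in h)).
apply: filterS2 HB HG => x HB HG xA i; have Dx := annD xA.
rewrite /drift indicE mem_set ?mul1r.
  by apply: eq_bigr => j _; rewrite HB// HG.
apply/(goodE xA); have x0 := annulus_neq0 (ltW t1_lt0) xA.
have lx : logr x < 0 by case/andP : xA => _ h; exact: lt_trans t1_lt0.
have x1 : enorm x != 1 by rewrite enorm_logr// lt_eqF// -[ltRHS]expR0 ltr_expR.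
have := A_bound Dx x0 x1; rewrite (enorm_logr x0) expRK => H1.
rewrite (_ : \sum_j _ = sq (A x)); last by apply: eq_bigr => j _; rewrite HB.
rewrite -enorm_sq (_ : Abound x = (C0 * `|logr x| ^- 3 * (expR (logr x))^-1) ^+ 2).
  rewrite ler_pXn2r ?nnegrE ?sqrtr_ge0// !mulr_ge0 ?invr_ge0 ?expR_ge0 ?exprn_ge0// ltW//.
have E (l : R) : l < 0 -> l ^- 6 = (`|l| ^- 3) ^+ 2.
  by move=> l0; rewrite ltr0_norm//; field; rewrite ?oppr_eq0 lt_eqF.
rewrite /Abound (E _ lx) (_ : expR (-2 * logr x) = (expR (logr x))^-1 ^+ 2); first by ring.
by rewrite -expRN -expRM_natl; congr expR; ring.
Qed.

Lemma drift_sq x : \sum_i drift i x ^+ 2 <= Abound x * \sum_i \sum_j G i j x ^+ 2.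
Proof.
have A0 : 0 <= Abound x.
  by rewrite /Abound mulr_ge0 ?sqr_ge0// mulr_ge0 ?expR_ge0 ?invr_ge0 ?exprn_even_ge0.
rewrite mulr_sumr; apply: ler_sum => i _; rewrite /drift indicE.
have [xg|xg] := boolP (x \in good); last first.
  rewrite mul0r expr0n mulr_ge0//; apply: sumr_ge0 => j _; exact: sqr_ge0.
rewrite mul1r (le_trans (cauchy_schwarz_sum _ _))// ler_wpM2r//.
  by apply: sumr_ge0 => j _; exact: sqr_ge0.
by apply/goodE => //; case: (set_mem xg) => [].
Qed.

Lemma drift_out i x : ~ annulus t0 t1 x -> drift i x = 0.
Proof. by move=> xA; rewrite /drift indicE memNset ?mul0r// => -[]. Qed.

Lemma measurable_drift i : measurable_fun setT (drift i).
Proof.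
apply: measurable_funM; first by apply: measurable_indic; exact: measurable_good.
apply: measurable_sum => j; apply: measurable_funM; first by have [] := rB j.
by have [] := rG i j.
Qed.

Lemma L2_drift i : L2 (drift i).
Proof.
split; first exact: measurable_drift.
(* An upper bound for [Abound] in the annulus, where |logr x| > |t1| and logr x > t0. *)
pose K := C0 ^+ 2 * (t1 ^- 6 * expR (- 2 * t0)).
apply: (@le_L1 _ _ _ (fun x => K * \sum_i \sum_j G i j x ^+ 2)).
- by apply: measurable_funX; exact: measurable_drift.
- move=> x _; rewrite ger0_norm ?sqr_ge0//.
  have S0 : 0 <= \sum_i \sum_j G i j x ^+ 2.
    by apply: sumr_ge0 => a _; apply: sumr_ge0 => b _; exact: sqr_ge0.
  have K0 : 0 <= K by rewrite /Abound mulr_ge0 ?sqr_ge0// mulr_ge0 ?expR_ge0 ?invr_ge0 ?exprn_even_ge0.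
  have [xA|xA] := pselect (annulus t0 t1 x); last by rewrite drift_out// expr0n mulr_ge0.
  apply: (@le_trans _ _ (\sum_i drift i x ^+ 2)).
    by rewrite (bigD1 i)//= lerDl; apply: sumr_ge0 => j _; exact: sqr_ge0.
  rewrite (le_trans (drift_sq x))// ler_wpM2r//.
  rewrite /Abound /K ler_wpM2l ?sqr_ge0//; case/andP : xA => h1 h2.
  have l0 : logr x < 0 by exact: lt_trans t1_lt0.
  apply: ler_pM; rewrite ?expR_ge0 ?invr_ge0 ?exprn_even_ge0//.
    have E6 (c : R) : c ^+ 6 = (- c) ^+ 6 by rewrite !exprS expr0; ring.
    have n1 : 0 < - t1 by rewrite oppr_gt0.
    have n2 : 0 < - logr x by rewrite oppr_gt0.
    rewrite (E6 t1) (E6 (logr x)) lef_pV2 ?posrE ?exprn_gt0//.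
    by rewrite (@ler_pXn2r _ 6)// ?nnegrE ?lerN2 ltW.
  by rewrite ler_expR; lra.
- by apply: L1Z; apply: L1_sum => a; apply: L1_sum => b; case: (L2_G a b).
Qed.

Section weak_equations.
Variables (kap : 'I_n -> nat) (eps : R) (x : 'rV[R]_n).
Hypotheses (eps_gt0 : 0 < eps) (x_in : cell_in t0 t1 eps x).

Let tf := test_function_zker kap eps_gt0 (fun y h => annD (x_in h)).

Let zero k y : ~ annulus t0 t1 y -> zker k eps x y = 0.
Proof.
move=> yA; have [i yi] : exists i, ~ `|y 0 i - x 0 i| <= eps.
  by apply/existsNP => h; exact/yA/x_in.
by apply: (zker_out _ (i := i)) => //; rewrite ltW// ltNge; exact/negP.
Qed.

Let mv i : measurable_fun setT (v i). Proof. by case: (rv i). Qed.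
Let mq : measurable_fun setT q. Proof. by case: rq. Qed.
Let mG i j : measurable_fun setT (G i j). Proof. by case: (rG i j). Qed.
Let mz k : measurable_fun setT (zker k eps x). Proof. exact: measurable_zker. Qed.

Lemma weak_gradient_rep i j :
  Int (fun y => v i y * (eps^-1 * zker (incr kap j) eps x y)) =
  - Int (fun y => G i j y * zker kap eps x y).
Proof.
have [_ /(_ _ tf)] := weak_partialP i j; rewrite partial_zker.
have [_ v0 vE] := rv i; have [_ G0 GE] := rG i j.
rewrite (@Int_rep _ _ D _ (fun y => v i y * (eps^-1 * zker (incr kap j) eps x y)) mD D1); last 3 first.
- by apply: measurable_funM => //; exact: measurable_funM.
- by move=> y yD; rewrite v0// mul0r.
- by apply: filterS vE => y H /H ->.
rewrite (@Int_rep _ _ D _ (fun y => G i j y * zker kap eps x y) mD D1)//.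
- exact: measurable_funM.
- by move=> y yD; rewrite G0// mul0r.
- by apply: filterS GE => y H /H ->.
Qed.

Let ae_all (P : 'I_n -> 'rV[R]_n -> Prop) : (forall j, {ae mu, forall x, P j x}) ->
    {ae mu, forall x, forall j, P j x}.
Proof.
move=> HP; have : {ae mu, forall x, forall m : nat, forall j : 'I_n, val j = m -> P j x}.
  apply: ae_foralln => m; have [nm|mn] := leqP n m.
    by apply: aeW => y j jm; have := ltn_ord j; rewrite jm ltnNge nm.
  by apply: filterS (HP (Ordinal mn)) => y Px j jm; rewrite (_ : j = Ordinal mn)//; exact/val_inj.
by apply: filterS => y h j; exact: (h (val j)).
Qed.

Lemma weak_divergence_rep :
  Int (fun y => \sum_i v i y * (eps^-1 * zker (incr kap i) eps x y)) = 0.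
Proof.
have := up_solution.2 _ tf.
under [X in Rintegral _ _ X = 0]eq_fun do under eq_bigr do rewrite partial_zker.
have vE := ae_all (fun i => let: And3 _ _ h := rv i in h).
rewrite (@Int_rep _ _ D _ (fun y => \sum_i v i y * (eps^-1 * zker (incr kap i) eps x y)) mD D1)//.
- by apply: measurable_sum => i; apply: measurable_funM => //; exact: measurable_funM.
- by move=> y yD; rewrite big1// => i _; have [_ v0 _] := rv i; rewrite v0// mul0r.
- by apply: filterS vE => y H yD; apply: eq_bigr => i _; rewrite H.
Qed.

Lemma weak_equation_rep i :
  Int (fun y => v i y * (\sum_a eps^-1 * (eps^-1 * zker (incr (incr kap a) a) eps x y)) +
    drift i y * zker kap eps x y - q y * (eps^-1 * zker (incr kap i) eps x y)) = 0.
Proof.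
have := up_solution.1 i _ tf.
rewrite /laplacian.
under [X in Rintegral _ _ X = 0]eq_fun do under eq_bigr do rewrite partial2_zker.
rewrite partial_zker.
have [_ v0 vE] := rv i; have [_ q0 qE] := rq.
rewrite (@Int_rep _ _ D _ (fun y => v i y * (\sum_a eps^-1 * (eps^-1 * zker (incr (incr kap a) a) eps x y)) +
    drift i y * zker kap eps x y - q y * (eps^-1 * zker (incr kap i) eps x y)) mD D1)//.
- apply: measurable_funB; last by apply: measurable_funM => //; exact: measurable_funM.
  apply: measurable_funD; last by apply: measurable_funM => //; exact: measurable_drift.
  apply: measurable_funM => //; apply: measurable_sum => a.
  by apply: measurable_funM => //; exact: measurable_funM.
- move=> y yD; rewrite v0// q0// drift_out; last by move=> /annD.
  by rewrite !mul0r subr0 addr0.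
- apply: filterS3 vE qE drift_ae => y Hv Hq Hd yD.
  rewrite Hv// Hq//; congr (_ + _ - _); have [yA|yA] := pselect (annulus t0 t1 y).
    rewrite (Hd yA i); congr (_ * _); apply: eq_bigr => j _.
    by rewrite /weak_grad mxE.
  (* Outside the annulus [drift] may differ from A . grad u, but the kernel vanishes there. *)
  by rewrite zero// !mulr0.
Qed.

End weak_equations.

Let v0 i x : ~ box (fun=> -1) (fun=> 1) x -> v i x = 0.
Proof. by move=> xQ; have [_ + _] := rv i; apply => /DQ. Qed.
Let q0 x : ~ box (fun=> -1) (fun=> 1) x -> q x = 0.
Proof. by move=> xQ; have [_ + _] := rq; apply => /DQ. Qed.
Let G0 i j x : ~ box (fun=> -1) (fun=> 1) x -> G i j x = 0.
Proof. by move=> xQ; have [_ + _] := rG i j; apply => /DQ. Qed.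
Let d0 i x : ~ box (fun=> -1) (fun=> 1) x -> drift i x = 0.
Proof. by move=> xQ; apply: drift_out => /annD /DQ. Qed.

Definition rep_pressure := limit_pressure L2_v L2_G L2_q L2_drift G0 q0 d0 t1_lt0
  (fun i j kap eps x e0 xi => weak_gradient_rep kap e0 xi i j) weak_divergence_rep
  (fun i kap eps x e0 xi => weak_equation_rep kap e0 xi i).
Definition rep_velocity := limit_velocity L2_v L2_G L2_q v0 G0 q0 t1_lt0
  (fun i j kap eps x e0 xi => weak_gradient_rep kap e0 xi i j) weak_divergence_rep.
Definition rep_caccioppoli := limit_caccioppoli L2_v L2_G L2_q L2_drift v0 G0 q0 d0 t1_lt0
  (fun i j kap eps x e0 xi => weak_gradient_rep kap e0 xi i j) weak_divergence_rep
  (fun i kap eps x e0 xi => weak_equation_rep kap e0 xi i).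

End in_annulus.

Let Pq (x : 'rV[R]_n) := q x ^+ 2.
Let U (x : 'rV[R]_n) := \sum_i v i x ^+ 2.
Let Gq (x : 'rV[R]_n) := \sum_i \sum_j G i j x ^+ 2.
Let W (x : 'rV[R]_n) := 2 * q x ^+ 2 + \sum_i \sum_j (G j i x - G i j x) ^+ 2.

Lemma L1_P : L1 Pq. Proof. by case: L2_q. Qed.
Lemma L1_U : L1 U. Proof. by apply: L1_sum => i; case: (L2_v i). Qed.
Lemma L1_G : L1 Gq. Proof. by apply: L1_sum => i; apply: L1_sum => j; case: (L2_G i j). Qed.
Lemma L1_om : L1 (fun x => \sum_i \sum_j (G j i x - G i j x) ^+ 2).
Proof.
by apply: L1_sum => i; apply: L1_sum => j; case: (L2B (L2_G j i) (L2_G i j)).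
Qed.
Lemma L1_W : L1 W.
Proof. by apply: L1D; [apply: L1Z; exact: L1_P|exact: L1_om]. Qed.

Let Gq_ge0 x : 0 <= Gq x.
Proof. by apply: sumr_ge0 => i _; apply: sumr_ge0 => j _; exact: sqr_ge0. Qed.

Lemma W_le x : W x <= 2 * Pq x + 4 * Gq x.
Proof.
rewrite lerD2l /Gq (_ : 4 * _ = \sum_i \sum_j (2 * G j i x ^+ 2 + 2 * G i j x ^+ 2)).
  apply: ler_sum => i _; apply: ler_sum => j _.
  by have := sqr_ge0 (G j i x + G i j x); lra.
under [RHS]eq_bigr do rewrite big_split/= -!mulr_sumr.
rewrite big_split/= -!mulr_sumr [X in 2 * X + _]exchange_big/=; ring.
Qed.

(** The weights end at s1 < ln R0, which leaves room inside the ball for a larger annulus in which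
    the mollified equations hold. *)
Let annuli (s1 : R) (chi dchi : R -> R) : s1 < ln R0 -> weight0 chi -> weight0 dchi ->
  (forall t, s1 <= t -> chi t = 0) -> (forall t, s1 <= t -> dchi t = 0) ->
  exists t0 t1 s0, [/\ t1 < 0, t1 <= ln R0, t0 < s0, s1 < t1 &
   (forall t, ~ (s0 < t < s1) -> chi t = 0) /\ (forall t, ~ (s0 < t < s1) -> dchi t = 0)].
Proof.
move=> s1R [_ [a0 [a1 [_ ha]]]] [_ [b0 [b1 [_ hb]]]] h1 h2.
have R1 : ln R0 <= 0 by exact: ln_le0.
exists (Num.min a0 b0 - 1), ((s1 + ln R0) / 2), (Num.min a0 b0).
split; [lra|lra| |lra|]; first by rewrite ltrBlDr ltrDl.
split=> t ht; have [st|ts] := leP s1 t; [exact: h1| |exact: h2|].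
  apply: ha => /andP[h _]; apply: ht; rewrite ts andbT.
  by apply: le_lt_trans h; rewrite ge_min lexx.
apply: hb => /andP[h _]; apply: ht; rewrite ts andbT.
by apply: le_lt_trans h; rewrite ge_min lexx orbT.
Qed.

Section carleman_inequalities.
Variables (s1 : R) (chi dchi E Psi dPsi : R -> R).
Hypotheses (s1R : s1 < ln R0) (wchi : weight1 chi dchi)
  (chi0 : forall t, s1 <= t -> chi t = 0) (dchi0 : forall t, s1 <= t -> dchi t = 0)
  (E0 : forall t : R, t < 0 -> 0 <= E t)
  (dE : forall t : R, t < 0 -> is_derive t (1 : R) E ((2 * Psi t - n%:R) * E t))
  (dP : forall t : R, t < 0 -> is_derive t (1 : R) Psi (dPsi t))
  (cP : forall t : R, t < 0 -> {for t, continuous dPsi}).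

Let wc : weight0 (fun t => chi t * chi t * E t).
Proof.
have [w _ _] := wchi; apply: weight0M => [|t t0].
  by apply: weight0M => // t _; exact: w.1.
exact: (@is_derive_continuous R E (fun t => (2 * Psi t - n%:R) * E t) t (dE t0)).
Qed.

Let sqE (x : 'rV[R]_n) (c : R) : logr x < 0 -> sq x = expR (2 * logr x).
Proof. by move=> h; rewrite expR_logr//; apply: contraTneq h => ->; rewrite logr0 ltxx. Qed.

(** The factor |x|^2 of the Carleman inequality cancels the |x|^-2 of the squared drift bound, and
    only t^-6 remains. *)
Lemma energy_pressure : J (fun t => chi t * chi t * (E t * dPsi t)) W <=
  2 * C0 ^+ 2 * J (fun t => chi t * chi t * E t * t ^- 6) Gq + J (fun t => dchi t * dchi t * E t) W.
Proof.
have [w w' _] := wchi.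
have [t0 [t1 [s0 [t10 t1R ts st [h1 h2]]]]] := annuli s1R w w' chi0 dchi0.
have := rep_pressure t10 t1R ts st wchi h1 h2 E0 dE dP cP.
move=> H; apply: (le_trans H); rewrite lerD2r.
have w6 : weight0 (fun t => chi t * chi t * E t * t ^- 6).
  by apply: weight0M => // t; exact: continuous_exprV.
rewrite -J_Z//; last exact: L1_G.
have Ld : L1 (fun x => \sum_j drift t0 t1 j x ^+ 2).
  by apply: L1_sum => j; case: (L2_drift t0 t10 j).
have bsq : bmfun (fun x => 2 * @sq R n x).
  apply: bmfunM; first exact: bmfun_cst.
  by apply: bmfun_sum => i; apply: bmfunX; exact: bmfun_coord.
apply: le_Int.
- by apply: L1_bmM => //; apply: bmfunM => //; exact: (weight_bm wc).
- exact: (L1_J (weight0Z (2 * C0 ^+ 2) w6) L1_G).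
move=> x _; have [l0|l0] := ltP (logr x) 0; last first.
  by rewrite (weight0_ge0 w)// !mul0r mulr0 mul0r.
have c0 : 0 <= chi (logr x) * chi (logr x) * E (logr x).
  by rewrite mulr_ge0 ?E0// -expr2 sqr_ge0.
rewrite -mulrA; apply: (@le_trans _ _ (chi (logr x) * chi (logr x) * E (logr x) *
    (2 * sq x * (Abound x * Gq x)))).
  by rewrite !ler_wpM2l// ?mulr_ge0 ?sq_ge0// drift_sq.
rewrite /Abound (sqE 0 l0) mulNr expRN le_eqVlt; apply/orP; left; apply/eqP.
have aux (c k l e g : R) : l < 0 -> 0 < e ->
    c * (2 * e * (k * (l ^- 6 * e^-1) * g)) = 2 * k * (c * l ^- 6) * g.
  by move=> l_lt0 e_gt0; field; rewrite (lt_eqF l_lt0) (gt_eqF e_gt0).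
by rewrite aux// expR_gt0.
Qed.

Lemma energy_velocity : J (fun t => chi t * chi t * (E t * dPsi t)) U <=
  J (fun t => chi t * chi t * E t * expR (2 * t)) W + J (fun t => dchi t * dchi t * E t) U.
Proof.
have [w w' _] := wchi.
have [t0 [t1 [s0 [t10 t1R ts st [h1 h2]]]]] := annuli s1R w w' chi0 dchi0.
have := rep_velocity t10 t1R ts st wchi h1 E0 dE dP cP.
move=> H; apply: (le_trans H); rewrite lerD2r.
have wE : weight0 (fun t => chi t * chi t * E t * expR (2 * t)) by exact: weight0_expM.
apply: (@le_trans _ _ (J (fun t => chi t * chi t * E t * expR (2 * t))
    (fun x => \sum_i \sum_j (G j i x - G i j x) ^+ 2))).
  rewrite le_eqVlt; apply/orP; left; apply/eqP; apply: eq_Int => x _.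
  have [l0|l0] := ltP (logr x) 0; first by rewrite (sqE 0 l0).
  by rewrite (weight0_ge0 w)// !mul0r.
apply: le_J_fun => //; [|exact: L1_om|exact: L1_W|].
  by move=> t t0'; rewrite mulr_ge0 ?expR_ge0// mulr_ge0 ?E0// -expr2 sqr_ge0.
by move=> x; rewrite lerDr mulr_ge0// sqr_ge0.
Qed.

End carleman_inequalities.

Lemma energy_caccioppoli (s1 : R) (eta deta : R -> R) : s1 < ln R0 -> weight1 eta deta ->
  (forall t, s1 <= t -> eta t = 0) -> (forall t, s1 <= t -> deta t = 0) ->
  J (fun t => eta t * eta t) Gq <=
  12 * J (fun t => deta t * deta t * expR (- 2 * t)) U + 4 * J (fun t => eta t * eta t) Pq +
  4 * C0 ^+ 2 * J (fun t => eta t * eta t * (t ^- 6 * expR (- 2 * t))) U.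
Proof.
move=> s1R we eta0 deta0; have [w w' _] := we.
have [t0 [t1 [s0 [t10 t1R ts st [h1 h2]]]]] := annuli s1R w w' eta0 deta0.
(* Chosen so that gam times [Abound] is 1/2: the drift then costs a quarter of the gradient
   integral, of which a half stands on the left. Multiplying the remaining quarter by 4 gives the
   constants 12, 4 and 4. *)
pose gam (t : R) := (2 * C0 ^+ 2)^-1 * (t ^+ 6 * expR (2 * t)).
have C2 : 0 < 2 * C0 ^+ 2 by rewrite mulr_gt0// exprn_gt0.
have cg (t : R) : t < 0 -> {for t, continuous gam}.
  move=> _; apply: cvgM; first exact: cvg_cst.
  by apply: cvgM; [exact: exprn_continuous|exact: continuous_expZ].
have g0 (t : R) : t < 0 -> 0 < gam t.
  by move=> tl; rewrite /gam mulr_gt0 ?invr_gt0// mulr_gt0 ?expR_gt0// exprn_even_gt0//= lt_eqF.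
have H := rep_caccioppoli t10 t1R ts st we h1 cg g0.
have w2 : weight0 (fun t => eta t * eta t) by apply: weight0M => // t _; exact: w.1.
have wd2 : weight0 (fun t => deta t * deta t * expR (- 2 * t)).
  by apply: weight0_expM; apply: weight0M => // t _; exact: w'.1.
have w3 : weight0 (fun t => eta t * eta t * (t ^- 6 * expR (- 2 * t))).
  apply: weight0M => // t tl; apply: cvgM; first exact: continuous_exprV.
  exact: continuous_expZ.
have eU : Int (fun x => (3 * (deta (logr x) * deta (logr x) * expR (- 2 * logr x)) +
      2^-1 * (eta (logr x) * eta (logr x) * (gam (logr x))^-1)) * \sum_i v i x ^+ 2) =
    3 * J (fun t => deta t * deta t * expR (- 2 * t)) U +
    C0 ^+ 2 * J (fun t => eta t * eta t * (t ^- 6 * expR (- 2 * t))) U.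
  rewrite -(J_Z 3 wd2 L1_U) -(J_Z (C0 ^+ 2) w3 L1_U).
  rewrite -(J_D (weight0Z 3 wd2) (weight0Z (C0 ^+ 2) w3) L1_U).
  apply: eq_Int => x _; congr (_ * _); congr (_ + _).
  have [l0|l0] := ltP (logr x) 0; last by rewrite (weight0_ge0 w)// !mul0r !mulr0.
  have aux (c k l e : R) : 0 < k -> l < 0 -> 0 < e ->
      2^-1 * (c * ((2 * k)^-1 * (l ^+ 6 * e))^-1) = k * (c * (l ^- 6 * e^-1)).
    by move=> k0 l_lt0 e_gt0; field; rewrite (lt_eqF l_lt0) (gt_eqF e_gt0) (gt_eqF k0).
  by rewrite /gam mulNr expRN aux// ?expR_gt0// exprn_gt0.
have eF : Int (fun x => (2^-1 * (eta (logr x) * eta (logr x) * gam (logr x))) *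
    \sum_i drift t0 t1 i x ^+ 2) <= 4^-1 * J (fun t => eta t * eta t) Gq.
  rewrite -J_Z//; last exact: L1_G.
  have wg : weight0 (fun t => 2^-1 * (eta t * eta t * gam t)) by apply: weight0Z; exact: weight0M.
  apply: le_Int.
  - apply: (L1_J wg); apply: L1_sum => j; by case: (L2_drift t0 t10 j).
  - exact: (L1_J (weight0Z 4^-1 w2) L1_G).
  move=> x _; have [l0|l0] := ltP (logr x) 0; last first.
    by rewrite (weight0_ge0 w)// !mul0r !mulr0 !mul0r.
  have c0 : 0 <= 2^-1 * (eta (logr x) * eta (logr x) * gam (logr x)).
    by rewrite mulr_ge0// mulr_ge0 ?(ltW (g0 _ l0))// -expr2 sqr_ge0.
  apply: (le_trans (ler_wpM2l c0 (drift_sq t0 t10 x))).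
  have aux (c k l e g : R) : 0 < k -> l < 0 -> 0 < e ->
      2^-1 * (c * ((2 * k)^-1 * (l ^+ 6 * e))) * (k * (l ^- 6 * e^-1) * g) = 4^-1 * c * g.
    by move=> k0 l_lt0 e_gt0; field; rewrite (lt_eqF l_lt0) (gt_eqF e_gt0) (gt_eqF k0).
  by rewrite /Abound /gam mulNr expRN aux// ?expR_gt0// exprn_gt0.
have eG : Int (fun x => (2^-1 * (eta (logr x) * eta (logr x))) * \sum_i \sum_a G i a x ^+ 2) =
    2^-1 * J (fun t => eta t * eta t) Gq.
  by rewrite -J_Z//; exact: L1_G.
rewrite eU eG in H; rewrite -/(J (fun t => eta t * eta t) Pq) in H.
move: H eF; set a := J _ Gq; set b := J _ U; set c := J _ U; set d := J _ Pq; set f := Int _.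
lra.
Qed.

Let ae_all (P : 'I_n -> 'rV[R]_n -> Prop) : (forall j, {ae mu, forall x, P j x}) ->
    {ae mu, forall x, forall j, P j x}.
Proof.
move=> HP; have : {ae mu, forall x, forall m : nat, forall j : 'I_n, val j = m -> P j x}.
  apply: ae_foralln => m; have [nm|mn] := leqP n m.
    by apply: aeW => y j jm; have := ltn_ord j; rewrite jm ltnNge nm.
  by apply: filterS (HP (Ordinal mn)) => y Px j jm; rewrite (_ : j = Ordinal mn)//; exact/val_inj.
by apply: filterS => y h j; exact: (h (val j)).
Qed.

Let uE : {ae mu, forall x, forall i, D x -> u x 0 i = v i x} :=
  ae_all (fun i => let: And3 _ _ h := rv i in h).

(** The integrand of the theorem is built from functions that need not be Borel, so it is bounded
    below by the Borel representatives through [ae_le_nonmeasurable_integral]. *)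
Lemma weighted_le_stokes_U (r e : R) (w : R -> R) : 0 < r -> r <= R0 ->
  (\int[mu]_(x in eball r) ((stokes_U D u p x) ^+ 2)%:E <= e%:E)%E ->
  weight0 w -> (forall t : R, t < 0 -> 0 <= w t <= 1) -> (forall t, ln r <= t -> w t = 0) ->
  J w U + J (fun t => w t * expR (2 * t)) Pq <= e.
Proof.
move=> r0 rR Hr ww w01 w0.
have we := weight0_expM 2 ww; pose f x := w (logr x) * U x + w (logr x) * expR (2 * logr x) * Pq x.
have f1 := L1_J ww L1_U; have f2 := L1_J we L1_P.
rewrite /J -IntD// -lee_fin EFin_Int; last exact: L1D.
apply: le_trans Hr.
have U0 x : 0 <= U x by apply: sumr_ge0 => i _; exact: sqr_ge0.
have mf : measurable_fun setT f.
  have mU : measurable_fun setT U.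
    by apply: measurable_sum => i; apply: measurable_funX; case: (rv i).
  have mP : measurable_fun setT Pq by apply: measurable_funX; case: rq.
  apply: measurable_funD; first by apply: measurable_funM => //; exact: weight_measurable.
  by apply: measurable_funM => //; exact: (weight_measurable we).
have wlt (x : 'rV[R]_n) : 0 <= w (logr x) <= 1.
  by have [/w01//|h] := ltP (logr x) 0; rewrite (weight0_ge0 ww)// lexx ler01.
have f0 x : 0 <= f x.
  have /andP[h _] := wlt x; apply: addr_ge0; apply: mulr_ge0 => //.
    by rewrite mulr_ge0// expR_ge0.
  exact: sqr_ge0.
have r1 : r <= 1 by exact: le_trans R0_le1.
apply: (@le_trans _ _ (\int[mu]_(x in eball r) (f x)%:E)%E).
  rewrite le_eqVlt; apply/orP; left; apply/eqP.
  rewrite [LHS]integral_mkcond [RHS]integral_mkcond; apply: eq_integral => x _.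
  rewrite /patch; case: ifPn => xQ; case: ifPn => // xr /=.
    have xr' : ~ eball r x by move=> h; rewrite mem_set in xr.
    have [l0|l0] := ltP (logr x) 0; last by rewrite (weight0_ge0 ww)// !mul0r addr0.
    rewrite (_ : w (logr x) = 0) ?mul0r ?addr0//; apply: w0; rewrite leNgt; apply/negP => h.
    have x0 : x != 0 by apply: contraTneq l0 => ->; rewrite logr0 ltxx.
    by apply: xr'; rewrite /eball/= enorm_logr// -[ltRHS]lnK ?posrE// ltr_expR.
  rewrite mem_set in xQ => //; apply/box_cube/(eball_cube r1); exact: set_mem.
apply: ae_le_nonmeasurable_integral.
- exact: measurable_eball.
- by move=> x _; rewrite lee_fin.
- by move=> x _; rewrite lee_fin sqr_ge0.
- by apply/measurable_EFinP; exact: measurable_funTS.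
have [_ _ qE] := rq; apply: filterS2 uE qE => x Hu Hq xr; rewrite lee_fin.
have xD : D x by exact: (lt_le_trans xr).
rewrite /stokes_U sqr_sqrtr; last first.
  apply: addr_ge0; last exact: sqr_ge0.
  by apply: addr_ge0; rewrite mulr_ge0// ?sqr_ge0// exprn_even_ge0.
have -> : enorm (u x) ^+ 2 = U x.
  by rewrite enorm_sq; apply: eq_bigr => i _; rewrite Hu.
have /andP[h1 h2] := wlt x.
rewrite Hq// -addrA; apply: ler_wpDl; first by rewrite mulr_ge0// ?sqr_ge0// exprn_even_ge0.
rewrite /f [leLHS]addrC; apply: lerD; last by rewrite ler_piMl.
rewrite -/(Pq x) ler_wpM2r ?sqr_ge0// enorm_sq.
have [->|x0] := eqVneq x 0; first by rewrite logr0 (weight0_ge0 ww)// mul0r sq_ge0.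
by rewrite expR_logr// ler_piMl// sq_ge0.
Qed.

(** Continuous and positive exactly on ]a, b[. For b < 0 it is a weight, and a nonnegative function
    with zero integral against it vanishes almost everywhere on the annulus. *)
Definition hat (a b t : R) : R := Num.max 0 (t - a) * Num.max 0 (b - t).

Lemma hat_ge0 a b t : 0 <= hat a b t.
Proof. by rewrite mulr_ge0// le_max lexx. Qed.

Lemma hat_gt0 a b t : a < t < b -> 0 < hat a b t.
Proof. by move=> /andP[h1 h2]; rewrite mulr_gt0// lt_max subr_gt0 ?h1 ?h2 orbT. Qed.

Lemma hat0 a b t : ~ (a < t < b) -> hat a b t = 0.
Proof.
move=> tab; have [at_|ta] := ltP a t; last by rewrite /hat max_l ?subr_le0// mul0r.
have [tb|bt] := ltP t b; first by case: tab; rewrite at_ tb.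
by rewrite /hat [X in _ * X]max_l ?subr_le0// mulr0.
Qed.

Lemma weight0_hat a b : b < 0 -> weight0 (hat a b).
Proof.
move=> b0; split; last by exists a, b; split => // t; exact: hat0.
move=> t; apply: cvgM.
  apply: (@continuous_max _ _ (cst 0) (fun t : R => t - a)); first exact: cvg_cst.
  by apply: cvgB; [exact: cvg_id|exact: cvg_cst].
apply: (@continuous_max _ _ (cst 0) (fun t : R => b - t)); first exact: cvg_cst.
by apply: cvgB; [exact: cvg_cst|exact: cvg_id].
Qed.

(** If all these integrals vanished, u and p would vanish almost everywhere on every annulus, and
    countably many annuli cover the ball up to the origin. *)
Lemma nontrivial_annulus : (0 < n)%N ->
  ~ {ae mu, forall x, D x -> u x = 0 /\ p x = 0} ->
  exists a b, b < ln R0 /\ 0 < J (hat a b) U + J (hat a b) Pq.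
Proof.
move=> n0 H; apply: contrapT => /forallNP Hn; apply: H.
have R1 : ln R0 <= 0 by exact: ln_le0.
have U0 x : 0 <= U x by apply: sumr_ge0 => i _; exact: sqr_ge0.
have Hab a b : b < ln R0 -> {ae mu, forall x, annulus a b x -> U x = 0 /\ Pq x = 0}.
  move=> bR; have wh : weight0 (hat a b) by apply: weight0_hat; exact: lt_le_trans R1.
  have /forallNP /(_ b) := Hn a => /not_andP[//|/negP]; rewrite -leNgt => HJ.
  pose f x := hat a b (logr x) * (U x + Pq x).
  have Lf : L1 f by apply: L1_J => //; apply: L1D; [exact: L1_U|exact: L1_P].
  have f0 x : 0 <= f x by rewrite mulr_ge0 ?hat_ge0// addr_ge0// sqr_ge0.
  have I0 : (\int[mu]_(x in cube 1) `|(f x)%:E| = 0)%E.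
    under eq_integral do rewrite abse_EFin ger0_norm//.
    rewrite -EFin_Int//; congr EFin; apply/eqP; rewrite eq_le Int_ge0// andbT.
    apply: le_trans HJ; rewrite /J -IntD; [|exact: (L1_J wh L1_U)|exact: (L1_J wh L1_P)].
    by rewrite le_eqVlt; apply/orP; left; apply/eqP; apply: eq_Int => x _; rewrite /f mulrDr.
  have mf : measurable_fun (cube 1) (EFin \o f) by case/integrableP : Lf.
  have := (ae_eq_integral_abs mu (measurable_cube 1) mf).1 I0.
  apply: filterS => x /= fx xA; have l0 : logr x < 0.
    by case/andP : xA => _ h; apply: (lt_trans h); exact: lt_le_trans R1.
  have xQ : cube 1 x.
    apply: contrapT => xQ; have := weight_supp wh xQ.
    by have := hat_gt0 xA => /[swap] ->; rewrite ltxx.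
  have [/eqP] := fx xQ; rewrite /f mulf_eq0 gt_eqF ?hat_gt0//=.
  rewrite paddr_eq0 ?sqr_ge0// => /andP[/eqP -> /eqP ->]; by split.
have Hk : {ae mu, forall x, forall k : nat, annulus (- k%:R) (ln R0 - k.+1%:R^-1) x -> U x = 0 /\ Pq x = 0}.
  by apply: ae_foralln => k; apply: Hab; rewrite ltrBlDr ltrDl invr_gt0.
(* The origin lies in no annulus; it is removed as part of a coordinate hyperplane, which exists
   because n > 0. *)
have Hc := @ae_coord_neq R n (fun=> 0).
have [_ _ qE] := rq.
apply: filterS2 (filterI Hk Hc) (filterI uE qE) => x [Hx xc] [Hu Hq] xD.
have x0 : x != 0 by apply: contraNneq (xc (Ordinal n0)) => ->; rewrite mxE.
have lR : logr x < ln R0.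
  by rewrite -ltr_expR -enorm_logr// lnK.
suff [k /Hx[Ux Px]] : exists k : nat, annulus (- k%:R) (ln R0 - k.+1%:R^-1) x.
  split; last by apply/eqP; rewrite -sqrf_eq0 Hq// -/(Pq x) Px.
  apply/rowP => i; rewrite Hu// mxE; apply/eqP; rewrite -sqrf_eq0 eq_le sqr_ge0 andbT -Ux.
  by rewrite /U (bigD1 i)//= lerDl; apply: sumr_ge0 => j _; exact: sqr_ge0.
have d0 : 0 < ln R0 - logr x by rewrite subr_gt0.
pose k := Num.bound (`|logr x| + (ln R0 - logr x)^-1).
have Bk : `|logr x| + (ln R0 - logr x)^-1 < k%:R.
  by apply: archi_boundP; rewrite addr_ge0// invr_ge0 ltW.
have k1 : (ln R0 - logr x)^-1 < k%:R by have := normr_ge0 (logr x); lra.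
have k2 : `|logr x| < k%:R.
  have : 0 < (ln R0 - logr x)^-1 by rewrite invr_gt0.
  lra.
exists k; rewrite /annulus/=; move: k2; rewrite ltr_norml => /andP[-> _] /=.
rewrite ltrBrDr -ltrBrDl invf_plt ?posrE// (lt_trans k1)// ltr_nat//.
Qed.

End system.

(** * The convex weight *)

Section cutoffs.
Context {R : realType}.
Implicit Types (a b c d s t : R).

Definition pos t : R := Num.max 0 t.

Lemma continuous_pos : continuous pos.
Proof. by move=> t; apply: (@continuous_max _ _ (cst 0) id); [exact: cvg_cst|exact: cvg_id]. Qed.

(** The remainder after the linear term is at most (s - t)^2 whatever the signs of s and t, so
    [is_derive_quad] treats all points at once, including 0. *)
Lemma is_derive_pos2 t : is_derive t (1 : R) (fun s => pos s ^+ 2) (2 * pos t).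
Proof.
have H : is_derive t (1 : R) (fun s => pos s ^+ 2 - pos t ^+ 2 - 2 * pos t * (s - t)) 0.
  apply: (@is_derive_quad R _ (cst 1)); [ring|exact: cvg_cst|].
  move=> s; rewrite /pos /cst mul1r ler_norml.
  have := sqr_ge0 (s - t); have := sqr_ge0 s; have := sqr_ge0 t; rewrite !expr2.
  have [s0|s0] := leP 0 s; have [t0|t0] := leP 0 t.
  - by move=> ? ? ?; apply/andP; split; lra.
  - have := mulr_ge0 s0 (ltW (etrans (oppr_gt0 t) t0)).
    by move=> ? ? ? ?; apply/andP; split; lra.
  - have := mulr_ge0 t0 (ltW (etrans (oppr_gt0 s) s0)).
    by move=> ? ? ? ?; apply/andP; split; lra.
  - by move=> ? ? ?; apply/andP; split; lra.
have H2 := is_derive_add (is_derive_mul (is_derive_cst (2 * pos t) t (1 : R))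
  (is_derive_add (is_derive_id t (1 : R)) (is_derive_cst (- t) t (1 : R))))
  (is_derive_cst (pos t ^+ 2) t (1 : R)).
have := is_derive_add H H2; congr is_derive; last by rewrite /cst; ring.
by apply/funext => s; rewrite /cst; ring.
Qed.

(* A C^1 transition from 0 to 1 on [0, 1]. *)
Definition step t : R := 2 * (pos t ^+ 2 - 2 * pos (t - 2^-1) ^+ 2 + pos (t - 1) ^+ 2).
Definition dstep t : R := 4 * (pos t - 2 * pos (t - 2^-1) + pos (t - 1)).

Lemma is_derive_step t : is_derive t (1 : R) step (dstep t).
Proof.
have H c : is_derive t (1 : R) (fun s => pos (s - c) ^+ 2) (2 * pos (t - c)).
  have := is_derive_comp1 (is_derive_add (is_derive_id t (1 : R)) (is_derive_cst (- c) t (1 : R)))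
    (is_derive_pos2 (t - c)).
  by rewrite addr0 mulr1.
have := is_derive_mul (is_derive_cst (2 : R) t (1 : R)) (is_derive_add (is_derive_add (is_derive_pos2 t)
  (is_derive_mul (is_derive_cst (- 2 : R) t (1 : R)) (H 2^-1))) (H 1)).
congr is_derive; last by rewrite /cst /dstep; ring.
by apply/funext => s; rewrite /cst /step; ring.
Qed.

Lemma continuous_dstep : continuous dstep.
Proof.
have H c : continuous (fun s : R => pos (s - c)).
  move=> t; apply: (@continuous_comp _ _ _ (fun s : R => s - c) pos); last exact: continuous_pos.
  by apply: cvgB; [exact: cvg_id|exact: cvg_cst].
move=> t; apply: cvgM; first exact: cvg_cst.
apply: cvgD; last exact: H.
apply: cvgB; first exact: continuous_pos.
by apply: cvgM; [exact: cvg_cst|exact: H].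
Qed.

Lemma step0 t : t <= 0 -> step t = 0 /\ dstep t = 0.
Proof. by move=> t0; rewrite /step /dstep /pos !max_l; [split; ring|lra|lra|lra]. Qed.

Lemma step1 t : 1 <= t -> step t = 1 /\ dstep t = 0.
Proof. by move=> t0; rewrite /step /dstep /pos !max_r; [split; field|lra|lra|lra]. Qed.

Lemma step01 t : 0 <= step t <= 1.
Proof.
rewrite /step /pos; have [t0|t0] := leP 0 t; have [t1|t1] := leP 0 (t - 2^-1);
  have [t2|t2] := leP 0 (t - 1); apply/andP; split; nra.
Qed.

Lemma dstep02 t : 0 <= dstep t <= 2.
Proof.
rewrite /dstep /pos; have [t0|t0] := leP 0 t; have [t1|t1] := leP 0 (t - 2^-1);
  have [t2|t2] := leP 0 (t - 1); apply/andP; split; lra.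
Qed.

Definition ramp a b t : R := step ((t - a) / (b - a)).
Definition dramp a b t : R := dstep ((t - a) / (b - a)) / (b - a).

Lemma is_derive_ramp a b t : is_derive t (1 : R) (ramp a b) (dramp a b t).
Proof.
have H : is_derive t (1 : R) (fun s => (s - a) / (b - a)) ((b - a)^-1).
  have := is_derive_mul (is_derive_add (is_derive_id t (1 : R)) (is_derive_cst (- a) t (1 : R)))
    (is_derive_cst ((b - a)^-1) t (1 : R)).
  by rewrite addr0 mul1r mulr0 addr0.
exact: (is_derive_comp1 H (is_derive_step _)).
Qed.

Lemma continuous_dramp a b : continuous (dramp a b).
Proof.
move=> t; apply: cvgM; last exact: cvg_cst.
apply: (@continuous_comp _ _ _ (fun s : R => (s - a) / (b - a)) dstep); last exact: continuous_dstep.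
by apply: cvgM; [apply: cvgB; [exact: cvg_id|exact: cvg_cst]|exact: cvg_cst].
Qed.

Lemma ramp0 a b t : a < b -> t <= a -> ramp a b t = 0 /\ dramp a b t = 0.
Proof.
move=> ab ta; have ba : 0 < b - a by rewrite subr_gt0.
have [|h1 h2] := @step0 ((t - a) / (b - a)); last by rewrite /ramp /dramp h1 h2 mul0r.
by rewrite pmulr_lle0 ?invr_gt0// subr_le0.
Qed.

Lemma ramp1 a b t : a < b -> b <= t -> ramp a b t = 1 /\ dramp a b t = 0.
Proof.
move=> ab bt; have ba : 0 < b - a by rewrite subr_gt0.
have [|h1 h2] := @step1 ((t - a) / (b - a)); last by rewrite /ramp /dramp h1 h2 mul0r.
by rewrite ler_pdivlMr// mul1r lerD2r.
Qed.

Lemma weight0_dramp a b : a < b -> b < 0 -> weight0 (dramp a b).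
Proof.
move=> ab b0; split; first exact: continuous_dramp.
exists a, b; split => // t tab; have [ta|at_] := leP t a; first by case: (ramp0 ab ta).
have [bt|tb] := leP b t; first by case: (ramp1 ab bt).
by case: tab; rewrite at_ tb.
Qed.

Definition plateau a b c d t : R := ramp a b t * (1 - ramp c d t).
Definition dplateau a b c d t : R := dramp a b t * (1 - ramp c d t) + ramp a b t * - dramp c d t.

Lemma weight1_plateau a b c d : a < b -> c < d -> d < 0 -> weight1 (plateau a b c d) (dplateau a b c d).
Proof.
move=> ab cd d0.
have D t : is_derive t (1 : R) (plateau a b c d) (dplateau a b c d t).
  have := is_derive_mul (is_derive_ramp a b t)
    (is_derive_add (is_derive_cst (1 : R) t (1 : R)) (is_derive_opp (is_derive_ramp c d t))).
  by rewrite add0r.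
have cr e f : continuous (ramp e f).
  by move=> t; apply: (@is_derive_continuous R (ramp e f) (dramp e f)); exact: is_derive_ramp.
have Z t : ~ (a < t < d) -> plateau a b c d t = 0 /\ dplateau a b c d t = 0.
  move=> tab; rewrite /plateau /dplateau; have [ta|at_] := leP t a.
    by have [-> ->] := ramp0 ab ta; rewrite !mul0r addr0.
  have [dt|td] := leP d t; last by case: tab; rewrite at_ td.
  by have [-> ->] := ramp1 cd dt; rewrite subrr oppr0 !mulr0 addr0.
split => //; split.
- by move=> t; apply: cvgM; [exact: cr|apply: cvgB; [exact: cvg_cst|exact: cr]].
- by exists a, d; split => // t /Z[].
- move=> t; apply: cvgD; apply: cvgM.
  + exact: continuous_dramp.
  + by apply: cvgB; [exact: cvg_cst|exact: cr].
  + exact: cr.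
  + by apply: cvgN; exact: continuous_dramp.
- by exists a, d; split => // t /Z[].
Qed.

Lemma plateau01 a b c d t : 0 <= plateau a b c d t <= 1.
Proof.
rewrite /plateau /ramp; have := step01 ((t - a) / (b - a)); have := step01 ((t - c) / (d - c)).
set x := step _; set y := step _ => /andP[? ?] /andP[? ?]; apply/andP; split; nra.
Qed.

Lemma plateau1 a b c d t : a < b -> c < d -> b <= t <= c -> plateau a b c d t = 1.
Proof.
move=> ab cd /andP[bt tc]; rewrite /plateau.
by have [-> _] := ramp1 ab bt; have [-> _] := ramp0 cd tc; rewrite subr0 mulr1.
Qed.

Lemma plateau0 a b c d t : c < d -> d <= t -> plateau a b c d t = 0 /\ dplateau a b c d t = 0.
Proof.
move=> cd dt; rewrite /plateau /dplateau.
by have [-> ->] := ramp1 cd dt; rewrite subrr oppr0 !mulr0 addr0.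
Qed.

Lemma plateau0l a b c d t : a < b -> t <= a -> plateau a b c d t = 0 /\ dplateau a b c d t = 0.
Proof.
by move=> ab ta; rewrite /plateau /dplateau; have [-> ->] := ramp0 ab ta; rewrite !mul0r addr0.
Qed.

Lemma dplateau_sqr a b c d t : dplateau a b c d t * dplateau a b c d t <=
  2 * dramp a b t ^+ 2 + 2 * dramp c d t ^+ 2.
Proof.
rewrite /dplateau /ramp; have := step01 ((t - a) / (b - a)); have := step01 ((t - c) / (d - c)).
move: (step ((t - a) / (b - a))) (step ((t - c) / (d - c))) => y x /andP[x0 x1] /andP[y0 y1].
move: (dramp a b t) (dramp c d t) => p q.
apply: (@le_trans _ _ (2 * (p * (1 - x)) ^+ 2 + 2 * (y * q) ^+ 2)).
  by have := sqr_ge0 (p * (1 - x) + y * q); nra.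
have h1 : (1 - x) ^+ 2 <= 1 by rewrite expr_le1//; lra.
have h2 : y ^+ 2 <= 1 by rewrite expr_le1.
by rewrite !exprMn; apply: lerD; rewrite ler_pM2l// ?ler_piMr ?ler_piMl ?sqr_ge0.
Qed.

Lemma dramp_sqr a b t : a < b -> dramp a b t ^+ 2 <= 4 / (b - a) ^+ 2.
Proof.
move=> ab; have ba : 0 < b - a by rewrite subr_gt0.
rewrite /dramp exprMn exprVn ler_wpM2r ?invr_ge0 ?sqr_ge0//.
have /andP[h1 h2] := dstep02 ((t - a) / (b - a)); nra.
Qed.

End cutoffs.

Section weight_functions.
Context {R : realType}.
Variables (n : nat) (c be : R).
Implicit Types (t : R).

Definition ect t : R := expR (c * t^-1).
(* The weight [phi] is convex in t, and its second derivative [aa] dominates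
   [|t|^-3] times its first derivative [- bb]. *)
Definition phi t : R := - t * ect t.
Definition bb t : R := ect t * (1 - c * t^-1).
Definition aa t : R := - (c ^+ 2 * t ^- 3 * ect t).
(** The factor exp(- n t) = |x|^-n offsets the divergence n of the Euler field; it is the term - n
    in the equation for E in [carleman]. *)
Definition w0 t : R := expR (2 * be * phi t - n%:R * t).

Lemma is_derive_inv t : t < 0 -> is_derive t (1 : R) (fun s : R => s^-1) (- t ^- 2).
Proof.
move=> t0; have := is_deriveV (ltr0_neq0 t0 : id t != 0) (is_derive_id t (1 : R)).
by rewrite /GRing.scale/= mulr1.
Qed.

Lemma is_derive_ect t : t < 0 -> is_derive t (1 : R) ect (- (c * t ^- 2) * ect t).
Proof.
move=> t0; have := is_derive_comp1 (is_derive_mul (is_derive_cst c t (1 : R)) (is_derive_inv t0))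
  (is_derive_expR (c * t^-1)).
by congr is_derive; rewrite /cst /ect; ring.
Qed.

Lemma is_derive_phi t : t < 0 -> is_derive t (1 : R) phi (- bb t).
Proof.
move=> t0; have := is_derive_mul (is_derive_opp (is_derive_id t (1 : R))) (is_derive_ect t0).
congr is_derive; rewrite /bb; field; by rewrite lt_eqF.
Qed.

Lemma is_derive_bb t : t < 0 -> is_derive t (1 : R) bb (- aa t).
Proof.
move=> t0; have := is_derive_mul (is_derive_ect t0)
  (is_derive_add (is_derive_cst (1 : R) t (1 : R)) (is_derive_opp
    (is_derive_mul (is_derive_cst c t (1 : R)) (is_derive_inv t0)))).
congr is_derive; rewrite /aa /cst; field; by rewrite lt_eqF.
Qed.

Lemma is_derive_aa t : t < 0 ->
  is_derive t (1 : R) aa ((- 3 * t^-1 - c * t ^- 2) * aa t).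
Proof.
move=> t0.
have -> : aa = (fun s => (- c ^+ 2 * (s^-1 ^+ 3)) * ect s).
  by apply/funext => s; rewrite /aa -exprVn; ring.
have := is_derive_mul (is_derive_mul (is_derive_cst (- c ^+ 2) t (1 : R))
  (is_derive_exp 3 (is_derive_inv t0))) (is_derive_ect t0).
congr is_derive; rewrite /cst; field; by rewrite lt_eqF.
Qed.

Lemma is_derive_w0 t : t < 0 ->
  is_derive t (1 : R) w0 ((- 2 * be * bb t - n%:R) * w0 t).
Proof.
move=> t0.
have := is_derive_comp1 (is_derive_add
  (is_derive_mul (is_derive_cst (2 * be) t (1 : R)) (is_derive_phi t0))
  (is_derive_opp (is_derive_mul (is_derive_cst (n%:R : R) t (1 : R)) (is_derive_id t (1 : R)))))
  (is_derive_expR (2 * be * phi t - n%:R * t)).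
by congr is_derive; rewrite /cst /w0; ring.
Qed.

Lemma w0_gt0 t : 0 < w0 t. Proof. exact: expR_gt0. Qed.

End weight_functions.

(** * Absorption *)

Section weight_bounds.
Context {R : realType}.
Variables (n : nat) (c be t1 : R).
Hypotheses (c_gt0 : 0 < c) (t1_lt0 : t1 < 0).
Implicit Types (t : R).

Local Notation ect := (ect c).
Local Notation bb := (bb c).
Local Notation aa := (aa c).

Let e1 := expR (c * t1^-1).
Let e1_gt0 : 0 < e1. Proof. exact: expR_gt0. Qed.

Lemma inv_bounds t : t <= t1 -> 0 < - t^-1 <= - t1^-1.
Proof.
move=> tt1; have t0 : t < 0 by exact: le_lt_trans t1_lt0.
by rewrite oppr_gt0 invr_lt0 t0 lerN2 lef_nV2// ?negrE.
Qed.

Lemma ect_ge t : t <= t1 -> e1 <= ect t.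
Proof.
move=> /inv_bounds /andP[_ h]; rewrite ler_expR ler_pM2l//; lra.
Qed.

Lemma ect_le1 t : t < 0 -> ect t <= 1.
Proof.
by move=> t0; rewrite -expR0 ler_expR nmulr_lle0 ?invr_lt0// ltW.
Qed.

Lemma aaE t : aa t = c ^+ 2 * (- t^-1) ^+ 3 * ect t.
Proof. by rewrite /aa -exprVn; ring. Qed.

Lemma bbE t : bb t = ect t * (1 + c * - t^-1).
Proof. by rewrite /bb mulrN. Qed.

Lemma aa_gt0 t : t < 0 -> 0 < aa t.
Proof.
move=> t0; rewrite aaE mulr_gt0 ?expR_gt0// mulr_gt0 ?exprn_gt0// oppr_gt0.
by rewrite invr_lt0.
Qed.

Lemma bb_ge t : t <= t1 -> e1 <= bb t.
Proof.
move=> tt1; have /andP[h _] := inv_bounds tt1; have := ect_ge tt1; rewrite bbE.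
have : 0 <= c * - t^-1 by rewrite mulr_ge0// ltW.
have := e1_gt0; nra.
Qed.

Definition Kconst : R := (- t1^-1) ^+ 3 * (c ^+ 2 * e1)^-1.

Lemma Kconst_ge0 : 0 <= Kconst.
Proof.
apply: mulr_ge0; first by rewrite exprn_ge0// oppr_ge0 invr_le0 ltW.
by rewrite invr_ge0 mulr_ge0 ?sqr_ge0// ltW.
Qed.

(** Of the two factors |t|^-3, one is bounded by its value at t1 and the other by [aa] divided by
    c^2 e1. *)
Lemma invX6_le t : t <= t1 -> t ^- 6 <= Kconst * aa t.
Proof.
move=> tt1; have /andP[h1 h2] := inv_bounds tt1; have h3 := ect_ge tt1.
rewrite aaE (_ : t ^- 6 = (- t^-1) ^+ 3 * (- t^-1) ^+ 3); last by rewrite -exprVn; ring.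
rewrite /Kconst; set y := - t^-1 in h1 h2 *; set y1 := - t1^-1 in h2 *.
have y10 : 0 < y1 by exact: lt_le_trans h2.
have ce : 0 < c ^+ 2 * e1 by rewrite mulr_gt0 ?exprn_gt0.
have -> : y1 ^+ 3 / (c ^+ 2 * e1) * (c ^+ 2 * y ^+ 3 * ect t) =
    y1 ^+ 3 * y ^+ 3 * (ect t / e1) by field; rewrite !gt_eqF.
have h4 : y ^+ 3 <= y1 ^+ 3 by rewrite ler_pXn2r// nnegrE ltW.
have h5 : 1 <= ect t / e1 by rewrite ler_pdivlMr// mul1r.
apply: (@le_trans _ _ (y1 ^+ 3 * y ^+ 3)); first by rewrite ler_wpM2r// exprn_ge0// ltW.
by rewrite ler_peMr// mulr_ge0// exprn_ge0// ltW.
Qed.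

(** The quotient of [aa] by [bb] is |t|^-3 c^2 / (1 + c |t|^-1), and the last fraction is smallest
    at t1. The first hypothesis on c asks it to be at least [Lam] there. *)
Lemma bb_le_aa (Lam t : R) : 0 <= Lam -> Lam * (1 - c * t1^-1) <= c ^+ 2 -> t <= t1 ->
  Lam ^+ 2 * (t ^- 6 * bb t ^+ 2) <= aa t ^+ 2.
Proof.
move=> L0 Lc tt1; have /andP[h1 h2] := inv_bounds tt1.
rewrite (_ : _ * _ = (Lam * (- t^-1) ^+ 3 * bb t) ^+ 2); last by rewrite -exprVn; ring.
have e0 := expR_gt0 (c * t^-1).
have y3 : 0 <= (- t^-1) ^+ 3 by rewrite exprn_ge0// ltW.
have b0 : 0 <= bb t by rewrite (le_trans _ (bb_ge tt1))// ltW.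
have l0 := mulr_ge0 (mulr_ge0 L0 y3) b0.
have a0 := ltW (aa_gt0 (le_lt_trans tt1 t1_lt0)).
rewrite ler_pXn2r// ?nnegrE//.
rewrite aaE bbE (_ : Lam * _ * _ = Lam * (1 + c * - t^-1) * (- t^-1) ^+ 3 * ect t); last by ring.
rewrite ler_wpM2r ?(ltW e0)// ler_wpM2r//.
apply: le_trans Lc; rewrite ler_wpM2l// lerD2l -mulrN ler_wpM2l// ltW//.
Qed.

(** The correction is half the second derivative of ln [aa]. Its negative part c |t|^-3 is at most
    half of [be * aa] as soon as be c e1 >= 2. *)
Lemma dPsi_ge t : 2 <= be * (c * e1) -> t <= t1 ->
  be / 2 * aa t <= be * aa t + 2^-1 * (3 * t ^- 2 + 2 * c * t ^- 3).
Proof.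
move=> hb tt1; have /andP[h1 h2] := inv_bounds tt1; have h3 := ect_ge tt1.
rewrite aaE -!exprVn; set y := - t^-1 in h1 h2 *; have -> : t^-1 = - y by rewrite opprK.
rewrite -subr_ge0.
have -> : be * (c ^+ 2 * y ^+ 3 * ect t) + 2^-1 * (3 * (- y) ^+ 2 + 2 * c * (- y) ^+ 3) -
    be / 2 * (c ^+ 2 * y ^+ 3 * ect t) =
    c * y ^+ 3 * (be * (c * ect t) / 2 - 1) + 2^-1 * 3 * y ^+ 2 by field.
have y2 : 0 <= 2^-1 * 3 * y ^+ 2 by rewrite mulr_ge0// sqr_ge0.
have cy : 0 <= c * y ^+ 3 by apply: mulr_ge0; [exact: ltW|rewrite exprn_ge0// ltW].
apply: addr_ge0 => //; apply: mulr_ge0 => //.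
have be0 : 0 <= be.
  rewrite leNgt; apply/negP => b0; have : be * (c * e1) < 0 by rewrite nmulr_rlt0// mulr_gt0.
  lra.
have : be * (c * e1) <= be * (c * ect t) by rewrite ler_wpM2l// ler_wpM2l// ltW.
lra.
Qed.

(** The bracket is the logarithmic derivative of the cut-off factor in [step3]. Its part free of
    [be] is at most [be * bb], so the whole is at most twice that, whence the factor 4. *)
Lemma dlog_sqr t : 1 + n%:R + 3 * - t1^-1 <= be * e1 -> 0 <= be -> t <= t1 ->
  (- be * bb t + (1 - n%:R / 2) - 3 * t^-1) ^+ 2 <= 4 * be ^+ 2 * bb t ^+ 2.
Proof.
move=> hb b0 tt1; have /andP[h1 h2] := inv_bounds tt1.
have h3 : be * e1 <= be * bb t by rewrite ler_wpM2l// bb_ge.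
have n0 : 0 <= n%:R :> R by [].
rewrite (_ : 4 * _ * _ = (2 * (be * bb t)) ^+ 2); last by ring.
rewrite -[leLHS]real_normK ?num_real// ler_pXn2r ?nnegrE//; last by have := e1_gt0; nra.
by rewrite ler_norml mulNr; apply/andP; split; lra.
Qed.

Lemma phi_le t : t < 0 -> phi c t <= - t.
Proof. by move=> t0; rewrite /phi ler_piMr ?ect_le1// oppr_ge0 ltW. Qed.

End weight_bounds.

Section absorption.
Context {R : realType} {n : nat}.
Variables (P U Gq W : 'rV[R]_n -> R) (L C0 : R).
Hypotheses (LP : L1 P) (LU : L1 U) (LG : L1 Gq) (LW : L1 W).
Hypotheses (P0 : forall x, 0 <= P x) (U0 : forall x, 0 <= U x) (G0 : forall x, 0 <= Gq x).
Hypotheses (PW : forall x, 2 * P x <= W x) (WPG : forall x, W x <= 2 * P x + 4 * Gq x).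
Hypotheses (L_le0 : L <= 0) (C0_gt0 : 0 < C0).

Hypothesis pressure_ineq : forall s1 (chi dchi E Psi dPsi : R -> R), s1 < L -> weight1 chi dchi ->
  (forall t, s1 <= t -> chi t = 0) -> (forall t, s1 <= t -> dchi t = 0) ->
  (forall t : R, t < 0 -> 0 <= E t) ->
  (forall t : R, t < 0 -> is_derive t (1 : R) E ((2 * Psi t - n%:R) * E t)) ->
  (forall t : R, t < 0 -> is_derive t (1 : R) Psi (dPsi t)) ->
  (forall t : R, t < 0 -> {for t, continuous dPsi}) ->
  J (fun t => chi t * chi t * (E t * dPsi t)) W <=
  2 * C0 ^+ 2 * J (fun t => chi t * chi t * E t * t ^- 6) Gq + J (fun t => dchi t * dchi t * E t) W.
Hypothesis velocity_ineq : forall s1 (chi dchi E Psi dPsi : R -> R), s1 < L -> weight1 chi dchi ->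
  (forall t, s1 <= t -> chi t = 0) -> (forall t, s1 <= t -> dchi t = 0) ->
  (forall t : R, t < 0 -> 0 <= E t) ->
  (forall t : R, t < 0 -> is_derive t (1 : R) E ((2 * Psi t - n%:R) * E t)) ->
  (forall t : R, t < 0 -> is_derive t (1 : R) Psi (dPsi t)) ->
  (forall t : R, t < 0 -> {for t, continuous dPsi}) ->
  J (fun t => chi t * chi t * (E t * dPsi t)) U <=
  J (fun t => chi t * chi t * E t * expR (2 * t)) W + J (fun t => dchi t * dchi t * E t) U.
Hypothesis caccioppoli_ineq : forall s1 (eta deta : R -> R), s1 < L -> weight1 eta deta ->
  (forall t, s1 <= t -> eta t = 0) -> (forall t, s1 <= t -> deta t = 0) ->
  J (fun t => eta t * eta t) Gq <=
  12 * J (fun t => deta t * deta t * expR (- 2 * t)) U + 4 * J (fun t => eta t * eta t) P +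
  4 * C0 ^+ 2 * J (fun t => eta t * eta t * (t ^- 6 * expR (- 2 * t))) U.

Let W0 x : 0 <= W x. Proof. by apply: le_trans (PW x); rewrite mulr_ge0. Qed.

Section fixed_parameter.
Variables (t1 c be : R).
Hypotheses (t1L : t1 < L) (c_gt0 : 0 < c).
Let t1_lt0 : t1 < 0. Proof. exact: lt_le_trans L_le0. Qed.
Let e1 := expR (c * t1^-1).
(** With this value the loss 96 be^2 / Lam^2 times the 2 C0^2 of [step1] is 3/25 be^2. Through
    [step2] it consumes 6/25 of be * X, safely below one half. *)
Let Lam : R := 40 * C0.
Let K := Kconst c t1.
Hypothesis c_large : Lam * (1 - c * t1^-1) <= c ^+ 2.
Hypotheses (be1 : 1 <= be) (be2 : 2 <= be * (c * e1)) (be3 : 1 + n%:R + 3 * - t1^-1 <= be * e1)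
  (be4 : 128 * C0 ^+ 4 * K ^+ 2 <= be) (be5 : 32 * C0 ^+ 2 * K <= be).

Local Notation bb := (bb c).
Local Notation aa := (aa c).
Local Notation w0 := (w0 n c be).

Let caa (t : R) : t < 0 -> {for t, continuous aa}.
Proof.
move=> t0; apply: (@is_derive_continuous R aa (fun t => (- 3 * t^-1 - c * t ^- 2) * aa t)).
exact: is_derive_aa.
Qed.
Let cbb (t : R) : t < 0 -> {for t, continuous bb}.
Proof. by move=> t0; apply: (@is_derive_continuous R bb (fun t => - aa t)); exact: is_derive_bb. Qed.
Let cw0 (t : R) : t < 0 -> {for t, continuous w0}.
Proof.
move=> t0; apply: (@is_derive_continuous R w0 (fun t => (- 2 * be * bb t - n%:R) * w0 t)).
exact: is_derive_w0.
Qed.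

Variables chi dchi : R -> R.
Hypotheses (wchi : weight1 chi dchi) (chi0 : forall t, t1 <= t -> chi t = 0)
  (dchi0 : forall t, t1 <= t -> dchi t = 0).

(** X carries pressure and vorticity, Y the velocity, Z the gradient; the B terms come from the
    cut-off. The velocity weight has one more factor [aa]: the choice E = w0 * aa makes the right
    side of the velocity inequality equal to X and lets its left side control be * Y. *)
Let X := J (fun t => chi t * chi t * (w0 t * expR (2 * t) * aa t)) W.
Let Y := J (fun t => chi t * chi t * (w0 t * aa t * aa t)) U.
Let Z := J (fun t => chi t * chi t * (w0 t * expR (2 * t) * t ^- 6)) Gq.
Let B1 := J (fun t => dchi t * dchi t * (w0 t * expR (2 * t))) W.
Let B2 := J (fun t => dchi t * dchi t * (w0 t * aa t)) U.
Let B3 := J (fun t => dchi t * dchi t * (w0 t * t ^- 6)) U.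

Let wM (k g : R -> R) : weight0 k -> (forall t : R, t < 0 -> {for t, continuous g}) ->
  weight0 (fun t => k t * k t * g t).
Proof. by move=> wk cg; apply: weight0M => //; apply: weight0M => // t _; exact: wk.1. Qed.

Let cwe (t : R) : t < 0 -> {for t, continuous (fun t => w0 t * expR (2 * t))}.
Proof. by move=> t0; apply: cvgM; [exact: cw0|exact: continuous_expZ]. Qed.
Let cwa (t : R) : t < 0 -> {for t, continuous (fun t => w0 t * aa t)}.
Proof. by move=> t0; apply: cvgM; [exact: cw0|exact: caa]. Qed.
Let cwaa (t : R) : t < 0 -> {for t, continuous (fun t => w0 t * aa t * aa t)}.
Proof. by move=> t0; apply: cvgM; [exact: cwa|exact: caa]. Qed.
Let cwea (t : R) : t < 0 -> {for t, continuous (fun t => w0 t * expR (2 * t) * aa t)}.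
Proof. by move=> t0; apply: cvgM; [exact: cwe|exact: caa]. Qed.
Let cwe6 (t : R) : t < 0 -> {for t, continuous (fun t => w0 t * expR (2 * t) * t ^- 6)}.
Proof. by move=> t0; apply: cvgM; [exact: cwe|exact: continuous_exprV]. Qed.
Let cw6 (t : R) : t < 0 -> {for t, continuous (fun t => w0 t * t ^- 6)}.
Proof. by move=> t0; apply: cvgM; [exact: cw0|exact: continuous_exprV]. Qed.

Let wc : weight0 chi. Proof. by case: wchi. Qed.
Let wd : weight0 dchi. Proof. by case: wchi. Qed.
Let sq0 (a : R) : 0 <= a * a. Proof. by rewrite -expr2 sqr_ge0. Qed.
Let aa0 (t : R) : t < 0 -> 0 <= aa t. Proof. by move=> t0; exact/ltW/aa_gt0. Qed.
Let w00 (t : R) : 0 <= w0 t. Proof. exact/ltW/w0_gt0. Qed.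

Let step1 : be * X <= 2 * C0 ^+ 2 * Z + B1.
Proof.
pose E t := w0 t * expR (2 * t); pose Psi t := - be * bb t + 1; pose dPsi t := be * aa t.
have dE (t : R) : t < 0 -> is_derive t (1 : R) E ((2 * Psi t - n%:R) * E t).
  move=> t0; have he := is_derive_comp1 (is_derive_mul (is_derive_cst (2 : R) t (1 : R))
    (is_derive_id t (1 : R))) (is_derive_expR (2 * t)).
  have := is_derive_mul (is_derive_w0 n c be t0) he.
  by congr is_derive; rewrite /Psi /E /cst; ring.
have dP (t : R) : t < 0 -> is_derive t (1 : R) Psi (dPsi t).
  move=> t0; have := is_derive_add (is_derive_mul (is_derive_cst (- be) t (1 : R)) (is_derive_bb c t0))
    (is_derive_cst (1 : R) t (1 : R)).
  by congr is_derive; rewrite /dPsi /cst; ring.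
have cP (t : R) : t < 0 -> {for t, continuous dPsi}.
  by move=> t0; apply: cvgM; [exact: cvg_cst|exact: caa].
have E0 (t : R) : t < 0 -> 0 <= E t by move=> _; rewrite mulr_ge0// expR_ge0.
have := pressure_ineq t1L wchi chi0 dchi0 E0 dE dP cP.
rewrite /X -(J_Z be (wM wc cwea) LW).
rewrite [J _ W](_ : _ = J (fun t => be * (chi t * chi t * (w0 t * expR (2 * t) * aa t))) W); last first.
  by congr J; apply/funext => t; rewrite /E /dPsi; ring.
rewrite [J _ Gq](_ : _ = Z)//; congr J; apply/funext => t; rewrite /E; ring.
Qed.

Let step2 : be / 2 * Y <= X + B2.
Proof.
pose E t := w0 t * aa t; pose Psi t := - be * bb t + 2^-1 * (- 3 * t^-1 - c * t ^- 2).
pose dPsi t := be * aa t + 2^-1 * (3 * t ^- 2 + 2 * c * t ^- 3).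
have dE (t : R) : t < 0 -> is_derive t (1 : R) E ((2 * Psi t - n%:R) * E t).
  move=> t0; have := is_derive_mul (is_derive_w0 n c be t0) (is_derive_aa c t0).
  by congr is_derive; rewrite /Psi /E; field; rewrite lt_eqF.
have dP (t : R) : t < 0 -> is_derive t (1 : R) Psi (dPsi t).
  move=> t0; have := is_derive_add (is_derive_mul (is_derive_cst (- be) t (1 : R)) (is_derive_bb c t0))
    (is_derive_mul (is_derive_cst (2^-1 : R) t (1 : R)) (is_derive_add
      (is_derive_mul (is_derive_cst (- 3 : R) t (1 : R)) (is_derive_inv t0))
      (is_derive_mul (is_derive_cst (- c) t (1 : R)) (is_derive_exp 2 (is_derive_inv t0))))).
  rewrite (_ : (fun _ => _) = Psi); last first.
    by apply/funext => s; rewrite /cst /Psi exprVn; ring.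
  by congr is_derive; rewrite /dPsi /cst; field; rewrite lt_eqF.
have cP (t : R) : t < 0 -> {for t, continuous dPsi}.
  move=> t0; apply: cvgD; first by apply: cvgM; [exact: cvg_cst|exact: caa].
  apply: cvgM; first exact: cvg_cst.
  by apply: cvgD; (apply: cvgM; [exact: cvg_cst|exact: continuous_exprV]).
have E0 (t : R) : t < 0 -> 0 <= E t by move=> t0; rewrite mulr_ge0// aa0.
have := velocity_ineq t1L wchi chi0 dchi0 E0 dE dP cP.
rewrite [J _ W](_ : _ = X); last by congr J; apply/funext => t; rewrite /E; ring.
apply: le_trans; rewrite /Y -(J_Z (be / 2) (wM wc cwaa) LU).
apply: le_J => //.
- exact: (weight0Z _ (wM wc cwaa)).
- by apply: wM => // t t0; apply: cvgM; [exact: cwa|exact: cP].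
move=> t t0; have [tt|tt] := leP t1 t; first by rewrite chi0// !mul0r mulr0.
rewrite (_ : be / 2 * _ = chi t * chi t * (w0 t * aa t * (be / 2 * aa t))); last by ring.
rewrite ler_wpM2l// ler_wpM2l ?mulr_ge0 ?aa0//; apply: (dPsi_ge c_gt0 t1_lt0) => //; exact: ltW.
Qed.

(** Caccioppoli with the cut-off chi * h, where h^2 = w0 exp(2 t) t^-6 makes the left side equal to
    Z. The logarithmic derivative of h costs be^2 bb^2 t^-6, which [bb_le_aa] converts into the
    weight of Y; the pressure and drift terms are converted by [invX6_le]. *)
Let step3 : Z <= 24 * B3 + 96 * be ^+ 2 / Lam ^+ 2 * Y + 2 * K * X + 4 * C0 ^+ 2 * K ^+ 2 * Y.
Proof.
have Lam0 : 0 < Lam by rewrite mulr_gt0.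
pose h t := expR (be * phi c t + (1 - n%:R / 2) * t) * t ^- 3.
pose dl t := - be * bb t + (1 - n%:R / 2) - 3 * t^-1.
have dh (t : R) : t < 0 -> is_derive t (1 : R) h (h t * dl t).
  move=> t0; have := is_derive_mul (is_derive_comp1 (is_derive_add
    (is_derive_mul (is_derive_cst be t (1 : R)) (is_derive_phi c t0))
    (is_derive_mul (is_derive_cst (1 - n%:R / 2 : R) t (1 : R)) (is_derive_id t (1 : R))))
    (is_derive_expR (be * phi c t + (1 - n%:R / 2) * t))) (is_derive_exp 3 (is_derive_inv t0)).
  rewrite (_ : (fun _ => _) = h); last first.
    by apply/funext => s; rewrite /cst /h exprVn.
  congr is_derive; rewrite /dl /h /cst; set b := bb t; set q := expR _; field; by rewrite lt_eqF.
have ch (t : R) : t < 0 -> {for t, continuous h}.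
  by move=> t0; apply: (@is_derive_continuous R h (fun t => h t * dl t)); exact: dh.
have cdl (t : R) : t < 0 -> {for t, continuous dl}.
  move=> t0; apply: cvgB.
    by apply: cvgD; [apply: cvgM; [exact: cvg_cst|exact: cbb]|exact: cvg_cst].
  by apply: cvgM; [exact: cvg_cst|exact: (continuous_exprV (k := 1))].
have cdh (t : R) : t < 0 -> {for t, continuous (fun t => h t * dl t)}.
  by move=> t0; apply: cvgM; [exact: ch|exact: cdl].
have hh (t : R) : t < 0 -> h t * h t = w0 t * expR (2 * t) * t ^- 6.
  move=> t0; rewrite /h /w0 -expRD.
  rewrite (_ : _ * _ = expR (be * phi c t + (1 - n%:R / 2) * t) *
    expR (be * phi c t + (1 - n%:R / 2) * t) * t ^- 6); last by field; rewrite lt_eqF.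
  by rewrite -expRD; congr (expR _ * _); field.
have hhe (t : R) : t < 0 -> h t * h t * expR (-2 * t) = w0 t * t ^- 6.
  move=> t0; rewrite hh//; have E0 : expR (2 * t) * expR (-2 * t) = 1.
    by rewrite -expRD (_ : 2 * t + -2 * t = 0) ?expR0//; ring.
  have aux (x y d e : R) : y * e = 1 -> x * y * d * e = x * d.
    by move=> ye; rewrite -[RHS]mulr1 -ye; ring.
  exact: aux.
have we := weight1M wchi dh cdh; have [we0 we1 _] := we.
have z1 (t : R) : t1 <= t -> chi t * h t = 0 by move=> /chi0 ->; rewrite mul0r.
have z2 (t : R) : t1 <= t -> dchi t * h t + chi t * (h t * dl t) = 0.
  by move=> tt; rewrite chi0// dchi0// !mul0r addr0.
have := caccioppoli_ineq t1L we z1 z2.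
have wz := wM wc cwe6.
have E1 (f : 'rV[R]_n -> R) : J (fun t => chi t * h t * (chi t * h t)) f =
    J (fun t => chi t * chi t * (w0 t * expR (2 * t) * t ^- 6)) f.
  apply: eq_J => t t0; first by rewrite mulrACA hh.
  by rewrite (weight0_ge0 wc)// !mul0r.
rewrite !E1 -/Z => H; apply: (le_trans H) => {H E1}.
have HP : J (fun t => chi t * chi t * (w0 t * expR (2 * t) * t ^- 6)) P <= 2^-1 * K * X.
  apply: (@le_trans _ _ (J (fun t => K * (chi t * chi t * (w0 t * expR (2 * t) * aa t))) P)).
    apply: le_J => //; first exact: (weight0Z _ (wM wc cwea)).
    move=> t t0; have [tt|tt] := leP t1 t; first by rewrite chi0// !mul0r mulr0.
    rewrite (_ : K * _ = chi t * chi t * (w0 t * expR (2 * t) * (K * aa t))); last by ring.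
    have we0' : 0 <= w0 t * expR (2 * t) by apply: mulr_ge0 => //; exact: expR_ge0.
    by rewrite ler_wpM2l// ler_wpM2l//; apply: invX6_le => //; exact: ltW.
  rewrite J_Z//; last exact: wM.
  have K0 : 0 <= K by exact: Kconst_ge0.
  suff H2 : J (fun t => chi t * chi t * (w0 t * expR (2 * t) * aa t)) P <= 2^-1 * X.
    by rewrite (_ : 2^-1 * K * X = K * (2^-1 * X)); [exact: ler_wpM2l|ring].
  have LW2 : L1 (fun x => 2^-1 * W x) by exact: L1Z.
  apply: (@le_trans _ _ (J (fun t => chi t * chi t * (w0 t * expR (2 * t) * aa t)) (fun x => 2^-1 * W x))).
    apply: le_J_fun => //; first exact: wM.
      by move=> t t0; rewrite mulr_ge0// mulr_ge0 ?aa0// mulr_ge0// expR_ge0.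
    by move=> x; have := PW x; lra.
  rewrite le_eqVlt; apply/orP; left; apply/eqP.
  rewrite /X -(J_Z 2^-1 (wM wc cwea) LW); apply: eq_Int => x _; ring.
have HU2 : J (fun t => chi t * h t * (chi t * h t) * (t ^- 6 * expR (-2 * t))) U <= K ^+ 2 * Y.
  rewrite /Y -(J_Z (K ^+ 2) (wM wc cwaa) LU); apply: le_J => //.
  - apply: weight0M => [|t t0]; first by apply: weight0M => // t _; exact: we0.1.
    by apply: cvgM; [exact: continuous_exprV|exact: continuous_expZ].
  - exact: (weight0Z _ (wM wc cwaa)).
  move=> t t0; have [tt|tt] := leP t1 t; first by rewrite chi0// !mul0r mulr0.
  have aux (x y d e : R) : x * y * (x * y) * (d * e) = x * x * (y * y * e * d) by ring.
  have aux2 (k x w b : R) : k ^+ 2 * (x * x * (w * b * b)) = x * x * (w * ((k * b) * (k * b))) by ring.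
  rewrite aux aux2 hhe// -[_ * _ * t ^- 6]mulrA.
  have h6 := invX6_le c_gt0 t1_lt0 (ltW tt).
  have h60 : 0 <= t ^- 6 by rewrite invr_ge0 exprn_even_ge0.
  have h7 : t ^- 6 * t ^- 6 <= K * aa t * (K * aa t) by exact: ler_pM.
  by rewrite ler_wpM2l// ler_wpM2l.
have HU1 : J (fun t => (dchi t * h t + chi t * (h t * dl t)) * (dchi t * h t + chi t * (h t * dl t)) *
    expR (-2 * t)) U <= 2 * B3 + 8 * be ^+ 2 / Lam ^+ 2 * Y.
  rewrite /B3 /Y -(J_Z 2 (wM wd cw6) LU) -(J_Z (8 * be ^+ 2 / Lam ^+ 2) (wM wc cwaa) LU).
  have wa := weight0Z 2 (wM wd cw6); have wb := weight0Z (8 * be ^+ 2 / Lam ^+ 2) (wM wc cwaa).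
  rewrite -(J_D wa wb LU); apply: le_J => //.
  - by apply: weight0_expM; apply: weight0M => // t _; exact: we1.1.
  - exact: weight0D.
  move=> t t0; have [tt|tt] := leP t1 t; first by rewrite chi0// dchi0// !(mul0r,mulr0,addr0).
  have H1 := dlog_sqr c_gt0 t1_lt0 be3 (le_trans ler01 be1) (ltW tt).
  have H2 := bb_le_aa c_gt0 t1_lt0 (ltW Lam0) c_large (ltW tt).
  have e0 := expR_gt0 (-2 * t).
  apply: (@le_trans _ _ (2 * (dchi t * dchi t * (w0 t * t ^- 6)) +
      2 * (chi t * chi t * (w0 t * t ^- 6)) * dl t ^+ 2)).
    have aux (x y z w e : R) : 2 * (x * x * (z * z * e)) + 2 * (y * y * (z * z * e)) * w ^+ 2 -
        (x * z + y * (z * w)) * (x * z + y * (z * w)) * e = (x - y * w) ^+ 2 * (z * z) * e by ring.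
    rewrite -(hhe t t0) -subr_ge0 aux; apply: mulr_ge0; last exact: ltW.
    by apply: mulr_ge0; [exact: sqr_ge0|exact: sq0].
  rewrite lerD2l; have cw : 0 <= chi t * chi t * w0 t by apply: mulr_ge0.
  have h60 : 0 <= t ^- 6 by rewrite invr_ge0 exprn_even_ge0.
  have p6 : 0 <= 2 * (chi t * chi t * (w0 t * t ^- 6)).
    by apply: mulr_ge0 => //; apply: mulr_ge0 => //; exact: mulr_ge0.
  apply: (le_trans (ler_wpM2l p6 H1)).
  have aux (x w d b l : R) : 0 < l -> 2 * (x * x * (w * d)) * (4 * be ^+ 2 * b ^+ 2) =
      8 * be ^+ 2 / l ^+ 2 * (x * x * w) * (l ^+ 2 * (d * b ^+ 2)).
    by move=> l0; field; rewrite gt_eqF.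
  have aux2 (k x w a : R) : k * (x * x * (w * a * a)) = k * (x * x * w) * a ^+ 2 by ring.
  rewrite (aux _ _ _ _ Lam)// aux2.
  have k0 : 0 <= 8 * be ^+ 2 / Lam ^+ 2.
    by apply: mulr_ge0; [rewrite mulr_ge0// sqr_ge0|rewrite invr_ge0 sqr_ge0].
  exact: (ler_wpM2l (mulr_ge0 k0 cw) H2).
have c4 : 0 <= 4 * C0 ^+ 2 by rewrite mulr_ge0// sqr_ge0.
have HU2' (a : R) : a <= K ^+ 2 * Y -> 4 * C0 ^+ 2 * a <= 4 * C0 ^+ 2 * K ^+ 2 * Y.
  by move=> h1; rewrite -[leRHS]mulrA; exact: ler_wpM2l.
have comb (a1 a2 a3 b3 y kx k1y k2 : R) : a1 <= kx -> a2 <= 2 * b3 + k2 * y -> a3 <= k1y ->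
    12 * a2 + 4 * a1 + a3 <= 24 * b3 + 12 * k2 * y + 4 * kx + k1y by lra.
have -> : 96 * be ^+ 2 / Lam ^+ 2 = 12 * (8 * be ^+ 2 / Lam ^+ 2) by ring.
have -> : 2 * K * X = 4 * (2^-1 * K * X) by field.
exact: comb HP HU1 (HU2' _ HU2).
Qed.

(* The only term whose coefficient is not negligible for large [be] is the one
   with [be ^+ 2 / Lam ^+ 2]; it is absorbed because [Lam] is large. *)
Lemma absorption : X + Y <= (288 * C0 ^+ 2 + 6) * (B1 + B2 + B3).
Proof.
have B10 : 0 <= B1.
  by apply: J_ge0 => //; [exact: wM|move=> t _; rewrite mulr_ge0// mulr_ge0// expR_ge0].
have B20 : 0 <= B2.
  by apply: J_ge0 => //; [exact: wM|move=> t t0; rewrite mulr_ge0// mulr_ge0// aa0].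
have B30 : 0 <= B3.
  apply: J_ge0 => //; [exact: wM|move=> t _; rewrite mulr_ge0// mulr_ge0//].
  by rewrite invr_ge0 exprn_even_ge0.
have X0 : 0 <= X.
  apply: J_ge0 => //; [exact: wM|move=> t t0; rewrite mulr_ge0// mulr_ge0 ?aa0//].
  by rewrite mulr_ge0// expR_ge0.
have Y0 : 0 <= Y.
  apply: J_ge0 => //; [exact: wM|move=> t t0; rewrite mulr_ge0// mulr_ge0 ?aa0//].
  by rewrite mulr_ge0// aa0.
move: step1 step2 step3 B10 B20 B30 X0 Y0; rewrite -/X -/Y -/Z.
have K0 : 0 <= K by exact: Kconst_ge0.
have LamE : 96 * be ^+ 2 / Lam ^+ 2 * C0 ^+ 2 = 3 / 50 * be ^+ 2.
  by rewrite /Lam; field; rewrite gt_eqF.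
move: X Y Z B1 B2 B3 => x y z b1 b2 b3 s1 s2 s3 b10 b20 b30 x0 y0.
have be4' := be4; have be5' := be5.
move: (K) K0 be4' be5' s3 => k k0 b4 b5 s3.
have C2 : 0 < C0 ^+ 2 by rewrite exprn_gt0.
have s3' : 2 * C0 ^+ 2 * z <= 48 * C0 ^+ 2 * b3 + 3 / 25 * be ^+ 2 * y +
    4 * C0 ^+ 2 * k * x + 8 * C0 ^+ 4 * k ^+ 2 * y.
  have := ler_wpM2l (ltW C2) s3.
  rewrite (_ : C0 ^+ 2 * (_ + _) = 24 * C0 ^+ 2 * b3 + 96 * be ^+ 2 / Lam ^+ 2 * C0 ^+ 2 * y +
    2 * C0 ^+ 2 * k * x + 4 * C0 ^+ 4 * k ^+ 2 * y); last by ring.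
  by rewrite LamE; lra.
have be0 : 0 < be by exact: lt_le_trans be1.
have by0 : be * y <= 2 * (x + b2) by lra.
have T1 : 3 / 25 * be ^+ 2 * y <= 6 / 25 * be * (x + b2).
  by have := ler_wpM2l (ltW be0) by0; lra.
have xb : x + b2 <= be * (x + b2) by rewrite ler_peMl// addr_ge0.
have T2 : 8 * C0 ^+ 4 * k ^+ 2 * y <= be / 8 * (x + b2).
  have : 8 * C0 ^+ 4 * k ^+ 2 * y <= be / 16 * y by rewrite ler_wpM2r//; lra.
  lra.
have T3 : 4 * C0 ^+ 2 * k * x <= be / 8 * x by rewrite ler_wpM2r//; lra.
(* The multiples of be * x on the right add up to 6/25 + 1/8 + 1/8 = 49/100, so they are absorbed by
   the left side at the cost of a factor 2. *)
have bx : be * x <= 96 * C0 ^+ 2 * b3 + 2 * b1 + be * b2.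
  have bb2 : 0 <= be * b2 by rewrite mulr_ge0// ltW.
  have bxx : 0 <= be * x by rewrite mulr_ge0// ltW.
  lra.
have cb : 0 <= 96 * C0 ^+ 2 * b3 by rewrite mulr_ge0// mulr_ge0// ltW.
have hx : x <= 96 * C0 ^+ 2 * b3 + 2 * b1 + b2.
  rewrite -(ler_pM2l be0); apply: (le_trans bx); rewrite !mulrDr lerD2r.
  by apply: lerD; rewrite ler_peMl// mulr_ge0.
(* Hence x + y <= 3 x + 2 b2, which yields the constants 288 = 3 * 96 and 6 = 3 * 2. *)
have hy : y <= 2 * (x + b2).
  by apply: le_trans by0; rewrite ler_peMl.
have c1 : 0 <= C0 ^+ 2 * b1 by rewrite mulr_ge0// ltW.
have c2 : 0 <= C0 ^+ 2 * b2 by rewrite mulr_ge0// ltW.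
lra.
Qed.

End fixed_parameter.

Let sq0' (a : R) : 0 <= a * a. Proof. by rewrite -expr2 sqr_ge0. Qed.

(** * The inner boundary terms *)

Section inner.
Variables (t1 tau S : R).
Hypotheses (t1L : t1 < L) (taut1 : tau <= t1).
Hypothesis small : forall w, weight0 w -> (forall t : R, t < 0 -> 0 <= w t <= 1) ->
  (forall t : R, tau <= t -> w t = 0) -> J w U + J (fun t => w t * expR (2 * t)) P <= S.

Let ww (t : R) := dramp (tau - 3) (tau - 2) t * dramp (tau - 3) (tau - 2) t.
(** The cut-offs are nested: [eta] is 1 on the support of [ww], and [ep] is 1 on the support of
    [eta]. Layers of unit length keep all derivatives bounded by absolute constants, and everything
    ends at tau, below which smallness is available. *)
Let ep := plateau (tau - 5) (tau - 4) (tau - 1) tau.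
Let eta := plateau (tau - 4) (tau - 3) (tau - 2) (tau - 1).
Let deta := dplateau (tau - 4) (tau - 3) (tau - 2) (tau - 1).
Let q := expR (- 2 * (tau - 4)).
Let y := (- t1^-1) ^+ 6.

Let t1_lt0 : t1 < 0. Proof. exact: lt_le_trans L_le0. Qed.

Let weta : weight1 eta deta. Proof. by apply: weight1_plateau; move: taut1 t1_lt0; lra. Qed.
Let wep : weight0 ep.
Proof.
by case: (@weight1_plateau R (tau - 5) (tau - 4) (tau - 1) tau _ _ _) => //; move: taut1 t1_lt0; lra.
Qed.
Let www : weight0 ww.
Proof.
have w : weight0 (dramp (tau - 3) (tau - 2)) by apply: weight0_dramp; move: taut1 t1_lt0; lra.
by apply: weight0M => // t _; exact: w.1.
Qed.

(** Smallness controls u and p but not the vorticity in W, which is recovered by the Caccioppoli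
    inequality on a wider layer; q bounds |x|^-2 there. The constants are 196 = 12 * 16 + 4 and 3152
    = 4 (2 + 4 * 196) + 8. *)
Lemma inner_bound : J ww W + 2 * J ww U <= (3152 + 64 * C0 ^+ 2 * y) * q * S.
Proof.
have [we wd _] := weta.
have we2 : weight0 (fun t => eta t * eta t) by apply: weight0M => // t _; exact: we.1.
have wd2 : weight0 (fun t => deta t * deta t * expR (- 2 * t)).
  by apply: weight0_expM; apply: weight0M => // t _; exact: wd.1.
have wepe := weight0_expM 2 wep.
have e01 (t : R) : 0 <= ep t <= 1 by exact: plateau01.
have ep0 t : 0 <= ep t by case/andP: (e01 t).
have SS : J ep U + J (fun t => ep t * expR (2 * t)) P <= S.
  apply: small => // t h; have ct : tau - 1 < tau by lra.
  by case: (plateau0 (tau - 5) (tau - 4) ct h).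
have U1 : 0 <= J ep U by apply: J_ge0 => // t _; case/andP: (e01 t).
have P1 : 0 <= J (fun t => ep t * expR (2 * t)) P.
  by apply: J_ge0 => // t _; apply: mulr_ge0 => //; exact: expR_ge0.
have q1 : 1 <= q by rewrite /q -[leLHS]expR0 ler_expR; move: taut1 t1_lt0; lra.
have q0 : 0 <= q by exact: le_trans q1.
have Z (t : R) : ep t = 1 /\ tau - 4 <= t <= tau - 1 \/ eta t = 0 /\ deta t = 0.
  have [h1|h1] := leP t (tau - 4).
    by right; apply: (@plateau0l R (tau - 4) (tau - 3)) => //; lra.
  have [h2|h2] := leP (tau - 1) t.
    by right; apply: (@plateau0 R (tau - 4) (tau - 3)) => //; lra.
  left; split; last by rewrite !ltW.
  by apply: plateau1; rewrite ?(ltW h1) ?(ltW h2)//; lra.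
have eq1 (t : R) : tau - 4 <= t -> expR (- 2 * t) <= q by move=> h; rewrite ler_expR; lra.
have eta1 (t : R) : eta t * eta t <= 1.
  by have /andP[h1 h2] := plateau01 (tau - 4) (tau - 3) (tau - 2) (tau - 1) t; rewrite mulr_ile1.
have JP : J (fun t => eta t * eta t) P <= q * S.
  apply: (@le_trans _ _ (J (fun t => q * (ep t * expR (2 * t))) P)).
    apply: le_J => //; first exact: (weight0Z q wepe).
    move=> t _; have [[h1 /andP[h2 _]]|[-> _]] := Z t; last first.
      by rewrite mul0r; apply: mulr_ge0 => //; apply: mulr_ge0 => //; exact: expR_ge0.
    rewrite h1 mul1r /q -expRD; apply: (le_trans (eta1 t)); rewrite -[leLHS]expR0 ler_expR; lra.
  by rewrite (J_Z q wepe LP) ler_wpM2l//; lra.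
have JU1 : J (fun t => deta t * deta t * expR (- 2 * t)) U <= 16 * q * S.
  apply: (@le_trans _ _ (J (fun t => 16 * q * ep t) U)).
    apply: le_J => //; first exact: (weight0Z (16 * q) wep).
    move=> t _; have [[h1 /andP[h2 _]]|[_ ->]] := Z t; last first.
      by rewrite !mul0r; apply: mulr_ge0 => //; exact: mulr_ge0.
    rewrite h1 mulr1; apply: ler_pM => //; last exact: eq1.
    (* The factor 16 is 2 * 4 + 2 * 4, one summand for each ramp of length 1. *)
    apply: (le_trans (dplateau_sqr _ _ _ _ _)).
    have a1 : tau - 4 < tau - 3 by lra. have a2 : tau - 2 < tau - 1 by lra.
    have := dramp_sqr t a1; have := dramp_sqr t a2.
    have -> : tau - 3 - (tau - 4) = 1 by ring.
    have -> : tau - 1 - (tau - 2) = 1 by ring.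
    rewrite expr1n divr1; lra.
  rewrite (J_Z (16 * q) wep LU) ler_wpM2l// ?mulr_ge0//; lra.
have JU2 : J (fun t => eta t * eta t * (t ^- 6 * expR (- 2 * t))) U <= y * q * S.
  have y0 : 0 <= y by rewrite exprn_even_ge0.
  apply: (@le_trans _ _ (J (fun t => y * q * ep t) U)).
    apply: le_J => //; last first.
      move=> t t0; have [[h1 /andP[h2 h3]]|[-> _]] := Z t; last first.
        by rewrite !mul0r; apply: mulr_ge0 => //; exact: mulr_ge0.
      rewrite h1 mulr1; have h60 : 0 <= t ^- 6 by rewrite invr_ge0 exprn_even_ge0.
      have h7 : t ^- 6 <= y.
        have tt1 : t <= t1 by move: taut1; lra.
        have /andP[y1 y2] := inv_bounds t1_lt0 tt1.
        rewrite (_ : t ^- 6 = (- t^-1) ^+ 6); last by rewrite -exprVn; ring.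
        by rewrite /y (@ler_pXn2r _ 6)// nnegrE ltW// (lt_le_trans y1).
      rewrite -[leRHS]mul1r; apply: ler_pM => //; first by rewrite mulr_ge0// expR_ge0.
      by apply: ler_pM => //; exact: eq1.
    exact: (weight0Z (y * q) wep).
    apply: weight0M => // t t0; apply: cvgM; first exact: continuous_exprV.
    exact: continuous_expZ.
  rewrite (J_Z (y * q) wep LU); apply: ler_wpM2l; first exact: mulr_ge0.
  by move: SS P1; lra.
have s1L : tau - 1 < L by move: taut1 t1L; lra.
have JG : J (fun t => eta t * eta t) Gq <= (196 + 4 * C0 ^+ 2 * y) * (q * S).
  have a2 : tau - 2 < tau - 1 by lra.
  have := caccioppoli_ineq s1L weta
    (fun t h => (plateau0 (tau - 4) (tau - 3) a2 h).1) (fun t h => (plateau0 (tau - 4) (tau - 3) a2 h).2).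
  have c4 : 0 <= 4 * C0 ^+ 2 by rewrite mulr_ge0// sqr_ge0.
  have := ler_wpM2l c4 JU2; move: JP JU1.
  set a1' := J _ P; set b1' := J _ U; set b2' := J _ U; set g := J _ Gq; lra.
have we4 : forall t, ww t <= 4 * (eta t * eta t).
  have a1 : tau - 3 < tau - 2 by lra.
  move=> t; have [h1|h1] := leP t (tau - 3).
    rewrite /ww; have [_ ->] := ramp0 a1 h1.
    by rewrite mul0r; apply: mulr_ge0 => //; exact: sq0'.
  have [h2|h2] := leP (tau - 2) t.
    rewrite /ww; have [_ ->] := ramp1 a1 h2.
    by rewrite mul0r; apply: mulr_ge0 => //; exact: sq0'.
  have -> : eta t = 1 by apply: plateau1; rewrite ?(ltW h1) ?(ltW h2)//; lra.
  have := dramp_sqr t a1; have -> : tau - 2 - (tau - 3) = 1 by ring.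
  by rewrite expr1n divr1 /ww expr2 !mulr1.
have JwW : J ww W <= 4 * (2 * J (fun t => eta t * eta t) P + 4 * J (fun t => eta t * eta t) Gq).
  have LPG : L1 (fun x => 2 * P x + 4 * Gq x) by apply: L1D; exact: L1Z.
  apply: (@le_trans _ _ (J (fun t => 4 * (eta t * eta t)) W)).
    by apply: le_J => //; exact: (weight0Z 4 we2).
  rewrite (J_Z 4 we2 LW) ler_pM2l//.
  apply: (@le_trans _ _ (J (fun t => eta t * eta t) (fun x => 2 * P x + 4 * Gq x))).
    by apply: le_J_fun.
  rewrite (J_lin 2 we2 LP); last exact: L1Z.
  rewrite lerD2l -(J_Z 4 we2 LG) le_eqVlt; apply/orP; left; apply/eqP.
  by apply: eq_Int => x _; rewrite mulrCA mulrA.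
have JwU : J ww U <= 4 * (q * S).
  apply: (@le_trans _ _ (J (fun t => 4 * ep t) U)).
    apply: le_J => //; first exact: (weight0Z 4 wep).
    move=> t _; apply: (le_trans (we4 t)); rewrite ler_pM2l//.
    have [[-> _]|[-> _]] := Z t; first exact: eta1.
    by rewrite mul0r; case/andP: (e01 t).
  rewrite (J_Z 4 wep LU) ler_pM2l//; apply: (@le_trans _ _ S); first lra.
  by rewrite ler_peMl//; lra.
move: JwW JwU JP JG; set a := J ww W; set b := J ww U; set d := J _ P; set g := J _ Gq; lra.
Qed.

End inner.

End absorption.

(** * Vanishing *)

Section monotonicity.
Context {R : realType}.
Variable c : R.
Hypothesis c_gt0 : 0 < c.
Implicit Types (s t a b : R).

Lemma ect_mono s t : s <= t -> t < 0 -> ect c t <= ect c s.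
Proof.
move=> st t0; rewrite ler_expR ler_pM2l// lef_nV2// ?negrE//; exact: le_lt_trans t0.
Qed.

Lemma phi_mono s t : s <= t -> t < 0 -> phi c t <= phi c s.
Proof.
move=> st t0.
by apply: ler_pM; [rewrite oppr_ge0 ltW|exact: expR_ge0|rewrite lerN2|exact: ect_mono].
Qed.

Lemma phi_lt s t : s < t -> t < 0 -> phi c t < phi c s.
Proof.
move=> st t0; apply: (@lt_le_trans _ _ (- s * ect c t)).
  by rewrite ltr_pM2r ?expR_gt0// ltrN2.
apply: ler_wpM2l; first by rewrite oppr_ge0 ltW// (lt_trans st).
by apply: ect_mono => //; exact: ltW.
Qed.

Lemma aa_ge a b t : a <= t -> t <= b -> b < 0 ->
  c ^+ 2 * (- a^-1) ^+ 3 * ect c b <= aa c t.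
Proof.
move=> at_ tb b0; have t0 : t < 0 by exact: le_lt_trans b0.
have a0 : a < 0 by exact: le_lt_trans t0.
have h1 : 0 < - a^-1 by rewrite oppr_gt0 invr_lt0.
have h2 : - a^-1 <= - t^-1 by rewrite lerN2 lef_nV2// ?negrE.
rewrite aaE; apply: ler_pM; [|exact: expR_ge0| |exact: ect_mono].
  by apply: mulr_ge0; [exact: sqr_ge0|rewrite exprn_ge0// ltW].
rewrite ler_wpM2l ?sqr_ge0// ler_pXn2r// nnegrE ltW//; exact: lt_le_trans h2.
Qed.

Lemma aa_le t1 t : t1 < 0 -> t <= t1 -> aa c t <= c ^+ 2 * (- t1^-1) ^+ 3.
Proof.
move=> t10 tt1; have t0 : t < 0 by exact: le_lt_trans t10.
have /andP[h1 h2] := inv_bounds t10 tt1.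
rewrite aaE -[leRHS]mulr1; apply: ler_pM; [|exact: expR_ge0| |exact: ect_le1].
  by apply: mulr_ge0; [exact: sqr_ge0|rewrite exprn_ge0// ltW].
rewrite ler_wpM2l ?sqr_ge0// ler_pXn2r// nnegrE ltW//; exact: lt_le_trans h2.
Qed.

End monotonicity.

Section vanishing.
Context {R : realType} {n : nat}.
Variables (P U Gq W : 'rV[R]_n -> R) (L C0 : R).
Hypotheses (LP : L1 P) (LU : L1 U) (LG : L1 Gq) (LW : L1 W).
Hypotheses (P0 : forall x, 0 <= P x) (U0 : forall x, 0 <= U x) (G0 : forall x, 0 <= Gq x).
Hypotheses (PW : forall x, 2 * P x <= W x) (WPG : forall x, W x <= 2 * P x + 4 * Gq x).
Hypotheses (L_le0 : L <= 0) (C0_gt0 : 0 < C0).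

Hypothesis pressure_ineq : forall s1 (chi dchi E Psi dPsi : R -> R), s1 < L -> weight1 chi dchi ->
  (forall t, s1 <= t -> chi t = 0) -> (forall t, s1 <= t -> dchi t = 0) ->
  (forall t : R, t < 0 -> 0 <= E t) ->
  (forall t : R, t < 0 -> is_derive t (1 : R) E ((2 * Psi t - n%:R) * E t)) ->
  (forall t : R, t < 0 -> is_derive t (1 : R) Psi (dPsi t)) ->
  (forall t : R, t < 0 -> {for t, continuous dPsi}) ->
  J (fun t => chi t * chi t * (E t * dPsi t)) W <=
  2 * C0 ^+ 2 * J (fun t => chi t * chi t * E t * t ^- 6) Gq + J (fun t => dchi t * dchi t * E t) W.
Hypothesis velocity_ineq : forall s1 (chi dchi E Psi dPsi : R -> R), s1 < L -> weight1 chi dchi ->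
  (forall t, s1 <= t -> chi t = 0) -> (forall t, s1 <= t -> dchi t = 0) ->
  (forall t : R, t < 0 -> 0 <= E t) ->
  (forall t : R, t < 0 -> is_derive t (1 : R) E ((2 * Psi t - n%:R) * E t)) ->
  (forall t : R, t < 0 -> is_derive t (1 : R) Psi (dPsi t)) ->
  (forall t : R, t < 0 -> {for t, continuous dPsi}) ->
  J (fun t => chi t * chi t * (E t * dPsi t)) U <=
  J (fun t => chi t * chi t * E t * expR (2 * t)) W + J (fun t => dchi t * dchi t * E t) U.
Hypothesis caccioppoli_ineq : forall s1 (eta deta : R -> R), s1 < L -> weight1 eta deta ->
  (forall t, s1 <= t -> eta t = 0) -> (forall t, s1 <= t -> deta t = 0) ->
  J (fun t => eta t * eta t) Gq <=
  12 * J (fun t => deta t * deta t * expR (- 2 * t)) U + 4 * J (fun t => eta t * eta t) P +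
  4 * C0 ^+ 2 * J (fun t => eta t * eta t * (t ^- 6 * expR (- 2 * t))) U.

Let small tau S := forall w, weight0 w -> (forall t : R, t < 0 -> 0 <= w t <= 1) ->
  (forall t : R, tau <= t -> w t = 0) -> J w U + J (fun t => w t * expR (2 * t)) P <= S.

Let W0 x : 0 <= W x. Proof. by apply: le_trans (PW x); rewrite mulr_ge0. Qed.
Let sq0 (a : R) : 0 <= a * a. Proof. by rewrite -expr2 sqr_ge0. Qed.

Section annulus_estimate.
Variables (a b t2 t1 c : R).
Hypotheses (ab : a < b) (bt2 : b < t2) (t21 : t2 < t1) (t1L : t1 < L) (c_gt0 : 0 < c).
Let e1 := expR (c * t1^-1).
Let K := Kconst c t1.
Hypothesis c_large : 40 * C0 * (1 - c * t1^-1) <= c ^+ 2.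

Let t1_lt0 : t1 < 0. Proof. exact: lt_le_trans L_le0. Qed.
Let b0 : b < 0. Proof. by move: bt2 t21 t1_lt0; lra. Qed.

Let wi tau (t : R) := dramp (tau - 3) (tau - 2) t * dramp (tau - 3) (tau - 2) t.
Let wo (t : R) := dramp t2 t1 t * dramp t2 t1 t.
(** A1 bounds exp(2 t), [aa] and t^-6 together for t <= t1; A2 is the constant of [inner_bound]; O
    collects the outer cut-off terms with the dependence on [be] removed. *)
Let A1 := 1 + c ^+ 2 * (- t1^-1) ^+ 3 + (- t1^-1) ^+ 6.
Let A2 := 3152 + 64 * C0 ^+ 2 * (- t1^-1) ^+ 6.
Let O := J (fun t => wo t * (expR (- n%:R * t) * expR (2 * t))) W +
  J (fun t => wo t * (expR (- n%:R * t) * aa c t)) U + J (fun t => wo t * (expR (- n%:R * t) * t ^- 6)) U.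
(** A lower bound for [aa] on [a, b]. In [ka] the division by (b - a)^2, an upper bound for
    [hat a b], puts [ka * hat a b] below both interior weights. *)
Let al := c ^+ 2 * (- a^-1) ^+ 3 * ect c b.
Let ka := Num.min (al * al) (expR (2 * a) * al) / (b - a) ^+ 2.

Let wwo : weight0 wo.
Proof.
have w : weight0 (dramp t2 t1) by apply: weight0_dramp.
by apply: weight0M => // t _; exact: w.1.
Qed.

Let caa (t : R) : t < 0 -> {for t, continuous (aa c)}.
Proof.
move=> t0; apply: (@is_derive_continuous R (aa c) (fun t => (- 3 * t^-1 - c * t ^- 2) * aa c t)).
exact: is_derive_aa.
Qed.

Lemma ka_gt0 : 0 < ka.
Proof.
have al0 : 0 < al.
  apply: mulr_gt0; last exact: expR_gt0.
  apply: mulr_gt0; first exact: exprn_gt0.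
  by rewrite exprn_gt0// oppr_gt0 invr_lt0 (lt_trans ab).
apply: divr_gt0; last by rewrite exprn_gt0// subr_gt0.
by rewrite lt_min mulr_gt0//= mulr_gt0// expR_gt0.
Qed.

Section fixed_be.
Variable be : R.
Hypotheses (be1 : 1 <= be) (be2 : 2 <= be * (c * e1)) (be3 : 1 + n%:R + 3 * - t1^-1 <= be * e1)
  (be4 : 128 * C0 ^+ 4 * K ^+ 2 <= be) (be5 : 32 * C0 ^+ 2 * K <= be).
Local Notation w0 := (w0 n c be).

Let be0 : 0 <= be. Proof. exact: le_trans be1. Qed.
Let cw0 (t : R) : t < 0 -> {for t, continuous w0}.
Proof.
move=> t0; apply: (@is_derive_continuous R w0 (fun t => (- 2 * be * bb c t - n%:R) * w0 t)).
exact: is_derive_w0.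
Qed.
Let cE (t : R) : t < 0 -> {for t, continuous (fun t => w0 t * expR (2 * t))}.
Proof. by move=> t0; apply: cvgM; [exact: cw0|exact: continuous_expZ]. Qed.
Let cA (t : R) : t < 0 -> {for t, continuous (fun t => w0 t * aa c t)}.
Proof. by move=> t0; apply: cvgM; [exact: cw0|exact: caa]. Qed.
Let c6 (t : R) : t < 0 -> {for t, continuous (fun t => w0 t * t ^- 6)}.
Proof. by move=> t0; apply: cvgM; [exact: cw0|exact: continuous_exprV]. Qed.
Let w00 t : 0 <= w0 t. Proof. exact/ltW/w0_gt0. Qed.

Let wM (k g : R -> R) : weight0 k -> (forall t : R, t < 0 -> {for t, continuous g}) ->
  weight0 (fun t => k t * k t * g t).
Proof. by move=> wk cg; apply: weight0M => //; apply: weight0M => // t _; exact: wk.1. Qed.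

(** The derivative of the plateau lives on two layers. On the inner one phi(t) <= - t bounds the
    weight by a power of the radius; on the outer one phi is at most phi(t2), because it
    decreases. *)
Let boundary tau (g : R -> R) (f : 'rV[R]_n -> R) (A : R) : tau <= t1 -> L1 f -> (forall x, 0 <= f x) ->
  (forall t : R, t < 0 -> {for t, continuous g}) ->
  (forall t : R, t < 0 -> 0 <= g t) -> 0 <= A -> (forall t, t <= t1 -> g t <= A) ->
  J (fun t => dplateau (tau - 3) (tau - 2) t2 t1 t * dplateau (tau - 3) (tau - 2) t2 t1 t *
    (w0 t * g t)) f <=
  2 * (expR (- (n%:R + 2 * be) * (tau - 3)) * A * J (wi tau) f) +
  2 * (expR (2 * be * phi c t2) * J (fun t => wo t * (expR (- n%:R * t) * g t)) f).
Proof.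
move=> taut1 Lf f0 cg g0 A0 gA.
have [_ wd _] : weight1 (plateau (tau - 3) (tau - 2) t2 t1) (dplateau (tau - 3) (tau - 2) t2 t1).
  by apply: weight1_plateau => //; lra.
have wwi : weight0 (wi tau).
  have w : weight0 (dramp (tau - 3) (tau - 2)) by apply: weight0_dramp; move: taut1 t1_lt0; lra.
  by apply: weight0M => // t _; exact: w.1.
have cg0 (t : R) : t < 0 -> {for t, continuous (fun t => w0 t * g t)}.
  by move=> t0; apply: cvgM; [exact: cw0|exact: cg].
have cgn (t : R) : t < 0 -> {for t, continuous (fun s : R => expR (- n%:R * s) * g s)}.
  by move=> t0; apply: cvgM; [exact: continuous_expZ|exact: cg].
have w1 := weight0Z (2 * (expR (- (n%:R + 2 * be) * (tau - 3)) * A)) wwi.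
have wo' := weight0M wwo cgn.
have w2 := weight0Z (2 * expR (2 * be * phi c t2)) wo'.
have -> : 2 * (expR (- (n%:R + 2 * be) * (tau - 3)) * A * J (wi tau) f) =
    J (fun t => 2 * (expR (- (n%:R + 2 * be) * (tau - 3)) * A) * wi tau t) f.
  by rewrite (J_Z _ wwi Lf) mulrA.
have -> : 2 * (expR (2 * be * phi c t2) * J (fun t => wo t * (expR (- n%:R * t) * g t)) f) =
    J (fun t => 2 * expR (2 * be * phi c t2) * (wo t * (expR (- n%:R * t) * g t))) f.
  by rewrite (J_Z _ wo' Lf) mulrA.
rewrite -(J_D w1 w2 Lf).
apply: le_J => //; [exact: wM|exact: weight0D|].
move=> t t0; have gt := g0 t t0.
apply: (@le_trans _ _ ((2 * dramp (tau - 3) (tau - 2) t ^+ 2 + 2 * dramp t2 t1 t ^+ 2) * (w0 t * g t))).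
  by rewrite ler_wpM2r ?dplateau_sqr// mulr_ge0.
rewrite mulrDl; apply: lerD.
  have a1 : tau - 3 < tau - 2 by lra.
  have [h1|h1] := leP t (tau - 3).
    by rewrite /wi; have [_ ->] := ramp0 a1 h1; rewrite expr0n !(mulr0,mul0r).
  have [h2|h2] := leP (tau - 2) t.
    by rewrite /wi; have [_ ->] := ramp1 a1 h2; rewrite expr0n !(mulr0,mul0r).
  rewrite -/(wi tau t) expr2 -/(wi tau t) -mulrA -[leRHS]mulrA ler_pM2l//.
  rewrite [leRHS]mulrC ler_wpM2l//; first exact: sq0.
  apply: ler_pM => //; last by apply: gA; move: taut1; lra.
  rewrite ler_expR.
  have h3 : be * phi c t <= be * - t by rewrite ler_wpM2l// phi_le.
  have h4 : (n%:R + 2 * be) * (tau - 3) <= (n%:R + 2 * be) * t.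
    apply: ler_wpM2l; last exact: ltW.
    by apply: addr_ge0 => //; exact: mulr_ge0.
  lra.
have [h1|h1] := leP t t2.
  by rewrite /wo; have [_ ->] := ramp0 t21 h1; rewrite expr0n !(mulr0,mul0r).
rewrite expr2 -/(wo t) (_ : 2 * wo t * _ = 2 * wo t * g t * w0 t); last by ring.
rewrite (_ : 2 * expR _ * _ = 2 * wo t * g t * (expR (2 * be * phi c t2) * expR (- n%:R * t))); last by ring.
rewrite ler_wpM2l//; first by apply: mulr_ge0 => //; apply: mulr_ge0 => //; exact: sq0.
rewrite -expRD ler_expR mulNr lerD2r ler_wpM2l ?mulr_ge0//; apply: phi_mono => //; exact: ltW.
Qed.

(** On [a, b] the cut-off is 1 and w0 is at least exp(2 be phi(b)), because phi decreases and - n t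
    is nonnegative. This exceeds the outer factor exp(2 be phi(t2)) since b < t2. *)
Lemma annulus_upper tau S : tau <= a -> small tau S ->
  ka * expR (2 * be * phi c b) * (J (hat a b) U + J (hat a b) P) <=
  (288 * C0 ^+ 2 + 6) * (2 * (expR (2 * be * phi c t2) * O) +
    2 * (expR (- (n%:R + 2 * be) * (tau - 3)) * A1 * (A2 * expR (- 2 * (tau - 4)) * S))).
Proof.
move=> taua sm; have taut1 : tau <= t1 by move: taua ab bt2 t21; lra.
have wch : weight1 (plateau (tau - 3) (tau - 2) t2 t1) (dplateau (tau - 3) (tau - 2) t2 t1).
  by apply: weight1_plateau => //; lra.
have [wc wd _] := wch.
set chi := plateau _ _ _ _ in wch wc wd *; set dchi := dplateau _ _ _ _ in wch wd *.
have chi0 t : t1 <= t -> chi t = 0 by move=> h; case: (plateau0 (tau - 3) (tau - 2) t21 h).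
have dchi0 t : t1 <= t -> dchi t = 0 by move=> h; case: (plateau0 (tau - 3) (tau - 2) t21 h).
have y0 : 0 < - t1^-1 by rewrite oppr_gt0 invr_lt0.
have p3 : 0 <= c ^+ 2 * (- t1^-1) ^+ 3.
  by apply: mulr_ge0; [exact: sqr_ge0|rewrite exprn_ge0// ltW].
have p6 : 0 <= (- t1^-1) ^+ 6 by rewrite exprn_ge0// ltW.
have A10 : 0 <= A1 by rewrite /A1; move: p3 p6; lra.
have g1 t : t <= t1 -> expR (2 * t) <= A1.
  move=> h; apply: (@le_trans _ _ 1); last by rewrite /A1; move: p3 p6; lra.
  by rewrite -[leRHS]expR0 ler_expR; move: t1_lt0; lra.
have g2 t : t <= t1 -> aa c t <= A1.
  by move=> h; apply: (le_trans (aa_le c_gt0 t1_lt0 h)); rewrite /A1; move: p3 p6; lra.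
have g6 (t : R) : 0 <= t ^- 6 by rewrite invr_ge0 exprn_even_ge0.
have g3 (t : R) : t <= t1 -> t ^- 6 <= A1.
  move=> h; apply: (@le_trans _ _ ((- t1^-1) ^+ 6)); last by rewrite /A1; move: p3 p6; lra.
  have /andP[y1 y2] := inv_bounds t1_lt0 h.
  rewrite (_ : t ^- 6 = (- t^-1) ^+ 6); last by rewrite -exprVn; ring.
  by rewrite (@ler_pXn2r _ 6)// nnegrE ltW.
have comb (x1 x2 x3 D W1 U1 G O1 O2 O3 r : R) : x1 <= 2 * (D * W1) + 2 * (G * O1) ->
    x2 <= 2 * (D * U1) + 2 * (G * O2) -> x3 <= 2 * (D * U1) + 2 * (G * O3) ->
    D * (W1 + 2 * U1) <= D * r ->
    x1 + x2 + x3 <= 2 * (G * (O1 + O2 + O3)) + 2 * (D * r) by lra.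
have C10 : 0 <= 288 * C0 ^+ 2 + 6 := addr_ge0 (mulr_ge0 (ler0n R 288) (sqr_ge0 C0)) (ler0n R 6).
have H := @absorption R n P U Gq W L C0 LP LU LW P0 U0 PW L_le0 C0_gt0 pressure_ineq velocity_ineq
  caccioppoli_ineq t1 c be t1L c_gt0 c_large be1 be2 be3 be4 be5 chi dchi wch chi0 dchi0.
have wh : weight0 (hat a b) by exact: weight0_hat.
have cEa (t : R) : t < 0 -> {for t, continuous (fun t => w0 t * expR (2 * t) * aa c t)}.
  by move=> t0; apply: cvgM; [exact: cE|exact: caa].
have cAa (t : R) : t < 0 -> {for t, continuous (fun t => w0 t * aa c t * aa c t)}.
  by move=> t0; apply: cvgM; [exact: cA|exact: caa].
have aa0 (t : R) : t < 0 -> 0 <= aa c t by move=> t0; exact/ltW/aa_gt0.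
have hat_le t : ka * hat a b t <= Num.min (al * al) (expR (2 * a) * al).
  have k0 : 0 <= Num.min (al * al) (expR (2 * a) * al).
    have := ka_gt0; rewrite /ka; set k := Num.min _ _ => kp.
    by move: kp; rewrite pmulr_lgt0 ?invr_gt0 ?exprn_gt0 ?subr_gt0// => /ltW.
  have d0 : 0 < (b - a) ^+ 2 by rewrite exprn_gt0// subr_gt0.
  rewrite /ka mulrAC ler_pdivrMr// ler_wpM2l//.
  have [h|h] := pselect (a < t < b); last by rewrite hat0// ltW.
  move/andP : h => [h1 h2]; rewrite /hat expr2.
  have -> : Num.max 0 (t - a) = t - a by rewrite max_r// subr_ge0 ltW.
  have -> : Num.max 0 (b - t) = b - t by rewrite max_r// subr_ge0 ltW.
  by apply: ler_pM; lra.
have lower (g : R -> R) (f : 'rV[R]_n -> R) : L1 f -> (forall x, 0 <= f x) ->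
    (forall t : R, t < 0 -> {for t, continuous (fun t => w0 t * g t)}) ->
    (forall t : R, t < 0 -> 0 <= g t) ->
    (forall t, a < t < b -> Num.min (al * al) (expR (2 * a) * al) <= g t) ->
    ka * expR (2 * be * phi c b) * J (hat a b) f <= J (fun t => chi t * chi t * (w0 t * g t)) f.
  move=> Lf f0 cg g0 gk; rewrite -(J_Z _ wh Lf); apply: le_J => //; [exact: weight0Z|exact: wM|].
  move=> t t0; have [h|h] := pselect (a < t < b); last first.
    by rewrite hat0// mulr0; apply: mulr_ge0; [exact: sq0|apply: mulr_ge0 => //; exact: g0].
  have -> : chi t = 1.
    have a1 : tau - 3 < tau - 2 by lra.
    apply: plateau1 => //; case/andP : h => h1 h2.
    by apply/andP; split; move: taua bt2; lra.
  rewrite !mul1r mulrAC mulrC; apply: ler_pM; [exact: expR_ge0| | |].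
  - by apply: mulr_ge0; [exact/ltW/ka_gt0|exact: hat_ge0].
  - rewrite ler_expR; case/andP : h => h1 h2.
    have := phi_mono c_gt0 (ltW h2) b0; move=> /(ler_wpM2l be0).
    have : n%:R * t <= 0 by rewrite nmulr_lle0.
    by lra.
  - exact: le_trans (hat_le t) (gk t h).
have HX : ka * expR (2 * be * phi c b) * J (hat a b) P <=
    J (fun t => chi t * chi t * (w0 t * expR (2 * t) * aa c t)) W.
  apply: (@le_trans _ _ (J (fun t => chi t * chi t * (w0 t * (expR (2 * t) * aa c t))) P)).
    apply: lower => //.
    - move=> t t0; apply: cvgM; first exact: cw0.
      by apply: cvgM; [exact: continuous_expZ|exact: caa].
    - by move=> t t0; apply: mulr_ge0; [exact: expR_ge0|exact: aa0].
    move=> t /andP[h1 h2]; rewrite ge_min; apply/orP; right.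
    apply: ler_pM; [exact: expR_ge0| | |].
    - apply: mulr_ge0; last exact: expR_ge0.
      by apply: mulr_ge0; [exact: sqr_ge0|rewrite exprn_ge0// oppr_ge0 invr_le0 ltW// (lt_trans ab)].
    - by rewrite ler_expR ler_pM2l// ltW.
    - by apply: aa_ge => //; exact: ltW.
  rewrite [leLHS](_ : _ = J (fun t => chi t * chi t * (w0 t * expR (2 * t) * aa c t)) P); last first.
    by congr J; apply/funext => t; rewrite -[w0 t * expR _ * _]mulrA.
  apply: le_J_fun => //; first exact: wM.
    move=> t t0; apply: mulr_ge0; first exact: sq0.
    by apply: mulr_ge0; [apply: mulr_ge0 => //; exact: expR_ge0|exact: aa0].
  by move=> x; have := PW x; have := P0 x; lra.
have HY : ka * expR (2 * be * phi c b) * J (hat a b) U <=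
    J (fun t => chi t * chi t * (w0 t * aa c t * aa c t)) U.
  apply: (@le_trans _ _ (J (fun t => chi t * chi t * (w0 t * (aa c t * aa c t))) U)).
    apply: lower => //.
    - by move=> t t0; apply: cvgM; [exact: cw0|apply: cvgM; exact: caa].
    move=> t /andP[h1 h2]; rewrite ge_min; apply/orP; left.
    have al0 : 0 <= al.
      apply: mulr_ge0; last exact: expR_ge0.
      by apply: mulr_ge0; [exact: sqr_ge0|rewrite exprn_ge0// oppr_ge0 invr_le0 ltW// (lt_trans ab)].
    by apply: ler_pM => //; apply: aa_ge => //; exact: ltW.
  rewrite le_eqVlt; apply/orP; left; apply/eqP.
  by congr J; apply/funext => t; rewrite -[w0 t * aa c t * _]mulrA.
have D1 := @boundary tau (fun t => expR (2 * t)) W A1 taut1 LW W0 _ _ A10 _.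
have D2 := @boundary tau (aa c) U A1 taut1 LU U0 caa aa0 A10 _.
have D3 := @boundary tau (fun t => t ^- 6) U A1 taut1 LU U0 _ _ A10 _.
have {}D1 := D1 (fun t _ => @continuous_expZ R 2 t) (fun t _ => expR_ge0 (2 * t)).
have {}D3 := D3 (fun t t0 => @continuous_exprV R 6 t t0).
have {}D1 := D1 g1; have {}D2 := D2 g2; have {}D3 := D3 (fun t _ => g6 t) g3.
have Hin := inner_bound LP LU LG LW P0 U0 PW WPG L_le0 caccioppoli_ineq t1L taut1 sm.
rewrite mulrDr; apply: (le_trans (lerD HY HX)); rewrite addrC; apply: (le_trans H).
rewrite (ler_wpM2l C10)//.
have DA : 0 <= expR (- (n%:R + 2 * be) * (tau - 3)) * A1 by apply: mulr_ge0 => //; exact: expR_ge0.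
have {}Hin := ler_wpM2l DA Hin.
exact: comb D1 D2 D3 Hin.
Qed.

End fixed_be.
End annulus_estimate.

Hypothesis frequently_small : forall m : R, 0 < m -> forall tau0, exists tau, tau < tau0 /\
  small tau (expR (m * tau)).

(* With the vanishing order chosen above [n + 2 * be], the inner boundary terms
   disappear; then [be] tends to infinity. *)
Lemma vanishing a b : b < L -> J (hat a b) U + J (hat a b) P <= 0.
Proof.
move=> bL; rewrite leNgt; apply/negP => H0.
have ab : a < b.
  rewrite ltNge; apply/negP => ba; move: H0; rewrite /J.
  have Z (f : 'rV[R]_n -> R) : Int (fun x : 'rV[R]_n => hat a b (logr x) * f x) = 0.
    rewrite -[RHS](@Int0 R n); apply: eq_Int => x _; rewrite hat0 ?mul0r// => /andP[h1 h2].
    by have := lt_trans h1 h2; rewrite ltNge ba.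
  by rewrite !Z addr0 ltxx.
(* The outer transition takes place on the middle third of ]b, L[, which makes phi(t2) < phi(b)
   strictly. *)
pose t2 := b + (L - b) / 3; pose t1 := b + 2 * (L - b) / 3.
have [bt2 t21 t1L] : [/\ b < t2, t2 < t1 & t1 < L] by rewrite /t1 /t2; split; lra.
have t1_lt0 : t1 < 0 by exact: lt_le_trans L_le0.
have y0 : 0 < - t1^-1 by rewrite oppr_gt0 invr_lt0.
(* As c >= 1, the quantity 40 C0 (1 - c / t1) is at most c times 40 C0 (1 - 1 / t1), hence at most
   c^2. *)
pose c := 1 + 40 * C0 * (1 - t1^-1).
have cp : 0 <= 40 * C0 * (1 - t1^-1) by rewrite mulr_ge0 ?mulr_ge0// ?(ltW C0_gt0)//; lra.
have c1 : 1 <= c by rewrite /c; lra.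
have c_gt0 : 0 < c by exact: lt_le_trans c1.
have c_large : 40 * C0 * (1 - c * t1^-1) <= c ^+ 2.
  apply: (@le_trans _ _ (c * (40 * C0 * (1 - t1^-1)))).
    rewrite mulrCA ler_wpM2l ?mulr_ge0 ?(ltW C0_gt0)// mulrBr mulr1 lerD2r//.
  by rewrite expr2 ler_pM2l// /c; lra.
set e1 := expR (c * t1^-1); have e10 : 0 < e1 by exact: expR_gt0.
set K := Kconst c t1; have K0 : 0 <= K by exact: Kconst_ge0.
pose k := Num.min ((c ^+ 2 * (- a^-1) ^+ 3 * ect c b) * (c ^+ 2 * (- a^-1) ^+ 3 * ect c b))
  (expR (2 * a) * (c ^+ 2 * (- a^-1) ^+ 3 * ect c b)) / (b - a) ^+ 2.
have k0 : 0 < k by exact: (ka_gt0 ab bt2 t21 t1L c_gt0).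
have t20 : t2 < 0 by exact: lt_trans t1_lt0.
have de0 : 0 < phi c b - phi c t2 by rewrite subr_gt0; exact: phi_lt.
set H := J _ U + J _ P in H0; set de := phi c b - phi c t2 in de0.
pose wo (t : R) := dramp t2 t1 t * dramp t2 t1 t.
pose O := J (fun t => wo t * (expR (- n%:R * t) * expR (2 * t))) W +
  J (fun t => wo t * (expR (- n%:R * t) * aa c t)) U + J (fun t => wo t * (expR (- n%:R * t) * t ^- 6)) U.
have wwo : weight0 wo.
  have w : weight0 (dramp t2 t1) by apply: weight0_dramp.
  by apply: weight0M => // t _; exact: w.1.
have caa (t : R) : t < 0 -> {for t, continuous (aa c)}.
  move=> t0; apply: (@is_derive_continuous R (aa c) (fun t => (- 3 * t^-1 - c * t ^- 2) * aa c t)).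
  exact: is_derive_aa.
have O0 : 0 <= O.
  have H1 (g : R -> R) (f : 'rV[R]_n -> R) : (forall t : R, t < 0 -> {for t, continuous g}) ->
      (forall t : R, t < 0 -> 0 <= g t) -> (forall x, 0 <= f x) ->
      0 <= J (fun t => wo t * (expR (- n%:R * t) * g t)) f.
    move=> cg g0 f0; apply: J_ge0 => //.
      by apply: weight0M => // t t0; apply: cvgM; [exact: continuous_expZ|exact: cg].
    move=> t t0; apply: mulr_ge0; first exact: sq0.
    by apply: mulr_ge0; [exact: expR_ge0|exact: g0].
  apply: addr_ge0; first apply: addr_ge0; apply: H1 => //.
  - by move=> t _; exact: continuous_expZ.
  - by move=> t t0; exact/ltW/aa_gt0.
  - by move=> t; exact: continuous_exprV.
  - by move=> t _; rewrite invr_ge0 exprn_even_ge0.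
pose C1 := 288 * C0 ^+ 2 + 6.
have C10 : 0 < C1 := ltr_wpDl (mulr_ge0 (ler0n R 288) (sqr_ge0 C0)) (ltr0Sn R 5).
(* q1 to q4 are the thresholds of the absorption argument. q5 gives 2 be de k H >= 2 C1 O, which
   contradicts k H (1 + 2 be de) <= 2 C1 O at the end. *)
pose q1 := 2 / (c * e1); pose q2 := (1 + n%:R + 3 * - t1^-1) / e1.
pose q3 := 128 * C0 ^+ 4 * K ^+ 2; pose q4 := 32 * C0 ^+ 2 * K; pose q5 := C1 * O / (k * H * de).
have q10 : 0 <= q1 by rewrite divr_ge0// ltW// mulr_gt0.
have q20 : 0 <= q2 by rewrite divr_ge0 ?(ltW e10)// !addr_ge0// mulr_ge0// ltW.
have q30 : 0 <= q3.
  by apply: mulr_ge0; [apply: mulr_ge0 => //; rewrite exprn_ge0// ltW|exact: sqr_ge0].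
have q40 : 0 <= q4 by apply: mulr_ge0 => //; apply: mulr_ge0 => //; exact: sqr_ge0.
have kHd : 0 < k * H * de by rewrite mulr_gt0// mulr_gt0.
have q50 : 0 <= q5 by rewrite divr_ge0 ?(ltW kHd)// mulr_ge0// ltW.
pose be := 1 + q1 + q2 + q3 + q4 + q5.
have be1 : 1 <= be by rewrite /be; lra.
have be2 : 2 <= be * (c * e1).
  by rewrite -ler_pdivrMr ?mulr_gt0// -/q1 /be; lra.
have be3 : 1 + n%:R + 3 * - t1^-1 <= be * e1 by rewrite -ler_pdivrMr// -/q2 /be; lra.
have be4 : q3 <= be by rewrite /be; lra.
have be5 : q4 <= be by rewrite /be; lra.
have be6 : C1 * O <= be * (k * H * de) by rewrite -ler_pdivrMr// -/q5 /be; lra.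
have be0 : 0 < be by exact: lt_le_trans be1.
(* The weight costs exp(-(n + 2 be) tau) and the inner bound exp(- 2 tau), so this order of
   vanishing leaves a factor exp(tau). *)
pose m := n%:R + 2 * be + 3.
have m0 : 0 < m by rewrite /m addr_gt0// ltr_wpDl// mulr_gt0.
pose A1 := 1 + c ^+ 2 * (- t1^-1) ^+ 3 + (- t1^-1) ^+ 6.
pose A2 := 3152 + 64 * C0 ^+ 2 * (- t1^-1) ^+ 6.
have A10 : 0 < A1.
  rewrite /A1 addrAC ltr_wpDr//; last by rewrite ltr_wpDr// exprn_ge0// ltW.
  by apply: mulr_ge0; [exact: sqr_ge0|rewrite exprn_ge0// ltW].
have A20 : 0 < A2.
  have h : 0 <= 64 * C0 ^+ 2 * (- t1^-1) ^+ 6.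
    apply: mulr_ge0; last by rewrite exprn_ge0// ltW.
    by apply: mulr_ge0 => //; exact: sqr_ge0.
  by rewrite /A2; move: h; lra.
have up tau : tau <= a -> small tau (expR (m * tau)) ->
    k * expR (2 * be * phi c b) * H <= 2 * C1 * (expR (2 * be * phi c t2) * O) +
      2 * C1 * A1 * A2 * expR (tau + (3 * (n%:R + 2 * be) + 8)).
  move=> ta sm; apply: (le_trans (annulus_upper ab bt2 t21 t1L c_gt0 c_large be1 be2 be3 be4 be5 ta sm)).
  rewrite -/C1 -/O -/A1 -/A2 le_eqVlt; apply/orP; left; apply/eqP.
  have -> : expR (tau + (3 * (n%:R + 2 * be) + 8)) =
      expR (- (n%:R + 2 * be) * (tau - 3)) * expR (- 2 * (tau - 4)) * expR (m * tau).
    by rewrite -!expRD /m; congr expR; ring.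
  by ring.
(* With [be] fixed, tau tends to minus infinity and the inner term disappears. *)
have lim : k * expR (2 * be * phi c b) * H <= 2 * C1 * (expR (2 * be * phi c t2) * O).
  rewrite leNgt -subr_gt0; apply/negP => eps0.
  set eps := _ - _ in eps0.
  have M0 : 0 < 2 * C1 * A1 * A2 by rewrite !mulr_gt0.
  have [tau [taulo sm]] := frequently_small m0
    (Num.min a (ln (eps / (2 * C1 * A1 * A2)) - (3 * (n%:R + 2 * be) + 8))).
  move: taulo; rewrite lt_min => /andP[/ltW ta]; rewrite ltrBrDr => h.
  have := up tau ta sm; have : 2 * C1 * A1 * A2 * expR (tau + (3 * (n%:R + 2 * be) + 8)) < eps.
    by rewrite mulrC -ltr_pdivlMr// -[ltRHS]lnK ?posrE ?divr_gt0// ltr_expR.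
  by rewrite /eps ltrBrDl => h1 h2; have := lt_le_trans h1 h2; rewrite addrC ltxx.
have : k * H * expR (2 * be * de) <= 2 * C1 * O.
  have g0 := expR_gt0 (2 * be * phi c t2); rewrite -(ler_pM2r g0).
  have aux (x y z w : R) : x * y * z * w = x * (z * w) * y by ring.
  rewrite aux.
  rewrite -expRD (_ : 2 * be * de + _ = 2 * be * phi c b); last by rewrite /de; ring.
  by apply: (le_trans lim); rewrite le_eqVlt; apply/orP; left; apply/eqP; ring.
have ex : 1 + 2 * be * de <= expR (2 * be * de) by exact: expR_ge1Dx.
have kH : 0 < k * H by rewrite mulr_gt0.
have := ler_wpM2l (ltW kH) ex; move: be6 kH; set z := expR _; lra.
Qed.

End vanishing.

(** * From failure of the lower bound to a trivial solution *)

Unset Implicit Arguments.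

Theorem theorem1p4 (R : realType) (n : nat) (hn : (2 <= n)%N)
    (Omega : set 'rV[R]_n) (Omega_open : open Omega)
    (Omega_connected : connected Omega) (Omega0 : Omega 0)
    (R0 : R) (R0_gt0 : 0 < R0) (R0_le1 : R0 <= 1)
    (ball_Omega : eball R0 `<=` Omega)
    (C0 : R) (C0_gt0 : 0 < C0)
    (A : 'rV[R]_n -> 'rV[R]_n) (A_measurable : lmeasurable_fun Omega A)
    (A_bound : forall x, Omega x -> x != 0 -> enorm x != 1 ->
      enorm (A x) <= C0 * `|ln (enorm x)| ^- 3 * (enorm x)^-1)
    (u : 'rV[R]_n -> 'rV[R]_n) (p : 'rV[R]_n -> R)
    (u_H1 : forall i : 'I_n, in_H1 (eball R0) (fun x => u x 0 i))
    (p_H1 : in_H1 (eball R0) p)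
    (up_solution : stokes_solution (eball R0) A u p)
    (up_nontrivial : ~ {ae lebesgue_rV R n,
      forall x, eball R0 x -> u x = 0 /\ p x = 0}) :
  exists K m : R, [/\ 0 < K, 0 < m &
    \forall r \near 0^'+,
      ((K * r `^ m)%:E <=
       \int[lebesgue_rV R n]_(x in eball r)
         ((stokes_U (eball R0) u p x) ^+ 2)%:E)%E].
Proof.
apply: contrapT => Hneg.
have A_meas j : lmeasurable_fun (eball R0) (fun x => A x 0 j : measurableTypeR R).
  move=> Y mY; rewrite (_ : _ `&` _ = eball R0 `&` (Omega `&` A @^-1` ((fun x => x 0 j) @^-1` Y))).
    apply: completed_subset; first exact: measurable_eball.
    by apply: A_measurable; rewrite -[X in measurable X]setTI; exact: measurable_rV_coord.
  by apply/seteqP; split => x /= [xD xY]; split => //; [split => //; exact: ball_Omega|case: xY].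
have A_bound' x : eball R0 x -> x != 0 -> enorm x != 1 ->
  enorm (A x) <= C0 * `|ln (enorm x)| ^- 3 * (enorm x)^-1.
  by move=> /ball_Omega; exact: A_bound.
have mD := @measurable_eball R n R0.
have wpL2 i j : in_L2 (eball R0) (weak_partial (eball R0) j (fun x => u x 0 i)).
  have [_ /(_ j)[g Hg]] := u_H1 i; rewrite /weak_partial; case: xgetP => [_ _ []//|].
  by move=> /(_ g) [].
have /choice[v rv] : forall i, exists g, rep (eball R0) (fun x => u x 0 i) g.
  by move=> i; apply: lmeasurable_rep => //; case: (u_H1 i) => -[].
have /choice[G0 rG] : forall ij : 'I_n * 'I_n, exists g,
    rep (eball R0) (weak_partial (eball R0) ij.2 (fun x => u x 0 ij.1)) g.
  by move=> [i j]; apply: lmeasurable_rep => //; case: (wpL2 i j).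
pose G i j := G0 (i, j).
have {}rG i j : rep (eball R0) (weak_partial (eball R0) j (fun x => u x 0 i)) (G i j) by exact: (rG (i, j)).
have [q rq] : exists g, rep (eball R0) p g by apply: lmeasurable_rep => //; case: p_H1 => -[].
have /choice[B rB] : forall j, exists g, rep (eball R0) (fun x => A x 0 j) g.
  by move=> j; exact: lmeasurable_rep.
have n0 : (0 < n)%N by exact: leq_trans hn.
have [a [b [bL Hab]]] := nontrivial_annulus R0_gt0 R0_le1 u_H1 p_H1 rv rq n0 up_nontrivial.
suff : J (hat a b) (fun x => \sum_i v i x ^+ 2) + J (hat a b) (fun x => q x ^+ 2) <= 0.
  by move=> /(lt_le_trans Hab); rewrite ltxx.
apply: (@vanishing R n (fun x => q x ^+ 2) (fun x => \sum_i v i x ^+ 2)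
  (fun x => \sum_i \sum_j G i j x ^+ 2)
  (fun x => 2 * q x ^+ 2 + \sum_i \sum_j (G j i x - G i j x) ^+ 2) (ln R0) C0) => //.
- exact: (L1_P R0_le1 p_H1 rq).
- exact: (L1_U R0_le1 u_H1 rv).
- exact: (L1_G R0_le1 u_H1 rG).
- exact: (L1_W R0_le1 u_H1 p_H1 rq rG).
- by move=> x; exact: sqr_ge0.
- by move=> x; apply: sumr_ge0 => i _; exact: sqr_ge0.
- move=> x; rewrite lerDl; apply: sumr_ge0 => i _; apply: sumr_ge0 => j _; exact: sqr_ge0.
- by move=> x; exact: W_le.
- exact: ln_le0.
- move=> s1 chi dchi E Psi dPsi.
  exact: (energy_pressure R0_gt0 R0_le1 C0_gt0 A_bound' u_H1 p_H1 up_solution rv rq rG rB).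
- move=> s1 chi dchi E Psi dPsi.
  exact: (energy_velocity R0_gt0 R0_le1 u_H1 p_H1 up_solution rv rq rG).
- move=> s1 eta deta.
  exact: (energy_caccioppoli R0_gt0 R0_le1 C0_gt0 A_bound' u_H1 p_H1 up_solution rv rq rG rB).
move=> m m0 tau0.
have [r [r0 rR rtau Hr]] : exists r, [/\ 0 < r, r <= R0, r < expR tau0 &
    (\int[lebesgue_rV R n]_(x in eball r) ((stokes_U (eball R0) u p x) ^+ 2)%:E <
    (r `^ m)%:E)%E].
  (* Failure of the bound is used with K = 1 and the given exponent m: otherwise all sufficiently
     small radii would satisfy it. *)
  apply: contrapT => /forallNP Hr; apply: Hneg; exists 1, m; split => //.
  have d0 : 0 < Num.min R0 (expR tau0) by rewrite lt_min R0_gt0 expR_gt0.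
  near=> r; have r0 : 0 < r by near: r; exact: nbhs_right_gt.
  have : r < Num.min R0 (expR tau0) by near: r; exact: nbhs_right_lt.
  rewrite lt_min => /andP[/ltW h1 h2].
  by rewrite mul1r leNgt; apply/negP => h; apply: (Hr r).
exists (ln r); split; first by rewrite -ltr_expR lnK.
move=> w ww w01 w0.
apply: (weighted_le_stokes_U R0_le1 u_H1 p_H1 rv rq r0 rR _ ww w01 w0).
apply/ltW; apply: (lt_le_trans Hr).
by rewrite lee_fin /powR gt_eqF.
Unshelve. all: by end_near. Qed.
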